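(* Let $\varphi_1$ be the multi-valued Schwarz map on $Z=\mathbb{C}-\{0,1\}$ for $(a,b,c)=(\frac16,\frac12,1)$ described in the context, and let $\mathbb{H}_1\subset\mathbb{H}$ be its image. The inverse of $\varphi_1$ is given by the function $$\nu(\tau)=3\sqrt{3}\,i\,\frac{\vartheta_{00}(\tau)^4\,\vartheta_{01}(\tau)^4\,\vartheta_{10}(\tau)^4}{\bigl(\vartheta_{00}(\tau)^4+\omega\,\vartheta_{10}(\tau)^4\bigr)^3};$$ that is, for $z\in Z$ and $\tau\in\mathbb{H}_1$, $\tau$ is one of the values of $\varphi_1$ at $z$ if and only if $\nu(\tau)=z$.
   Context: $i=\sqrt{-1}$, $\omega=\frac{-1+\sqrt3\, i}{2}$, $\mathbb{H}$ is the upper half-plane, $B(\cdot,\cdot)$ is the beta function. Theta constants: for $p,q\in\{0,1\}$ and $\tau\in\mathbb{H}$, $\vartheta_{pq}(\tau)=\sum_{n\in\mathbb{Z}}\exp\bigl(\pi i(n+\frac p2)^2\tau+2\pi i(n+\frac p2)\frac q2\bigr)$. Hypergeometric series: $F(a,b,c;z)=\sum_{n\ge0}\frac{(a,n)(b,n)}{(c,n)(1,n)}z^n$ for $|z|<1$, with $(a,n)=a(a+1)\cdots(a+n-1)$. Schwarz's map $\varphi_1$: it is the multi-valued map obtained by analytic continuation along all paths in $Z=\mathbb{C}-\{0,1\}$ of $$z\mapsto \omega^2+i\cdot\frac{B(\frac16,\frac12)}{\pi}\cdot\frac{F(\frac16,\frac12,\frac23;1-z)}{F(\frac16,\frac12,1;z)},$$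 initially defined on $\{z\in\mathbb{C}: |z|<1,\ |1-z|<1\}$. Its image is $\mathbb{H}_1=\mathbb{H}-\{g\cdot\omega,\ g\cdot(-\omega^2)\mid g\in\Gamma(2)^{1/3}\}$, where $\Gamma(2)=\{g\in \mathrm{SL}_2(\mathbb{Z})\mid g\equiv I_2 \bmod 2\}$, $\Gamma(2)^{1/3}=\{g\in\mathrm{SL}_2(\mathbb{Z})\mid g^3\in\Gamma(2)\}$, acting on $\mathbb{H}$ by linear fractional transformations. *)

(* Defs.v *)
From Stdlib Require Import Reals ZArith.
From Coquelicot Require Import Coquelicot.

Open Scope R_scope.

Definition omega : C := ((-1 + sqrt 3 * Ci) / 2)%C.

Definition Cexp (z : C) : C :=
  (exp (Re z) * cos (Im z), exp (Re z) * sin (Im z)).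

(* [Series] is real-valued and total, so a complex series is summed
   componentwise; this is the sum whenever the series converges. *)
Definition CSeries (a : nat -> C) : C :=
  (Series (fun n => Re (a n)), Series (fun n => Im (a n))).

(* Sum over Z, split into nonnegative and negative indices. *)
Definition ZSeries (a : Z -> C) : C :=
  (CSeries (fun n => a (Z.of_nat n)) + CSeries (fun n => a (- Z.of_nat (S n))%Z))%C.

Definition upper_half_plane (tau : C) : Prop := 0 < Im tau.

Definition theta (p q : nat) (tau : C) : C :=
  ZSeries (fun n =>
    let m : C := RtoC (IZR n + INR p / 2) in
    Cexp (RtoC PI * Ci * m ^ 2 * tau
          + 2 * RtoC PI * Ci * m * RtoC (INR q / 2))%C).

(* The integral is improper at either end when x < 1 or y < 1. *)
Definition Beta (x y : R) : R :=
  RInt_gen (fun t => Rpower t (x - 1) * Rpower (1 - t) (y - 1))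
           (at_right 0) (at_left 1).

Fixpoint pochhammer (a : R) (n : nat) : R :=
  match n with
  | O => 1
  | S m => pochhammer a m * (a + INR m)
  end.

(* Meaningful for Cmod z < 1. *)
Definition hypergeometric (a b c : R) (z : C) : C :=
  CSeries (fun n =>
    (RtoC (pochhammer a n * pochhammer b n / (pochhammer c n * pochhammer 1 n))
     * z ^ n)%C).

Definition unit_interval (t : R) : Prop := 0 <= t <= 1.

Definition germ_eq (z : C) (f g : C -> C) : Prop :=
  exists r : R, 0 < r /\ forall w : C, Cmod (w - z)%C < r -> f w = g w.

Definition holomorphic_on_disc (z : C) (r : R) (f : C -> C) : Prop :=
  forall w : C, Cmod (w - z)%C < r ->
    ex_derive (K := C_AbsRing) (V := C_NormedModule) f w.

Definition path_in (D : C -> Prop) (gamma : R -> C) (z0 z1 : C) : Prop :=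
  continuous_on unit_interval gamma
  /\ (forall t, unit_interval t -> D (gamma t))
  /\ gamma 0 = z0 /\ gamma 1 = z1.

(* The function elements are (f t, disc of centre [gamma t] and radius [r t]). *)
Definition continuation_along
    (gamma : R -> C) (f : R -> C -> C) (r : R -> R) : Prop :=
  forall t, unit_interval t ->
    0 < r t
    /\ holomorphic_on_disc (gamma t) (r t) (f t)
    /\ exists delta : R, 0 < delta /\
         forall s, unit_interval s -> Rabs (s - t) < delta ->
           Cmod (gamma s - gamma t)%C < r t /\ germ_eq (gamma s) (f s) (f t).

(* [tau] is a value at [z] of the multi-valued function obtained from [f0],
   given on the open set [U], by continuation along all paths in [D]. *)
Definition multivalued (D U : C -> Prop) (f0 : C -> C) (z tau : C) : Prop :=
  exists (z0 : C) (gamma : R -> C) (f : R -> C -> C) (r : R -> R),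
    U z0 /\ path_in D gamma z0 z
    /\ continuation_along gamma f r
    /\ germ_eq z0 (f 0) f0
    /\ f 1 z = tau.

Definition Zdomain (z : C) : Prop := z <> 0 /\ z <> 1.

Definition lens (z : C) : Prop := Cmod z < 1 /\ Cmod (1 - z)%C < 1.

Definition phi1_principal (z : C) : C :=
  (omega ^ 2
   + Ci * RtoC (Beta (1 / 6) (1 / 2) / PI)
     * (hypergeometric (1 / 6) (1 / 2) (2 / 3) (1 - z)
        / hypergeometric (1 / 6) (1 / 2) 1 z))%C.

(* A relation: [phi1 z tau] says that [tau] is one of the values at [z]. *)
Definition phi1 (z tau : C) : Prop := multivalued Zdomain lens phi1_principal z tau.

Record mat2 : Set := Mat2 { m11 : Z; m12 : Z; m21 : Z; m22 : Z }.

Definition mat2_mul (g h : mat2) : mat2 :=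
  (Mat2 (m11 g * m11 h + m12 g * m21 h) (m11 g * m12 h + m12 g * m22 h)
        (m21 g * m11 h + m22 g * m21 h) (m21 g * m12 h + m22 g * m22 h))%Z.

Definition SL2Z (g : mat2) : Prop := (m11 g * m22 g - m12 g * m21 g = 1)%Z.

Definition Gamma2 (g : mat2) : Prop :=
  SL2Z g /\ (2 | m11 g - 1)%Z /\ (2 | m12 g)%Z /\ (2 | m21 g)%Z /\ (2 | m22 g - 1)%Z.

Definition Gamma2_cuberoot (g : mat2) : Prop :=
  SL2Z g /\ Gamma2 (mat2_mul g (mat2_mul g g)).

Definition mobius (g : mat2) (tau : C) : C :=
  ((RtoC (IZR (m11 g)) * tau + RtoC (IZR (m12 g)))
   / (RtoC (IZR (m21 g)) * tau + RtoC (IZR (m22 g))))%C.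

Definition H1 (tau : C) : Prop :=
  upper_half_plane tau
  /\ forall g : mat2, Gamma2_cuberoot g ->
       tau <> mobius g omega /\ tau <> mobius g (- omega ^ 2)%C.

Definition nu (tau : C) : C :=
  (3 * RtoC (sqrt 3) * Ci
   * (theta 0 0 tau ^ 4 * theta 0 1 tau ^ 4 * theta 1 0 tau ^ 4
      / (theta 0 0 tau ^ 4 + omega * theta 1 0 tau ^ 4) ^ 3))%C.

(* Main.v *)
Require Import Defs.
From Stdlib Require Import Reals Ranalysis5 ZArith Lra Lia Psatz ClassicalEpsilon.
From Coquelicot Require Import Coquelicot.

Open Scope R_scope.

(** Write a, b, c for the fourth powers of theta00, theta01, theta10, so that a = b + c, and put
    H = a + omega c, u = (a + omega^2 c) / H; then nu = 1 - u^3.  The duplication formulas for theta00^2 and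
    theta01^2 yield, by descent to the cusp, the first-order equations satisfied by the theta constants, and
    these show that F(nu) H^(-1/2) and G(1 - nu) H^(-1/2) have vanishing second derivative in tau, where F and G
    are the hypergeometric series with parameters (1/6,1/2,1) and (1/6,1/2,2/3).  On the ray Re tau = -1/2,
    Im tau > sqrt 3 / 2, where 0 < nu < 1, the behaviour at the cusp and at omega identifies the first with 1
    and the second with a multiple of tau - omega^2, hence phi1 (nu tau) = tau there.

    The values of phi1 are therefore obtained by continuing a local inverse of nu.  Its derivative does not
    vanish on the set of tau with nu tau in Z, a connected set since its complement in the upper half-plane is
    discrete; lifting the image of a path in it gives every such tau as a value of phi1.
    Conversely, reduction to the compact part of a fundamental domain shows that around each
    point of Z all local inverses of nu exist on one common disc, so by the identity theorem being a local
    inverse of nu propagates along every continuation. *)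

(** The exponents fit because nu' = nu u^2 H in the variable pi i tau: with g = H^(-1/2) this reads
    nu' g^2 = nu (1 - nu)^(2/3), the right side being the reciprocal Wronskian of the equation with
    parameters (1/6,1/2,1). The Beta constant enters through growth at the cusp: the coefficients
    h_n of G satisfy n h_n -> 1/B(1/6,1/2), and Abel summation turns this into the slope -i pi / B
    of the affine function G(1 - nu) g. Its zero omega^2 comes from H'(omega), read off the order 3
    map fixing omega. The rule for tau -> -1/tau is itself obtained from the affine-function
    argument, with parameters (1/2,1/2,1) and g = theta00^(-2) on the imaginary axis; Landen's
    transformation removes the unknown additive constant. The obstacle in the converse is that the
    full modular group does not preserve nu: its generators invert u^3, so nu goes to nu/(nu - 1).
    Local inverses are therefore handled near z and z/(z - 1) simultaneously. Since division by 0
    gives 0, a pole of nu counts as the value 0 and lies outside Z. *)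

(** * Limits in C along filters *)

Definition Cnear (z : C) : (C -> Prop) -> Prop :=
  fun P => exists d, 0 < d /\ forall w, Cmod (w - z)%C < d -> P w.

Lemma Cmod_self (z : C) : Cmod (z - z)%C = 0.
Proof. replace (z - z)%C with (RtoC 0) by ring. apply Cmod_0. Qed.

Lemma Cmod_sym (z w : C) : Cmod (z - w)%C = Cmod (w - z)%C.
Proof. rewrite <- Cmod_opp. f_equal. ring. Qed.

Lemma Cmod_tri_sub (x y z : C) : Cmod (x - z)%C <= Cmod (x - y)%C + Cmod (y - z)%C.
Proof. replace (x - z)%C with ((x - y) + (y - z))%C by ring. apply Cmod_triangle. Qed.

Lemma Cmod_rev_tri (x y : C) : Cmod x - Cmod y <= Cmod (x - y)%C.
Proof.
  assert (H := Cmod_triangle (x - y)%C y).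
  replace (x - y + y)%C with x in H by ring. lra.
Qed.

Lemma Cminus_eq_0 (x y : C) : (x - y)%C = 0 -> x = y.
Proof. intro H. replace x with (x - y + y)%C by ring. rewrite H. ring. Qed.

Lemma Im_le_Cmod (c : C) : Rabs (Im c) <= Cmod c.
Proof.
  eapply Rle_trans; [ | apply Rmax_Cmod]. apply Rmax_r.
Qed.

Lemma Cmod_le_ReIm (c : C) : Cmod c <= Rabs (Re c) + Rabs (Im c).
Proof.
  destruct c as [x y].
  replace (x, y) with (RtoC x + Ci * RtoC y)%C
    by (unfold Cplus, Cmult, RtoC, Ci; simpl; f_equal; ring).
  eapply Rle_trans; [apply Cmod_triangle|].
  rewrite Cmod_mult, !Cmod_R, Cmod_Ci.
  unfold Re, Im, Cplus, Cmult, RtoC, Ci; simpl.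
  replace (x + (0 * y - 1 * 0)) with x by ring.
  replace (0 + (0 * 0 + 1 * y)) with y by ring. lra.
Qed.

Global Instance Cnear_filter (z : C) : ProperFilter (Cnear z).
Proof.
  constructor.
  - intros P [d [Hd H]]. exists z. apply H. rewrite Cmod_self. exact Hd.
  - constructor.
    + exists 1. split; [lra | auto].
    + intros P Q [d [Hd HP]] [d' [Hd' HQ]]. exists (Rmin d d').
      split; [apply Rmin_pos; auto|]. intros w Hw. split.
      * apply HP. eapply Rlt_le_trans; [exact Hw | apply Rmin_l].
      * apply HQ. eapply Rlt_le_trans; [exact Hw | apply Rmin_r].
    + intros P Q HPQ [d [Hd HP]]. exists d. split; auto.
Qed.

Lemma Cnear_self z P : Cnear z P -> P z.
Proof. intros [d [Hd H]]. apply H. rewrite Cmod_self. exact Hd. Qed.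

Lemma Cnear_ball z d : 0 < d -> Cnear z (fun w => Cmod (w - z)%C < d).
Proof. intro Hd. exists d. auto. Qed.

(** The filter is arbitrary because the same calculus is used at a point ([Cnear]), along sequences
    ([eventually]), at the cusp ([Iinf]), along a vertical ray ([Rinf]) and on the real line
    ([locally t]). *)
Definition Clf {T} (F : (T -> Prop) -> Prop) (f : T -> C) (l : C) : Prop :=
  forall e, 0 < e -> F (fun x => Cmod (f x - l)%C < e).

Section Limits.
Context {T : Type} {F : (T -> Prop) -> Prop} {FF : Filter F}.

Lemma Clf_const l : Clf F (fun _ => l) l.
Proof.
  intros e He. apply filter_forall. intros _. rewrite Cmod_self. exact He.
Qed.

Lemma Clf_ext f g l : F (fun x => f x = g x) -> Clf F f l -> Clf F g l.
Proof.
  intros H Hf e He. specialize (Hf e He). generalize (filter_and _ _ H Hf).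
  apply filter_imp. intros x [<- Hx]. exact Hx.
Qed.

Lemma Clf_eq f l m : l = m -> Clf F f l -> Clf F f m.
Proof. intros <-. auto. Qed.

Lemma Clf_plus f g l m : Clf F f l -> Clf F g m -> Clf F (fun x => f x + g x)%C (l + m)%C.
Proof.
  intros Hf Hg e He. assert (He2 : 0 < e / 2) by lra.
  generalize (filter_and _ _ (Hf _ He2) (Hg _ He2)).
  apply filter_imp. intros x [H1 H2].
  replace (f x + g x - (l + m))%C with ((f x - l) + (g x - m))%C by ring.
  eapply Rle_lt_trans; [apply Cmod_triangle|]. lra.
Qed.

Lemma Clf_opp f l : Clf F f l -> Clf F (fun x => - f x)%C (- l)%C.
Proof.
  intros Hf e He. generalize (Hf e He). apply filter_imp. intros x H.
  replace (- f x - - l)%C with (- (f x - l))%C by ring. rewrite Cmod_opp. exact H.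
Qed.

Lemma Clf_minus f g l m : Clf F f l -> Clf F g m -> Clf F (fun x => f x - g x)%C (l - m)%C.
Proof. intros Hf Hg. apply Clf_plus; [exact Hf | apply Clf_opp; exact Hg]. Qed.

Lemma Clf_bounded f l : Clf F f l -> F (fun x => Cmod (f x) <= Cmod l + 1).
Proof.
  intro Hf. generalize (Hf 1 Rlt_0_1). apply filter_imp. intros x H.
  assert (H1 := Cmod_rev_tri (f x) l). lra.
Qed.

Lemma Clf_mult f g l m : Clf F f l -> Clf F g m -> Clf F (fun x => f x * g x)%C (l * m)%C.
Proof.
  intros Hf Hg e He.
  assert (Hl := Cmod_ge_0 l). assert (Hm := Cmod_ge_0 m).
  set (K := Cmod l + Cmod m + 2).
  assert (HK : 0 < K) by (unfold K; lra).
  assert (He' : 0 < e / (2 * K)) by (apply Rdiv_lt_0_compat; lra).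
  generalize (filter_and _ _ (Clf_bounded f l Hf)
    (filter_and _ _ (Hf _ He') (Hg _ He'))).
  apply filter_imp. intros x [Hb [H1 H2]].
  replace (f x * g x - l * m)%C with (f x * (g x - m) + m * (f x - l))%C by ring.
  eapply Rle_lt_trans; [apply Cmod_triangle|]. rewrite !Cmod_mult.
  assert (E : e = e / (2 * K) * K + e / (2 * K) * K) by (field; lra).
  rewrite E. assert (H3 := Cmod_ge_0 (f x)).
  apply Rplus_lt_le_compat.
  - apply Rle_lt_trans with (K * Cmod (g x - m)%C).
    + apply Rmult_le_compat_r; [apply Cmod_ge_0 | unfold K; lra].
    + rewrite (Rmult_comm _ K). apply Rmult_lt_compat_l; auto.
  - rewrite (Rmult_comm _ K). apply Rmult_le_compat; try apply Cmod_ge_0; unfold K in *; lra.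
Qed.

Lemma Clf_inv (f : T -> C) (l : C) : l <> 0 -> Clf F f l -> Clf F (fun x => / f x)%C (/ l)%C.
Proof.
  intros Hl Hf e He. assert (Hp : 0 < Cmod l) by (apply Cmod_gt_0; exact Hl).
  set (d := Rmin (Cmod l / 2) (e * (Cmod l * Cmod l / 2))).
  assert (Hd : 0 < d).
  { unfold d. apply Rmin_pos; [lra|]. apply Rmult_lt_0_compat; [lra|].
    assert (0 < Cmod l * Cmod l) by (apply Rmult_lt_0_compat; auto). lra. }
  generalize (Hf d Hd). apply filter_imp. intros x H.
  assert (H1 : Cmod l / 2 <= Cmod (f x)).
  { assert (H2 := Cmod_rev_tri l (f x)). rewrite Cmod_sym in H2.
    assert (d <= Cmod l / 2) by apply Rmin_l. lra. }
  assert (Hfx : f x <> 0) by (apply Cmod_gt_0; lra).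
  replace (/ f x - / l)%C with ((l - f x) * (/ f x * / l))%C by (field; auto).
  rewrite !Cmod_mult, !Cmod_inv by auto. rewrite Cmod_sym.
  apply Rlt_le_trans with (d * (/ Cmod (f x) * / Cmod l)).
  - apply Rmult_lt_compat_r; [|exact H].
    apply Rmult_lt_0_compat; apply Rinv_0_lt_compat; lra.
  - apply Rle_trans with (e * (Cmod l * Cmod l / 2) * (/ (Cmod l / 2) * / Cmod l)).
    + apply Rmult_le_compat.
      * lra.
      * apply Rlt_le, Rmult_lt_0_compat; apply Rinv_0_lt_compat; lra.
      * apply Rmin_r.
      * apply Rmult_le_compat_r; [apply Rlt_le, Rinv_0_lt_compat; lra|].
        apply Rinv_le_contravar; lra.
    + right. field. lra.
Qed.

Lemma Clf_div (f g : T -> C) (l m : C) : m <> 0 -> Clf F f l -> Clf F g m -> Clf F (fun x => f x / g x)%C (l / m)%C.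
Proof. intros Hm Hf Hg. apply Clf_mult; auto. apply Clf_inv; auto. Qed.

Lemma Clf_pow f l n : Clf F f l -> Clf F (fun x => f x ^ n)%C (l ^ n)%C.
Proof.
  intro Hf. induction n as [|n IH]; simpl.
  - apply Clf_const.
  - apply Clf_mult; auto.
Qed.

Lemma Clf_neq (f : T -> C) (l m : C) : l <> m -> Clf F f l -> F (fun x => f x <> m).
Proof.
  intros Hl Hf. assert (Hp : 0 < Cmod (l - m)%C).
  { apply Cmod_gt_0. intro H. apply Hl. apply Cminus_eq_0. exact H. }
  generalize (Hf _ Hp). apply filter_imp. intros x Hx E. subst m.
  rewrite Cmod_sym in Hx. lra.
Qed.
End Limits.

Lemma Clf_unique {T} (F : (T -> Prop) -> Prop) {FF : ProperFilter F} f l m :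
  Clf F f l -> Clf F f m -> l = m.
Proof.
  intros Hl Hm. apply Cminus_eq_0, Cmod_eq_0. apply Rle_antisym; [|apply Cmod_ge_0].
  apply Rnot_lt_le. intro H.
  assert (H' : 0 < Cmod (l - m)%C / 2) by lra.
  destruct (filter_ex _ (filter_and _ _ (Hl _ H') (Hm _ H'))) as [x [H1 H2]].
  assert (H3 := Cmod_tri_sub l (f x) m). rewrite (Cmod_sym l (f x)) in H3. lra.
Qed.

Lemma Clf_le {T} (F : (T -> Prop) -> Prop) {FF : ProperFilter F} f l (M : R) :
  F (fun x => Cmod (f x) <= M) -> Clf F f l -> Cmod l <= M.
Proof.
  intros Hb Hf. apply Rnot_lt_le. intro H.
  assert (H' : 0 < Cmod l - M) by lra.
  destruct (filter_ex _ (filter_and _ _ Hb (Hf _ H'))) as [x [H1 H2]].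
  assert (H3 := Cmod_rev_tri l (f x)). rewrite Cmod_sym in H3. lra.
Qed.

(** * Continuity and complex derivatives *)

Definition Ccont (f : C -> C) (z : C) : Prop := Clf (Cnear z) f (f z).

Lemma Ccont_id z : Ccont (fun w => w) z.
Proof. intros e He. exists e. auto. Qed.

Lemma Ccont_comp {T} (F : (T -> Prop) -> Prop) {FF : Filter F} f (g : T -> C) l :
  Clf F g l -> Ccont f l -> Clf F (fun x => f (g x)) (f l).
Proof.
  intros Hg Hf e He. destruct (Hf e He) as [d [Hd H]].
  generalize (Hg d Hd). apply filter_imp. intros x Hx. apply H. exact Hx.
Qed.

Lemma Clf_near {T} (F : (T -> Prop) -> Prop) {FF : Filter F} (g : T -> C) l P :
  Clf F g l -> Cnear l P -> F (fun x => P (g x)).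
Proof.
  intros Hg [d [Hd H]]. generalize (Hg d Hd). apply filter_imp. intros x Hx. auto.
Qed.

(* Caratheodory's form of the complex derivative: the difference quotient extends
   continuously, which makes the chain and inverse function rules algebraic. *)
Definition Cder (f : C -> C) (z l : C) : Prop :=
  exists phi, Cnear z (fun w => f w = f z + phi w * (w - z))%C
    /\ phi z = l /\ Clf (Cnear z) phi l.

Lemma Cder_cont f z l : Cder f z l -> Ccont f z.
Proof.
  intros [phi [H1 [H2 H3]]]. unfold Ccont.
  apply (Clf_ext (fun w => f z + phi w * (w - z))%C).
  { generalize H1. apply filter_imp. auto. }
  apply (Clf_eq _ (f z + l * (z - z))%C); [ring|].
  apply Clf_plus; [apply Clf_const|]. apply Clf_mult; [exact H3|].
  apply Clf_minus; [apply Ccont_id | apply Clf_const].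
Qed.

Lemma Cder_eq f z l m : Cder f z l -> l = m -> Cder f z m.
Proof. intros H <-. exact H. Qed.

Lemma Cder_ext f g z l : Cnear z (fun w => f w = g w) -> Cder f z l -> Cder g z l.
Proof.
  intros H [phi [H1 [H2 H3]]]. exists phi. split; [|auto].
  assert (Hz := Cnear_self _ _ H). simpl in Hz.
  generalize (filter_and _ _ H H1). apply filter_imp. intros w [E1 E2].
  rewrite <- E1, <- Hz. exact E2.
Qed.

Lemma Cder_const c z : Cder (fun _ => c) z 0.
Proof.
  exists (fun _ => RtoC 0). split; [|split; [reflexivity | apply Clf_const]].
  apply filter_forall. intro w. ring.
Qed.

Lemma Cder_id z : Cder (fun w => w) z 1.
Proof.
  exists (fun _ => RtoC 1). split; [|split; [reflexivity | apply Clf_const]].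
  apply filter_forall. intro w. ring.
Qed.

Lemma Cder_plus f g z l m : Cder f z l -> Cder g z m -> Cder (fun w => f w + g w)%C z (l + m)%C.
Proof.
  intros [p [H1 [H2 H3]]] [q [K1 [K2 K3]]]. exists (fun w => p w + q w)%C.
  split; [|split; [congruence | apply Clf_plus; auto]].
  generalize (filter_and _ _ H1 K1). apply filter_imp. intros w [-> ->]. ring.
Qed.

Lemma Cder_opp f z l : Cder f z l -> Cder (fun w => - f w)%C z (- l)%C.
Proof.
  intros [p [H1 [H2 H3]]]. exists (fun w => - p w)%C.
  split; [|split; [congruence | apply Clf_opp; auto]].
  generalize H1. apply filter_imp. intros w ->. ring.
Qed.

Lemma Cder_minus f g z l m : Cder f z l -> Cder g z m -> Cder (fun w => f w - g w)%C z (l - m)%C.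
Proof. intros Hf Hg. apply Cder_plus; auto. apply Cder_opp; auto. Qed.

Lemma Cder_mult f g z l m :
  Cder f z l -> Cder g z m -> Cder (fun w => f w * g w)%C z (l * g z + f z * m)%C.
Proof.
  intros Hf Hg. assert (Hc := Cder_cont _ _ _ Hg).
  destruct Hf as [p [H1 [H2 H3]]]. destruct Hg as [q [K1 [K2 K3]]].
  exists (fun w => p w * g w + f z * q w)%C.
  split; [|split].
  - generalize (filter_and _ _ H1 K1). apply filter_imp. intros w [E1 E2].
    rewrite E1. replace (f z * g z)%C with (f z * (g w - q w * (w - z)))%C by (rewrite E2; ring).
    ring.
  - simpl. congruence.
  - apply Clf_plus; apply Clf_mult; auto. apply Clf_const.
Qed.

Lemma Cder_inv (f : C -> C) z l : f z <> 0 -> Cder f z l -> Cder (fun w => / f w)%C z (- l / (f z * f z))%C.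
Proof.
  intros Hz Hf. assert (Hc := Cder_cont _ _ _ Hf).
  destruct Hf as [p [H1 [H2 H3]]].
  exists (fun w => - p w * / (f z * f w))%C.
  split; [|split].
  - generalize (filter_and _ _ H1 (Clf_neq _ _ _ Hz Hc)). apply filter_imp. intros w [E1 E2].
    replace (/ f w)%C with (/ f z + (f z - f w) * / (f z * f w))%C by (field; auto).
    rewrite E1 at 1. ring.
  - simpl. rewrite H2. reflexivity.
  - apply Clf_mult; [apply Clf_opp; auto|]. apply Clf_inv.
    + apply Cmult_neq_0; auto.
    + apply Clf_mult; [apply Clf_const | exact Hc].
Qed.

Lemma Cder_div (f g : C -> C) z l m : g z <> 0 -> Cder f z l -> Cder g z m ->
  Cder (fun w => f w / g w)%C z ((l * g z - f z * m) / (g z * g z))%C.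
Proof.
  intros Hz Hf Hg. eapply Cder_eq.
  - apply Cder_mult; [exact Hf | apply Cder_inv; eauto].
  - cbv beta. field. auto.
Qed.

Lemma Cder_comp f g z l m : Cder f (g z) l -> Cder g z m -> Cder (fun w => f (g w)) z (l * m)%C.
Proof.
  intros [p [H1 [H2 H3]]] Hg. assert (Hc := Cder_cont _ _ _ Hg).
  destruct Hg as [q [K1 [K2 K3]]].
  exists (fun w => p (g w) * q w)%C. split; [|split].
  - generalize (filter_and _ _ (Clf_near _ _ _ _ Hc H1) K1).
    apply filter_imp. intros w [E1 E2]. rewrite E1. rewrite E2 at 2. ring.
  - simpl. congruence.
  - apply Clf_mult; auto. rewrite <- H2. apply (Ccont_comp _ p g (g z)); auto.
    unfold Ccont. rewrite H2. exact H3.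
Qed.

Lemma Cder_scal c f z l : Cder f z l -> Cder (fun w => c * f w)%C z (c * l)%C.
Proof.
  intro H. eapply Cder_eq; [apply Cder_mult; [apply Cder_const | exact H]|]. cbv beta. ring.
Qed.

Lemma Cnear_punctured z P : Cnear z P -> exists w, w <> z /\ P w.
Proof.
  intros [d [Hd H]]. exists (z + RtoC (d / 2))%C.
  assert (E : (z + RtoC (d / 2) - z)%C = RtoC (d / 2)) by ring. split.
  - intro K. rewrite K in E. replace (z - z)%C with (RtoC 0) in E by ring.
    injection E. lra.
  - apply H. rewrite E, Cmod_R, Rabs_pos_eq; lra.
Qed.

Lemma Cder_unique f z l m : Cder f z l -> Cder f z m -> l = m.
Proof.
  intros [p [H1 [H2 H3]]] [q [K1 [K2 K3]]].
  apply Cminus_eq_0, Cmod_eq_0. apply Rle_antisym; [|apply Cmod_ge_0].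
  apply Rnot_lt_le. intro H.
  assert (H' : 0 < Cmod (l - m)%C / 2) by lra.
  destruct (Cnear_punctured z _ (filter_and _ _ (filter_and _ _ H1 K1)
    (filter_and _ _ (H3 _ H') (K3 _ H')))) as [w [Hw [[E1 E2] [L1 L2]]]].
  assert (E : p w = q w).
  { assert (N : (w - z)%C <> 0) by (intro N; apply Hw, Cminus_eq_0, N).
    assert (E : ((p w - q w) * (w - z))%C = 0).
    { replace ((p w - q w) * (w - z))%C
        with ((f z + p w * (w - z)) - (f z + q w * (w - z)))%C by ring.
      rewrite <- E1, <- E2. ring. }
    apply Cminus_eq_0. replace (p w - q w)%C with ((p w - q w) * (w - z) / (w - z))%C
      by (field; auto). rewrite E. field. auto. }
  rewrite E in L1. assert (T := Cmod_tri_sub l (q w) m). rewrite (Cmod_sym l (q w)) in T. lra.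
Qed.

(** Balls of [C_UniformSpace] are squares, within a factor sqrt 2 of the discs of the modulus. The
    comparison is used for [continuous_on] in the definition of a path, which refers to that uniform
    structure. *)
Lemma Cnear_locally z (P : C -> Prop) : Cnear z P <-> locally (T := C_UniformSpace) z P.
Proof.
  split.
  - intros [d [Hd H]]. assert (Hs : 0 < sqrt 2) by (apply sqrt_lt_R0; lra).
    exists (mkposreal (d / sqrt 2) (Rdiv_lt_0_compat _ _ Hd Hs)).
    intros y Hy. apply H.
    assert (K := C_NormedModule_mixin_compat2 z y _ Hy). simpl in K.
    replace (sqrt 2 * (d / sqrt 2)) with d in K by (field; lra). exact K.
  - intros [d H]. exists d. split; [apply cond_pos|]. intros w Hw. apply H.
    apply C_NormedModule_mixin_compat1. exact Hw.
Qed.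

Lemma Cnear_locally_AbsRing z (P : C -> Prop) :
  Cnear z P <-> locally (T := AbsRing_UniformSpace C_AbsRing) z P.
Proof.
  split.
  - intros [d [Hd H]]. exists (mkposreal d Hd). exact H.
  - intros [d H]. exists d. split; [apply cond_pos | exact H].
Qed.

Lemma Cder_is_derive f z l :
  Cder f z l <-> is_derive (K := C_AbsRing) (V := C_NormedModule) f z l.
Proof.
  split.
  - intros [p [H1 [H2 H3]]]. split; [apply is_linear_scal_l|].
    intros x Hx. assert (E : z = x) by (apply (is_filter_lim_locally_unique (V := AbsRing_NormedModule C_AbsRing) z x); exact Hx).
    subst x. intro eps. apply Cnear_locally_AbsRing.
    generalize (filter_and _ _ H1 (H3 eps (cond_pos eps))). apply filter_imp.
    intros w [E1 E2].
    change (Cmod (f w - f z - (w - z) * l)%C <= eps * Cmod (w - z)%C).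
    replace (f w - f z - (w - z) * l)%C with ((p w - l) * (w - z))%C
      by (rewrite E1; ring).
    rewrite Cmod_mult. apply Rmult_le_compat_r; [apply Cmod_ge_0 | lra].
  - intros [_ H]. specialize (H z (fun P h => h)).
    set (p := fun w => if excluded_middle_informative (w = z) then l
                       else ((f w - f z) / (w - z))%C).
    exists p. split; [|split].
    + apply filter_forall. intro w. unfold p. destruct excluded_middle_informative as [->|N].
      * ring.
      * field. intro K. apply N, Cminus_eq_0, K.
    + unfold p. destruct excluded_middle_informative as [_|N]; [reflexivity | now elim N].
    + intros e He. assert (He2 : 0 < e / 2) by lra.
      specialize (H (mkposreal _ He2)). apply Cnear_locally_AbsRing in H.
      revert H. apply filter_imp. intros w Hw.
      change (Cmod (f w - f z - (w - z) * l)%C <= e / 2 * Cmod (w - z)%C) in Hw.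
      unfold p. destruct excluded_middle_informative as [->|N].
      * rewrite Cmod_self. exact He.
      * assert (N' : (w - z)%C <> 0) by (intro K; apply N, Cminus_eq_0, K).
        replace ((f w - f z) / (w - z) - l)%C with ((f w - f z - (w - z) * l) / (w - z))%C
          by (field; auto).
        rewrite Cmod_div by auto. apply Cmod_gt_0 in N'.
        apply Rle_lt_trans with (e / 2); [|lra].
        apply (Rmult_le_reg_r (Cmod (w - z)%C)); [exact N'|].
        unfold Rdiv. rewrite Rmult_assoc, Rinv_l by lra. rewrite Rmult_1_r. exact Hw.
Qed.

Lemma Cder_ex_derive f z l :
  Cder f z l -> ex_derive (K := C_AbsRing) (V := C_NormedModule) f z.
Proof. intro H. exists l. apply Cder_is_derive. exact H. Qed.

Lemma ex_derive_Cder f z :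
  ex_derive (K := C_AbsRing) (V := C_NormedModule) f z -> exists l, Cder f z l.
Proof. intros [l H]. exists l. apply Cder_is_derive. exact H. Qed.

(** * Complex series *)

(** The sum has n terms, whereas [sum_n] includes the index n; hence the [S n] in every comparison
    of the two. The empty sum being available, splitting at N needs no correction. *)
Fixpoint Csum (a : nat -> C) (n : nat) : C :=
  match n with O => RtoC 0 | S m => (Csum a m + a m)%C end.

Definition Cis_series (a : nat -> C) (l : C) : Prop := Clf eventually (Csum a) l.

Lemma Csum_ReIm a n :
  Re (Csum a (S n)) = sum_n (fun k => Re (a k)) n /\ Im (Csum a (S n)) = sum_n (fun k => Im (a k)) n.
Proof.
  induction n as [|n [IH1 IH2]].
  - rewrite !sum_O. split; apply Rplus_0_l.
  - rewrite !sum_Sn, <- IH1, <- IH2. split; reflexivity.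
Qed.

Lemma Cis_series_components a l :
  Cis_series a l <-> is_series (fun n => Re (a n)) (Re l) /\ is_series (fun n => Im (a n)) (Im l).
Proof.
  split.
  - intro H. split; [apply (is_lim_seq_spec _ (Finite (Re l))) | apply (is_lim_seq_spec _ (Finite (Im l)))];
      intro eps.
    + destruct (H eps (cond_pos eps)) as [N HN]. exists N. intros n Hn.
      match goal with |- Rabs (?s - _) < _ => replace s with (Re (Csum a (S n))) by (apply Csum_ReIm) end.
      eapply Rle_lt_trans; [|apply (HN (S n)); lia].
      change (Re (Csum a (S n)) - Re l) with (Re (Csum a (S n) - l)%C). apply re_le_Cmod.
    + destruct (H eps (cond_pos eps)) as [N HN]. exists N. intros n Hn.
      match goal with |- Rabs (?s - _) < _ => replace s with (Im (Csum a (S n))) by (apply Csum_ReIm) end.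
      eapply Rle_lt_trans; [|apply (HN (S n)); lia].
      change (Im (Csum a (S n)) - Im l) with (Im (Csum a (S n) - l)%C). apply Im_le_Cmod.
  - intros [H1 H2] e He. apply (is_lim_seq_spec _ (Finite (Re l))) in H1.
    apply (is_lim_seq_spec _ (Finite (Im l))) in H2.
    assert (He2 : 0 < e / 2) by lra.
    destruct (H1 (mkposreal _ He2)) as [N1 HN1]. destruct (H2 (mkposreal _ He2)) as [N2 HN2].
    exists (S (N1 + N2)). intros [|n] Hn; [lia|].
    specialize (HN1 n ltac:(lia)). specialize (HN2 n ltac:(lia)).
    match type of HN1 with Rabs (?s - _) < _ =>
      replace s with (Re (Csum a (S n))) in HN1 by (apply Csum_ReIm) end.
    match type of HN2 with Rabs (?s - _) < _ =>
      replace s with (Im (Csum a (S n))) in HN2 by (apply Csum_ReIm) end.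
    simpl pos in HN1, HN2.
    eapply Rle_lt_trans; [apply Cmod_le_ReIm|].
    change (Re (Csum a (S n) - l)%C) with (Re (Csum a (S n)) - Re l).
    change (Im (Csum a (S n) - l)%C) with (Im (Csum a (S n)) - Im l). lra.
Qed.

Lemma CSeries_unique a l : Cis_series a l -> CSeries a = l.
Proof.
  intro H. apply Cis_series_components in H. destruct H as [H1 H2].
  unfold CSeries. rewrite (is_series_unique _ _ H1), (is_series_unique _ _ H2).
  now destruct l.
Qed.

Lemma CSeries_ext a b : (forall n, a n = b n) -> CSeries a = CSeries b.
Proof.
  intro H. unfold CSeries. f_equal; apply Series_ext; intro n; now rewrite H.
Qed.

Lemma ex_series_dom (a b : nat -> R) :
  (forall n, Rabs (a n) <= b n) -> ex_series b -> ex_series a.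
Proof. intros H Hb. apply (ex_series_le (V := R_CompleteNormedModule) a b); auto. Qed.

Lemma CSeries_correct a (M : nat -> R) :
  ex_series M -> (forall n, Cmod (a n) <= M n) -> Cis_series a (CSeries a).
Proof.
  intros HM H. apply Cis_series_components. simpl. split; apply Series_correct;
    apply (ex_series_dom _ M); auto; intro n; eapply Rle_trans; try apply H.
  - apply re_le_Cmod.
  - apply Im_le_Cmod.
Qed.

Lemma Csum_Cmod a n M : ex_series M -> (forall n, Cmod (a n) <= M n) -> Cmod (Csum a n) <= Series M.
Proof.
  intros HM H.
  assert (P : forall n, 0 <= M n) by (intro k; eapply Rle_trans; [apply Cmod_ge_0 | apply H]).
  assert (K : forall n, Cmod (Csum a n) <= sum_n M n - M n).
  { clear n. induction n as [|n IH].
    - rewrite sum_O. simpl. rewrite Cmod_0. lra.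
    - rewrite sum_Sn. unfold plus; simpl.
      eapply Rle_trans; [apply Cmod_triangle|]. specialize (H n). lra. }
  assert (L : sum_n M n <= Series M).
  { apply Series_correct in HM.
    apply (is_lim_seq_incr_compare (sum_n M) (Series M)); [exact HM|].
    intro k. rewrite sum_Sn. unfold plus; simpl. specialize (P (S k)). lra. }
  specialize (K n). specialize (P n). lra.
Qed.

Lemma CSeries_le a M : ex_series M -> (forall n, Cmod (a n) <= M n) -> Cmod (CSeries a) <= Series M.
Proof.
  intros HM H. apply (Clf_le eventually (Csum a)).
  - exists 0%nat. intros n _. apply Csum_Cmod; auto.
  - apply (CSeries_correct a M); auto.
Qed.

Lemma Csum_shift a N n : Csum a (N + n) = (Csum a N + Csum (fun k => a (N + k)%nat) n)%C.
Proof.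
  induction n as [|n IH].
  - rewrite Nat.add_0_r. simpl. ring.
  - rewrite Nat.add_succ_r. simpl. rewrite IH. ring.
Qed.

Lemma Cis_series_shift a l N :
  Cis_series a l -> Cis_series (fun k => a (N + k)%nat) (l - Csum a N)%C.
Proof.
  intro H. intros e He. destruct (H e He) as [K HK]. exists K. intros n Hn.
  specialize (HK (N + n)%nat ltac:(lia)). rewrite Csum_shift in HK.
  replace (Csum (fun k => a (N + k)%nat) n - (l - Csum a N))%C
    with (Csum a N + Csum (fun k => a (N + k)%nat) n - l)%C by ring. exact HK.
Qed.

Lemma ex_series_shift (M : nat -> R) N : ex_series M -> ex_series (fun k => M (N + k)%nat).
Proof. intro H. apply (ex_series_incr_n (V := R_NormedModule) M N). exact H. Qed.

Lemma CSeries_tail a M N : ex_series M -> (forall n, Cmod (a n) <= M n) ->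
  Cmod (CSeries a - Csum a N)%C <= Series (fun k => M (N + k)%nat).
Proof.
  intros HM H. assert (H1 := CSeries_correct a M HM H).
  apply (Cis_series_shift _ _ N) in H1. apply CSeries_unique in H1. rewrite <- H1.
  apply CSeries_le; [apply ex_series_shift; auto | auto].
Qed.

Lemma Series_tail_lim (M : nat -> R) : ex_series M ->
  forall e, 0 < e -> exists N, Rabs (Series (fun k => M (N + k)%nat)) < e.
Proof.
  intros HM e He. assert (H := Series_correct _ HM).
  apply (is_lim_seq_spec _ (Finite (Series M))) in H.
  destruct (H (mkposreal e He)) as [N HN]. exists (S N).
  specialize (HN N (Nat.le_refl _)). simpl in HN.
  rewrite (Series_incr_n M (S N)) in HN; [|lia | exact HM]. simpl pred in HN.
  rewrite sum_n_Reals in HN. rewrite <- Rabs_Ropp.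
  match goal with |- Rabs (- ?x) < _ => match type of HN with Rabs (?s - (?s + ?y)) < _ =>
    replace (- x) with (s - (s + y)) by (simpl; ring) end end. exact HN.
Qed.

Lemma Clf_Csum {T} (F : (T -> Prop) -> Prop) {FF : Filter F} (t : nat -> T -> C) L N :
  (forall n, Clf F (t n) (L n)) -> Clf F (fun x => Csum (fun n => t n x) N) (Csum L N).
Proof.
  intro H. induction N as [|N IH]; simpl.
  - apply Clf_const.
  - apply Clf_plus; auto.
Qed.

(** Dominated convergence for series. The limits inherit the bound [M], so one N makes the tails of
    the terms and of the limits both smaller than e/3; the first N terms converge as a finite
    sum. *)
Lemma Tannery {T} (F : (T -> Prop) -> Prop) {FF : ProperFilter F}
    (t : nat -> T -> C) (L : nat -> C) (M : nat -> R) :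
  ex_series M -> F (fun x => forall n, Cmod (t n x) <= M n) ->
  (forall n, Clf F (t n) (L n)) ->
  Clf F (fun x => CSeries (fun n => t n x)) (CSeries L).
Proof.
  intros HM Hb Hl e He.
  assert (HL : forall n, Cmod (L n) <= M n).
  { intro n. apply (Clf_le F (t n)); auto. generalize Hb. apply filter_imp. auto. }
  assert (He3 : 0 < e / 3) by lra.
  destruct (Series_tail_lim M HM _ He3) as [N HN].
  generalize (filter_and _ _ Hb (Clf_Csum F t L N Hl _ He3)).
  apply filter_imp. intros x [Hx H].
  assert (H1 := CSeries_tail (fun n => t n x) M N HM Hx).
  assert (H2 := CSeries_tail L M N HM HL).
  assert (H3 := Rle_abs (Series (fun k => M (N + k)%nat))).
  assert (H4 := Cmod_tri_sub (CSeries (fun n => t n x)) (Csum (fun n => t n x) N) (CSeries L)).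
  assert (H5 := Cmod_tri_sub (Csum (fun n => t n x) N) (Csum L N) (CSeries L)).
  rewrite (Cmod_sym (Csum L N) (CSeries L)) in H5. lra.
Qed.

(** * Power series with polynomially bounded coefficients *)

(** Convergence on the unit disc, in a form stable under [dcoef], shifts, sums and scalar multiples.
    The theta and hypergeometric coefficients are even bounded, but their derived series are not. *)
Definition poly_bd (a : nat -> R) : Prop :=
  exists K k, forall n, Rabs (a n) <= K * (INR n + 1) ^ k.

Definition CPS (a : nat -> R) (z : C) : C := CSeries (fun n => RtoC (a n) * z ^ n)%C.

Definition dcoef (a : nat -> R) (n : nat) : R := (INR n + 1) * a (S n).

(** Each of the n + 1 terms of 1 + s + ... + s^n is at least s^n, and 1 - s times their sum
    telescopes to the right-hand side. *)
Lemma geom_linear s n : 0 <= s < 1 -> (INR n + 1) * s ^ n * (1 - s) <= 1 - s ^ S n.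
Proof.
  intros Hs. induction n as [|n IH]; [simpl; lra|].
  assert (P : 0 <= s ^ S n) by (apply pow_le; lra).
  assert (P' : s ^ S n <= 1).
  { rewrite <- (pow1 (S n)). apply pow_incr. lra. }
  rewrite S_INR. change (s ^ S (S n)) with (s * s ^ S n).
  replace ((INR n + 1 + 1) * s ^ S n * (1 - s))
    with (s * ((INR n + 1) * s ^ n * (1 - s)) + s ^ S n * (1 - s)) by (simpl; ring).
  assert (s * ((INR n + 1) * s ^ n * (1 - s)) <= s * (1 - s ^ S n))
    by (apply Rmult_le_compat_l; lra).
  assert (0 <= (1 - s ^ S n) * (1 - s)) by (apply Rmult_le_pos; lra). nra.
Qed.

(** One factor n + 1 is absorbed by sqrt rho ^ n, at the price of continuing with sqrt rho in place
    of rho; after k such steps the ratio is still below 1. *)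
Lemma geom_poly k : forall rho, 0 <= rho < 1 -> exists K r, 0 <= K /\ 0 <= r < 1 /\
  forall n, (INR n + 1) ^ k * rho ^ n <= K * r ^ n.
Proof.
  induction k as [|k IH]; intros rho Hr.
  - exists 1, rho. repeat split; try lra. intro n. simpl. lra.
  - assert (Hs : 0 <= sqrt rho < 1).
    { split; [apply sqrt_pos|]. rewrite <- sqrt_1. apply sqrt_lt_1; lra. }
    destruct (IH _ Hs) as [K [r [HK [Hr' H]]]].
    exists (K / (1 - sqrt rho)), r. repeat split; try lra.
    + apply Rdiv_le_0_compat; lra.
    + intro n. replace (rho ^ n) with (sqrt rho ^ n * sqrt rho ^ n)
        by (rewrite <- Rpow_mult_distr, sqrt_sqrt; [reflexivity | lra]).
      assert (G := geom_linear (sqrt rho) n Hs).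
      assert (P : 0 <= sqrt rho ^ S n) by (apply pow_le; lra).
      assert (G' : (INR n + 1) * sqrt rho ^ n <= / (1 - sqrt rho)).
      { apply (Rmult_le_reg_r (1 - sqrt rho)); [lra|]. rewrite Rinv_l by lra. lra. }
      specialize (H n). assert (Pn := pos_INR n).
      assert (P1 : 0 <= (INR n + 1) ^ k * sqrt rho ^ n).
      { apply Rmult_le_pos; apply pow_le; lra. }
      assert (P2 : 0 <= (INR n + 1) * sqrt rho ^ n).
      { apply Rmult_le_pos; [lra | apply pow_le; lra]. }
      replace ((INR n + 1) ^ S k * (sqrt rho ^ n * sqrt rho ^ n))
        with (((INR n + 1) ^ k * sqrt rho ^ n) * ((INR n + 1) * sqrt rho ^ n)) by (simpl; ring).
      replace (K / (1 - sqrt rho) * r ^ n) with (K * r ^ n * / (1 - sqrt rho)) by (field; lra).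
      apply Rmult_le_compat; auto.
Qed.

Lemma ex_series_geom_scal K r : 0 <= r < 1 -> ex_series (fun n => K * r ^ n).
Proof.
  intro Hr. apply (ex_series_scal (V := R_NormedModule) K). apply ex_series_geom.
  rewrite Rabs_pos_eq; lra.
Qed.

Lemma poly_bd_ex_series a rho :
  poly_bd a -> 0 <= rho < 1 -> ex_series (fun n => Rabs (a n) * rho ^ n).
Proof.
  intros [K [k H]] Hr. destruct (geom_poly k rho Hr) as [K' [r [HK [Hr' H']]]].
  apply (ex_series_dom _ (fun n => (Rabs K * K') * r ^ n)); [|apply ex_series_geom_scal; auto].
  intro n. assert (P : 0 <= rho ^ n) by (apply pow_le; lra).
  rewrite Rabs_mult, Rabs_Rabsolu, (Rabs_pos_eq (rho ^ n)) by auto.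
  apply Rle_trans with (Rabs K * ((INR n + 1) ^ k * rho ^ n)).
  - rewrite <- Rmult_assoc. apply Rmult_le_compat_r; auto.
    eapply Rle_trans; [apply H|]. apply Rmult_le_compat_r; [|apply Rle_abs].
    apply pow_le. assert (Pn := pos_INR n). lra.
  - rewrite Rmult_assoc. apply Rmult_le_compat_l; [apply Rabs_pos | apply H'].
Qed.

Lemma poly_bd_dcoef a : poly_bd a -> poly_bd (dcoef a).
Proof.
  intros [K [k H]]. exists (Rabs K * 2 ^ k), (S k). intro n. unfold dcoef.
  assert (Pn := pos_INR n).
  rewrite Rabs_mult, (Rabs_pos_eq (INR n + 1)) by lra.
  specialize (H (S n)). rewrite S_INR in H.
  assert (P : 0 <= (INR n + 1 + 1) ^ k <= (2 * (INR n + 1)) ^ k).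
  { split; [apply pow_le; lra | apply pow_incr; lra]. }
  rewrite Rpow_mult_distr in P. assert (Q := Rabs_pos K). assert (Q' := Rle_abs K).
  replace (Rabs K * 2 ^ k * (INR n + 1) ^ S k)
    with ((INR n + 1) * (Rabs K * (2 ^ k * (INR n + 1) ^ k))) by (simpl; ring).
  apply Rmult_le_compat_l; [lra|]. eapply Rle_trans; [apply H|].
  eapply Rle_trans; [apply Rmult_le_compat_r; [apply P | exact Q']|].
  apply Rmult_le_compat_l; [lra | apply P].
Qed.

Lemma poly_bd_const a K : (forall n, Rabs (a n) <= K) -> poly_bd a.
Proof. intro H. exists K, O. intro n. simpl. rewrite Rmult_1_r. apply H. Qed.

Section PowerSeries.
Context (a : nat -> R) (Ha : poly_bd a).

Lemma CPS_dom z rho : Cmod z <= rho -> forall n, Cmod (RtoC (a n) * z ^ n)%C <= Rabs (a n) * rho ^ n.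
Proof.
  intros H n. rewrite Cmod_mult, Cmod_R, Cmod_pow.
  apply Rmult_le_compat_l; [apply Rabs_pos|]. apply pow_incr. split; [apply Cmod_ge_0 | exact H].
Qed.

Lemma CPS_correct z : Cmod z < 1 -> Cis_series (fun n => RtoC (a n) * z ^ n)%C (CPS a z).
Proof.
  intro Hz. apply (CSeries_correct _ (fun n => Rabs (a n) * Cmod z ^ n)).
  - apply poly_bd_ex_series; auto. split; [apply Cmod_ge_0 | exact Hz].
  - apply CPS_dom. lra.
Qed.

(** The polynomial (w^n - z^n) / (w - z), written so that it keeps a meaning at w = z, where it is n
    z^(n-1). *)
Fixpoint diffq (z w : C) (n : nat) : C :=
  match n with O => RtoC 0 | S m => (w * diffq z w m + z ^ m)%C end.

Lemma diffq_spec z w n : (w ^ n - z ^ n = diffq z w n * (w - z))%C.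
Proof.
  induction n as [|n IH]; simpl; [ring|].
  replace (w * w ^ n - z * z ^ n)%C with (w * (w ^ n - z ^ n) + z ^ n * (w - z))%C by ring.
  rewrite IH. ring.
Qed.

Lemma diffq_diag z n : diffq z z (S n) = (RtoC (INR n + 1) * z ^ n)%C.
Proof.
  induction n as [|n IH]; [simpl; rewrite Rplus_0_l; ring|].
  change (diffq z z (S (S n))) with (z * diffq z z (S n) + z ^ S n)%C. rewrite IH, S_INR.
  rewrite !RtoC_plus. simpl. ring.
Qed.

Lemma diffq_bound z w rho n : Cmod z <= rho -> Cmod w <= rho ->
  Cmod (diffq z w (S n)) <= (INR n + 1) * rho ^ n.
Proof.
  intros Hz Hw. assert (P := Cmod_ge_0 z).
  assert (Q : forall n, Cmod (z ^ n)%C <= rho ^ n).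
  { intro m. rewrite Cmod_pow. apply pow_incr. auto. }
  induction n as [|n IH].
  - simpl. replace (w * 0 + 1)%C with (RtoC 1) by ring. rewrite Cmod_1. lra.
  - change (diffq z w (S (S n))) with (w * diffq z w (S n) + z ^ S n)%C.
    eapply Rle_trans; [apply Cmod_triangle|]. rewrite Cmod_mult, S_INR. specialize (Q (S n)).
    assert (Cmod w * Cmod (diffq z w (S n)) <= rho * ((INR n + 1) * rho ^ n)).
    { apply Rmult_le_compat; auto; apply Cmod_ge_0. }
    simpl in *. lra.
Qed.

Lemma diffq_cont z n : Clf (Cnear z) (fun w => diffq z w n) (diffq z z n).
Proof.
  induction n as [|n IH]; simpl; [apply Clf_const|].
  apply Clf_plus; [|apply Clf_const]. apply Clf_mult; [apply Ccont_id | exact IH].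
Qed.

Lemma Cis_series_plus u v l m :
  Cis_series u l -> Cis_series v m -> Cis_series (fun n => u n + v n)%C (l + m)%C.
Proof.
  intros Hu Hv. apply (Clf_ext (fun n => Csum u n + Csum v n)%C).
  - exists O. intros n _. induction n as [|n IH]; simpl; [ring|]. rewrite <- IH. ring.
  - apply Clf_plus; auto.
Qed.

Lemma Cis_series_scal c u l : Cis_series u l -> Cis_series (fun n => c * u n)%C (c * l)%C.
Proof.
  intros Hu. apply (Clf_ext (fun n => c * Csum u n)%C).
  - exists O. intros n _. induction n as [|n IH]; simpl; [ring|]. rewrite <- IH. ring.
  - apply Clf_mult; [apply Clf_const | exact Hu].
Qed.

Lemma Cis_series_ext u v l : (forall n, u n = v n) -> Cis_series u l -> Cis_series v l.
Proof.
  intros H Hu. apply (Clf_ext (Csum u)); auto. exists O. intros n _.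
  induction n as [|n IH]; simpl; [reflexivity|]. now rewrite IH, H.
Qed.

Lemma Cis_series_unshift u l : Cis_series (fun n => u (S n)) l -> Cis_series u (u O + l)%C.
Proof.
  intros H e He. destruct (H e He) as [N HN]. exists (S N). intros [|n] Hn; [lia|].
  specialize (HN n ltac:(lia)). change (S n) with (1 + n)%nat. rewrite (Csum_shift u 1 n). simpl.
  replace (0 + u O + Csum (fun k => u (S k)) n - (u O + l))%C
    with (Csum (fun k => u (S k)) n - l)%C by ring. exact HN.
Qed.

(** The Caratheodory slope is the series of the quotients [diffq]. On a disc of radius [rho] with
    |z| < rho < 1 it is dominated by the series of n |a n| rho^(n-1), so [Tannery] gives its
    continuity at z. *)
Lemma CPS_der z : Cmod z < 1 -> Cder (CPS a) z (CPS (dcoef a) z).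
Proof.
  intro Hz. set (rho := (Cmod z + 1) / 2). assert (P := Cmod_ge_0 z).
  assert (Hr : 0 <= rho < 1) by (unfold rho; lra).
  assert (Hzr : Cmod z < rho) by (unfold rho; lra).
  set (M := fun n => match n with O => 0 | S m => Rabs (dcoef a m) * rho ^ m end).
  assert (HM : ex_series M).
  { apply (ex_series_incr_1 (V := R_NormedModule)). apply poly_bd_ex_series; auto.
    apply poly_bd_dcoef; auto. }
  assert (near : Cnear z (fun w => Cmod w < rho)).
  { exists (rho - Cmod z). split; [lra|]. intros w Hw. assert (H := Cmod_rev_tri w z). lra. }
  assert (bd : forall w, Cmod w <= rho -> forall n, Cmod (RtoC (a n) * diffq z w n)%C <= M n).
  { intros w Hw [|n].
    - simpl. rewrite Cmult_0_r, Cmod_0. lra.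
    - rewrite Cmod_mult, Cmod_R. unfold M, dcoef. rewrite Rabs_mult, (Rabs_pos_eq (INR n + 1))
        by (assert (Pn := pos_INR n); lra).
      assert (B := diffq_bound z w rho n ltac:(lra) Hw).
      replace ((INR n + 1) * Rabs (a (S n)) * rho ^ n)
        with (Rabs (a (S n)) * ((INR n + 1) * rho ^ n)) by ring.
      apply Rmult_le_compat_l; [apply Rabs_pos | exact B]. }
  exists (fun w => CSeries (fun n => RtoC (a n) * diffq z w n)%C).
  assert (E : CSeries (fun n => RtoC (a n) * diffq z z n)%C = CPS (dcoef a) z).
  { assert (H := CSeries_correct _ M HM (bd z ltac:(lra))). apply (Cis_series_shift _ _ 1) in H.
    apply CSeries_unique in H. simpl in H.
    replace (CSeries (fun n => RtoC (a n) * diffq z z n)%C) with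
      (CSeries (fun n : nat => (a (S n) * (z * diffq z z n + z ^ n))%C)) by (rewrite H; ring).
    apply CSeries_ext. intro n. change (z * diffq z z n + z ^ n)%C with (diffq z z (S n)).
    rewrite diffq_diag. unfold dcoef. rewrite RtoC_mult. ring. }
  split; [|split; [exact E|]].
  - generalize near. apply filter_imp. intros w Hw.
    symmetry. unfold CPS at 1 2. symmetry. apply CSeries_unique.
    apply (Cis_series_ext (fun n => RtoC (a n) * z ^ n + (w - z) * (RtoC (a n) * diffq z w n))%C).
    + intro n. replace ((w - z) * (RtoC (a n) * diffq z w n))%C
        with (RtoC (a n) * (diffq z w n * (w - z)))%C by ring.
      rewrite <- diffq_spec. ring.
    + rewrite (Cmult_comm _ (w - z)%C). apply Cis_series_plus.
      * apply CPS_correct. exact Hz.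
      * apply Cis_series_scal. apply (CSeries_correct _ M HM). apply bd. lra.
  - rewrite <- E. apply (Tannery _ _ _ M); auto.
    + generalize near. apply filter_imp. intros w Hw. apply bd. lra.
    + intro n. apply Clf_mult; [apply Clf_const | apply diffq_cont].
Qed.

Lemma CPS_at_0 : CPS a 0 = RtoC (a O).
Proof.
  apply CSeries_unique. apply (Clf_ext (fun n => match n with O => RtoC 0 | S _ => RtoC (a O) end)).
  - exists O. intros n _. induction n as [|[|n] IH]; [reflexivity| simpl; ring |].
    change (RtoC (a O) = Csum (fun k => RtoC (a k) * 0 ^ k)%C (S n) + RtoC (a (S n)) * (0 * 0 ^ n))%C.
    rewrite <- IH. ring.
  - intros e He. exists 1%nat. intros [|n] Hn; [lia|]. rewrite Cmod_self. exact He.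
Qed.

Lemma CPS_shift z : Cmod z < 1 ->
  CPS (fun n => match n with O => 0 | S m => a m end) z = (z * CPS a z)%C.
Proof.
  intro Hz. apply CSeries_unique. apply (Clf_eq _ (RtoC 0 * z ^ 0 + z * CPS a z)%C); [ring|].
  apply (Cis_series_unshift (fun n => RtoC (match n with O => 0 | S m => a m end) * z ^ n)%C).
  apply (Cis_series_ext (fun n => z * (RtoC (a n) * z ^ n))%C); [intro n; simpl; ring|].
  apply Cis_series_scal, CPS_correct, Hz.
Qed.

Lemma CPS_unshift z : Cmod z < 1 -> CPS a z = (RtoC (a O) + z * CPS (fun n => a (S n)) z)%C.
Proof.
  intro Hz. apply CSeries_unique.
  apply (Clf_eq _ (RtoC (a O) * z ^ 0 + z * CPS (fun n => a (S n)) z)%C); [simpl; ring|].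
  apply (Cis_series_unshift (fun n => RtoC (a n) * z ^ n)%C).
  apply (Cis_series_ext (fun n => z * (RtoC (a (S n)) * z ^ n))%C); [intro n; simpl; ring|].
  apply Cis_series_scal. apply (CSeries_correct _ (fun n => Rabs (a (S n)) * Cmod z ^ n)).
  - apply (poly_bd_ex_series (fun n => a (S n))); [|split; [apply Cmod_ge_0 | exact Hz]].
    destruct Ha as [K [k H]]. exists (Rabs K * 2 ^ k), k. intro n.
    eapply Rle_trans; [apply H|]. rewrite S_INR. assert (Pn := pos_INR n).
    assert (Pp : 0 <= (INR n + 1 + 1) ^ k <= (2 * (INR n + 1)) ^ k).
    { split; [apply pow_le; lra | apply pow_incr; lra]. }
    rewrite Rpow_mult_distr in Pp. rewrite Rmult_assoc.
    assert (Q := Rabs_pos K). assert (Q' := Rle_abs K).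
    eapply Rle_trans; [apply Rmult_le_compat_r; [apply Pp | exact Q']|].
    apply Rmult_le_compat_l; [lra | apply Pp].
  - intro n. rewrite Cmod_mult, Cmod_R, Cmod_pow. lra.
Qed.

Lemma CPS_real x : Rabs x < 1 -> CPS a (RtoC x) = RtoC (Series (fun n => a n * x ^ n)).
Proof.
  intro Hx. assert (H := CPS_correct (RtoC x)). rewrite Cmod_R in H. specialize (H Hx).
  apply Cis_series_components in H. destruct H as [H1 H2].
  assert (E1 : Re (CPS a (RtoC x)) = Series (fun n => a n * x ^ n)).
  { apply is_series_unique in H1. rewrite <- H1. apply Series_ext. intro n.
    rewrite <- RtoC_pow, <- RtoC_mult. reflexivity. }
  assert (E2 : Im (CPS a (RtoC x)) = 0).
  { apply is_series_unique in H2. rewrite <- H2.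
    rewrite <- (Rmult_0_l (Series a)), <- Series_scal_l. apply Series_ext. intro n.
    rewrite <- RtoC_pow, <- RtoC_mult. simpl. ring. }
  destruct (CPS a (RtoC x)) as [u v]. simpl in *. subst. reflexivity.
Qed.

Lemma Clf_conj {T} (F : (T -> Prop) -> Prop) {FF : Filter F} f l :
  Clf F f l -> Clf F (fun x => Cconj (f x)) (Cconj l).
Proof.
  intros H e He. generalize (H e He). apply filter_imp. intros x Hx.
  rewrite <- Cminus_conj, Cmod_conj. exact Hx.
Qed.

Lemma CPS_conj z : Cmod z < 1 -> CPS a (Cconj z) = Cconj (CPS a z).
Proof.
  intro Hz. apply CSeries_unique. apply (Clf_ext (fun n => Cconj (Csum (fun n => RtoC (a n) * z ^ n)%C n))).
  - exists O. intros n _. induction n as [|n IH]; simpl.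
    + apply injective_projections; simpl; ring.
    + rewrite Cplus_conj, Cmult_conj, Cpow_conj, IH. f_equal. f_equal.
      apply injective_projections; simpl; ring.
  - apply Clf_conj; [apply _ | apply CPS_correct, Hz].
Qed.
End PowerSeries.

Lemma CPS_ext a b z : (forall n, a n = b n) -> CPS a z = CPS b z.
Proof. intro H. apply CSeries_ext. intro n. now rewrite H. Qed.

Lemma CPS_plus a b z : poly_bd a -> poly_bd b -> Cmod z < 1 ->
  CPS (fun n => a n + b n) z = (CPS a z + CPS b z)%C.
Proof.
  intros Ha Hb Hz. apply CSeries_unique.
  apply (Cis_series_ext (fun n => RtoC (a n) * z ^ n + RtoC (b n) * z ^ n)%C).
  - intro n. rewrite RtoC_plus. ring.
  - apply Cis_series_plus; apply CPS_correct; auto.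
Qed.

Lemma CPS_scal c a z : poly_bd a -> Cmod z < 1 ->
  CPS (fun n => c * a n) z = (RtoC c * CPS a z)%C.
Proof.
  intros Ha Hz. apply CSeries_unique.
  apply (Cis_series_ext (fun n => RtoC c * (RtoC (a n) * z ^ n))%C).
  - intro n. rewrite RtoC_mult. ring.
  - apply Cis_series_scal, CPS_correct; auto.
Qed.

Lemma CPS_cont a z : poly_bd a -> Cmod z < 1 -> Ccont (CPS a) z.
Proof. intros Ha Hz. eapply Cder_cont, CPS_der; auto. Qed.

(** * The complex exponential *)

Lemma Cexp_plus z w : Cexp (z + w)%C = (Cexp z * Cexp w)%C.
Proof.
  destruct z as [a b], w as [c d]. unfold Cexp, Cplus, Cmult; simpl.
  rewrite exp_plus, cos_plus, sin_plus. f_equal; ring.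
Qed.

Lemma Cexp_0 : Cexp 0 = 1.
Proof.
  unfold Cexp. simpl. rewrite exp_0, cos_0, sin_0. apply injective_projections; simpl; ring.
Qed.

Lemma Cmod_Cexp z : Cmod (Cexp z) = exp (Re z).
Proof.
  unfold Cexp, Cmod; simpl.
  replace (exp (Re z) * cos (Im z) * (exp (Re z) * cos (Im z) * 1) +
    exp (Re z) * sin (Im z) * (exp (Re z) * sin (Im z) * 1)) with (Rsqr (exp (Re z))).
  - apply sqrt_Rsqr. apply Rlt_le, exp_pos.
  - assert (H := sin2_cos2 (Im z)). unfold Rsqr in *.
    replace (exp (Re z) * cos (Im z) * (exp (Re z) * cos (Im z) * 1) +
      exp (Re z) * sin (Im z) * (exp (Re z) * sin (Im z) * 1))
      with (exp (Re z) * exp (Re z) * (sin (Im z) * sin (Im z) + cos (Im z) * cos (Im z))) by ring.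
    rewrite H. ring.
Qed.

Lemma Cexp_neq_0 z : Cexp z <> 0.
Proof. apply Cmod_gt_0. rewrite Cmod_Cexp. apply exp_pos. Qed.

Lemma Cexp_INR n z : Cexp (RtoC (INR n) * z)%C = (Cexp z ^ n)%C.
Proof.
  induction n as [|n IH].
  - simpl. rewrite Cmult_0_l. apply Cexp_0.
  - rewrite S_INR, RtoC_plus. replace ((INR n + 1) * z)%C with (z + INR n * z)%C by ring.
    rewrite Cexp_plus, IH. reflexivity.
Qed.

Lemma deriv0_bound f l : derivable_pt_lim f 0 l -> forall e, 0 < e ->
  exists d, 0 < d /\ forall x, Rabs x < d -> Rabs (f x - f 0 - l * x) <= e * Rabs x.
Proof.
  intros H e He. destruct (H e He) as [d Hd]. exists d. split; [apply cond_pos|].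
  intros x Hx. destruct (Req_dec x 0) as [->|N].
  - rewrite Rmult_0_r, Rminus_0_r, Rminus_diag, Rabs_R0. lra.
  - specialize (Hd x N Hx). rewrite Rplus_0_l in Hd.
    replace (f x - f 0 - l * x) with (((f x - f 0) / x - l) * x) by (field; auto).
    rewrite Rabs_mult. apply Rmult_le_compat_r; [apply Rabs_pos | lra].
Qed.

Lemma Cder_Cexp_0 : Cder Cexp 0 1.
Proof.
  set (p := fun w => if excluded_middle_informative (w = RtoC 0) then RtoC 1
                     else ((Cexp w - 1) / w)%C).
  exists p. split; [|split].
  - apply filter_forall. intro w. unfold p. rewrite Cexp_0.
    destruct excluded_middle_informative as [->|N].
    + rewrite Cexp_0. ring.
    + field. exact N.
  - unfold p. destruct excluded_middle_informative as [_|N]; [reflexivity | now elim N].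
  (* With m = |w|, the errors below add up to 3 e' m + 4 e' m, so e / 12 leaves room; e' <= 1 serves
     to bound |1 + x| by 2 and |sin y| by 2 m. *)
  - intros e He. set (e' := Rmin (e / 12) 1).
    assert (He' : 0 < e') by (unfold e'; apply Rmin_pos; lra).
    assert (Hl : e' <= e / 12) by apply Rmin_l. assert (Hl1 : e' <= 1) by apply Rmin_r.
    assert (D1 := derivable_pt_lim_exp 0). rewrite exp_0 in D1.
    assert (D2 := derivable_pt_lim_cos 0). rewrite sin_0 in D2.
    assert (D3 := derivable_pt_lim_sin 0). rewrite cos_0 in D3.
    destruct (deriv0_bound _ _ D1 e' He') as [d1 [Hd1 B1]].
    destruct (deriv0_bound _ _ D2 e' He') as [d2 [Hd2 B2]].
    destruct (deriv0_bound _ _ D3 e' He') as [d3 [Hd3 B3]].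
    exists (Rmin e' (Rmin d1 (Rmin d2 d3))). split.
    { apply Rmin_pos; [exact He'|]. repeat apply Rmin_pos; auto. }
    intros w Hw. replace (w - 0)%C with w in Hw by ring.
    assert (L0 := Rmin_l e' (Rmin d1 (Rmin d2 d3))).
    assert (L1 := Rmin_r e' (Rmin d1 (Rmin d2 d3))).
    assert (L2 := Rmin_l d1 (Rmin d2 d3)). assert (L3 := Rmin_r d1 (Rmin d2 d3)).
    assert (L4 := Rmin_l d2 d3). assert (L5 := Rmin_r d2 d3).
    unfold p. destruct excluded_middle_informative as [->|N].
    { rewrite Cmod_self. exact He. }
    assert (Nw := proj1 (Cmod_gt_0 w) N).
    assert (Rx := re_le_Cmod w). assert (Ry := Im_le_Cmod w).
    specialize (B1 (Re w) ltac:(lra)). specialize (B2 (Im w) ltac:(lra)).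
    specialize (B3 (Im w) ltac:(lra)). rewrite exp_0 in B1. rewrite cos_0 in B2. rewrite sin_0 in B3.
    replace ((Cexp w - 1) / w - 1)%C with ((Cexp w - 1 - w) / w)%C by (field; exact N).
    rewrite Cmod_div by exact N.
    apply (Rmult_lt_reg_r (Cmod w)); [exact Nw|].
    unfold Rdiv. rewrite Rmult_assoc, Rinv_l, Rmult_1_r by lra.
    eapply Rle_lt_trans; [apply Cmod_le_ReIm|].
    destruct w as [x y]. unfold Cexp, Cminus, Cplus, Copp, Re, Im, RtoC in *. cbn [fst snd] in *.
    set (m := Cmod (x, y)) in *.
    set (E := exp x) in *. set (c := cos y) in *. set (s := sin y) in *.
    replace (E * c + - (1) + - x) with ((E - 1 - 1 * x) * c + (1 + x) * (c - 1 - - 0 * y)  ) by ring.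
    assert (Hc : Rabs c <= 1) by (apply Rabs_le, COS_bound).
    assert (Hs : Rabs s <= 1) by (apply Rabs_le, SIN_bound).
    replace (E * s + - 0 + - y) with ((s - 0 - 1 * y) + (E - 1 - 1 * x) * s + x * s) by ring.
    assert (Rabs ((E - 1 - 1 * x) * c + (1 + x) * (c - 1 - - 0 * y)) <= e' * m + 2 * (e' * m)).
    { eapply Rle_trans; [apply Rabs_triang|]. rewrite !Rabs_mult. apply Rplus_le_compat.
      - rewrite <- (Rmult_1_r (e' * m)). apply Rmult_le_compat; try apply Rabs_pos; auto.
        eapply Rle_trans; [apply B1 | apply Rmult_le_compat_l; lra].
      - apply Rmult_le_compat; try apply Rabs_pos.
        + eapply Rle_trans; [apply Rabs_triang|]. rewrite Rabs_R1. lra.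
        + eapply Rle_trans; [apply B2 | apply Rmult_le_compat_l; lra]. }
    assert (Hsy : Rabs s <= 2 * m).
    { replace s with ((s - 0 - 1 * y) + y) by ring. eapply Rle_trans; [apply Rabs_triang|].
      assert (e' * Rabs y <= 1 * m) by (apply Rmult_le_compat; try apply Rabs_pos; lra). lra. }
    assert (Rabs ((s - 0 - 1 * y) + (E - 1 - 1 * x) * s + x * s) <= e' * m + e' * m + 2 * (e' * m)).
    { eapply Rle_trans; [apply Rabs_triang|]. apply Rplus_le_compat.
      - eapply Rle_trans; [apply Rabs_triang|]. apply Rplus_le_compat.
        + eapply Rle_trans; [apply B3 | apply Rmult_le_compat_l; lra].
        + rewrite Rabs_mult, <- (Rmult_1_r (e' * m)). apply Rmult_le_compat; try apply Rabs_pos; auto.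
          eapply Rle_trans; [apply B1 | apply Rmult_le_compat_l; lra].
      - rewrite Rabs_mult. replace (2 * (e' * m)) with (e' * (2 * m)) by ring.
        apply Rmult_le_compat; try apply Rabs_pos; lra. }
    assert (0 < e' * m) by (apply Rmult_lt_0_compat; lra).
    assert (e' * m <= e / 12 * m) by (apply Rmult_le_compat_r; lra).
    assert (0 < e * m) by (apply Rmult_lt_0_compat; lra). lra.
Qed.

Lemma Cder_Cexp z : Cder Cexp z (Cexp z).
Proof.
  apply (Cder_ext (fun w => Cexp z * Cexp (w - z))%C).
  - apply filter_forall. intro w. rewrite <- Cexp_plus. f_equal. ring.
  - eapply Cder_eq.
    + apply Cder_scal. apply (Cder_comp Cexp (fun w => w - z)%C z 1).
      * replace (z - z)%C with (RtoC 0) by ring. apply Cder_Cexp_0.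
      * apply Cder_minus; [apply Cder_id | apply Cder_const].
    + ring.
Qed.

(** * Goursat's lemma and the identity theorem *)

Definition Rcont (g : R -> C) (t : R) : Prop := Clf (locally t) g (g t).

Lemma Rcont_Re g t : Rcont g t -> continuous (fun s => Re (g s)) t.
Proof.
  intro H. apply filterlim_locally. intro eps. generalize (H eps (cond_pos eps)).
  apply filter_imp. intros s Hs. eapply Rle_lt_trans; [|exact Hs].
  apply (re_le_Cmod (g s - g t)%C).
Qed.

Lemma Rcont_Im g t : Rcont g t -> continuous (fun s => Im (g s)) t.
Proof.
  intro H. apply filterlim_locally. intro eps. generalize (H eps (cond_pos eps)).
  apply filter_imp. intros s Hs. eapply Rle_lt_trans; [|exact Hs].
  apply (Im_le_Cmod (g s - g t)%C).
Qed.

Lemma Rcont_line f p v t : Ccont f (p + RtoC t * v)%C -> Rcont (fun s => f (p + RtoC s * v)%C) t.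
Proof.
  intro H. apply (Ccont_comp (locally t) f (fun s => p + RtoC s * v)%C); [|exact H].
  intros e He. assert (K : 0 < Cmod v + 1) by (assert (P := Cmod_ge_0 v); lra).
  exists (mkposreal _ (Rdiv_lt_0_compat _ _ He K)). intros s Hs.
  change (Rabs (s - t) < e / (Cmod v + 1)) in Hs.
  replace (p + RtoC s * v - (p + RtoC t * v))%C with (RtoC (s - t) * v)%C
    by (rewrite RtoC_minus; ring).
  rewrite Cmod_mult, Cmod_R.
  apply Rle_lt_trans with (Rabs (s - t) * (Cmod v + 1)).
  - apply Rmult_le_compat_l; [apply Rabs_pos | lra].
  - replace e with (e / (Cmod v + 1) * (Cmod v + 1)) by (field; lra).
    apply Rmult_lt_compat_r; auto.
Qed.

Definition CI (g : R -> C) (a b : R) : C :=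
  (RInt (fun t => Re (g t)) a b, RInt (fun t => Im (g t)) a b).

Definition Rcont_on (g : R -> C) (a b : R) := forall t, a <= t <= b -> Rcont g t.

Lemma Rcont_on_ex g a b : a <= b -> Rcont_on g a b ->
  ex_RInt (fun t => Re (g t)) a b /\ ex_RInt (fun t => Im (g t)) a b.
Proof.
  intros Hab H. split; apply (ex_RInt_continuous (V := R_CompleteNormedModule));
    intros z; rewrite Rmin_left, Rmax_right by lra; intro Hz.
  - apply Rcont_Re. auto.
  - apply Rcont_Im. auto.
Qed.

Lemma CI_plus f g a b : a <= b -> Rcont_on f a b -> Rcont_on g a b ->
  CI (fun t => f t + g t)%C a b = (CI f a b + CI g a b)%C.
Proof.
  intros Hab Hf Hg. destruct (Rcont_on_ex f a b Hab Hf) as [F1 F2].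
  destruct (Rcont_on_ex g a b Hab Hg) as [G1 G2].
  unfold CI, Cplus; simpl. f_equal.
  - apply (RInt_plus (V := R_CompleteNormedModule)); auto.
  - apply (RInt_plus (V := R_CompleteNormedModule)); auto.
Qed.

Lemma CI_scal c f a b : a <= b -> Rcont_on f a b ->
  CI (fun t => c * f t)%C a b = (c * CI f a b)%C.
Proof.
  intros Hab Hf. destruct (Rcont_on_ex f a b Hab Hf) as [F1 F2].
  unfold CI, Cmult; simpl. f_equal.
  - rewrite (RInt_minus (V := R_CompleteNormedModule) (fun t => fst c * Re (f t)) (fun t => snd c * Im (f t)));
      try (apply (ex_RInt_scal (V := R_NormedModule)); auto).
    rewrite !(RInt_scal (V := R_CompleteNormedModule)); auto.
  - rewrite (RInt_plus (V := R_CompleteNormedModule) (fun t => fst c * Im (f t)) (fun t => snd c * Re (f t)));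
      try (apply (ex_RInt_scal (V := R_NormedModule)); auto).
    rewrite !(RInt_scal (V := R_CompleteNormedModule)); auto.
Qed.

Lemma CI_Chasles g a m b : a <= m <= b -> Rcont_on g a b ->
  CI g a b = (CI g a m + CI g m b)%C.
Proof.
  intros H Hg. destruct (Rcont_on_ex g a m ltac:(lra)) as [F1 F2].
  { intros t Ht. apply Hg. lra. }
  destruct (Rcont_on_ex g m b ltac:(lra)) as [G1 G2].
  { intros t Ht. apply Hg. lra. }
  unfold CI, Cplus; simpl. f_equal; symmetry; apply (RInt_Chasles (V := R_CompleteNormedModule)); auto.
Qed.

Lemma CI_ext f g a b : a <= b -> (forall t, a <= t <= b -> f t = g t) -> CI f a b = CI g a b.
Proof.
  intros Hab H. unfold CI. f_equal; apply RInt_ext; intros t; rewrite Rmin_left, Rmax_right by lra;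
    intro Ht; rewrite H; auto; lra.
Qed.

(** The factor 2 is the price of estimating the real and the imaginary part separately. *)
Lemma CI_bound g a b M : a <= b -> Rcont_on g a b -> (forall t, a <= t <= b -> Cmod (g t) <= M) ->
  Cmod (CI g a b) <= 2 * M * (b - a).
Proof.
  intros Hab Hc Hg. destruct (Rcont_on_ex g a b Hab Hc) as [F1 F2].
  eapply Rle_trans; [apply Cmod_le_ReIm|].
  unfold CI; simpl.
  assert (Rabs (RInt (fun t => Re (g t)) a b) <= (b - a) * M).
  { apply abs_RInt_le_const; auto. intros t Ht. eapply Rle_trans; [apply re_le_Cmod | auto]. }
  assert (Rabs (RInt (fun t => Im (g t)) a b) <= (b - a) * M).
  { apply abs_RInt_le_const; auto. intros t Ht. eapply Rle_trans; [apply Im_le_Cmod | auto]. }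
  lra.
Qed.

Lemma Cder_line f p v t l : Cder f (p + RtoC t * v)%C l ->
  is_derive (fun s => Re (f (p + RtoC s * v)%C)) t (Re (l * v)%C) /\
  is_derive (fun s => Im (f (p + RtoC s * v)%C)) t (Im (l * v)%C).
Proof.
  intros [phi [H1 [H2 H3]]].
  assert (K : 0 < Cmod v + 1) by (assert (P := Cmod_ge_0 v); lra).
  assert (Q : forall eps : posreal, locally t (fun s =>
    Cmod (f (p + RtoC s * v) - f (p + RtoC t * v) - RtoC (s - t) * (l * v))%C <= eps * Rabs (s - t))).
  { intros eps. assert (He : 0 < eps / (Cmod v + 1)) by (apply Rdiv_lt_0_compat; [apply cond_pos | auto]).
    assert (L : Clf (locally t) (fun s => p + RtoC s * v)%C (p + RtoC t * v)%C)
      by (apply (Rcont_line (fun w => w)), Ccont_id).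
    generalize (Clf_near _ _ _ _ L (filter_and _ _ H1 (H3 _ He))).
    apply filter_imp. intros s [E1 E2].
    rewrite E1. replace (p + RtoC s * v - (p + RtoC t * v))%C with (RtoC (s - t) * v)%C
      by (rewrite RtoC_minus; ring).
    replace (f (p + RtoC t * v) + phi (p + RtoC s * v) * (RtoC (s - t) * v) - f (p + RtoC t * v) - RtoC (s - t) * (l * v))%C
      with (RtoC (s - t) * ((phi (p + RtoC s * v) - l) * v))%C by ring.
    rewrite !Cmod_mult, Cmod_R, Rmult_comm. apply Rmult_le_compat_r; [apply Rabs_pos|].
    apply Rle_trans with (eps / (Cmod v + 1) * (Cmod v + 1)).
    - apply Rmult_le_compat; try apply Cmod_ge_0; lra.
    - right. field. lra. }
  split; (split; [apply is_linear_scal_l|]); intros x Hx; apply (is_filter_lim_locally_unique (V := R_NormedModule)) in Hx;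
    subst x; intro eps; generalize (Q eps); apply filter_imp; intros s Hs;
    (eapply Rle_trans; [|exact Hs]).
  - eapply Rle_trans; [|apply re_le_Cmod]. right. unfold norm, minus, plus, opp, scal; simpl. unfold mult; simpl.
    unfold abs; simpl. f_equal. destruct l, v. simpl. unfold Re, Im, Rminus. ring.
  - eapply Rle_trans; [|apply Im_le_Cmod]. right. unfold norm, minus, plus, opp, scal; simpl. unfold mult; simpl.
    unfold abs; simpl. f_equal. destruct l, v. simpl. unfold Re, Im, Rminus. ring.
Qed.

Lemma CI_primitive F f p v a b : a <= b ->
  (forall t, a <= t <= b -> Cder F (p + RtoC t * v)%C (f (p + RtoC t * v)%C)) ->
  Rcont_on (fun t => f (p + RtoC t * v)%C * v)%C a b ->
  CI (fun t => f (p + RtoC t * v)%C * v)%C a b = (F (p + RtoC b * v) - F (p + RtoC a * v))%C.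
Proof.
  intros Hab H Hc. unfold CI. apply injective_projections; simpl; apply is_RInt_unique.
  - apply (is_RInt_derive (V := R_CompleteNormedModule) (fun t => Re (F (p + RtoC t * v)%C)));
      intros t; rewrite Rmin_left, Rmax_right by lra; intro Ht.
    + apply Cder_line. auto.
    + apply (Rcont_Re (fun t => f (p + RtoC t * v) * v)%C). auto.
  - apply (is_RInt_derive (V := R_CompleteNormedModule) (fun t => Im (F (p + RtoC t * v)%C)));
      intros t; rewrite Rmin_left, Rmax_right by lra; intro Ht.
    + apply Cder_line. auto.
    + apply (Rcont_Im (fun t => f (p + RtoC t * v) * v)%C). auto.
Qed.

(** The ordinate comes first, so that [hline y] is the horizontal line at height y. Both families of
    lines have the form p + t v, by [hline_h] and [hline_v]. *)
Definition hline (y x : R) : C := (RtoC x + Ci * RtoC y)%C.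

Lemma hline_pair x y : hline y x = (x, y).
Proof. unfold hline. apply injective_projections; simpl; ring. Qed.

Lemma hline_h x y : hline y x = (Ci * RtoC y + RtoC x * 1)%C.
Proof. unfold hline. ring. Qed.

Lemma hline_v x y : hline y x = (RtoC x + RtoC y * Ci)%C.
Proof. unfold hline. ring. Qed.

(** The contour integral along the boundary of the rectangle, counterclockwise. *)
Definition Irect (f : C -> C) (x0 x1 y0 y1 : R) : C :=
  (CI (fun x => f (hline y0 x)) x0 x1 + Ci * CI (fun y => f (hline y x1)) y0 y1
   - CI (fun x => f (hline y1 x)) x0 x1 - Ci * CI (fun y => f (hline y x0)) y0 y1)%C.

Definition on_rect (x0 x1 y0 y1 : R) (P : C -> Prop) : Prop :=
  forall x y, x0 <= x <= x1 -> y0 <= y <= y1 ->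
    (x = x0 \/ x = x1 \/ y = y0 \/ y = y1) -> P (hline y x).

Lemma Rcont_hline f x y : Ccont f (hline y x) -> Rcont (fun t => f (hline y t)) x.
Proof.
  intro H. rewrite hline_h in H. apply (Rcont_line f (Ci * RtoC y)%C 1) in H.
  apply (Clf_eq _ (f (Ci * RtoC y + RtoC x * 1)%C)); [now rewrite hline_h|].
  eapply Clf_ext; [|exact H]. apply filter_forall. intro t. now rewrite hline_h.
Qed.

Lemma Rcont_vline f x y : Ccont f (hline y x) -> Rcont (fun t => f (hline t x)) y.
Proof.
  intro H. rewrite hline_v in H. apply (Rcont_line f (RtoC x)%C Ci) in H.
  apply (Clf_eq _ (f (RtoC x + RtoC y * Ci)%C)); [now rewrite hline_v|].
  eapply Clf_ext; [|exact H]. apply filter_forall. intro t. now rewrite hline_v.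
Qed.

Lemma on_rect_cont f x0 x1 y0 y1 : x0 <= x1 -> y0 <= y1 -> on_rect x0 x1 y0 y1 (Ccont f) ->
  Rcont_on (fun x => f (hline y0 x)) x0 x1 /\ Rcont_on (fun x => f (hline y1 x)) x0 x1 /\
  Rcont_on (fun y => f (hline y x0)) y0 y1 /\ Rcont_on (fun y => f (hline y x1)) y0 y1.
Proof.
  intros Hx Hy H. repeat split; intros t Ht; (apply Rcont_hline || apply Rcont_vline);
    apply H; try lra; auto.
Qed.

Lemma Irect_split_x f x0 m x1 y0 y1 : x0 <= m <= x1 -> y0 <= y1 ->
  on_rect x0 x1 y0 y1 (Ccont f) ->
  Irect f x0 x1 y0 y1 = (Irect f x0 m y0 y1 + Irect f m x1 y0 y1)%C.
Proof.
  intros Hm Hy H. destruct (on_rect_cont f x0 x1 y0 y1 ltac:(lra) Hy H) as [C1 [C2 _]].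
  unfold Irect. rewrite (CI_Chasles _ x0 m x1 Hm C1), (CI_Chasles _ x0 m x1 Hm C2). ring.
Qed.

Lemma Irect_split_y f x0 x1 y0 m y1 : x0 <= x1 -> y0 <= m <= y1 ->
  on_rect x0 x1 y0 y1 (Ccont f) ->
  Irect f x0 x1 y0 y1 = (Irect f x0 x1 y0 m + Irect f x0 x1 m y1)%C.
Proof.
  intros Hx Hm H. destruct (on_rect_cont f x0 x1 y0 y1 Hx ltac:(lra) H) as [_ [_ [C1 C2]]].
  unfold Irect. rewrite (CI_Chasles _ y0 m y1 Hm C1), (CI_Chasles _ y0 m y1 Hm C2). ring.
Qed.

Lemma Irect_plus f g x0 x1 y0 y1 : x0 <= x1 -> y0 <= y1 ->
  on_rect x0 x1 y0 y1 (Ccont f) -> on_rect x0 x1 y0 y1 (Ccont g) ->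
  Irect (fun z => f z + g z)%C x0 x1 y0 y1 = (Irect f x0 x1 y0 y1 + Irect g x0 x1 y0 y1)%C.
Proof.
  intros Hx Hy Hf Hg. destruct (on_rect_cont f _ _ _ _ Hx Hy Hf) as [A1 [A2 [A3 A4]]].
  destruct (on_rect_cont g _ _ _ _ Hx Hy Hg) as [B1 [B2 [B3 B4]]].
  unfold Irect. rewrite !CI_plus by auto. ring.
Qed.

Lemma Irect_scal c f x0 x1 y0 y1 : x0 <= x1 -> y0 <= y1 -> on_rect x0 x1 y0 y1 (Ccont f) ->
  Irect (fun z => c * f z)%C x0 x1 y0 y1 = (c * Irect f x0 x1 y0 y1)%C.
Proof.
  intros Hx Hy Hf. destruct (on_rect_cont f _ _ _ _ Hx Hy Hf) as [A1 [A2 [A3 A4]]].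
  unfold Irect. rewrite !CI_scal by auto. ring.
Qed.

Lemma Irect_ext f g x0 x1 y0 y1 : x0 <= x1 -> y0 <= y1 ->
  on_rect x0 x1 y0 y1 (fun z => f z = g z) -> Irect f x0 x1 y0 y1 = Irect g x0 x1 y0 y1.
Proof.
  intros Hx Hy H. unfold Irect.
  rewrite (CI_ext (fun x => f (hline y0 x)) (fun x => g (hline y0 x))) by (auto; intros; apply H; auto; lra).
  rewrite (CI_ext (fun x => f (hline y1 x)) (fun x => g (hline y1 x))) by (auto; intros; apply H; auto; lra).
  rewrite (CI_ext (fun y => f (hline y x0)) (fun y => g (hline y x0))) by (auto; intros; apply H; auto; lra).
  rewrite (CI_ext (fun y => f (hline y x1)) (fun y => g (hline y x1))) by (auto; intros; apply H; auto; lra).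
  reflexivity.
Qed.

Lemma Irect_bound f x0 x1 y0 y1 M : x0 <= x1 -> y0 <= y1 -> on_rect x0 x1 y0 y1 (Ccont f) ->
  on_rect x0 x1 y0 y1 (fun z => Cmod (f z) <= M) ->
  Cmod (Irect f x0 x1 y0 y1) <= 4 * M * ((x1 - x0) + (y1 - y0)).
Proof.
  intros Hx Hy Hf Hb. destruct (on_rect_cont f _ _ _ _ Hx Hy Hf) as [A1 [A2 [A3 A4]]].
  assert (B1 := CI_bound _ _ _ M Hx A1 ltac:(intros; apply Hb; auto; lra)).
  assert (B2 := CI_bound _ _ _ M Hx A2 ltac:(intros; apply Hb; auto; lra)).
  assert (B3 := CI_bound _ _ _ M Hy A3 ltac:(intros; apply Hb; auto; lra)).
  assert (B4 := CI_bound _ _ _ M Hy A4 ltac:(intros; apply Hb; auto; lra)).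
  unfold Irect. eapply Rle_trans; [apply Cmod_triangle|]. rewrite Cmod_opp, Cmod_mult, Cmod_Ci.
  eapply Rle_trans; [apply Rplus_le_compat_r, Cmod_triangle|]. rewrite Cmod_opp.
  eapply Rle_trans; [apply Rplus_le_compat_r, Rplus_le_compat_r, Cmod_triangle|].
  rewrite Cmod_mult, Cmod_Ci. lra.
Qed.

Lemma Irect_primitive F f x0 x1 y0 y1 : x0 <= x1 -> y0 <= y1 ->
  (forall z, Cder F z (f z)) -> (forall z, Ccont f z) -> Irect f x0 x1 y0 y1 = 0.
Proof.
  intros Hx Hy HF Hf.
  assert (Hh : forall y, CI (fun x => f (hline y x)) x0 x1 = (F (hline y x1) - F (hline y x0))%C).
  { intro y. rewrite !hline_h. rewrite <- (CI_primitive F f (Ci * RtoC y)%C 1 x0 x1); auto.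
    - apply CI_ext; auto. intros t _. rewrite hline_h. ring.
    - intros t _. apply Clf_mult; [apply Rcont_line, Hf | apply Clf_const]. }
  assert (Hv : forall x, (Ci * CI (fun y => f (hline y x)) y0 y1)%C = (F (hline y1 x) - F (hline y0 x))%C).
  { intro x. rewrite !hline_v. rewrite <- (CI_primitive F f (RtoC x)%C Ci y0 y1); auto.
    - rewrite <- CI_scal; auto.
      + apply CI_ext; auto. intros t _. rewrite hline_v. ring.
      + intros t _. apply Rcont_vline. apply Hf.
    - intros t _. apply Clf_mult; [apply Rcont_line, Hf | apply Clf_const]. }
  unfold Irect. rewrite !Hh, !Hv. ring.
Qed.

Lemma Irect_affine a b p x0 x1 y0 y1 : x0 <= x1 -> y0 <= y1 ->
  Irect (fun z => a + b * (z - p))%C x0 x1 y0 y1 = 0.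
Proof.
  intros Hx Hy.
  apply (Irect_primitive (fun z => a * (z - p) + b / 2 * (z - p) * (z - p))%C); auto; intro z.
  - assert (D : Cder (fun z => z - p)%C z 1).
    { eapply Cder_eq; [apply Cder_minus; [apply Cder_id | apply Cder_const]|]. ring. }
    eapply Cder_eq; [apply Cder_plus; [apply Cder_scal, D | apply Cder_mult; [apply Cder_scal, D | apply D]]|].
    cbv beta. field.
  - apply Clf_plus; [apply Clf_const|]. apply Clf_mult; [apply Clf_const|].
    apply Clf_minus; [apply Ccont_id | apply Clf_const].
Qed.

Definition holo_at (f : C -> C) (z : C) : Prop := exists l, Cder f z l.

Lemma holo_cont f z : holo_at f z -> Ccont f z.
Proof. intros [l H]. eapply Cder_cont; eauto. Qed.

Lemma rect_diam x y X Y d e : Rabs (x - X) <= d -> Rabs (y - Y) <= e ->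
  Cmod (hline y x - hline Y X)%C <= d + e.
Proof.
  intros Hx Hy. eapply Rle_trans; [apply Cmod_le_ReIm|]. rewrite !hline_pair. simpl.
  unfold Rminus in *. lra.
Qed.

Section Goursat.
Context (f : C -> C) (X0 X1 Y0 Y1 : R) (HX : X0 < X1) (HY : Y0 < Y1).
Context (Hf : forall x y, X0 <= x <= X1 -> Y0 <= y <= Y1 -> holo_at f (hline y x)).

Let a := X1 - X0.
Let b := Y1 - Y0.

Let good (x y s : R) : Prop :=
  X0 <= x /\ x + s * a <= X1 /\ Y0 <= y /\ y + s * b <= Y1 /\ 0 < s.

Let bad (eps x y s : R) : Prop :=
  good x y s /\ eps * (s * s) < Cmod (Irect f x (x + s * a) y (y + s * b)).

(** The integral is the sum of the integrals over the four quarters, and their thresholds eps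
    (s/2)^2 add up to eps s^2; hence one quarter exceeds its own threshold. *)
Let bisect eps x y s : bad eps x y s ->
  exists x' y', (x' = x \/ x' = x + s / 2 * a) /\ (y' = y \/ y' = y + s / 2 * b) /\ bad eps x' y' (s / 2).
Proof.
  intros [[G1 [G2 [G3 [G4 G5]]]] B].
  assert (Pa : 0 < s * a) by (apply Rmult_lt_0_compat; unfold a; lra).
  assert (Pb : 0 < s * b) by (apply Rmult_lt_0_compat; unfold b; lra).
  assert (Ca : s / 2 * a = s * a / 2) by field.
  assert (Cb : s / 2 * b = s * b / 2) by field.
  assert (cont : forall x0 x1 y0 y1, X0 <= x0 -> x1 <= X1 -> Y0 <= y0 -> y1 <= Y1 ->
    on_rect x0 x1 y0 y1 (Ccont f)).
  { intros x0 x1 y0 y1 H1 H2 H3 H4 u v Hu Hv _. apply holo_cont, Hf; lra. }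
  rewrite (Irect_split_x f x (x + s / 2 * a)) in B by (try lra; apply cont; lra).
  rewrite (Irect_split_y f x _ y (y + s / 2 * b)) in B by (try lra; apply cont; lra).
  rewrite (Irect_split_y f (x + s / 2 * a) _ y (y + s / 2 * b)) in B by (try lra; apply cont; lra).
  apply NNPP. intro N.
  assert (K : forall x' y', (x' = x \/ x' = x + s / 2 * a) -> (y' = y \/ y' = y + s / 2 * b) ->
    Cmod (Irect f x' (x' + s / 2 * a) y' (y' + s / 2 * b)) <= eps * (s / 2 * (s / 2))).
  { intros x' y' Hx' Hy'. apply Rnot_lt_le. intro H. apply N. exists x', y'.
    split; [auto|]. split; [auto|]. split; [|exact H].
    repeat split; try lra; destruct Hx' as [->| ->]; destruct Hy' as [->| ->]; lra. }
  assert (K1 := K x y ltac:(auto) ltac:(auto)).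
  assert (K2 := K x (y + s / 2 * b) ltac:(auto) ltac:(auto)).
  assert (K3 := K (x + s / 2 * a) y ltac:(auto) ltac:(auto)).
  assert (K4 := K (x + s / 2 * a) (y + s / 2 * b) ltac:(auto) ltac:(auto)).
  replace (y + s / 2 * b + s / 2 * b) with (y + s * b) in * by lra.
  replace (x + s / 2 * a + s / 2 * a) with (x + s * a) in * by lra.
  match type of B with _ < Cmod (?p + ?q + (?r + ?t))%C =>
    assert (T1 := Cmod_triangle (p + q) (r + t)); assert (T2 := Cmod_triangle p q);
    assert (T3 := Cmod_triangle r t) end.
  lra.
Qed.

Let bstep (eps : R) (n : nat) (p : R * R) : R * R :=
  match excluded_middle_informative (exists q : R * R,
     (fst q = fst p \/ fst q = fst p + (/ 2) ^ S n * a) /\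
     (snd q = snd p \/ snd q = snd p + (/ 2) ^ S n * b) /\
     bad eps (fst q) (snd q) ((/ 2) ^ S n)) with
  | left H => proj1_sig (constructive_indefinite_description _ H)
  | right _ => p
  end.

Let bseq (eps : R) : nat -> R * R :=
  fix go n := match n with O => (X0, Y0) | S m => bstep eps m (go m) end.

Let nested (u : nat -> R) (c : R) : 0 < c ->
  (forall n, u n <= u (S n) <= u n + (/ 2) ^ S n * c) ->
  exists U, forall n, u n <= U <= u n + (/ 2) ^ n * c.
Proof.
  intros Hc H.
  assert (mono : forall n k, u n <= u (n + k)%nat).
  { intros n k. induction k as [|k IH]; [rewrite Nat.add_0_r; lra|].
    rewrite Nat.add_succ_r. specialize (H (n + k)%nat). lra. }
  assert (mono' : forall n k, u (n + k)%nat + (/ 2) ^ (n + k) * c <= u n + (/ 2) ^ n * c).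
  { intros n k. induction k as [|k IH]; [rewrite Nat.add_0_r; lra|].
    rewrite Nat.add_succ_r. specialize (H (n + k)%nat). simpl pow in *. lra. }
  assert (pos : forall n, 0 < (/ 2) ^ n * c).
  { intro n. apply Rmult_lt_0_compat; [apply pow_lt; lra | auto]. }
  assert (ub : forall n m, u m <= u n + (/ 2) ^ n * c).
  { intros n m. destruct (Nat.le_gt_cases n m) as [L|L].
    - replace m with (n + (m - n))%nat by lia. specialize (mono' n (m - n)%nat).
      specialize (pos (n + (m - n))%nat). lra.
    - replace n with (m + (n - m))%nat by lia. specialize (mono m (n - m)%nat).
      specialize (pos (m + (n - m))%nat). lra. }
  destruct (completeness (fun v => exists n, v = u n)) as [U [HU1 HU2]].
  - exists (u O + (/ 2) ^ O * c). intros v [n ->]. apply ub.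
  - exists (u O). now exists O.
  - exists U. intro n. split.
    + apply HU1. now exists n.
    + apply HU2. intros v [m ->]. apply ub.
Qed.

Lemma Goursat : Irect f X0 X1 Y0 Y1 = 0.
Proof.
  apply Cmod_eq_0. apply Rle_antisym; [|apply Cmod_ge_0]. apply Rnot_lt_le. intro N.
  set (eps := Cmod (Irect f X0 X1 Y0 Y1) / 2).
  assert (He : 0 < eps) by (unfold eps; lra).
  assert (Hbad : forall n, bad eps (fst (bseq eps n)) (snd (bseq eps n)) ((/ 2) ^ n) /\
    (fst (bseq eps (S n)) = fst (bseq eps n) \/ fst (bseq eps (S n)) = fst (bseq eps n) + (/ 2) ^ S n * a) /\
    (snd (bseq eps (S n)) = snd (bseq eps n) \/ snd (bseq eps (S n)) = snd (bseq eps n) + (/ 2) ^ S n * b)).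
  { assert (step : forall n, bad eps (fst (bseq eps n)) (snd (bseq eps n)) ((/ 2) ^ n) ->
      (fst (bseq eps (S n)) = fst (bseq eps n) \/ fst (bseq eps (S n)) = fst (bseq eps n) + (/ 2) ^ S n * a) /\
      (snd (bseq eps (S n)) = snd (bseq eps n) \/ snd (bseq eps (S n)) = snd (bseq eps n) + (/ 2) ^ S n * b) /\
      bad eps (fst (bseq eps (S n))) (snd (bseq eps (S n))) ((/ 2) ^ S n)).
    { intros n Hn. apply bisect in Hn. change (bseq eps (S n)) with (bstep eps n (bseq eps n)).
      unfold bstep. destruct excluded_middle_informative as [H|H].
      - destruct (constructive_indefinite_description _ H) as [q Hq]. exact Hq.
      - exfalso. apply H. destruct Hn as [x' [y' Hxy]].
        replace ((/ 2) ^ n / 2) with ((/ 2) ^ S n) in Hxy by (simpl; field).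
        exists (x', y'). exact Hxy. }
    assert (all : forall n, bad eps (fst (bseq eps n)) (snd (bseq eps n)) ((/ 2) ^ n)).
    { induction n as [|n IH].
      - simpl. split.
        + repeat split; unfold a, b; lra.
        + replace (X0 + 1 * a) with X1 by (unfold a; ring).
          replace (Y0 + 1 * b) with Y1 by (unfold b; ring). unfold eps. lra.
      - apply step in IH. apply IH. }
    intro n. split; [apply all|]. split; apply (step n), all. }
  assert (Pa : 0 < a) by (unfold a; lra). assert (Pb : 0 < b) by (unfold b; lra).
  assert (P2 : forall n, 0 < (/ 2) ^ n) by (intro n; apply pow_lt; lra).
  destruct (nested (fun n => fst (bseq eps n)) a Pa) as [X HXn].
  { intro n. destruct (Hbad n) as [_ [[->| ->] _]]; assert (0 < (/ 2) ^ S n * a) by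
      (apply Rmult_lt_0_compat; auto); lra. }
  destruct (nested (fun n => snd (bseq eps n)) b Pb) as [Y HYn].
  { intro n. destruct (Hbad n) as [_ [_ [->| ->]]]; assert (0 < (/ 2) ^ S n * b) by
      (apply Rmult_lt_0_compat; auto); lra. }
  assert (HXr : X0 <= X <= X1).
  { specialize (HXn O). simpl in HXn. unfold a in HXn. lra. }
  assert (HYr : Y0 <= Y <= Y1).
  { specialize (HYn O). simpl in HYn. unfold b in HYn. lra. }
  destruct (Hf X Y HXr HYr) as [l [phi [E1 [E2 E3]]]].
  set (p := hline Y X) in *.
  (* Chosen so that the boundary estimate 4 (e' s (a + b)) s (a + b) is exactly eps s^2. *)
  set (e' := eps / (4 * ((a + b) * (a + b)))).
  assert (He' : 0 < e').
  { unfold e'. apply Rdiv_lt_0_compat; auto. apply Rmult_lt_0_compat; [lra|].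
    apply Rmult_lt_0_compat; lra. }
  destruct (filter_and _ _ E1 (E3 e' He')) as [d [Hd Hdw]].
  assert (Hn : exists n, (/ 2) ^ n * (a + b) < d).
  { destruct (pow_lt_1_zero (/ 2) ltac:(rewrite Rabs_pos_eq; lra) (d / (a + b))
      ltac:(apply Rdiv_lt_0_compat; lra)) as [n Hn].
    exists n. specialize (Hn n (Nat.le_refl _)). rewrite Rabs_pos_eq in Hn by (apply Rlt_le, P2).
    apply (Rmult_lt_compat_r (a + b)) in Hn; [|lra].
    replace (d / (a + b) * (a + b)) with d in Hn by (field; lra). exact Hn. }
  destruct Hn as [n Hn]. destruct (Hbad n) as [[[G1 [G2 [G3 [G4 G5]]]] B] _].
  specialize (HXn n). specialize (HYn n). simpl in HXn, HYn.
  set (x := fst (bseq eps n)) in *. set (y := snd (bseq eps n)) in *. set (s := (/ 2) ^ n) in *.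
  assert (Psa : 0 < s * a) by (apply Rmult_lt_0_compat; auto).
  assert (Psb : 0 < s * b) by (apply Rmult_lt_0_compat; auto).
  assert (near : forall u v, x <= u <= x + s * a -> y <= v <= y + s * b ->
    Cmod (hline v u - p)%C <= s * (a + b)).
  { intros u v Hu Hv. eapply Rle_trans; [apply (rect_diam u v X Y (s * a) (s * b)); apply Rabs_le; lra|]. lra. }
  assert (cf : on_rect x (x + s * a) y (y + s * b) (Ccont f)).
  { intros u v Hu Hv _. apply holo_cont, Hf; lra. }
  assert (ca : forall z, Ccont (fun z => f p + l * (z - p))%C z).
  { intro z. apply Clf_plus; [apply Clf_const|]. apply Clf_mult; [apply Clf_const|].
    apply Clf_minus; [apply Ccont_id | apply Clf_const]. }
  assert (cr : on_rect x (x + s * a) y (y + s * b) (Ccont (fun z => f z + -(1) * (f p + l * (z - p)))%C)).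
  { intros u v Hu Hv Huv. apply Clf_plus; [apply cf; auto|]. apply Clf_mult; [apply Clf_const | apply ca]. }
  (* The tangent function f p + l (z - p) has a primitive and contributes 0, so only the remainder,
     of order e' |z - p|, is integrated. *)
  assert (E : Irect f x (x + s * a) y (y + s * b)
    = Irect (fun z => f z + -(1) * (f p + l * (z - p)))%C x (x + s * a) y (y + s * b)).
  { rewrite Irect_plus; try lra; auto.
    - rewrite Irect_scal; try lra.
      + rewrite Irect_affine by lra. ring.
      + intros u v _ _ _. apply ca.
    - intros u v _ _ _. apply Clf_mult; [apply Clf_const | apply ca]. }
  rewrite E in B.
  assert (B' := Irect_bound _ x (x + s * a) y (y + s * b) (e' * (s * (a + b))) ltac:(lra) ltac:(lra) cr).
  assert (B'' : Cmod (Irect (fun z => f z + -(1) * (f p + l * (z - p)))%C x (x + s * a) y (y + s * b))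
     <= 4 * (e' * (s * (a + b))) * ((x + s * a - x) + (y + s * b - y))).
  { apply B'. intros u v Hu Hv _. specialize (near u v Hu Hv).
    destruct (Hdw (hline v u) ltac:(lra)) as [K1 K2].
    rewrite K1. replace (f p + phi (hline v u) * (hline v u - p) + - (1) * (f p + l * (hline v u - p)))%C
      with ((phi (hline v u) - l) * (hline v u - p))%C by ring.
    rewrite Cmod_mult. apply Rmult_le_compat; try apply Cmod_ge_0; lra. }
  replace (4 * (e' * (s * (a + b))) * (x + s * a - x + (y + s * b - y))) with (eps * (s * s)) in B''.
  - lra.
  - unfold e'. field. lra.
Qed.
End Goursat.

Lemma hline_neq x y w : x <> Re w \/ y <> Im w -> (hline y x - w)%C <> 0.
Proof.
  intros H E. apply Cminus_eq_0 in E. rewrite hline_pair in E. subst w. simpl in H. lra.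
Qed.

Lemma hline_sub_lb x y w : Rabs (x - Re w) <= Cmod (hline y x - w)%C /\
  Rabs (y - Im w) <= Cmod (hline y x - w)%C.
Proof.
  rewrite hline_pair. split.
  - apply (re_le_Cmod ((x, y) - w)%C).
  - apply (Im_le_Cmod ((x, y) - w)%C).
Qed.

Lemma Ccont_cst_sub w z : Ccont (fun v => v - w)%C z.
Proof. apply Clf_minus; [apply Ccont_id | apply Clf_const]. Qed.

Lemma Ccont_inv_sub w z : (z - w)%C <> 0 -> Ccont (fun v => / (v - w))%C z.
Proof. intro H. apply (Clf_inv (fun v => v - w)%C); auto. apply Ccont_cst_sub. Qed.

Lemma Rcont_pos_RInt g a b (h : C -> R) : a < b -> Rcont_on g a b ->
  (h = Re \/ h = Im) -> (forall t, a <= t <= b -> 0 < h (g t)) -> 0 < h (CI g a b).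
Proof.
  intros Hab Hc Hh Hp. unfold CI. destruct Hh as [->| ->]; simpl; apply RInt_gt_0; auto;
    try (intros; apply Hp; lra); intros t Ht.
  - apply Rcont_Re; auto.
  - apply Rcont_Im; auto.
Qed.

Lemma sum_sq_pos a b : a <> 0 \/ b <> 0 -> 0 < a * (a * 1) + b * (b * 1).
Proof. intros [H|H]; assert (K := Rsqr_pos_lt _ H); unfold Rsqr in K; nra. Qed.

(** Each of the four sides contributes a positive imaginary part, because w lies inside. This
    nonzero number stands in for 2 pi i in [Cauchy_rect]. *)
Lemma Irect_inv_neq_0 w x0 x1 y0 y1 : x0 < Re w < x1 -> y0 < Im w < y1 ->
  Irect (fun z => / (z - w))%C x0 x1 y0 y1 <> 0.
Proof.
  intros Hx Hy E.
  assert (N : forall x y, (x = x0 \/ x = x1 \/ y = y0 \/ y = y1) -> (hline y x - w)%C <> 0).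
  { intros x y H. apply hline_neq. lra. }
  assert (cf : on_rect x0 x1 y0 y1 (Ccont (fun z => / (z - w))%C)).
  { intros x y _ _ H. apply Ccont_inv_sub. auto. }
  destruct (on_rect_cont _ x0 x1 y0 y1 ltac:(lra) ltac:(lra) cf) as [A1 [A2 [A3 A4]]].
  assert (val : forall x y, (hline y x - w)%C = (x - Re w, y - Im w)).
  { intros x y. rewrite hline_pair. reflexivity. }
  assert (P1 : 0 < Im (CI (fun x => / (hline y0 x - w))%C x0 x1)).
  { apply (Rcont_pos_RInt _ x0 x1 Im); auto; try lra. intros t Ht. rewrite val.
    unfold Cinv, Im; simpl. apply Rdiv_lt_0_compat; [unfold Im in *; lra|].
    apply sum_sq_pos. right. unfold Im in *; lra. }
  assert (P2 : 0 < Im (CI (fun x => -(1) * / (hline y1 x - w))%C x0 x1)).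
  { apply (Rcont_pos_RInt _ x0 x1 Im); auto; try lra.
    { intros t Ht. apply Clf_mult; [apply Clf_const|]. apply A2. exact Ht. }
    intros t Ht. replace (- (1) * / (hline y1 t - w))%C with (- / (hline y1 t - w))%C by ring. rewrite val.
    unfold Cinv, Copp, Im; simpl. unfold Rdiv. rewrite <- Ropp_mult_distr_l, Ropp_involutive.
    apply Rdiv_lt_0_compat; [unfold Im in *; lra|].
    apply sum_sq_pos. right. unfold Im in *; lra. }
  assert (P3 : 0 < Re (CI (fun y => / (hline y x1 - w))%C y0 y1)).
  { apply (Rcont_pos_RInt _ y0 y1 Re); auto; try lra. intros t Ht. rewrite val.
    unfold Cinv, Re; simpl. apply Rdiv_lt_0_compat; [unfold Re in *; lra|].
    apply sum_sq_pos. left. unfold Re in *; lra. }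
  assert (P4 : 0 < Re (CI (fun y => -(1) * / (hline y x0 - w))%C y0 y1)).
  { apply (Rcont_pos_RInt _ y0 y1 Re); auto; try lra.
    { intros t Ht. apply Clf_mult; [apply Clf_const|]. apply A3. exact Ht. }
    intros t Ht. replace (- (1) * / (hline t x0 - w))%C with (- / (hline t x0 - w))%C by ring. rewrite val.
    unfold Cinv, Copp, Re; simpl. unfold Rdiv. rewrite Ropp_mult_distr_l.
    apply Rdiv_lt_0_compat; [unfold Re in *; lra|].
    apply sum_sq_pos. left. unfold Re in *; lra. }
  rewrite CI_scal in P2 by (auto; lra). rewrite CI_scal in P4 by (auto; lra).
  unfold Irect in E. apply (f_equal Im) in E.
  revert P1 P2 P3 P4 E.
  generalize (CI (fun x => / (hline y0 x - w))%C x0 x1) (CI (fun x => / (hline y1 x - w))%C x0 x1)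
    (CI (fun y => / (hline y x1 - w))%C y0 y1) (CI (fun y => / (hline y x0 - w))%C y0 y1).
  intros [a1 a2] [b1 b2] [c1 c2] [d1 d2]. unfold Im, Re. simpl. intros. lra.
Qed.

Lemma Goursat_le f X0 X1 Y0 Y1 : X0 <= X1 -> Y0 <= Y1 ->
  (forall x y, X0 <= x <= X1 -> Y0 <= y <= Y1 -> holo_at f (hline y x)) -> Irect f X0 X1 Y0 Y1 = 0.
Proof.
  intros Hx Hy Hf. destruct (Req_dec X0 X1) as [->|Nx].
  { unfold Irect. assert (E : forall g, CI g X1 X1 = RtoC 0).
    { intro g. unfold CI. now rewrite !(RInt_point (V := R_CompleteNormedModule)). }
    rewrite !E. ring. }
  destruct (Req_dec Y0 Y1) as [->|Ny].
  { unfold Irect. assert (E : forall g, CI g Y1 Y1 = RtoC 0).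
    { intro g. unfold CI. now rewrite !(RInt_point (V := R_CompleteNormedModule)). }
    rewrite !E. ring. }
  apply Goursat; auto; lra.
Qed.

(** The quotient (f z - f w) / (z - w) is holomorphic off w and bounded near w. By Goursat on the
    four surrounding rectangles its integral equals the one over a small square about w, which tends
    to 0 with the side. *)
Lemma Cauchy_rect f w x0 x1 y0 y1 : x0 < Re w < x1 -> y0 < Im w < y1 ->
  (forall x y, x0 <= x <= x1 -> y0 <= y <= y1 -> holo_at f (hline y x)) ->
  Irect (fun z => f z * / (z - w))%C x0 x1 y0 y1 = (f w * Irect (fun z => / (z - w))%C x0 x1 y0 y1)%C.
Proof.
  intros Hx Hy Hf.
  assert (Hw : holo_at f w).
  { replace w with (hline (Im w) (Re w)); [apply Hf; lra|].
    rewrite hline_pair. now destruct w. }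
  set (g := fun z => (f z * / (z - w) + - f w * / (z - w))%C).
  assert (cI : forall z, (z - w)%C <> 0 -> Ccont (fun z => / (z - w))%C z) by (apply Ccont_inv_sub).
  assert (N : forall x y, (x = x0 \/ x = x1 \/ y = y0 \/ y = y1) -> (hline y x - w)%C <> 0).
  { intros x y H. apply hline_neq. lra. }
  assert (cg : forall x y, x0 <= x <= x1 -> y0 <= y <= y1 -> (hline y x - w)%C <> 0 -> Ccont g (hline y x)).
  { intros x y H1 H2 H. apply Clf_plus; apply Clf_mult; try (apply Clf_const); try (apply cI; auto).
    apply holo_cont; auto. }
  assert (hg : forall x y, x0 <= x <= x1 -> y0 <= y <= y1 -> (hline y x - w)%C <> 0 -> holo_at g (hline y x)).
  { intros x y H1 H2 H. destruct (Hf x y H1 H2) as [l Hl].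
    assert (D : Cder (fun z => z - w)%C (hline y x) 1).
    { eapply Cder_eq; [apply Cder_minus; [apply Cder_id | apply Cder_const]|]. ring. }
    eexists. unfold g. apply Cder_plus; apply Cder_mult.
    - exact Hl.
    - apply (Cder_inv (fun z => z - w)%C); [exact H | exact D].
    - apply Cder_const.
    - apply (Cder_inv (fun z => z - w)%C); [exact H | exact D]. }
  assert (E : Irect g x0 x1 y0 y1 = 0).
  { apply Cmod_eq_0. apply Rle_antisym; [|apply Cmod_ge_0]. apply Rnot_lt_le. intro K.
    destruct Hw as [l [phi [E1 [E2 E3]]]].
    assert (B := filter_and _ _ E1 (Clf_bounded _ _ E3)). destruct B as [d [Hd B]].
    set (M := Cmod l + 1) in *. assert (HM : 0 < M) by (unfold M; assert (P := Cmod_ge_0 l); lra).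
    set (m := Rmin (Rmin (Re w - x0) (x1 - Re w)) (Rmin (Im w - y0) (y1 - Im w))).
    assert (Hm : 0 < m) by (unfold m; repeat apply Rmin_pos; lra).
    assert (m1 : m <= Re w - x0) by (unfold m; eapply Rle_trans; [apply Rmin_l | apply Rmin_l]).
    assert (m2 : m <= x1 - Re w) by (unfold m; eapply Rle_trans; [apply Rmin_l | apply Rmin_r]).
    assert (m3 : m <= Im w - y0) by (unfold m; eapply Rle_trans; [apply Rmin_r | apply Rmin_l]).
    assert (m4 : m <= y1 - Im w) by (unfold m; eapply Rle_trans; [apply Rmin_r | apply Rmin_r]).
    set (c := Cmod (Irect g x0 x1 y0 y1)) in *.
    (* The bound c / (32 M) leads to c <= 4 M (4 eta) <= c / 2, a contradiction; d / 3 keeps the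
       square, whose points are within 2 eta of w, inside the disc where the quotient is bounded. *)
    set (eta := Rmin m (Rmin (d / 3) (c / (32 * M)))).
    assert (He : 0 < eta).
    { unfold eta. apply Rmin_pos; [exact Hm|]. apply Rmin_pos; [lra|]. apply Rdiv_lt_0_compat; lra. }
    assert (e1 : eta <= m) by apply Rmin_l.
    assert (e2 : eta <= d / 3) by (unfold eta; eapply Rle_trans; [apply Rmin_r | apply Rmin_l]).
    assert (e3 : eta <= c / (32 * M)) by (unfold eta; eapply Rle_trans; [apply Rmin_r | apply Rmin_r]).
    assert (S1 : Irect g x0 x1 y0 y1 = Irect g (Re w - eta) (Re w + eta) (Im w - eta) (Im w + eta)).
    { rewrite (Irect_split_x g x0 (Re w - eta) x1); try lra.
      2: { intros x y Hx' Hy' H. apply cg; auto. }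
      rewrite (Irect_split_x g (Re w - eta) (Re w + eta) x1); try lra.
      2: { intros x y Hx' Hy' H. apply cg; try lra. apply hline_neq. lra. }
      rewrite (Irect_split_y g (Re w - eta) (Re w + eta) y0 (Im w - eta)); try lra.
      2: { intros x y Hx' Hy' H. apply cg; try lra. apply hline_neq. lra. }
      rewrite (Irect_split_y g (Re w - eta) (Re w + eta) (Im w - eta) (Im w + eta)); try lra.
      2: { intros x y Hx' Hy' H. apply cg; try lra. apply hline_neq. lra. }
      rewrite (Goursat_le g x0 (Re w - eta)); try lra.
      2: { intros x y Hx' Hy'. apply hg; try lra. apply hline_neq. lra. }
      rewrite (Goursat_le g (Re w + eta) x1); try lra.
      2: { intros x y Hx' Hy'. apply hg; try lra. apply hline_neq. lra. }
      rewrite (Goursat_le g (Re w - eta) (Re w + eta) y0); try lra.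
      2: { intros x y Hx' Hy'. apply hg; try lra. apply hline_neq. lra. }
      rewrite (Goursat_le g (Re w - eta) (Re w + eta) (Im w + eta)); try lra.
      2: { intros x y Hx' Hy'. apply hg; try lra. apply hline_neq. lra. }
      ring. }
    assert (S2 := Irect_bound g (Re w - eta) (Re w + eta) (Im w - eta) (Im w + eta) M ltac:(lra) ltac:(lra)).
    rewrite <- S1 in S2. fold c in S2.
    assert (c <= 4 * M * (Re w + eta - (Re w - eta) + (Im w + eta - (Im w - eta)))).
    { apply S2.
      - intros x y Hx' Hy' H. apply cg; try lra. apply hline_neq. lra.
      - intros x y Hx' Hy' H. assert (Nz : (hline y x - w)%C <> 0) by (apply hline_neq; lra).
        assert (D : Cmod (hline y x - w)%C < d).
        { replace w with (hline (Im w) (Re w)) by (rewrite hline_pair; now destruct w).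
          eapply Rle_lt_trans; [apply (rect_diam x y (Re w) (Im w) eta eta); apply Rabs_le; lra|]. lra. }
        destruct (B _ D) as [B1 B2]. unfold g. rewrite B1.
        replace ((f w + phi (hline y x) * (hline y x - w)) * / (hline y x - w) + - f w * / (hline y x - w))%C
          with (phi (hline y x)) by (field; auto). exact B2. }
    assert (eta * (32 * M) <= c).
    { apply (Rmult_le_compat_r (32 * M)) in e3; [|lra].
      replace (c / (32 * M) * (32 * M)) with c in e3 by (field; lra). exact e3. }
    nra. }
  unfold g in E. rewrite Irect_plus in E; try lra.
  2: { intros x y Hx' Hy' H. apply Clf_mult; [apply holo_cont; auto | apply cI; auto]. }
  2: { intros x y Hx' Hy' H. apply Clf_mult; [apply Clf_const | apply cI; auto]. }
  rewrite Irect_scal in E; try lra.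
  2: { intros x y Hx' Hy' H. apply cI; auto. }
  apply Cminus_eq_0. rewrite <- E. ring.
Qed.

Lemma Rcont_bounded g a b : a <= b -> Rcont_on g a b -> exists M, forall t, a <= t <= b -> Cmod (g t) <= M.
Proof.
  intros Hab H. destruct (continuity_ab_maj (fun t => Cmod (g t)) a b Hab) as [m [Hm _]].
  - intros t Ht. apply continuity_pt_filterlim. apply filterlim_locally. intro eps.
    generalize (H t Ht eps (cond_pos eps)). apply filter_imp. intros s Hs.
    eapply Rle_lt_trans; [|exact Hs]. change (Rabs (Cmod (g s) - Cmod (g t)) <= Cmod (g s - g t)%C).
    apply Rabs_le. assert (A := Cmod_rev_tri (g s) (g t)). assert (B := Cmod_rev_tri (g t) (g s)).
    rewrite (Cmod_sym (g t) (g s)) in B. lra.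
  - exists (Cmod (g m)). exact Hm.
Qed.

(** Taylor's theorem for f times the nonvanishing factor [J]. Iterating 1/(z - w) = 1/(z - z0) + (w
    - z0) / ((z - z0)(z - w)) in Cauchy's formula produces the coefficients [c k] and a remainder (w
    - z0)^n [K n w]. Zeros accumulating at z0 kill the coefficients one after another, and the
    remainder then tends to 0. *)
Lemma identity_local f z0 r : 0 < r ->
  (forall z, Cmod (z - z0)%C <= 2 * r -> holo_at f z) ->
  (forall e, 0 < e -> exists w, 0 < Cmod (w - z0)%C < e /\ f w = 0) ->
  forall w, Cmod (w - z0)%C < r -> f w = 0.
Proof.
  intros Hr Hf Hz.
  set (x0 := Re z0 - r). set (x1 := Re z0 + r). set (y0 := Im z0 - r). set (y1 := Im z0 + r).
  assert (hf : forall x y, x0 <= x <= x1 -> y0 <= y <= y1 -> holo_at f (hline y x)).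
  { intros x y Hx Hy. apply Hf. replace z0 with (hline (Im z0) (Re z0)) by (rewrite hline_pair; now destruct z0).
    eapply Rle_trans; [apply (rect_diam x y (Re z0) (Im z0) r r); apply Rabs_le; unfold x0, x1, y0, y1 in *; lra|]. lra. }
  assert (Hx01 : x0 <= x1) by (unfold x0, x1; lra). assert (Hy01 : y0 <= y1) by (unfold y0, y1; lra).
  assert (bdr : on_rect x0 x1 y0 y1 (fun z => r <= Cmod (z - z0)%C)).
  { intros x y Hx Hy H. destruct (hline_sub_lb x y z0) as [L1 L2].
    assert (r <= Rabs (x - Re z0) \/ r <= Rabs (y - Im z0)); [|lra].
    destruct H as [->|[->|[->| ->]]]; [left|left|right|right]; unfold x0, x1, y0, y1.
    - rewrite Rabs_left; lra.
    - rewrite Rabs_pos_eq; lra.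
    - rewrite Rabs_left; lra.
    - rewrite Rabs_pos_eq; lra. }
  assert (cf : on_rect x0 x1 y0 y1 (Ccont f)) by (intros x y Hx Hy _; apply holo_cont; auto).
  assert (HM : exists M, 0 < M /\ on_rect x0 x1 y0 y1 (fun z => Cmod (f z) <= M)).
  { destruct (on_rect_cont f _ _ _ _ Hx01 Hy01 cf) as [A1 [A2 [A3 A4]]].
    destruct (Rcont_bounded _ _ _ Hx01 A1) as [M1 B1]. destruct (Rcont_bounded _ _ _ Hx01 A2) as [M2 B2].
    destruct (Rcont_bounded _ _ _ Hy01 A3) as [M3 B3]. destruct (Rcont_bounded _ _ _ Hy01 A4) as [M4 B4].
    exists (Rabs M1 + Rabs M2 + Rabs M3 + Rabs M4 + 1).
    assert (P1 := Rabs_pos M1). assert (P2 := Rabs_pos M2). assert (P3 := Rabs_pos M3). assert (P4 := Rabs_pos M4).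
    assert (Q1 := Rle_abs M1). assert (Q2 := Rle_abs M2). assert (Q3 := Rle_abs M3). assert (Q4 := Rle_abs M4).
    split; [lra|]. intros x y Hx Hy [->|[->|[->| ->]]].
    - specialize (B3 y Hy). simpl in B3. lra.
    - specialize (B4 y Hy). simpl in B4. lra.
    - specialize (B1 x Hx). simpl in B1. lra.
    - specialize (B2 x Hx). simpl in B2. lra. }
  destruct HM as [M [HM bM]].
  set (J := fun w => Irect (fun z => / (z - w))%C x0 x1 y0 y1).
  set (c := fun n => Irect (fun z => f z * / (z - z0) ^ S n)%C x0 x1 y0 y1).
  set (K := fun n w => Irect (fun z => f z * (/ (z - w) * / (z - z0) ^ n))%C x0 x1 y0 y1).
  assert (N0 : on_rect x0 x1 y0 y1 (fun z => (z - z0)%C <> 0)).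
  { intros x y Hx Hy H. apply Cmod_gt_0. specialize (bdr x y Hx Hy H). simpl in bdr. lra. }
  assert (Nw : forall w, Cmod (w - z0)%C < r -> on_rect x0 x1 y0 y1 (fun z => r - Cmod (w - z0)%C <= Cmod (z - w)%C)).
  { intros w Hw x y Hx Hy H. specialize (bdr x y Hx Hy H). simpl in bdr.
    assert (T := Cmod_tri_sub (hline y x) w z0). lra. }
  assert (ccn : forall n, on_rect x0 x1 y0 y1 (Ccont (fun z => / (z - z0) ^ n)%C)).
  { intros n x y Hx Hy H. apply (Clf_inv (fun z => (z - z0) ^ n)%C).
    - apply Cpow_nz. apply N0; auto.
    - apply Clf_pow. apply Ccont_cst_sub. }
  assert (ccw : forall w, Cmod (w - z0)%C < r -> on_rect x0 x1 y0 y1 (Ccont (fun z => / (z - w))%C)).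
  { intros w Hw x y Hx Hy H. apply Ccont_inv_sub. apply Cmod_gt_0.
    specialize (Nw w Hw x y Hx Hy H). simpl in Nw. lra. }
  assert (rec : forall n w, Cmod (w - z0)%C < r -> K n w = (c n + (w - z0) * K (S n) w)%C).
  { intros n w Hw. unfold K, c. rewrite <- Irect_scal; auto.
    2: { intros x y Hx Hy H. apply Clf_mult; [apply cf; auto|]. apply Clf_mult; [apply ccw; auto | apply ccn; auto]. }
    rewrite <- Irect_plus; auto.
    2: { intros x y Hx Hy H. apply Clf_mult; [apply cf; auto | apply ccn; auto]. }
    2: { intros x y Hx Hy H. apply Clf_mult; [apply Clf_const|].
         apply Clf_mult; [apply cf; auto|]. apply Clf_mult; [apply ccw; auto | apply ccn; auto]. }
    apply Irect_ext; auto. intros x y Hx Hy H.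
    assert (A := N0 x y Hx Hy H). simpl in A.
    assert (B : (hline y x - w)%C <> 0).
    { apply Cmod_gt_0. specialize (Nw w Hw x y Hx Hy H). simpl in Nw. lra. }
    assert (B' := Cpow_nz _ n A). simpl Cpow.
    set (q := ((hline y x - z0) ^ n)%C) in *. field. repeat split; auto. }
  assert (Kb : forall n w, Cmod (w - z0)%C < r -> Cmod (K n w) <= 4 * (M * (/ (r - Cmod (w - z0)%C) * / r ^ n)) * (x1 - x0 + (y1 - y0))).
  { intros n w Hw. unfold K. apply Irect_bound; [exact Hx01 | exact Hy01 | |].
    - intros x y Hx Hy H. apply Clf_mult; [apply cf; auto|]. apply Clf_mult; [apply ccw; auto | apply ccn; auto].
    - intros x y Hx Hy H. rewrite !Cmod_mult.
      assert (A := bdr x y Hx Hy H). simpl in A. assert (B := Nw w Hw x y Hx Hy H). simpl in B.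
      rewrite !Cmod_inv; [| apply Cpow_nz, N0; auto | apply Cmod_gt_0; lra ].
      assert (0 < r ^ n) by (apply pow_lt; auto).
      rewrite Cmod_pow. apply Rmult_le_compat; try apply Cmod_ge_0.
      + apply Rmult_le_pos; apply Rlt_le, Rinv_0_lt_compat; [lra|]. apply pow_lt. lra.
      + apply bM; auto.
      + apply Rmult_le_compat.
        * apply Rlt_le, Rinv_0_lt_compat. lra.
        * apply Rlt_le, Rinv_0_lt_compat, pow_lt. lra.
        * apply Rinv_le_contravar; lra.
        * apply Rinv_le_contravar; [auto|]. apply pow_incr. lra. }
  assert (K0 : forall w, Cmod (w - z0)%C < r -> (f w * J w)%C = K O w).
  { intros w Hw. unfold J. rewrite <- Cauchy_rect; auto.
    - unfold K. apply Irect_ext; auto. intros x y Hx Hy H. simpl. replace (/ RtoC 1)%C with (RtoC 1) by (field).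
      ring.
    - unfold x0, x1. assert (T := re_le_Cmod (w - z0)%C). change (Re (w - z0)%C) with (Re w - Re z0) in T.
      apply Rabs_le_between in T. lra.
    - unfold y0, y1. assert (T := Im_le_Cmod (w - z0)%C). change (Im (w - z0)%C) with (Im w - Im z0) in T.
      apply Rabs_le_between in T. lra. }
  assert (Kn : forall n, (forall k, (k < n)%nat -> c k = 0) -> forall w, Cmod (w - z0)%C < r ->
     (f w * J w)%C = ((w - z0) ^ n * K n w)%C).
  { induction n as [|n IH]; intros Hc w Hw.
    - simpl. rewrite K0 by auto. ring.
    - rewrite IH by (auto; intros; apply Hc; lia). rewrite rec by auto. rewrite (Hc n) by lia.
      simpl. ring. }
  (* With the earlier coefficients already 0, a zero w of f gives c n = - (w - z0) K (n + 1) w,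
     which is as small as desired when w approaches z0. *)
  assert (c0 : forall n k, (k < n)%nat -> c k = 0).
  { induction n as [|n IH]; intros k Hk; [lia|].
    destruct (Nat.eq_dec k n) as [->|Hkn]; [|apply IH; lia].
    apply Cmod_eq_0. apply Rle_antisym; [|apply Cmod_ge_0]. apply Rnot_lt_le. intro Hc.
    set (B := 4 * (M * (/ (r / 2) * / r ^ S n)) * (x1 - x0 + (y1 - y0))).
    assert (HB : 0 < B).
    { unfold B. assert (0 < / (r / 2)) by (apply Rinv_0_lt_compat; lra).
      assert (0 < / r ^ S n) by (apply Rinv_0_lt_compat, pow_lt; auto).
      assert (0 < / (r / 2) * / r ^ S n) by (apply Rmult_lt_0_compat; auto).
      assert (0 < M * (/ (r / 2) * / r ^ S n)) by (apply Rmult_lt_0_compat; auto).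
      apply Rmult_lt_0_compat; [lra|]. unfold x0, x1, y0, y1. lra. }
    destruct (Hz (Rmin (r / 2) (Cmod (c n) / (2 * B)))) as [w [Hw Hfw]].
    { apply Rmin_pos; [lra|]. apply Rdiv_lt_0_compat; lra. }
    assert (l1 := Rmin_l (r / 2) (Cmod (c n) / (2 * B))).
    assert (l2 := Rmin_r (r / 2) (Cmod (c n) / (2 * B))).
    assert (E := Kn n IH w ltac:(lra)). rewrite Hfw, Cmult_0_l in E.
    rewrite rec in E by lra.
    assert (E' : (c n + (w - z0) * K (S n) w)%C = 0).
    { assert (P : (w - z0)%C <> 0) by (apply Cmod_gt_0; lra).
      assert (P' := Cpow_nz _ n P). set (q := ((w - z0) ^ n)%C) in *.
      replace (c n + (w - z0) * K (S n) w)%C with (q * (c n + (w - z0) * K (S n) w) / q)%C by (field; auto).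
      rewrite <- E. field. auto. }
    assert (E2 : Cmod (c n) = Cmod (w - z0)%C * Cmod (K (S n) w)).
    { rewrite <- Cmod_mult, <- Cmod_opp. f_equal. apply Cminus_eq_0.
      replace (- c n - (w - z0) * K (S n) w)%C with (- (c n + (w - z0) * K (S n) w))%C by ring.
      rewrite E'. ring. }
    assert (E3 := Kb (S n) w ltac:(lra)).
    assert (E4 : Cmod (K (S n) w) <= B).
    { eapply Rle_trans; [exact E3|]. unfold B. apply Rmult_le_compat_r; [unfold x0, x1, y0, y1; lra|].
      apply Rmult_le_compat_l; [lra|]. apply Rmult_le_compat_l; [lra|].
      apply Rmult_le_compat_r; [apply Rlt_le, Rinv_0_lt_compat, pow_lt; auto|].
      apply Rinv_le_contravar; lra. }
    assert (Cmod (w - z0)%C * (2 * B) < Cmod (c n)).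
    { apply Rlt_le_trans with (Cmod (c n) / (2 * B) * (2 * B)).
      - apply Rmult_lt_compat_r; lra.
      - right. field. lra. }
    assert (Cmod (w - z0)%C * Cmod (K (S n) w) <= Cmod (w - z0)%C * B) by (apply Rmult_le_compat_l; lra).
    nra. }
  intros w Hw. assert (JN : J w <> 0).
  { unfold J. apply Irect_inv_neq_0.
    - unfold x0, x1. assert (T := re_le_Cmod (w - z0)%C). change (Re (w - z0)%C) with (Re w - Re z0) in T.
      apply Rabs_le_between in T. lra.
    - unfold y0, y1. assert (T := Im_le_Cmod (w - z0)%C). change (Im (w - z0)%C) with (Im w - Im z0) in T.
      apply Rabs_le_between in T. lra. }
  assert (E : (f w * J w)%C = 0).
  { apply Cmod_eq_0. apply Rle_antisym; [|apply Cmod_ge_0]. apply Rnot_lt_le. intro Hc.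
    set (B := 4 * (M * / (r - Cmod (w - z0)%C)) * (x1 - x0 + (y1 - y0))).
    assert (HB : 0 < B).
    { unfold B. assert (0 < / (r - Cmod (w - z0)%C)) by (apply Rinv_0_lt_compat; lra).
      assert (0 < M * / (r - Cmod (w - z0)%C)) by (apply Rmult_lt_0_compat; auto).
      apply Rmult_lt_0_compat; [lra|]. unfold x0, x1, y0, y1. lra. }
    assert (P := Cmod_ge_0 (w - z0)%C).
    assert (Hq : Rabs (Cmod (w - z0)%C / r) < 1).
    { rewrite Rabs_pos_eq by (apply Rdiv_le_0_compat; lra). apply (Rmult_lt_reg_r r); [lra|].
      unfold Rdiv. rewrite Rmult_assoc, Rinv_l by lra. lra. }
    destruct (pow_lt_1_zero _ Hq (Cmod (f w * J w)%C / B)) as [n Hn].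
    { apply Rdiv_lt_0_compat; lra. }
    specialize (Hn n (Nat.le_refl _)). rewrite Rabs_pos_eq in Hn by (apply pow_le, Rdiv_le_0_compat; lra).
    rewrite (Kn n (c0 n) w Hw) in Hc, Hn.
    apply (Rmult_lt_compat_r B) in Hn; auto.
    match type of Hn with _ < ?x / B * B => replace (x / B * B) with x in Hn by (field; lra) end.
    rewrite Cmod_mult, Cmod_pow in Hn. assert (E3 := Kb n w Hw).
    assert (0 < r ^ n) by (apply pow_lt; auto).
    assert (0 <= Cmod (w - z0)%C ^ n) by (apply pow_le; auto).
    apply (Rmult_le_compat_l (Cmod (w - z0)%C ^ n)) in E3; auto.
    replace (Cmod (w - z0)%C ^ n * (4 * (M * (/ (r - Cmod (w - z0)%C) * / r ^ n)) * (x1 - x0 + (y1 - y0))))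
      with ((Cmod (w - z0)%C / r) ^ n * B) in E3.
    - lra.
    - unfold B, Rdiv. rewrite Rpow_mult_distr, pow_inv. ring. }
  replace (f w) with (f w * J w / J w)%C by (field; auto). rewrite E. field. auto.
Qed.

Definition convexC (Om : C -> Prop) : Prop :=
  forall z w t, Om z -> Om w -> 0 <= t <= 1 -> Om (z + RtoC t * (w - z))%C.

Definition openC (Om : C -> Prop) : Prop := forall z, Om z -> Cnear z Om.

(** Discs of one radius r are placed along the segment from z0 to w, at steps shorter than r: each
    centre lies in the previous disc and so is an accumulation point of zeros. The discs of radius 2
    r stay in [Om] because translates of the segment by small vectors have both ends in [Om]. *)
Theorem identity_theorem Om f z0 : convexC Om -> openC Om -> (forall z, Om z -> holo_at f z) ->
  Om z0 -> (forall e, 0 < e -> exists w, 0 < Cmod (w - z0)%C < e /\ f w = 0) ->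
  forall w, Om w -> f w = 0.
Proof.
  intros Hc Ho Hf Hz0 Hz w Hw.
  destruct (Ho _ Hz0) as [d1 [Hd1 B1]]. destruct (Ho _ Hw) as [d2 [Hd2 B2]].
  set (r := Rmin d1 d2 / 3).
  assert (Hd : 0 < Rmin d1 d2) by (apply Rmin_pos; auto).
  assert (L1 := Rmin_l d1 d2). assert (L2 := Rmin_r d1 d2).
  assert (Hr : 0 < r) by (unfold r; lra).
  set (p := fun t => (z0 + RtoC t * (w - z0))%C).
  assert (In : forall t v, 0 <= t <= 1 -> Cmod (v - p t)%C <= 2 * r -> Om v).
  { intros t v Ht Hv.
    replace v with ((z0 + (v - p t)) + RtoC t * ((w + (v - p t)) - (z0 + (v - p t))))%C by (unfold p; ring).
    apply Hc; auto.
    - apply B1. replace (z0 + (v - p t) - z0)%C with (v - p t)%C by ring. unfold r in Hv. lra.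
    - apply B2. replace (w + (v - p t) - w)%C with (v - p t)%C by ring. unfold r in Hv. lra. }
  destruct (archimed_cor1 (r / (Cmod (w - z0)%C + 1))) as [N [HN HN0]].
  { apply Rdiv_lt_0_compat; auto. assert (P := Cmod_ge_0 (w - z0)%C). lra. }
  assert (PN : 0 < INR N) by (apply lt_0_INR; auto).
  assert (Hstep : Cmod (RtoC (/ INR N)%R * (w - z0))%C < r).
  { assert (P := Cmod_ge_0 (w - z0)%C). rewrite Cmod_mult, Cmod_R, Rabs_pos_eq by (apply Rlt_le, Rinv_0_lt_compat; auto).
    apply Rle_lt_trans with (/ INR N * (Cmod (w - z0)%C + 1)).
    - apply Rmult_le_compat_l; [apply Rlt_le, Rinv_0_lt_compat; auto | lra].
    - apply (Rmult_lt_compat_r (Cmod (w - z0)%C + 1)) in HN; [|lra].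
      replace (r / (Cmod (w - z0)%C + 1) * (Cmod (w - z0)%C + 1)) with r in HN by (field; lra). exact HN. }
  assert (ind : forall k, (k <= N)%nat -> forall v, Cmod (v - p (INR k / INR N)%R)%C < r -> f v = 0).
  { induction k as [|k IH]; intros Hk.
    - apply identity_local; auto.
      + intros z Hzz. apply Hf. apply (In 0); [lra|]. simpl in Hzz. unfold Rdiv in Hzz. rewrite Rmult_0_l in Hzz. exact Hzz.
      + replace (p (INR 0 / INR N)%R) with z0; [exact Hz|]. unfold p. simpl. unfold Rdiv. rewrite Rmult_0_l. ring.
    - assert (Pk : INR (S k) / INR N = INR k / INR N + / INR N) by (rewrite S_INR; field; lra).
      assert (0 <= INR (S k) / INR N <= 1).
      { split; [apply Rdiv_le_0_compat; [apply pos_INR | auto]|].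
        apply (Rmult_le_reg_r (INR N)); auto. unfold Rdiv. rewrite Rmult_assoc, Rinv_l by lra.
        apply le_INR in Hk. lra. }
      apply identity_local; auto.
      + intros z Hzz. apply Hf. apply (In (INR (S k) / INR N)); auto.
      + intros e He. set (e' := Rmin e (r - Cmod (RtoC (/ INR N)%R * (w - z0))%C)).
        assert (He' : 0 < e') by (unfold e'; apply Rmin_pos; lra).
        assert (q1 := Rmin_l e (r - Cmod (RtoC (/ INR N)%R * (w - z0))%C)).
        assert (q2 := Rmin_r e (r - Cmod (RtoC (/ INR N)%R * (w - z0))%C)). fold e' in q1, q2.
        exists (p (INR (S k) / INR N)%R + RtoC (e' / 2)%R)%C.
        replace (p (INR (S k) / INR N)%R + RtoC (e' / 2)%R - p (INR (S k) / INR N)%R)%C with (RtoC (e' / 2)%R) by ring.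
        rewrite Cmod_R, Rabs_pos_eq by lra. split; [lra|].
        apply IH; [lia|].
        replace (p (INR (S k) / INR N)%R + RtoC (e' / 2)%R - p (INR k / INR N)%R)%C
          with (RtoC (e' / 2)%R + RtoC (/ INR N)%R * (w - z0))%C
          by (unfold p; rewrite Pk, RtoC_plus; ring).
        eapply Rle_lt_trans; [apply Cmod_triangle|]. rewrite Cmod_R, Rabs_pos_eq by lra. lra. }
  apply (ind N (Nat.le_refl N)). replace (p (INR N / INR N)%R) with w.
  - rewrite Cmod_self. exact Hr.
  - unfold p. replace (INR N / INR N) with 1 by (field; lra). ring.
Qed.

(** * Mean value inequality and inverse function theorem *)

Lemma Rder_mvt (g : R -> R) (dg : R -> R) M :
  (forall t, 0 <= t <= 1 -> is_derive g t (dg t)) -> (forall t, 0 <= t <= 1 -> Rabs (dg t) <= M) ->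
  Rabs (g 1 - g 0) <= M.
Proof.
  intros H HM. destruct (MVT_gen g 0 1 dg) as [c [Hc E]].
  - intros x; rewrite Rmin_left, Rmax_right by lra. intro Hx. apply H. lra.
  - intros x; rewrite Rmin_left, Rmax_right by lra. intro Hx.
    apply continuity_pt_filterlim. apply (ex_derive_continuous (V := R_NormedModule)).
    exists (dg x). apply H. lra.
  - rewrite Rmin_left, Rmax_right in Hc by lra.
    rewrite E. replace (dg c * (1 - 0)) with (dg c) by ring. apply HM. lra.
Qed.

Lemma Cder_mvt g dg p v M :
  (forall t, 0 <= t <= 1 -> Cder g (p + RtoC t * v)%C (dg (p + RtoC t * v)%C)) ->
  (forall t, 0 <= t <= 1 -> Cmod (dg (p + RtoC t * v) * v)%C <= M) ->
  Cmod (g (p + v) - g p)%C <= 2 * M.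
Proof.
  intros H HM.
  assert (A : Rabs (Re (g (p + RtoC 1 * v)%C) - Re (g (p + RtoC 0 * v)%C)) <= M).
  { apply (Rder_mvt (fun t => Re (g (p + RtoC t * v)%C)) (fun t => Re (dg (p + RtoC t * v) * v)%C)).
    - intros t Ht. apply (Cder_line g p v t). auto.
    - intros t Ht. eapply Rle_trans; [apply re_le_Cmod | auto]. }
  assert (B : Rabs (Im (g (p + RtoC 1 * v)%C) - Im (g (p + RtoC 0 * v)%C)) <= M).
  { apply (Rder_mvt (fun t => Im (g (p + RtoC t * v)%C)) (fun t => Im (dg (p + RtoC t * v) * v)%C)).
    - intros t Ht. apply (Cder_line g p v t). auto.
    - intros t Ht. eapply Rle_trans; [apply Im_le_Cmod | auto]. }
  replace (p + RtoC 1 * v)%C with (p + v)%C in * by ring.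
  replace (p + RtoC 0 * v)%C with p in * by ring.
  eapply Rle_trans; [apply Cmod_le_ReIm|].
  change (Re (g (p + v) - g p)%C) with (Re (g (p + v)%C) - Re (g p)).
  change (Im (g (p + v) - g p)%C) with (Im (g (p + v)%C) - Im (g p)). lra.
Qed.

Lemma Cder_0_segment g z w :
  (forall t, 0 <= t <= 1 -> Cder g (z + RtoC t * (w - z))%C 0) -> g w = g z.
Proof.
  intro H. apply Cminus_eq_0, Cmod_eq_0. apply Rle_antisym; [|apply Cmod_ge_0].
  assert (K := Cder_mvt g (fun _ => RtoC 0) z (w - z)%C 0 H).
  replace (z + (w - z))%C with w in K by ring. rewrite Rmult_0_r in K. apply K.
  intros. rewrite Cmult_0_l, Cmod_0. lra.
Qed.

Lemma disc_convex z0 r : convexC (fun z => Cmod (z - z0)%C < r).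
Proof.
  intros z w t Hz Hw Ht.
  replace (z + RtoC t * (w - z) - z0)%C with (RtoC (1 - t) * (z - z0) + RtoC t * (w - z0))%C
    by (rewrite RtoC_minus; ring).
  eapply Rle_lt_trans; [apply Cmod_triangle|]. rewrite !Cmod_mult, !Cmod_R, !Rabs_pos_eq by lra.
  destruct (Rle_lt_dec t (1 / 2)).
  - apply Rlt_le_trans with ((1 - t) * r + t * r); [|lra].
    apply Rplus_lt_le_compat; [apply Rmult_lt_compat_l; lra | apply Rmult_le_compat_l; lra].
  - apply Rlt_le_trans with ((1 - t) * r + t * r); [|lra].
    apply Rplus_le_lt_compat; [apply Rmult_le_compat_l; lra | apply Rmult_lt_compat_l; lra].
Qed.

Lemma disc_open z0 r : openC (fun z => Cmod (z - z0)%C < r).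
Proof.
  intros z Hz. exists (r - Cmod (z - z0)%C). split; [lra|]. intros w Hw.
  assert (T := Cmod_tri_sub w z z0). lra.
Qed.

Lemma Clim_of_geometric (x : nat -> C) K :
  (forall n, Cmod (x (S n) - x n)%C <= K * (/ 2) ^ n) -> exists l, Clf eventually x l.
Proof.
  intro H. exists (x O + CSeries (fun n => x (S n) - x n))%C.
  apply (Clf_ext (fun n => x O + Csum (fun n => x (S n) - x n) n)%C).
  - exists O. intros n _. induction n as [|n IH]; simpl; [ring|].
    transitivity (x O + Csum (fun n => (x (S n) - x n)%C) n + (x (S n) - x n))%C; [ring|].
    rewrite IH. ring.
  - apply Clf_plus; [apply Clf_const|].
    apply (CSeries_correct _ (fun n => K * (/ 2) ^ n)); auto. apply ex_series_geom_scal. lra.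
Qed.

(** Newton's iteration with the fixed slope d = f' z0 contracts by 1/2 where f' is within |d|/4 of
    d, the mean value inequality costing a factor 2. Holomorphy of the inverse comes from inverting
    the Caratheodory slope of f. *)
Theorem inverse_function f f' z0 :
  Cnear z0 (fun z => Cder f z (f' z)) -> Ccont f' z0 -> f' z0 <> 0 ->
  exists eta eps s, 0 < eta /\ 0 < eps /\
    (forall x y, Cmod (x - z0)%C < eta -> Cmod (y - z0)%C < eta -> f x = f y -> x = y) /\
    (forall w, Cmod (w - f z0)%C < eps -> Cmod (s w - z0)%C < eta /\ f (s w) = w /\ holo_at s w).
Proof.
  intros HD Hc Hd. set (d := f' z0) in *. assert (Pd := proj1 (Cmod_gt_0 d) Hd).
  assert (Pd4 : 0 < Cmod d / 4) by lra.
  destruct (filter_and _ _ HD (Hc _ Pd4)) as [eta [He H]].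
  assert (lip : forall x y, Cmod (x - z0)%C < eta -> Cmod (y - z0)%C < eta ->
    Cmod (f x - f y - d * (x - y))%C <= Cmod d / 2 * Cmod (x - y)%C).
  { intros x y Hx Hy.
    assert (K := Cder_mvt (fun z => f z - d * z)%C (fun z => f' z - d)%C y (x - y)%C (Cmod d / 4 * Cmod (x - y)%C)).
    replace (y + (x - y))%C with x in K by ring.
    replace (f x - f y - d * (x - y))%C with (f x - d * x - (f y - d * y))%C by ring.
    eapply Rle_trans; [apply K|lra]; intros t Ht.
    - eapply Cder_eq; [apply Cder_minus; [apply H; apply disc_convex; auto | apply Cder_scal, Cder_id]|].
      ring.
    - rewrite Cmod_mult. apply Rmult_le_compat_r; [apply Cmod_ge_0|].
      apply Rlt_le, H. apply disc_convex; auto. }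
  assert (lb : forall x y, Cmod (x - z0)%C < eta -> Cmod (y - z0)%C < eta ->
    Cmod d / 2 * Cmod (x - y)%C <= Cmod (f x - f y)%C).
  { intros x y Hx Hy. specialize (lip x y Hx Hy).
    assert (K := Cmod_rev_tri (d * (x - y))%C (f x - f y)%C).
    rewrite (Cmod_sym (d * (x - y))%C), Cmod_mult in K. lra. }
  assert (inj : forall x y, Cmod (x - z0)%C < eta -> Cmod (y - z0)%C < eta -> f x = f y -> x = y).
  { intros x y Hx Hy E. specialize (lb x y Hx Hy). rewrite E, Cmod_self in lb.
    apply Cminus_eq_0, Cmod_eq_0. assert (P := Cmod_ge_0 (x - y)%C). nra. }
  (* Then the first step moves z0 by at most eta/4, and with contraction 1/2 all iterates stay
     within eta/2 of z0. *)
  set (eps := Cmod d * eta / 4).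
  assert (Heps : 0 < eps) by (unfold eps; assert (0 < Cmod d * eta) by (apply Rmult_lt_0_compat; auto); lra).
  assert (sol : forall w, Cmod (w - f z0)%C < eps -> exists x, Cmod (x - z0)%C < eta /\ f x = w).
  { intros w Hw. set (T := fun x => (x - (f x - w) / d)%C).
    assert (Tc : forall x y, Cmod (x - z0)%C < eta -> Cmod (y - z0)%C < eta ->
      Cmod (T x - T y)%C <= / 2 * Cmod (x - y)%C).
    { intros x y Hx Hy. unfold T.
      replace (x - (f x - w) / d - (y - (f y - w) / d))%C with (- ((f x - f y - d * (x - y)) / d))%C by (field; auto).
      rewrite Cmod_opp, Cmod_div by auto. apply (Rmult_le_reg_r (Cmod d)); [exact Pd|].
      unfold Rdiv. rewrite Rmult_assoc, Rinv_l by lra. specialize (lip x y Hx Hy). lra. }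
    assert (T0 : Cmod (T z0 - z0)%C <= eta / 4).
    { unfold T. replace (z0 - (f z0 - w) / d - z0)%C with ((w - f z0) / d)%C by (field; auto).
      rewrite Cmod_div by auto. apply (Rmult_le_reg_r (Cmod d)); [exact Pd|].
      unfold Rdiv. rewrite Rmult_assoc, Rinv_l by lra. unfold eps in Hw. lra. }
    assert (z00 : Cmod (z0 - z0)%C < eta) by (rewrite Cmod_self; auto).
    assert (Tb : forall x, Cmod (x - z0)%C <= eta / 2 -> Cmod (T x - z0)%C <= eta / 2).
    { intros x Hx. assert (K := Cmod_tri_sub (T x) (T z0) z0). specialize (Tc x z0 ltac:(lra) z00). lra. }
    set (x := fix go n := match n with O => z0 | S m => T (go m) end).
    assert (xb : forall n, Cmod (x n - z0)%C <= eta / 2).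
    { induction n as [|n IH]; [simpl; rewrite Cmod_self; lra|]. apply Tb, IH. }
    assert (xd : forall n, Cmod (x (S n) - x n)%C <= eta / 4 * (/ 2) ^ n).
    { induction n as [|n IH]; [simpl; lra|].
      change (x (S (S n))) with (T (x (S n))). change (x (S n)) with (T (x n)) at 2.
      assert (A := xb n). assert (B := xb (S n)).
      eapply Rle_trans; [apply Tc; lra|]. simpl pow. lra. }
    destruct (Clim_of_geometric x _ xd) as [l Hl].
    assert (lb' : Cmod (l - z0)%C <= eta / 2).
    { apply (Clf_le eventually (fun n => x n - z0)%C).
      - exists O. intros n _. apply xb.
      - apply Clf_minus; [exact Hl | apply Clf_const]. }
    exists l. split; [lra|].
    assert (Hfl : Ccont f l).
    { eapply Cder_cont. apply H. lra. }
    assert (E : T l = l).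
    { apply (Clf_unique eventually (fun n => x (S n))).
      - change (Clf eventually (fun n => T (x n)) (T l)).
        unfold T. apply Clf_minus; [exact Hl|]. apply Clf_mult; [|apply Clf_const].
        apply Clf_minus; [|apply Clf_const]. apply Ccont_comp; auto; apply _.
      - intros e Hepos. destruct (Hl e Hepos) as [N HN]. exists N. intros n Hn. apply HN. lia. }
    unfold T in E. assert (E' : ((f l - w) / d)%C = 0).
    { replace ((f l - w) / d)%C with (l - (l - (f l - w) / d))%C by ring. rewrite E. ring. }
    apply Cminus_eq_0. replace (f l - w)%C with ((f l - w) / d * d)%C by (field; auto).
    rewrite E'. ring. }
  set (s := fun w => match excluded_middle_informative (exists x, Cmod (x - z0)%C < eta /\ f x = w) with
    | left E => proj1_sig (constructive_indefinite_description _ E) | right _ => z0 end).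
  assert (Hs : forall w, Cmod (w - f z0)%C < eps -> Cmod (s w - z0)%C < eta /\ f (s w) = w).
  { intros w Hw. unfold s. destruct excluded_middle_informative as [E|E].
    - destruct (constructive_indefinite_description _ E) as [x Hx]. exact Hx.
    - elim E. apply sol, Hw. }
  exists eta, eps, s. split; [auto|]. split; [auto|]. split; [exact inj|].
  intros w Hw. destruct (Hs w Hw) as [S1 S2]. split; [auto|]. split; [auto|].
  destruct (H _ S1) as [D1 D2].
  assert (N : f' (s w) <> 0).
  { intro E. assert (D3 : Cmod (f' (s w) - d)%C < Cmod d / 4) by exact D2. rewrite E in D3.
    rewrite Cmod_sym in D3. replace (d - 0)%C with d in D3 by ring. lra. }
  destruct D1 as [phi [E1 [E2 E3]]].
  assert (near : Cnear w (fun w' => Cmod (w' - f z0)%C < eps)) by (apply disc_open, Hw).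
  assert (Sc : Clf (Cnear w) s (s w)).
  { intros e Hepos.
    generalize (filter_and _ _ near (Cnear_ball w (Cmod d / 2 * e) ltac:(apply Rmult_lt_0_compat; lra))).
    apply filter_imp. intros w' [W1 W2]. destruct (Hs w' W1) as [S1' S2'].
    specialize (lb (s w') (s w) S1' S1). rewrite S2, S2' in lb.
    apply (Rmult_lt_reg_l (Cmod d / 2)); lra. }
  exists (/ f' (s w))%C. exists (fun w' => / phi (s w'))%C.
  assert (pc : Clf (Cnear w) (fun w' => phi (s w')) (f' (s w))).
  { rewrite <- E2. apply Ccont_comp; [apply _ | exact Sc|]. unfold Ccont. rewrite E2. exact E3. }
  split; [|split].
  - generalize (filter_and _ _ near (filter_and _ _ (Clf_near _ _ _ _ Sc E1) (Clf_neq _ _ _ N pc))).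
    apply filter_imp. intros w' [W1 [W2 W3]]. destruct (Hs w' W1) as [S1' S2'].
    rewrite S2', S2 in W2.
    assert (W4 : (w' - w)%C = (phi (s w') * (s w' - s w))%C).
    { transitivity (w + phi (s w') * (s w' - s w) - w)%C; [f_equal; exact W2 | ring]. }
    rewrite W4. field. exact W3.
  - now rewrite E2.
  - apply Clf_inv; auto.
Qed.

(** * Theta constants and their doubling formulas *)

(** Pairing n with -n makes a sum over Z an ordinary series whose partial sums are the symmetric
    ones; a shift of the index then changes them by boundary terms only. *)
Definition zfold (g : Z -> C) (n : nat) : C :=
  match n with O => g 0%Z | S _ => (g (Z.of_nat n) + g (- Z.of_nat n)%Z)%C end.

Definition Zsum (g : Z -> C) : C := CSeries (zfold g).

Definition Zbd (g : Z -> C) : Prop :=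
  exists K r, 0 <= r < 1 /\ 0 <= K /\ forall n, Cmod (g n) <= K * r ^ Z.abs_nat n.

Lemma zfold_bound g K r : 0 <= K -> 0 <= r < 1 -> (forall n, Cmod (g n) <= K * r ^ Z.abs_nat n) ->
  forall n, Cmod (zfold g n) <= 2 * K * r ^ n.
Proof.
  intros HK Hr H [|n].
  - simpl. specialize (H 0%Z). simpl in H. lra.
  - unfold zfold. eapply Rle_trans; [apply Cmod_triangle|].
    assert (H1 := H (Z.of_nat (S n))). assert (H2 := H (- Z.of_nat (S n))%Z).
    replace (Z.abs_nat (Z.of_nat (S n))) with (S n) in H1 by lia.
    replace (Z.abs_nat (- Z.of_nat (S n))) with (S n) in H2 by lia. lra.
Qed.

Lemma Zsum_correct g : Zbd g -> Cis_series (zfold g) (Zsum g).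
Proof.
  intros [K [r [Hr [HK H]]]]. apply (CSeries_correct _ (fun n => 2 * K * r ^ n)).
  - apply ex_series_geom_scal, Hr.
  - apply zfold_bound; auto.
Qed.

Lemma Zsum_unique g l : Cis_series (zfold g) l -> Zsum g = l.
Proof. apply CSeries_unique. Qed.

Lemma Zsum_ext g h : (forall n, g n = h n) -> Zsum g = Zsum h.
Proof. intro H. apply CSeries_ext. intros [|n]; simpl; now rewrite !H. Qed.

Lemma geom_lim K r : 0 <= r < 1 -> forall e, 0 < e -> exists N, forall n, (N <= n)%nat -> Rabs (K * r ^ n) < e.
Proof.
  intros Hr e He. destruct (pow_lt_1_zero r ltac:(rewrite Rabs_pos_eq; lra) (e / (Rabs K + 1))) as [N HN].
  { apply Rdiv_lt_0_compat; auto. assert (P := Rabs_pos K). lra. }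
  exists N. intros n Hn. specialize (HN n Hn). rewrite Rabs_mult.
  assert (P := Rabs_pos K). assert (Q := Rabs_pos (r ^ n)).
  apply Rle_lt_trans with ((Rabs K + 1) * Rabs (r ^ n)).
  - apply Rmult_le_compat_r; lra.
  - apply (Rmult_lt_compat_l (Rabs K + 1)) in HN; [|lra].
    replace ((Rabs K + 1) * (e / (Rabs K + 1))) with e in HN by (field; lra). exact HN.
Qed.

Lemma Zbd_lim g (u : nat -> Z) : Zbd g -> (forall n, (n <= Z.abs_nat (u n))%nat) ->
  Clf eventually (fun n => g (u n)) 0.
Proof.
  intros [K [r [Hr [HK H]]]] Hu e He. destruct (geom_lim K r Hr e He) as [N HN].
  exists N. intros n Hn. replace (g (u n) - 0)%C with (g (u n)) by ring.
  eapply Rle_lt_trans; [apply H|]. specialize (HN (Z.abs_nat (u n))). specialize (Hu n).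
  eapply Rle_lt_trans; [apply Rle_abs|]. apply HN. lia.
Qed.

Lemma pow_decr r n m : 0 <= r <= 1 -> (n <= m)%nat -> r ^ m <= r ^ n.
Proof.
  intros Hr H. replace m with (n + (m - n))%nat by lia. rewrite pow_add.
  rewrite <- (Rmult_1_r (r ^ n)) at 2. apply Rmult_le_compat_l; [apply pow_le; lra|].
  rewrite <- (pow1 (m - n)). apply pow_incr. lra.
Qed.

Lemma Zbd_shift g m : Zbd g -> Zbd (fun s => g (s - m)%Z).
Proof.
  intros [K [r [Hr [HK H]]]]. destruct (Req_dec r 0) as [->|Nr].
  (* For r = 0 the bound is nonzero at the index m alone, and 2^|m| (1/2)^|m| = 1 accounts for
     it. *)
  - exists (K * 2 ^ Z.abs_nat m), (1 / 2). split; [lra|]. split; [apply Rmult_le_pos; auto; apply pow_le; lra|].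
    intro n. eapply Rle_trans; [apply H|]. rewrite Rmult_assoc. apply Rmult_le_compat_l; auto.
    destruct (Z.eq_dec n m) as [->|Hnm].
    + rewrite Z.sub_diag. simpl. rewrite <- Rpow_mult_distr. replace (2 * (1 / 2)) with 1 by lra.
      rewrite pow1. lra.
    + rewrite pow_i by lia. apply Rmult_le_pos; apply pow_le; lra.
  - exists (K * (/ r) ^ Z.abs_nat m), r. split; [lra|].
    split; [apply Rmult_le_pos; auto; apply pow_le, Rlt_le, Rinv_0_lt_compat; lra|].
    intro n. eapply Rle_trans; [apply H|]. rewrite Rmult_assoc. apply Rmult_le_compat_l; auto.
    apply (Rmult_le_reg_l (r ^ Z.abs_nat m)); [apply pow_lt; lra|].
    rewrite <- Rmult_assoc, <- Rpow_mult_distr, Rinv_r, pow1, Rmult_1_l by lra.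
    rewrite <- pow_add. apply pow_decr; [lra | lia].
Qed.

Lemma zs_shift g N : Csum (zfold (fun s => g (s - 1)%Z)) (S N) =
  (Csum (zfold g) (S N) + g (- Z.of_nat (S N))%Z - g (Z.of_nat N))%C.
Proof.
  induction N as [|N IH].
  - simpl. ring.
  - change (Csum (zfold (fun s => g (s - 1)%Z)) (S (S N))) with
      (Csum (zfold (fun s => g (s - 1)%Z)) (S N) + zfold (fun s => g (s - 1)%Z) (S N))%C.
    change (Csum (zfold g) (S (S N))) with (Csum (zfold g) (S N) + zfold g (S N))%C.
    rewrite IH. unfold zfold.
    replace (Z.of_nat (S N) - 1)%Z with (Z.of_nat N) by lia.
    replace (- Z.of_nat (S N) - 1)%Z with (- Z.of_nat (S (S N)))%Z by lia. ring.
Qed.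

Lemma Clf_eventually_S f l : Clf eventually (fun n => f (S n)) l -> Clf eventually f l.
Proof.
  intros H e He. destruct (H e He) as [N HN]. exists (S N). intros [|n] Hn; [lia|]. apply HN. lia.
Qed.

Lemma Clf_eventually_sub (f : nat -> C) l (u : nat -> nat) : (forall n, (n <= u n)%nat) ->
  Clf eventually f l -> Clf eventually (fun n => f (u n)) l.
Proof.
  intros Hu H e He. destruct (H e He) as [N HN]. exists N. intros n Hn. apply HN.
  specialize (Hu n). lia.
Qed.

Lemma Zsum_shift1 g : Zbd g -> Zsum (fun s => g (s - 1)%Z) = Zsum g.
Proof.
  intro H. apply Zsum_unique. apply Clf_eventually_S.
  apply (Clf_ext (fun N => Csum (zfold g) (S N) + g (- Z.of_nat (S N))%Z - g (Z.of_nat N))%C).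
  - exists O. intros n _. now rewrite zs_shift.
  - apply (Clf_eq _ (Zsum g + 0 - 0)%C); [ring|]. apply Clf_minus; [apply Clf_plus|].
    + apply (Clf_eventually_sub (Csum (zfold g)) _ S); [lia|]. apply Zsum_correct, H.
    + apply (Zbd_lim g (fun N => - Z.of_nat (S N))%Z H). intro n. lia.
    + apply (Zbd_lim g (fun N => Z.of_nat N)%Z H). intro n. lia.
Qed.

Lemma Zsum_shift g m : Zbd g -> Zsum (fun s => g (s - m)%Z) = Zsum g.
Proof.
  intro H.
  assert (P : forall n g, Zbd g -> Zsum (fun s => g (s - Z.of_nat n)%Z) = Zsum g).
  { clear. induction n as [|n IH]; intros g H.
    - apply Zsum_ext. intro s. f_equal. lia.
    - rewrite <- (Zsum_shift1 g H). rewrite <- (IH (fun s => g (s - 1)%Z)) by (apply Zbd_shift, H).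
      apply Zsum_ext. intro s. f_equal. lia. }
  destruct (Z_le_gt_dec 0 m) as [L|L].
  - rewrite <- (P (Z.to_nat m) g H). apply Zsum_ext. intro s. f_equal. lia.
  - rewrite <- (P (Z.to_nat (- m)) (fun s => g (s - m)%Z)) by (apply Zbd_shift, H).
    apply Zsum_ext. intro s. f_equal. lia.
Qed.

Lemma Zbd_scal c g : Zbd g -> Zbd (fun n => c * g n)%C.
Proof.
  intros [K [r [Hr [HK H]]]]. exists (Cmod c * K), r.
  split; [auto|]. split; [apply Rmult_le_pos; auto; apply Cmod_ge_0|].
  intro n. rewrite Cmod_mult, Rmult_assoc. apply Rmult_le_compat_l; [apply Cmod_ge_0 | auto].
Qed.

Lemma zfold_scal c g n : zfold (fun k => c * g k)%C n = (c * zfold g n)%C.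
Proof. destruct n; simpl; ring. Qed.

Lemma Zsum_scal c g : Zbd g -> Zsum (fun n => c * g n)%C = (c * Zsum g)%C.
Proof.
  intro H. apply Zsum_unique. apply (Cis_series_ext (fun n => c * zfold g n)%C).
  - intro n. now rewrite zfold_scal.
  - apply Cis_series_scal, Zsum_correct, H.
Qed.

Lemma Zsum_even_odd g : Zbd g -> Zbd (fun j => g (2 * j)%Z) -> Zbd (fun j => g (2 * j + 1)%Z) ->
  Zsum g = (Zsum (fun j => g (2 * j)%Z) + Zsum (fun j => g (2 * j + 1)%Z))%C.
Proof.
  intros H H0 H1.
  (* The odd numbers 2 j + 1 with |j| <= N run from -2 N + 1 to 2 N + 1; the last one exceeds 2 N
     and is subtracted. *)
  assert (E : forall N, Csum (zfold g) (S (2 * N)) = (Csum (zfold (fun j => g (2 * j)%Z)) (S N)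
    + Csum (zfold (fun j => g (2 * j + 1)%Z)) (S N) - g (2 * Z.of_nat N + 1)%Z)%C).
  { induction N as [|N IH]; [simpl; ring|].
    replace (S (2 * S N)) with (S (S (S (2 * N)))) by lia.
    change (Csum (zfold g) (S (S (S (2 * N))))) with
      (Csum (zfold g) (S (2 * N)) + zfold g (S (2 * N)) + zfold g (S (S (2 * N))))%C.
    rewrite IH.
    change (Csum (zfold (fun j => g (2 * j)%Z)) (S (S N))) with
      (Csum (zfold (fun j => g (2 * j)%Z)) (S N) + zfold (fun j => g (2 * j)%Z) (S N))%C.
    change (Csum (zfold (fun j => g (2 * j + 1)%Z)) (S (S N))) with
      (Csum (zfold (fun j => g (2 * j + 1)%Z)) (S N) + zfold (fun j => g (2 * j + 1)%Z) (S N))%C.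
    unfold zfold.
    replace (Z.of_nat (S (2 * N))) with (2 * Z.of_nat N + 1)%Z by lia.
    replace (Z.of_nat (S (S (2 * N)))) with (2 * Z.of_nat (S N))%Z by lia.
    replace (- (2 * Z.of_nat N + 1))%Z with (2 * - Z.of_nat (S N) + 1)%Z by lia.
    replace (- (2 * Z.of_nat (S N)))%Z with (2 * - Z.of_nat (S N))%Z by lia. ring. }
  apply (Clf_unique eventually (fun N => Csum (zfold g) (S (2 * N)))).
  - apply (Clf_eventually_sub (Csum (zfold g)) _ (fun N => S (2 * N))); [intro; lia|]. apply Zsum_correct, H.
  - eapply Clf_ext; [exists O; intros N _; symmetry; apply E|].
    match goal with |- Clf _ _ ?l => apply (Clf_eq _ (l - 0)%C); [ring|] end.
    apply Clf_minus; [apply Clf_plus|].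
    + apply (Clf_eventually_sub _ _ S); [lia|]. apply Zsum_correct, H0.
    + apply (Clf_eventually_sub _ _ S); [lia|]. apply Zsum_correct, H1.
    + apply (Zbd_lim g (fun N => 2 * Z.of_nat N + 1)%Z H). intro n. lia.
Qed.

(** * Theta series in the nome, and summation over a rotated lattice *)

(** Exponents are kept in Z because the changes of index are polynomial identities there. Those that
    occur are nonnegative, so [Z.to_nat] does not truncate them. *)
Definition qz (q : C) (e : Z) : C := (q ^ Z.to_nat e)%C.

Lemma qz_add q e f : (0 <= e)%Z -> (0 <= f)%Z -> qz q (e + f) = (qz q e * qz q f)%C.
Proof. intros He Hf. unfold qz. rewrite Z2Nat.inj_add by auto. apply Cpow_add_r. Qed.

Lemma qz_bound q e n : Cmod q < 1 -> (Z.of_nat n <= e)%Z -> Cmod (qz q e) <= Cmod q ^ n.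
Proof.
  intros Hq H. unfold qz. rewrite Cmod_pow. apply pow_decr; [split; [apply Cmod_ge_0 | lra]|]. lia.
Qed.

Lemma Zbd_qz q (e : Z -> Z) : Cmod q < 1 -> (forall n, (Z.abs n <= e n)%Z) -> Zbd (fun n => qz q (e n)).
Proof.
  intros Hq H. exists 1, (Cmod q). split; [split; [apply Cmod_ge_0 | exact Hq]|]. split; [lra|].
  intro n. rewrite Rmult_1_l. apply qz_bound; auto. specialize (H n). lia.
Qed.

Definition TH (q : C) : C := Zsum (fun n => qz q (n * n)).
(** This is theta10 at 2 tau without its factor q^(1/2), since 2 (n + 1/2)^2 = 2 n (n + 1) + 1/2;
    what remains has integral exponents. *)
Definition PSI (q : C) : C := Zsum (fun n => qz q (2 * (n * (n + 1)))).

Lemma sq_ge_abs n : (Z.abs n <= n * n)%Z. Proof. nia. Qed.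

Lemma Zbd_TH q : Cmod q < 1 -> Zbd (fun n => qz q (n * n)).
Proof. intro Hq. apply Zbd_qz; auto. intro n. apply sq_ge_abs. Qed.

Lemma PSI_exp_ge n : (Z.abs n <= 2 * (n * (n + 1)) + 1)%Z. Proof. nia. Qed.

Lemma Zbd_PSI q : Cmod q < 1 -> Zbd (fun n => qz q (2 * (n * (n + 1)))).
Proof.
  (* The exponent is 0 at n = -1 as well as at n = 0, so a bound by r^|n| costs a factor 1/|q|, and
     q = 0 has to be treated apart. *)
  intro Hq. destruct (Req_dec (Cmod q) 0) as [E|E].
  - apply Cmod_eq_0 in E. subst q. exists 2, (1 / 2). split; [lra|]. split; [lra|].
    intro n. destruct (Z.eq_dec (n * (n + 1)) 0) as [Z0|Z0].
    + rewrite Z0. simpl. unfold qz. simpl. rewrite Cmod_1.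
      assert (n = 0 \/ n = -1)%Z as [->| ->] by nia; simpl; lra.
    + unfold qz. replace (Z.to_nat (2 * (n * (n + 1)))) with (S (Nat.pred (Z.to_nat (2 * (n * (n + 1)))))) by nia.
      simpl. rewrite Cmult_0_l, Cmod_0. apply Rmult_le_pos; [lra | apply pow_le; lra].
  - exists (/ Cmod q), (Cmod q). assert (P := Cmod_ge_0 q). split; [lra|].
    split; [apply Rlt_le, Rinv_0_lt_compat; lra|].
    intro n. apply (Rmult_le_reg_l (Cmod q)); [lra|].
    rewrite <- Rmult_assoc, Rinv_r, Rmult_1_l by lra.
    rewrite <- Cmod_mult. change (q * qz q (2 * (n * (n + 1))))%C with (q ^ S (Z.to_nat (2 * (n * (n + 1)))))%C.
    rewrite Cmod_pow. apply pow_decr; [lra|]. assert (H := PSI_exp_ge n). nia.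
Qed.

Lemma zfold_sum_bound g c r N : 0 <= c -> 0 <= r < 1 -> (forall m, Cmod (g m) <= c * r ^ Z.abs_nat m) ->
  Cmod (Csum (zfold g) N) <= 2 * c * / (1 - r).
Proof.
  intros Hc Hr H. rewrite <- (Series_geom r), <- Series_scal_l by (rewrite Rabs_pos_eq; lra).
  apply Csum_Cmod.
  - apply ex_series_geom_scal, Hr.
  - apply zfold_bound; auto.
Qed.

(* Summing q^(m^2+n^2) along the lines m+n = s. *)
Definition Tdiag (q : C) (s : Z) : C := Zsum (fun m => qz q (m * m + (s - m) * (s - m))).

Section DoubleSum.
Context (q : C) (Hq : Cmod q < 1).

(** Twice the exponent m^2 + (s - m)^2 is at least |s| + |m|, so the ratio sqrt |q| bounds the
    double series by a product of geometric series in s and m. *)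
Let r := sqrt (Cmod q).

Let Hr : 0 <= r < 1.
Proof.
  split; [apply sqrt_pos|]. unfold r. rewrite <- sqrt_1. apply sqrt_lt_1; [apply Cmod_ge_0 | lra | exact Hq].
Qed.

Let dbound s m : Cmod (qz q (m * m + (s - m) * (s - m))) <= r ^ Z.abs_nat s * r ^ Z.abs_nat m.
Proof.
  unfold qz. rewrite Cmod_pow. replace (Cmod q) with (r * r) by (apply sqrt_sqrt, Cmod_ge_0).
  rewrite Rpow_mult_distr, <- !pow_add. apply pow_decr; [lra|].
  assert (H1 := sq_ge_abs m). assert (H2 := sq_ge_abs (s - m)). lia.
Qed.

Let Zbd_diag s : Zbd (fun m => qz q (m * m + (s - m) * (s - m))).
Proof.
  exists (r ^ Z.abs_nat s), r. split; [apply Hr|]. split; [apply pow_le, Hr | apply dbound].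
Qed.

Let Tpart (N : nat) (s : Z) : C := Csum (zfold (fun m => qz q (m * m + (s - m) * (s - m)))) N.

Let Tpart_bound N s : Cmod (Tpart N s) <= 2 * / (1 - r) * r ^ Z.abs_nat s.
Proof.
  assert (H := zfold_sum_bound _ (r ^ Z.abs_nat s) r N (pow_le _ _ (proj1 Hr)) Hr (dbound s)).
  unfold Tpart. lra.
Qed.

Let K_pos : 0 <= 2 * / (1 - r).
Proof. apply Rmult_le_pos; [lra|]. apply Rlt_le, Rinv_0_lt_compat. assert (H := Hr). lra. Qed.

Let Zbd_Tpart N : Zbd (Tpart N).
Proof. exists (2 * / (1 - r)), r. split; [apply Hr|]. split; [apply K_pos | apply Tpart_bound]. Qed.

Let Zbd_term m : Zbd (fun s => qz q (m * m + (s - m) * (s - m))).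
Proof.
  exists 1, (Cmod q). split; [split; [apply Cmod_ge_0 | exact Hq]|]. split; [lra|].
  intro s. rewrite Rmult_1_l. apply qz_bound; auto. assert (H1 := sq_ge_abs m). assert (H2 := sq_ge_abs (s - m)). lia.
Qed.

Let Zsum_term m : Zsum (fun s => qz q (m * m + (s - m) * (s - m))) = (qz q (m * m) * TH q)%C.
Proof.
  unfold TH. rewrite <- (Zsum_shift _ m (Zbd_TH q Hq)), <- Zsum_scal by (apply (Zbd_shift (fun n => qz q (n * n))), Zbd_TH, Hq).
  apply Zsum_ext. intro s. apply qz_add; apply Z.square_nonneg.
Qed.

Lemma Zsum_plus g h : Zbd g -> Zbd h -> Zsum (fun n => g n + h n)%C = (Zsum g + Zsum h)%C.
Proof.
  intros Hg Hh. apply Zsum_unique. apply (Cis_series_ext (fun n => zfold g n + zfold h n)%C).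
  - intros [|n]; simpl; ring.
  - apply Cis_series_plus; apply Zsum_correct; auto.
Qed.

Lemma Zbd_plus g h : Zbd g -> Zbd h -> Zbd (fun n => g n + h n)%C.
Proof.
  intros [K [r1 [Hr1 [HK H]]]] [L [r2 [Hr2 [HL H']]]].
  assert (M1 := Rmax_l r1 r2). assert (M2 := Rmax_r r1 r2).
  assert (M3 : Rmax r1 r2 < 1) by (apply Rmax_lub_lt; lra).
  exists (K + L), (Rmax r1 r2). split; [lra|]. split; [lra|].
  intro n. eapply Rle_trans; [apply Cmod_triangle|]. rewrite Rmult_plus_distr_r.
  apply Rplus_le_compat; (eapply Rle_trans; [apply H || apply H'|]); apply Rmult_le_compat_l; auto;
    apply pow_incr; lra.
Qed.

Let Zsum_Tpart N : Zsum (Tpart (S N)) = (Csum (zfold (fun m => qz q (m * m))) (S N) * TH q)%C.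
Proof.
  induction N as [|N IH].
  - transitivity (Zsum (fun s => qz q (0 * 0 + (s - 0) * (s - 0)))).
    + apply Zsum_ext. intro s. unfold Tpart. simpl. ring.
    + rewrite Zsum_term. simpl. ring.
  - transitivity (Zsum (fun s => Tpart (S N) s + (qz q (Z.of_nat (S N) * Z.of_nat (S N) + (s - Z.of_nat (S N)) * (s - Z.of_nat (S N)))
      + qz q ((- Z.of_nat (S N)) * (- Z.of_nat (S N)) + (s - (- Z.of_nat (S N))) * (s - (- Z.of_nat (S N)))))))%C.
    + apply Zsum_ext. intro s. unfold Tpart. reflexivity.
    + rewrite Zsum_plus, Zsum_plus; auto; [|apply Zbd_plus; auto].
      rewrite IH, !Zsum_term.
      change (Csum (zfold (fun m => qz q (m * m))) (S (S N))) with
        (Csum (zfold (fun m => qz q (m * m))) (S N) + zfold (fun m => qz q (m * m)) (S N))%C.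
      unfold zfold. ring.
Qed.

(** Interchange of the two summations. For m in a finite symmetric range the sum over s is a shifted
    theta series, which gives a partial sum times [TH q]; as the range grows, [Tannery] passes to
    the limit under the sum over s. *)
Lemma TH_sq_diag : (TH q * TH q)%C = Zsum (Tdiag q).
Proof.
  apply (Clf_unique eventually (fun N => Zsum (Tpart (S N)))).
  - eapply Clf_ext; [exists O; intros N _; symmetry; apply Zsum_Tpart|].
    apply Clf_mult; [|apply Clf_const]. apply (Clf_eventually_sub (Csum (zfold (fun m => qz q (m * m)))) _ S); [lia|].
    apply Zsum_correct, Zbd_TH, Hq.
  - unfold Zsum at 1.
    apply (Clf_ext (fun N => CSeries (fun n => zfold (Tpart (S N)) n))); [exists O; reflexivity|].
    apply (Tannery eventually (fun n N => zfold (Tpart (S N)) n) (zfold (Tdiag q)) (fun n => 2 * (2 * / (1 - r)) * r ^ n)).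
    + apply ex_series_geom_scal, Hr.
    + exists O. intros N _ n. apply zfold_bound; auto.
    + assert (L : forall s, Clf eventually (fun N => Tpart (S N) s) (Tdiag q s)).
      { intro s. apply (Clf_eventually_sub (fun N => Tpart N s) _ S); [lia|]. apply Zsum_correct, Zbd_diag. }
      intros [|n]; simpl; [apply L | apply Clf_plus; apply L].
Qed.

Let Cmod_q2 : Cmod (q ^ 2)%C < 1.
Proof. rewrite Cmod_pow. assert (P := Cmod_ge_0 q). nra. Qed.

Lemma qz_sq e : (0 <= e)%Z -> qz (q ^ 2) e = qz q (2 * e).
Proof. intro He. unfold qz. rewrite <- Cpow_mult_r. f_equal. lia. Qed.

Let Tdiag_even j : Tdiag q (2 * j) = (qz (q ^ 2) (j * j) * TH (q ^ 2))%C.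
Proof.
  unfold Tdiag, TH. rewrite <- (Zsum_shift _ (- j) (Zbd_diag (2 * j))), <- Zsum_scal by (apply Zbd_TH; auto).
  apply Zsum_ext. intro k. rewrite !qz_sq, <- qz_add by nia. f_equal. ring.
Qed.

Let Tdiag_odd j : Tdiag q (2 * j + 1) = (q * (qz q (2 * (j * (j + 1))) * PSI q))%C.
Proof.
  unfold Tdiag, PSI. rewrite <- (Zsum_shift _ (- (j + 1)) (Zbd_diag (2 * j + 1))).
  rewrite <- !Zsum_scal by (try apply Zbd_scal; apply Zbd_PSI, Hq).
  apply Zsum_ext. intro k. replace (q * (qz q (2 * (j * (j + 1))) * qz q (2 * (k * (k + 1)))))%C
    with (qz q 1 * (qz q (2 * (j * (j + 1))) * qz q (2 * (k * (k + 1)))))%C by (unfold qz; simpl; ring).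
  assert (N1 : (0 <= j * (j + 1))%Z) by nia. assert (N2 : (0 <= k * (k + 1))%Z) by nia.
  rewrite <- qz_add, <- qz_add by lia. f_equal. ring.
Qed.

(** A rotation of the square lattice: on the line s = 2 j, m = j + k makes the exponent 2 j^2 + 2
    k^2, and on s = 2 j + 1, m = j + 1 + k makes it 2 j (j + 1) + 2 k (k + 1) + 1. Both double sums
    factor. *)
Lemma TH_sq : (TH q * TH q = TH (q ^ 2) * TH (q ^ 2) + q * (PSI q * PSI q))%C.
Proof.
  rewrite TH_sq_diag, Zsum_even_odd.
  - f_equal.
    + rewrite (Zsum_ext _ (fun j => TH (q ^ 2) * qz (q ^ 2) (j * j))%C) by (intro j; rewrite Tdiag_even; ring).
      rewrite Zsum_scal by (apply Zbd_TH; auto). reflexivity.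
    + rewrite (Zsum_ext _ (fun j => (q * PSI q) * qz q (2 * (j * (j + 1))))%C) by (intro j; rewrite Tdiag_odd; ring).
      rewrite Zsum_scal by (apply Zbd_PSI; auto). change (Zsum (fun j => qz q (2 * (j * (j + 1))))) with (PSI q). ring.
  - exists (2 * / (1 - r)), r. split; [apply Hr|]. split; [apply K_pos|].
    intro s. apply (Clf_le eventually (fun N => Tpart N s)).
    + exists O. intros N _. apply Tpart_bound.
    + apply Zsum_correct, Zbd_diag.
  - destruct (Zbd_scal (TH (q ^ 2)) _ (Zbd_TH _ Cmod_q2)) as [K [r0 [A [B D]]]].
    exists K, r0. split; [auto|]. split; [auto|]. intro n. rewrite Tdiag_even, Cmult_comm. apply D.
  - destruct (Zbd_scal (q * PSI q)%C _ (Zbd_PSI _ Hq)) as [K [r0 [A [B D]]]].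
    exists K, r0. split; [auto|]. split; [auto|]. intro n. rewrite Tdiag_odd.
    replace (q * (qz q (2 * (n * (n + 1))) * PSI q))%C with (q * PSI q * qz q (2 * (n * (n + 1))))%C by ring. apply D.
Qed.
End DoubleSum.

Lemma Cpow_opp_even (q : C) n : ((- q) ^ (2 * n) = q ^ (2 * n))%C.
Proof. rewrite !Cpow_mult_r. f_equal. simpl. ring. Qed.

Lemma PSI_opp q : PSI (- q)%C = PSI q.
Proof.
  apply Zsum_ext. intro n. unfold qz.
  replace (Z.to_nat (2 * (n * (n + 1)))) with (2 * Z.to_nat (n * (n + 1)))%nat by nia. apply Cpow_opp_even.
Qed.

Lemma TH_even_part q : Cmod q < 1 -> (TH q + TH (- q) = 2 * TH (q ^ 4))%C.
Proof.
  intro Hq. assert (Hq' : Cmod (- q)%C < 1) by (rewrite Cmod_opp; auto).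
  assert (Hq4 : Cmod (q ^ 4)%C < 1).
  { rewrite Cmod_pow. assert (P := Cmod_ge_0 q).
    assert (H := pow_decr (Cmod q) 1 4 ltac:(lra) ltac:(lia)). rewrite pow_1 in H. lra. }
  assert (B1 : forall q, Cmod q < 1 -> Zbd (fun j => qz q (2 * j * (2 * j)))).
  { intros p Hp. apply Zbd_qz; auto. intro n. nia. }
  assert (B2 : forall q, Cmod q < 1 -> Zbd (fun j => qz q ((2 * j + 1) * (2 * j + 1)))).
  { intros p Hp. apply Zbd_qz; auto. intro n. nia. }
  unfold TH. rewrite (Zsum_even_odd _ (Zbd_TH q Hq)) by auto.
  rewrite (Zsum_even_odd _ (Zbd_TH (- q)%C Hq')) by auto.
  rewrite (Zsum_ext (fun j => qz (- q) (2 * j * (2 * j))) (fun j => qz (q ^ 4) (j * j))).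
  2: { intro j. unfold qz. replace (Z.to_nat (2 * j * (2 * j))) with (2 * (2 * Z.to_nat (j * j)))%nat by nia.
       rewrite Cpow_opp_even, <- Cpow_mult_r. f_equal. lia. }
  rewrite (Zsum_ext (fun j => qz q (2 * j * (2 * j))) (fun j => qz (q ^ 4) (j * j))).
  2: { intro j. unfold qz. rewrite <- Cpow_mult_r. f_equal. nia. }
  rewrite (Zsum_ext (fun j => qz (- q) ((2 * j + 1) * (2 * j + 1))) (fun j => -(1) * qz q ((2 * j + 1) * (2 * j + 1)))%C).
  2: { intro j. unfold qz. replace (Z.to_nat ((2 * j + 1) * (2 * j + 1))) with (S (2 * (Z.to_nat (2 * (j * (j + 1)))))) by nia.
       rewrite !Cpow_S, Cpow_opp_even. ring. }
  rewrite (Zsum_scal (-(1))%C) by auto. ring.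
Qed.

Lemma TH_sq_sum q : Cmod q < 1 -> (TH q * TH q + TH (- q) * TH (- q) = 2 * (TH (q ^ 2) * TH (q ^ 2)))%C.
Proof.
  intro Hq. rewrite TH_sq, (TH_sq (- q)%C) by (rewrite ?Cmod_opp; auto).
  rewrite PSI_opp. replace ((- q) ^ 2)%C with (q ^ 2)%C by (simpl; ring). ring.
Qed.

Lemma TH_sq_diff q : Cmod q < 1 -> (TH q * TH q - TH (- q) * TH (- q) = 2 * (q * (PSI q * PSI q)))%C.
Proof.
  intro Hq. rewrite TH_sq, (TH_sq (- q)%C) by (rewrite ?Cmod_opp; auto).
  rewrite PSI_opp. replace ((- q) ^ 2)%C with (q ^ 2)%C by (simpl; ring). ring.
Qed.

Lemma Cmod_q2 q : Cmod q < 1 -> Cmod (q ^ 2)%C < 1.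
Proof. intro Hq. rewrite Cmod_pow. assert (P := Cmod_ge_0 q). nra. Qed.

(** Twice the product is (TH q + TH(-q))^2 - (TH q^2 + TH(-q)^2), where TH q^2 means the square of
    TH q; the first term is 4 TH(q^4)^2 by the even part, and the sum of squares is known at q and
    at q^2. With [TH_sq_sum] this is one step of the arithmetic-geometric mean for theta00^2 and
    theta01^2. *)
Lemma TH_prod q : Cmod q < 1 -> (TH q * TH (- q) = TH (- q ^ 2) * TH (- q ^ 2))%C.
Proof.
  intro Hq. assert (E1 := TH_even_part q Hq). assert (E2 := TH_sq_sum q Hq).
  assert (E3 := TH_sq_sum (q ^ 2)%C (Cmod_q2 q Hq)).
  replace ((q ^ 2) ^ 2)%C with (q ^ 4)%C in E3 by ring.
  assert (S : ((TH q + TH (- q)) * (TH q + TH (- q)) = 2 * TH (q ^ 4) * (2 * TH (q ^ 4)))%C) by (now rewrite E1).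
  assert (F : (2 * (TH q * TH (- q)) = 2 * (TH (- q ^ 2) * TH (- q ^ 2)))%C).
  { replace (2 * (TH q * TH (- q)))%C with ((TH q + TH (- q)) * (TH q + TH (- q)) - (TH q * TH q + TH (- q) * TH (- q)))%C by ring.
    rewrite S, E2. replace (2 * TH (q ^ 4) * (2 * TH (q ^ 4)))%C with (2 * (2 * (TH (q ^ 4) * TH (q ^ 4))))%C by ring.
    rewrite <- E3. ring. }
  apply (f_equal (fun z => z / 2)%C) in F.
  replace (TH q * TH (- q))%C with (2 * (TH q * TH (- q)) / 2)%C by field.
  replace (TH (- q ^ 2) * TH (- q ^ 2))%C with (2 * (TH (- q ^ 2) * TH (- q ^ 2)) / 2)%C by field. exact F.
Qed.

(* The coefficients of theta00 as a power series in exp (pi i tau). *)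
Definition tc (n : nat) : R :=
  match n with O => 1 | _ => if Nat.eqb (Nat.sqrt n * Nat.sqrt n) n then 2 else 0 end.

Lemma tc_bound n : Rabs (tc n) <= 2.
Proof.
  unfold tc. destruct n; [rewrite Rabs_R1; lra|].
  destruct Nat.eqb; [rewrite Rabs_pos_eq; lra | rewrite Rabs_R0; lra].
Qed.

Lemma tc_poly : poly_bd tc.
Proof. apply (poly_bd_const _ 2), tc_bound. Qed.

Lemma tc_sq N : tc (S N * S N) = 2.
Proof.
  unfold tc. change (S N * S N)%nat with (S (N + N * S N))%nat.
  change (S (N + N * S N))%nat with (S N * S N)%nat.
  rewrite Nat.sqrt_square, Nat.eqb_refl. reflexivity.
Qed.

Lemma tc_nonsq N n : (N * N < n < S N * S N)%nat -> tc n = 0.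
Proof.
  intro H. unfold tc. destruct n; [lia|]. rewrite (Nat.sqrt_unique (S n) N) by lia.
  destruct (Nat.eqb_spec (N * N) (S n)); [lia | reflexivity].
Qed.

Lemma Csum_zeros (a : nat -> C) n k : (forall i, (n <= i < n + k)%nat -> a i = 0) -> Csum a (n + k) = Csum a n.
Proof.
  induction k as [|k IH]; intro H.
  - now rewrite Nat.add_0_r.
  - rewrite Nat.add_succ_r. simpl. rewrite IH, H by (intros; try apply H; lia). ring.
Qed.

(** Partial sums up to the exponent N^2 agree with the symmetric sums over |n| <= N, the
    coefficients between consecutive squares being 0. The power series form is what allows
    differentiation. *)
Lemma TH_CPS q : Cmod q < 1 -> CPS tc q = TH q.
Proof.
  intro Hq. apply (Clf_unique eventually (fun N => Csum (fun n => RtoC (tc n) * q ^ n)%C (S (N * N)))).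
  - apply (Clf_eventually_sub _ _ (fun N => S (N * N))); [intro; nia|]. apply CPS_correct; [apply tc_poly | exact Hq].
  - apply (Clf_ext (fun N => Csum (zfold (fun n => qz q (n * n))) (S N))).
    + exists O. intros N _. induction N as [|N IH].
      * simpl. unfold qz. simpl. ring.
      * replace (S (S N * S N)) with (S ((S (N * N)) + (2 * N))) by lia.
        change (Csum (fun n => RtoC (tc n) * q ^ n)%C (S (S (N * N) + 2 * N))) with
          (Csum (fun n => RtoC (tc n) * q ^ n)%C (S (N * N) + 2 * N) + RtoC (tc (S (N * N) + 2 * N)) * q ^ (S (N * N) + 2 * N))%C.
        rewrite Csum_zeros by (intros i Hi; rewrite (tc_nonsq N) by lia; ring).
        rewrite <- IH. replace (S (N * N) + 2 * N)%nat with (S N * S N)%nat by lia.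
        rewrite tc_sq. change (Csum (zfold (fun n => qz q (n * n))) (S (S N))) with
          (Csum (zfold (fun n => qz q (n * n))) (S N) + zfold (fun n => qz q (n * n)) (S N))%C.
        f_equal. unfold zfold, qz. replace (Z.to_nat (Z.of_nat (S N) * Z.of_nat (S N))) with (S N * S N)%nat by lia.
        replace (Z.to_nat (- Z.of_nat (S N) * - Z.of_nat (S N))) with (S N * S N)%nat by lia. ring.
    + apply (Clf_eventually_sub (Csum (zfold (fun n => qz q (n * n)))) _ S); [lia|]. apply Zsum_correct, Zbd_TH, Hq.
Qed.

Lemma ZSeries_Zsum g : Zbd g -> ZSeries g = Zsum g.
Proof.
  intro H. unfold ZSeries. symmetry. apply Zsum_unique.
  destruct H as [K [r [Hr [HK H]]]].
  assert (H1 : Cis_series (fun n => g (Z.of_nat n)) (CSeries (fun n => g (Z.of_nat n)))).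
  { apply (CSeries_correct _ (fun n => K * r ^ n)); [apply ex_series_geom_scal, Hr|].
    intro n. specialize (H (Z.of_nat n)). now rewrite Zabs2Nat.id in H. }
  assert (H2 : Cis_series (fun n => g (- Z.of_nat (S n))%Z) (CSeries (fun n => g (- Z.of_nat (S n))%Z))).
  { apply (CSeries_correct _ (fun n => (K * r) * r ^ n)); [apply ex_series_geom_scal, Hr|].
    intro n. specialize (H (- Z.of_nat (S n))%Z).
    replace (Z.abs_nat (- Z.of_nat (S n))) with (S n) in H by lia. simpl pow in H. lra. }
  assert (H3 : Cis_series (fun n => match n with O => RtoC 0 | S m => g (- Z.of_nat (S m))%Z end)
     (0 + CSeries (fun n => g (- Z.of_nat (S n))%Z))%C).
  { apply (Cis_series_unshift (fun n => match n with O => RtoC 0 | S m => g (- Z.of_nat (S m))%Z end)). exact H2. }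
  rewrite Cplus_0_l in H3.
  apply (Cis_series_ext (fun n => g (Z.of_nat n) + match n with O => RtoC 0 | S m => g (- Z.of_nat (S m))%Z end)%C).
  - intros [|n]; [simpl; ring | reflexivity].
  - apply Cis_series_plus; auto.
Qed.

Definition ipi : C := (RtoC PI * Ci)%C.

Lemma ipi_neq_0 : ipi <> 0.
Proof.
  apply Cmult_neq_0.
  - intro H. injection H. assert (P := PI_RGT_0). lra.
  - intro H. injection H. lra.
Qed.

Definition nome (tau : C) : C := Cexp (ipi * tau)%C.

Lemma Cmod_nome tau : Cmod (nome tau) = exp (- PI * Im tau).
Proof.
  unfold nome. rewrite Cmod_Cexp. f_equal. unfold ipi, Re, Im. destruct tau. simpl. ring.
Qed.

Lemma nome_lt_1 tau : 0 < Im tau -> Cmod (nome tau) < 1.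
Proof.
  intro H. rewrite Cmod_nome, <- exp_0. apply exp_increasing.
  assert (P := PI_RGT_0). assert (0 < PI * Im tau) by (apply Rmult_lt_0_compat; auto). lra.
Qed.

Lemma nome_neq_0 tau : nome tau <> 0.
Proof. apply Cexp_neq_0. Qed.

Lemma nome_double tau : nome (2 * tau)%C = (nome tau ^ 2)%C.
Proof.
  unfold nome. rewrite <- Cexp_INR. f_equal. simpl. rewrite RtoC_plus. ring.
Qed.

Lemma Cexp_ipi : Cexp ipi = (-(1))%C.
Proof.
  unfold Cexp, ipi. simpl. rewrite !Rmult_0_r, !Rmult_0_l, Rmult_1_r, Rplus_0_r, Rminus_diag, exp_0, cos_PI, sin_PI.
  apply injective_projections; simpl; ring.
Qed.

Lemma nome_plus_1 tau : nome (tau + 1)%C = (- nome tau)%C.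
Proof.
  unfold nome. replace (ipi * (tau + 1))%C with (ipi + ipi * tau)%C by ring.
  rewrite Cexp_plus, Cexp_ipi. ring.
Qed.

Lemma Cder_nome tau : Cder nome tau (ipi * nome tau)%C.
Proof.
  eapply Cder_eq.
  - apply (Cder_comp Cexp (fun w => ipi * w)%C); [apply Cder_Cexp | apply Cder_scal, Cder_id].
  - unfold nome. ring.
Qed.

Lemma RtoC_div2 (x : R) : RtoC (x / 2) = (RtoC x / 2)%C.
Proof. unfold Rdiv. rewrite RtoC_mult, RtoC_inv by lra. reflexivity. Qed.

Lemma qz_nome tau (e : Z) : (0 <= e)%Z -> qz (nome tau) e = Cexp (RtoC (IZR e) * (ipi * tau))%C.
Proof.
  intro He. unfold qz, nome. rewrite <- Cexp_INR. f_equal. f_equal. f_equal.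
  rewrite INR_IZR_INZ. f_equal. lia.
Qed.

Lemma theta00_TH tau : 0 < Im tau -> theta 0 0 tau = TH (nome tau).
Proof.
  intro H. unfold theta, TH. assert (Hq := nome_lt_1 _ H).
  assert (E : forall n : Z, Cexp (RtoC PI * Ci * RtoC (IZR n + INR 0 / 2) ^ 2 * tau
     + 2 * RtoC PI * Ci * RtoC (IZR n + INR 0 / 2) * RtoC (INR 0 / 2))%C = qz (nome tau) (n * n)).
  { intro n. rewrite qz_nome by apply Z.square_nonneg. f_equal.
    simpl INR. replace (0 / 2) with 0 by field. rewrite Rplus_0_r, mult_IZR, RtoC_mult.
    unfold ipi. ring. }
  cbv zeta. rewrite ZSeries_Zsum.
  - apply Zsum_ext, E.
  - destruct (Zbd_TH _ Hq) as [K [r [Hr [HK B]]]]. exists K, r. split; [auto|]. split; [auto|].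
    intro n. rewrite E. apply B.
Qed.

Lemma theta01_TH tau : 0 < Im tau -> theta 0 1 tau = TH (- nome tau)%C.
Proof.
  intro H. unfold theta, TH. assert (Hq := nome_lt_1 _ H).
  assert (Hq' : Cmod (- nome tau)%C < 1) by (rewrite Cmod_opp; auto).
  assert (E : forall n : Z, Cexp (RtoC PI * Ci * RtoC (IZR n + INR 0 / 2) ^ 2 * tau
     + 2 * RtoC PI * Ci * RtoC (IZR n + INR 0 / 2) * RtoC (INR 1 / 2))%C = qz (- nome tau) (n * n)).
  { intro n. rewrite <- nome_plus_1, qz_nome by apply Z.square_nonneg.
    (* Since n^2 and n have the same parity, the sign exp(pi i n) of the characteristic is absorbed
       by the shift tau -> tau + 1, which turns q into -q. *)
    assert (Hk : exists k : nat, (n * n = n + 2 * Z.of_nat k)%Z).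
    { exists (Z.to_nat ((n * n - n) / 2)). rewrite Z2Nat.id by (apply Z.div_pos; nia).
      assert (M : ((n * n - n) mod 2 = 0)%Z).
      { replace (n * n - n)%Z with (n * (n - 1))%Z by ring. rewrite Z.mul_mod by lia.
        assert (C1 := Z.mod_pos_bound n 2 ltac:(lia)).
        rewrite (Zminus_mod n 1). assert (n mod 2 = 0 \/ n mod 2 = 1)%Z as [->| ->] by lia; reflexivity. }
      assert (D := Z.div_mod (n * n - n) 2 ltac:(lia)). lia. }
    destruct Hk as [k Hk].
    replace (RtoC (IZR (n * n)) * (ipi * (tau + 1)))%C with
      (RtoC (IZR (n * n)) * (ipi * tau) + RtoC (IZR n) * ipi + RtoC (INR k) * (2 * ipi))%C.
    - rewrite (Cexp_plus _ (RtoC (INR k) * (2 * ipi))), Cexp_INR.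
      replace (2 * ipi)%C with (ipi + ipi)%C by ring. rewrite (Cexp_plus ipi ipi), Cexp_ipi.
      replace (- (1) * - (1))%C with (RtoC 1) by ring. rewrite Cpow_1_l, Cmult_1_r. f_equal.
      simpl INR. replace (0 / 2) with 0 by field. rewrite Rplus_0_r, mult_IZR, RtoC_mult, RtoC_div2.
      unfold ipi. field.
    - rewrite Hk. rewrite plus_IZR, mult_IZR, <- INR_IZR_INZ, !RtoC_plus, RtoC_mult. ring. }
  cbv zeta. rewrite ZSeries_Zsum.
  - apply Zsum_ext, E.
  - destruct (Zbd_TH _ Hq') as [K [r [Hr [HK B]]]]. exists K, r. split; [auto|]. split; [auto|].
    intro n. rewrite E. apply B.
Qed.

Lemma theta10_PSI tau : 0 < Im tau -> theta 1 0 (2 * tau)%C = (Cexp (ipi * tau / 2) * PSI (nome tau))%C.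
Proof.
  intro H. unfold theta, PSI. assert (Hq := nome_lt_1 _ H).
  assert (E : forall n : Z, Cexp (RtoC PI * Ci * RtoC (IZR n + INR 1 / 2) ^ 2 * (2 * tau)
     + 2 * RtoC PI * Ci * RtoC (IZR n + INR 1 / 2) * RtoC (INR 0 / 2))%C
     = (Cexp (ipi * tau / 2) * qz (nome tau) (2 * (n * (n + 1))))%C).
  { intro n. rewrite qz_nome by nia. rewrite <- Cexp_plus. f_equal.
    simpl INR. replace (0 / 2) with 0 by field. rewrite !mult_IZR, plus_IZR.
    rewrite !RtoC_mult, !RtoC_plus, RtoC_div2. unfold ipi. field. }
  cbv zeta. rewrite ZSeries_Zsum.
  - rewrite <- Zsum_scal by (apply Zbd_PSI, Hq). apply Zsum_ext, E.
  - destruct (Zbd_scal (Cexp (ipi * tau / 2)) _ (Zbd_PSI _ Hq)) as [K [r [Hr [HK B]]]].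
    exists K, r. split; [auto|]. split; [auto|]. intro n. rewrite E. apply B.
Qed.

(** * The squares theta00^2, theta01^2 and their derivatives *)

(** [FA1] and [FA2] are the first and second images of [FA] under q d/dq, which is d/dtau divided by
    pi i. Evaluated at q they serve theta00^2, at -q theta01^2. *)
Definition FA (q : C) : C := (CPS tc q * CPS tc q)%C.
Definition FA1 (q : C) : C := (2 * CPS tc q * (q * CPS (dcoef tc) q))%C.
Definition FA2 (q : C) : C :=
  (2 * (q * CPS (dcoef tc) q) * (q * CPS (dcoef tc) q)
   + 2 * CPS tc q * (q * CPS (dcoef tc) q + q * q * CPS (dcoef (dcoef tc)) q))%C.

Lemma FA_der q tau (p : C -> C) : Cmod q < 1 -> p tau = q -> Cder p tau (ipi * q)%C ->
  Cder (fun t => FA (p t)) tau (ipi * FA1 q)%C /\ Cder (fun t => FA1 (p t)) tau (ipi * FA2 q)%C.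
Proof.
  intros Hq Hp Hd. subst q.
  assert (D0 : Cder (fun t => CPS tc (p t)) tau (CPS (dcoef tc) (p tau) * (ipi * p tau))%C).
  { apply (Cder_comp (CPS tc) p); [apply CPS_der; [apply tc_poly | exact Hq] | exact Hd]. }
  assert (D1 : Cder (fun t => CPS (dcoef tc) (p t)) tau (CPS (dcoef (dcoef tc)) (p tau) * (ipi * p tau))%C).
  { apply (Cder_comp (CPS (dcoef tc)) p); [apply CPS_der; [apply poly_bd_dcoef, tc_poly | exact Hq] | exact Hd]. }
  split.
  - unfold FA. eapply Cder_eq; [apply Cder_mult; exact D0|]. unfold FA1. cbv beta. ring.
  - unfold FA1. eapply Cder_eq.
    + apply (Cder_mult (fun t => 2 * CPS tc (p t))%C); [apply Cder_scal; exact D0|].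
      apply Cder_mult; [exact Hd | exact D1].
    + unfold FA2. cbv beta. ring.
Qed.

(* tA, tB and tC (below) are theta00^2, theta01^2 and theta10^4.  A suffix 1 or 2 denotes the first or
   second derivative with respect to pi i tau. *)
Definition tA (tau : C) : C := FA (nome tau).
Definition tA1 (tau : C) : C := FA1 (nome tau).
Definition tA2 (tau : C) : C := FA2 (nome tau).
Definition tB (tau : C) : C := FA (- nome tau)%C.
Definition tB1 (tau : C) : C := FA1 (- nome tau)%C.
Definition tB2 (tau : C) : C := FA2 (- nome tau)%C.

Lemma tA_der tau : 0 < Im tau ->
  Cder tA tau (ipi * tA1 tau)%C /\ Cder tA1 tau (ipi * tA2 tau)%C.
Proof.
  intro H. apply (FA_der (nome tau) tau nome); [apply nome_lt_1, H | reflexivity | apply Cder_nome].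
Qed.

Lemma tB_der tau : 0 < Im tau ->
  Cder tB tau (ipi * tB1 tau)%C /\ Cder tB1 tau (ipi * tB2 tau)%C.
Proof.
  intro H. apply (FA_der (- nome tau)%C tau (fun t => - nome t)%C); [rewrite Cmod_opp; apply nome_lt_1, H | reflexivity |].
  eapply Cder_eq; [apply Cder_opp, Cder_nome|]. ring.
Qed.

Lemma FA_TH q : Cmod q < 1 -> FA q = (TH q * TH q)%C.
Proof. intro H. unfold FA. now rewrite TH_CPS. Qed.

Lemma Im_double tau : Im (2 * tau)%C = 2 * Im tau.
Proof. destruct tau. unfold Im. simpl. ring. Qed.

Lemma tA_double tau : 0 < Im tau -> tA (2 * tau)%C = ((tA tau + tB tau) / 2)%C.
Proof.
  intro H. assert (Hq := nome_lt_1 _ H). unfold tA, tB. rewrite nome_double.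
  rewrite !FA_TH by (try apply Cmod_q2; rewrite ?Cmod_opp; auto).
  rewrite TH_sq_sum by auto. field.
Qed.

Lemma tB_double_sq tau : 0 < Im tau -> (tB (2 * tau) * tB (2 * tau) = tA tau * tB tau)%C.
Proof.
  intro H. assert (Hq := nome_lt_1 _ H). unfold tA, tB. rewrite nome_double.
  rewrite !FA_TH by (try (rewrite Cmod_opp; apply Cmod_q2); rewrite ?Cmod_opp; auto).
  rewrite <- TH_prod by auto. ring.
Qed.

Lemma theta00_tA tau : 0 < Im tau -> (theta 0 0 tau ^ 4 = tA tau * tA tau)%C.
Proof.
  intro H. rewrite theta00_TH by auto. unfold tA. rewrite FA_TH by (apply nome_lt_1, H). ring.
Qed.

Lemma theta01_tB tau : 0 < Im tau -> (theta 0 1 tau ^ 4 = tB tau * tB tau)%C.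
Proof.
  intro H. rewrite theta01_TH by auto. unfold tB. rewrite FA_TH by (rewrite Cmod_opp; apply nome_lt_1, H). ring.
Qed.

(** Jacobi's quartic identity. At tau = 2 s both sides are ((tA s - tB s) / 2)^2: on the right by
    the two doubling formulas, on the left by the odd part of theta00^2. *)
Lemma theta10_tAB tau : 0 < Im tau -> (theta 1 0 tau ^ 4 = tA tau * tA tau - tB tau * tB tau)%C.
Proof.
  intro H. set (s := (tau / 2)%C). assert (E : tau = (2 * s)%C) by (unfold s; field).
  assert (Hs : 0 < Im s). { assert (K := Im_double s). rewrite <- E in K. lra. }
  assert (Hq := nome_lt_1 _ Hs). rewrite E.
  rewrite tB_double_sq, tA_double, theta10_PSI by auto.
  assert (S : (Cexp (ipi * s / 2) * Cexp (ipi * s / 2))%C = nome s).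
  { rewrite <- Cexp_plus. unfold nome. f_equal. field. }
  assert (D := TH_sq_diff _ Hq). rewrite <- FA_TH in D by auto.
  rewrite <- (FA_TH (- nome s)%C) in D by (rewrite Cmod_opp; auto).
  change (FA (nome s)) with (tA s) in D. change (FA (- nome s)%C) with (tB s) in D.
  assert (F : ((Cexp (ipi * s / 2) * PSI (nome s)) ^ 4)%C = ((tA s - tB s) / 2 * ((tA s - tB s) / 2))%C).
  { rewrite D.
    replace ((Cexp (ipi * s / 2) * PSI (nome s)) ^ 4)%C with
     ((Cexp (ipi * s / 2) * Cexp (ipi * s / 2)) * (Cexp (ipi * s / 2) * Cexp (ipi * s / 2)) * (PSI (nome s) ^ 4))%C by ring.
    rewrite S. field. }
  rewrite F. field.
Qed.

(** * Behaviour at the cusp, and descent by doubling *)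

Definition Iinf : (C -> Prop) -> Prop := fun P => exists M, forall tau, M < Im tau -> P tau.

Global Instance Iinf_filter : ProperFilter Iinf.
Proof.
  constructor.
  - intros P [M H]. exists (0, M + 1). apply H. simpl. lra.
  - constructor.
    + exists 0. auto.
    + intros P Q [M H] [M' H']. exists (Rmax M M'). intros tau Ht.
      assert (A := Rmax_l M M'). assert (B := Rmax_r M M'). split; [apply H | apply H']; lra.
    + intros P Q HPQ [M H]. exists M. auto.
Qed.

Lemma Iinf_above M : Iinf (fun tau => M < Im tau).
Proof. exists M. auto. Qed.

Lemma nome_Iinf : Clf Iinf nome 0.
Proof.
  intros e He. exists (- ln e / PI). intros tau H.
  replace (nome tau - 0)%C with (nome tau) by ring. rewrite Cmod_nome.
  rewrite <- (exp_ln e He). apply exp_increasing.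
  assert (P := PI_RGT_0). apply (Rmult_lt_compat_l PI) in H; auto.
  replace (PI * (- ln e / PI)) with (- ln e) in H by (field; lra). lra.
Qed.

Lemma opp_nome_Iinf : Clf Iinf (fun tau => - nome tau)%C 0.
Proof. apply (Clf_eq _ (- 0)%C); [ring|]. apply Clf_opp, nome_Iinf. Qed.

Lemma CPS_Iinf a (p : C -> C) : poly_bd a -> Clf Iinf p 0 -> Clf Iinf (fun tau => CPS a (p tau)) (RtoC (a O)).
Proof.
  intros Ha Hp. rewrite <- CPS_at_0. apply Ccont_comp; [apply _ | exact Hp|].
  apply CPS_cont; auto. rewrite Cmod_0. lra.
Qed.

Lemma tA_Iinf : Clf Iinf tA 1.
Proof.
  apply (Clf_eq _ (RtoC (tc O) * RtoC (tc O))%C); [simpl; ring|].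
  apply Clf_mult; apply (CPS_Iinf tc nome tc_poly nome_Iinf).
Qed.

Lemma tB_Iinf : Clf Iinf tB 1.
Proof.
  apply (Clf_eq _ (RtoC (tc O) * RtoC (tc O))%C); [simpl; ring|].
  apply Clf_mult; apply (CPS_Iinf tc (fun t => - nome t)%C tc_poly opp_nome_Iinf).
Qed.

Lemma dcoef_tc_0 : dcoef tc 0 = 2.
Proof. unfold dcoef. simpl. ring. Qed.

Lemma FA1_quot (p : C -> C) : Clf Iinf p 0 ->
  Clf Iinf (fun t => 2 * CPS tc (p t) * CPS (dcoef tc) (p t))%C 4.
Proof.
  intro Hp. apply (Clf_eq _ (2 * RtoC (tc O) * RtoC (dcoef tc O))%C).
  { rewrite dcoef_tc_0. simpl. rewrite <- !RtoC_mult. f_equal. ring. }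
  apply Clf_mult; [apply Clf_mult; [apply Clf_const|]|]; apply CPS_Iinf; auto.
  - apply tc_poly.
  - apply poly_bd_dcoef, tc_poly.
Qed.

(** From theta00^2 = 1 + 4 q + ... and theta01^2 = 1 - 4 q + ...; these leading coefficients fix the
    constants in the descents below. *)
Lemma tA1_quot : Clf Iinf (fun t => tA1 t / nome t)%C 4.
Proof.
  eapply Clf_ext; [|apply (FA1_quot nome nome_Iinf)]. apply filter_forall. intro t.
  unfold tA1, FA1. field. apply nome_neq_0.
Qed.

Lemma tB1_quot : Clf Iinf (fun t => tB1 t / nome t)%C (-(4))%C.
Proof.
  eapply Clf_ext; [|apply Clf_opp, (FA1_quot _ opp_nome_Iinf)]. apply filter_forall. intro t.
  unfold tB1, FA1. field. apply nome_neq_0.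
Qed.

Lemma tA2_quot : Clf Iinf (fun t => tA2 t / nome t)%C 4.
Proof.
  apply (Clf_ext (fun t => 2 * nome t * CPS (dcoef tc) (nome t) * CPS (dcoef tc) (nome t)
     + 2 * CPS tc (nome t) * (CPS (dcoef tc) (nome t) + nome t * CPS (dcoef (dcoef tc)) (nome t)))%C).
  - apply filter_forall. intro t. unfold tA2, FA2. field. apply nome_neq_0.
  - apply (Clf_eq _ (2 * 0 * RtoC (dcoef tc 0) * RtoC (dcoef tc 0)
      + 2 * RtoC (tc 0) * (RtoC (dcoef tc 0) + 0 * RtoC (dcoef (dcoef tc) 0)))%C).
    + rewrite dcoef_tc_0. simpl. rewrite Cmult_0_r, !Cmult_0_l, Cplus_0_l, Cplus_0_r.
      rewrite <- !RtoC_mult. f_equal. ring.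
    + assert (P0 := CPS_Iinf tc nome tc_poly nome_Iinf).
      assert (P1 := CPS_Iinf (dcoef tc) nome (poly_bd_dcoef _ tc_poly) nome_Iinf).
      assert (P2 := CPS_Iinf (dcoef (dcoef tc)) nome (poly_bd_dcoef _ (poly_bd_dcoef _ tc_poly)) nome_Iinf).
      assert (P3 := nome_Iinf).
      apply Clf_plus; repeat (apply Clf_mult || apply Clf_plus || apply Clf_const || assumption).
Qed.

Lemma tAB_quot : Clf Iinf (fun t => (tA t - tB t) / nome t)%C 8.
Proof.
  assert (Ps : poly_bd (fun n => tc (S n))) by (apply (poly_bd_const _ 2); intro; apply tc_bound).
  apply (Clf_ext (fun t => (CPS (fun n => tc (S n)) (nome t) + CPS (fun n => tc (S n)) (- nome t)%C)
     * (CPS tc (nome t) + CPS tc (- nome t)%C))%C).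
  - exists 0. intros t Ht. unfold tA, tB, FA. assert (Hq := nome_lt_1 _ Ht).
    replace (CPS tc (nome t) * CPS tc (nome t) - CPS tc (- nome t) * CPS tc (- nome t))%C
      with ((CPS tc (nome t) - CPS tc (- nome t)) * (CPS tc (nome t) + CPS tc (- nome t)))%C by ring.
    replace (CPS tc (nome t) - CPS tc (- nome t))%C
      with (nome t * (CPS (fun n => tc (S n)) (nome t) + CPS (fun n => tc (S n)) (- nome t)))%C.
    + field. apply nome_neq_0.
    + rewrite (CPS_unshift tc tc_poly (nome t)) by auto.
      rewrite (CPS_unshift tc tc_poly (- nome t)%C) by (rewrite Cmod_opp; auto). ring.
  - apply (Clf_eq _ ((RtoC (tc 1) + RtoC (tc 1)) * (RtoC (tc 0) + RtoC (tc 0)))%C).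
    + simpl. rewrite <- !RtoC_plus, <- RtoC_mult. f_equal. ring.
    + apply Clf_mult; apply Clf_plus.
      * exact (CPS_Iinf _ _ Ps nome_Iinf).
      * exact (CPS_Iinf _ _ Ps opp_nome_Iinf).
      * exact (CPS_Iinf _ _ tc_poly nome_Iinf).
      * exact (CPS_Iinf _ _ tc_poly opp_nome_Iinf).
Qed.

Fixpoint dbl (n : nat) (tau : C) : C := match n with O => tau | S m => dbl m (2 * tau)%C end.

Lemma Im_dbl n : forall tau, Im (dbl n tau) = 2 ^ n * Im tau.
Proof. induction n as [|n IH]; intro tau; simpl; [ring|]. rewrite IH, Im_double. ring. Qed.

Lemma dbl_Iinf tau P : 0 < Im tau -> Iinf P -> eventually (fun n => P (dbl n tau)).
Proof.
  intros H [M HM]. destruct (Pow_x_infinity 2 ltac:(rewrite Rabs_pos_eq; lra) (Rabs M / Im tau + 1)) as [N HN].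
  exists N. intros n Hn. apply HM. rewrite Im_dbl. specialize (HN n Hn).
  rewrite Rabs_pos_eq in HN by (apply pow_le; lra).
  apply Rge_le in HN. apply (Rmult_le_compat_r (Im tau)) in HN; [|lra].
  replace ((Rabs M / Im tau + 1) * Im tau) with (Rabs M + Im tau) in HN by (field; lra).
  assert (A := Rle_abs M). lra.
Qed.

(** Doubling tau doubles Im tau, so every point of the half-plane enters a given neighbourhood of i
    infinity after finitely many steps, and P is pulled back from there. *)
Lemma doubling_induction (P : C -> Prop) : (forall tau, 0 < Im tau -> P (2 * tau)%C -> P tau) ->
  Iinf P -> forall tau, 0 < Im tau -> P tau.
Proof.
  intros Hs HI tau H. destruct (dbl_Iinf tau P H HI) as [N HN]. specialize (HN N (Nat.le_refl _)).
  revert tau H HN. induction N as [|N IH]; intros tau H HN; [exact HN|].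
  apply Hs; auto. apply IH; [rewrite Im_double; lra | exact HN].
Qed.

Lemma doubling_const f l : (forall tau, 0 < Im tau -> f (2 * tau)%C = f tau) -> Clf Iinf f l ->
  forall tau, 0 < Im tau -> f tau = l.
Proof.
  intros Hd Hl tau H. apply (Clf_unique eventually (fun n => f (dbl n tau))).
  - apply (Clf_ext (fun _ => f tau)); [|apply Clf_const]. exists O. intros n _.
    revert tau H. induction n as [|n IH]; intros tau H; [reflexivity|].
    simpl. rewrite <- IH by (rewrite Im_double; lra). symmetry. auto.
  - intros e He. apply (dbl_Iinf tau (fun t => Cmod (f t - l)%C < e)); auto.
Qed.

Lemma C2_neq_0 : RtoC 2 <> 0. Proof. intro H. injection H. lra. Qed.

(** By the geometric mean formula a zero of either function at tau is a zero of theta01^2 at 2 tau,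
    and so on towards the cusp, where both functions tend to 1. *)
Lemma tAB_neq_0 tau : 0 < Im tau -> tA tau <> 0 /\ tB tau <> 0.
Proof.
  revert tau. apply doubling_induction.
  - intros tau H [H1 H2]. assert (E := tB_double_sq tau H).
    split; intro K; rewrite K in E; rewrite ?Cmult_0_l, ?Cmult_0_r in E;
      apply (Cmult_neq_0 _ _ H2 H2); exact E.
  - assert (N : RtoC 1 <> RtoC 0) by (intro H; injection H; lra).
    apply filter_and; [apply (Clf_neq _ _ _ N tA_Iinf) | apply (Clf_neq _ _ _ N tB_Iinf)].
Qed.

Definition tC (tau : C) : C := (tA tau * tA tau - tB tau * tB tau)%C.

Lemma tC_double tau : 0 < Im tau -> tC (2 * tau)%C = ((tA tau - tB tau) / 2 * ((tA tau - tB tau) / 2))%C.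
Proof. intro H. unfold tC. rewrite tB_double_sq, tA_double by auto. field. Qed.

Lemma tA_plus_tB_neq_0 tau : 0 < Im tau -> (tA tau + tB tau)%C <> 0.
Proof.
  intros H E. assert (K := tA_double tau H). rewrite E in K.
  destruct (tAB_neq_0 (2 * tau)%C) as [N _]; [rewrite Im_double; lra|]. apply N. rewrite K.
  field.
Qed.

(** The same descent: a zero at tau forces tA = tB there, because tA + tB = 2 tA(2 tau) does not
    vanish, and hence a zero at 2 tau. Near the cusp (tA - tB) / q is close to 8. *)
Lemma tC_neq_0 tau : 0 < Im tau -> tC tau <> 0.
Proof.
  revert tau. apply doubling_induction.
  - intros tau H N E. apply N. rewrite tC_double by auto.
    assert (F : (tA tau - tB tau)%C = 0).
    { replace (tA tau - tB tau)%C with (tC tau / (tA tau + tB tau))%C.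
      - rewrite E. field. apply tA_plus_tB_neq_0, H.
      - unfold tC. field. apply tA_plus_tB_neq_0, H. }
    rewrite F. field.
  - assert (N : RtoC 8 <> RtoC 0) by (intro H; injection H; lra).
    generalize (filter_and _ _ (Iinf_above 0) (Clf_neq _ _ _ N tAB_quot)). apply filter_imp.
    intros tau [H K] E. apply K. replace (tA tau - tB tau)%C with (tC tau / (tA tau + tB tau))%C.
    + rewrite E. field. split; [apply tA_plus_tB_neq_0, H | apply nome_neq_0].
    + unfold tC. field. apply tA_plus_tB_neq_0, H.
Qed.

Lemma tA_minus_tB_neq_0 tau : 0 < Im tau -> (tA tau - tB tau)%C <> 0.
Proof.
  intros H E. apply (tC_neq_0 tau H). unfold tC.
  replace (tA tau * tA tau - tB tau * tB tau)%C with ((tA tau - tB tau) * (tA tau + tB tau))%C by ring.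
  rewrite E. ring.
Qed.

(** * Differential equations of the theta constants *)

Lemma upper_open tau : 0 < Im tau -> Cnear tau (fun t => 0 < Im t).
Proof.
  intro H. exists (Im tau). split; [auto|]. intros w Hw.
  assert (K := Im_le_Cmod (w - tau)%C). change (Im (w - tau)%C) with (Im w - Im tau) in K.
  apply Rabs_le_between in K. lra.
Qed.

Lemma Cder_double f tau l : Cder f (2 * tau)%C l -> Cder (fun t => f (2 * t)%C) tau (2 * l)%C.
Proof.
  intro H. eapply Cder_eq.
  - apply (Cder_comp f (fun t => 2 * t)%C); [exact H | apply Cder_scal, Cder_id].
  - ring.
Qed.

Lemma ipi_cancel x y : (ipi * x = ipi * y)%C -> x = y.
Proof.
  intro H. replace x with (ipi * x / ipi)%C by (field; apply ipi_neq_0). rewrite H.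
  field. apply ipi_neq_0.
Qed.

Lemma tA1_double tau : 0 < Im tau -> tA1 (2 * tau)%C = ((tA1 tau + tB1 tau) / 4)%C.
Proof.
  intro H. assert (H2 : 0 < Im (2 * tau)%C) by (rewrite Im_double; lra).
  assert (D1 := Cder_double tA tau _ (proj1 (tA_der _ H2))).
  assert (D2 : Cder (fun t => tA (2 * t)%C) tau ((ipi * tA1 tau + ipi * tB1 tau) * / 2)%C).
  { apply (Cder_ext (fun t => (tA t + tB t) * / 2)%C).
    - generalize (upper_open _ H). apply filter_imp. intros t Ht. rewrite tA_double by auto. reflexivity.
    - eapply Cder_eq; [apply Cder_mult; [apply Cder_plus; [apply tA_der | apply tB_der]; auto | apply Cder_const]|].
      cbv beta. ring. }
  assert (E := Cder_unique _ _ _ _ D1 D2). apply ipi_cancel.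
  replace (ipi * tA1 (2 * tau))%C with ((2 * (ipi * tA1 (2 * tau))) / 2)%C by field. rewrite E. field.
Qed.

Lemma tA2_double tau : 0 < Im tau -> tA2 (2 * tau)%C = ((tA2 tau + tB2 tau) / 8)%C.
Proof.
  intro H. assert (H2 : 0 < Im (2 * tau)%C) by (rewrite Im_double; lra).
  assert (D1 := Cder_double tA1 tau _ (proj2 (tA_der _ H2))).
  assert (D2 : Cder (fun t => tA1 (2 * t)%C) tau ((ipi * tA2 tau + ipi * tB2 tau) * / 4)%C).
  { apply (Cder_ext (fun t => (tA1 t + tB1 t) * / 4)%C).
    - generalize (upper_open _ H). apply filter_imp. intros t Ht. rewrite tA1_double by auto. reflexivity.
    - eapply Cder_eq; [apply Cder_mult; [apply Cder_plus; [apply tA_der | apply tB_der]; auto | apply Cder_const]|].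
      cbv beta. ring. }
  assert (E := Cder_unique _ _ _ _ D1 D2). apply ipi_cancel.
  replace (ipi * tA2 (2 * tau))%C with ((2 * (ipi * tA2 (2 * tau))) / 2)%C by field. rewrite E. field.
Qed.

Lemma tB1_double tau : 0 < Im tau ->
  (4 * (tB (2 * tau) * tB1 (2 * tau)) = tA1 tau * tB tau + tA tau * tB1 tau)%C.
Proof.
  intro H. assert (H2 : 0 < Im (2 * tau)%C) by (rewrite Im_double; lra).
  assert (D0 := Cder_double tB tau _ (proj1 (tB_der _ H2))).
  assert (D1 := Cder_mult _ _ _ _ _ D0 D0).
  assert (D2 : Cder (fun t => tB (2 * t) * tB (2 * t))%C tau (ipi * tA1 tau * tB tau + tA tau * (ipi * tB1 tau))%C).
  { apply (Cder_ext (fun t => tA t * tB t)%C).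
    - generalize (upper_open _ H). apply filter_imp. intros t Ht. rewrite tB_double_sq by auto. reflexivity.
    - apply Cder_mult; [apply tA_der | apply tB_der]; auto. }
  assert (E := Cder_unique _ _ _ _ D1 D2). apply ipi_cancel.
  replace (ipi * (tA1 tau * tB tau + tA tau * tB1 tau))%C
    with (ipi * tA1 tau * tB tau + tA tau * (ipi * tB1 tau))%C by ring.
  rewrite <- E. ring.
Qed.

(* The Wronskian of theta00^2 and theta01^2, divided by its expected value, is
   invariant under tau -> 2 tau; its limit at i*infinity determines it. *)
Lemma theta_wronskian tau : 0 < Im tau ->
  ((tA tau * tB1 tau - tB tau * tA1 tau) / (tA tau * tB tau * tC tau) = - (1 / 2))%C.
Proof.
  revert tau. apply doubling_const.
  - intros tau H. assert (H2 : 0 < Im (2 * tau)%C) by (rewrite Im_double; lra).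
    destruct (tAB_neq_0 _ H) as [N1 N2]. assert (N3 := tA_plus_tB_neq_0 _ H). assert (N4 := tA_minus_tB_neq_0 _ H).
    assert (N5 := tC_neq_0 _ H). destruct (tAB_neq_0 _ H2) as [N6 N7].
    (* Numerator and denominator are multiplied by theta01^2 at 2 tau, so that this function occurs
       only squared or next to its derivative, where the doubling formulas apply. *)
    transitivity ((tA (2 * tau) * (4 * (tB (2 * tau) * tB1 (2 * tau))) / 4 - (tB (2 * tau) * tB (2 * tau)) * tA1 (2 * tau)) /
       (tA (2 * tau) * (tB (2 * tau) * tB (2 * tau)) * tC (2 * tau)))%C.
    { field. repeat split; auto. apply tC_neq_0, H2. }
    rewrite tB1_double, tB_double_sq, tC_double, tA_double, tA1_double by auto. unfold tC in *.
    field. repeat split; auto.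
  - assert (N : (RtoC 1 * 1 * (8 * (1 + 1)))%C <> 0).
    { rewrite <- !RtoC_plus, <- !RtoC_mult. intro H. injection H. lra. }
    apply (Clf_eq _ ((1 * -(4) - 1 * 4) / (1 * 1 * (8 * (1 + 1))))%C).
    { field. }
    apply (Clf_ext (fun t => (tA t * (tB1 t / nome t) - tB t * (tA1 t / nome t)) /
      (tA t * tB t * ((tA t - tB t) / nome t * (tA t + tB t))))%C).
    + exists 0. intros t Ht. destruct (tAB_neq_0 _ Ht) as [N1 N2]. assert (N3 := tA_plus_tB_neq_0 _ Ht).
      assert (N4 := tA_minus_tB_neq_0 _ Ht). assert (N5 := tC_neq_0 _ Ht). assert (N6 := nome_neq_0 t).
      unfold tC in *. field. repeat split; auto.
    + assert (Q1 := tA_Iinf). assert (Q2 := tB_Iinf). assert (Q3 := tA1_quot).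
      assert (Q4 := tB1_quot). assert (Q5 := tAB_quot).
      apply Clf_div; [exact N| |];
      repeat (apply Clf_minus || apply Clf_mult || apply Clf_plus || assumption).
Qed.

(** The Wronskian read as a difference of logarithmic derivatives, theta01^2 against theta00^2. From
    here on [tA1] is the one derivative left in the formulas. *)
Lemma tB1_eq tau : 0 < Im tau -> tB1 tau = (tB tau * (tA1 tau / tA tau - tC tau / 2))%C.
Proof.
  intro H. assert (W := theta_wronskian tau H). destruct (tAB_neq_0 _ H) as [N1 N2]. assert (N3 := tC_neq_0 _ H).
  replace (tB1 tau) with ((tA tau * tB1 tau - tB tau * tA1 tau) / (tA tau * tB tau * tC tau) * (tB tau * tC tau)
     + tB tau * tA1 tau / tA tau)%C by (field; auto).
  rewrite W. field. auto.
Qed.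

Lemma tC_der tau : 0 < Im tau -> Cder tC tau (ipi * (2 * (tA tau * tA1 tau - tB tau * tB1 tau)))%C.
Proof.
  intro H. destruct (tA_der _ H) as [DA _]. destruct (tB_der _ H) as [DB _].
  eapply Cder_eq; [apply Cder_minus; apply Cder_mult; eauto|]. ring.
Qed.

Lemma tB2_eq tau : 0 < Im tau -> tB2 tau = (tB1 tau * (tA1 tau / tA tau - tC tau / 2)
  + tB tau * ((tA2 tau * tA tau - tA1 tau * tA1 tau) / (tA tau * tA tau) - (tA tau * tA1 tau - tB tau * tB1 tau)))%C.
Proof.
  intro H. destruct (tA_der _ H) as [DA DA1]. destruct (tB_der _ H) as [DB DB1].
  destruct (tAB_neq_0 _ H) as [N1 N2].
  assert (D : Cder tB1 tau (ipi * (tB1 tau * (tA1 tau / tA tau - tC tau / 2)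
  + tB tau * ((tA2 tau * tA tau - tA1 tau * tA1 tau) / (tA tau * tA tau) - (tA tau * tA1 tau - tB tau * tB1 tau))))%C).
  { apply (Cder_ext (fun t => tB t * (tA1 t / tA t - tC t * / 2))%C).
    - generalize (upper_open _ H). apply filter_imp. intros t Ht. rewrite tB1_eq by auto. reflexivity.
    - eapply Cder_eq.
      + apply Cder_mult; [exact DB|]. apply Cder_minus; [apply Cder_div; [exact N1 | exact DA1 | exact DA]|].
        apply Cder_mult; [apply tC_der, H | apply Cder_const].
      + cbv beta. field. exact N1. }
  apply ipi_cancel. exact (Cder_unique _ _ _ _ DB1 D).
Qed.

(** The defect in (1/A)'' = - (B^2 C / 4) (1/A), the linear second order equation for the weight 1/A
    = theta00^(-2), with B = theta01^2 and C = theta10^4. *)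
Definition tE (tau : C) : C := (- tA2 tau / tA tau + 2 * (tA1 tau * tA1 tau) / (tA tau * tA tau)
  + tB tau * tB tau * tC tau / 4)%C.

Lemma tE_double tau : 0 < Im tau -> tE (2 * tau)%C = (tE tau / 4)%C.
Proof.
  intro H. destruct (tAB_neq_0 _ H) as [N1 N2]. assert (N3 := tA_plus_tB_neq_0 _ H).
  unfold tE. rewrite tB_double_sq, tC_double, tA2_double, tA1_double, tA_double by auto.
  rewrite tB2_eq, tB1_eq by auto. unfold tC. field. repeat split; auto.
Qed.

Lemma tE_quot : Clf Iinf (fun t => tE t / nome t)%C 0.
Proof.
  apply (Clf_eq _ (- (4) / 1 + 2 * (4 * 4 * 0) / (1 * 1) + 1 * 1 * (8 * (1 + 1)) / 4)%C).
  { field. }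
  apply (Clf_ext (fun t => - (tA2 t / nome t) / tA t + 2 * ((tA1 t / nome t) * (tA1 t / nome t) * nome t) / (tA t * tA t)
    + tB t * tB t * ((tA t - tB t) / nome t * (tA t + tB t)) / 4)%C).
  - exists 0. intros t Ht. destruct (tAB_neq_0 _ Ht) as [N1 N2]. unfold tE, tC. field. split; [auto | apply nome_neq_0].
  - assert (Q1 := tA_Iinf). assert (Q2 := tB_Iinf). assert (Q3 := tA1_quot).
    assert (Q4 := tA2_quot). assert (Q5 := tAB_quot). assert (Q6 := nome_Iinf).
    assert (N1 : RtoC 1 <> 0) by (intro K; injection K; lra).
    assert (N4 : RtoC 4 <> 0) by (intro K; injection K; lra).
    assert (N11 : (RtoC 1 * 1)%C <> 0) by (apply Cmult_neq_0; auto).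
    repeat (apply Clf_plus || apply Clf_div || apply Clf_mult || apply Clf_opp || apply Clf_const || assumption).
Qed.

Lemma pow2_ge_S n : (S n <= 2 ^ n)%nat.
Proof. induction n as [|n IH]; simpl; lia. Qed.

Lemma nome_dbl n : forall tau, nome (dbl n tau) = (nome tau ^ (2 ^ n))%C.
Proof.
  induction n as [|n IH]; intro tau; [simpl; ring|].
  simpl dbl. rewrite IH, nome_double, <- Cpow_mult_r. f_equal.
Qed.

(* The defect is divided by 4 under tau -> 2 tau, yet decays like nome(tau). *)
Lemma tE_0 tau : 0 < Im tau -> tE tau = 0.
Proof.
  revert tau. apply doubling_induction.
  - intros tau H E. rewrite tE_double in E by auto.
    replace (tE tau) with (tE tau / 4 * 4)%C by field. rewrite E. ring.
  - destruct (tE_quot 1 Rlt_0_1) as [M HM].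
    (* Once |q| <= 1/8, n doublings give the bound 4^n |q|^(2^n) <= (4/8)^n for the defect at
       tau. *)
    assert (He : 0 < 1 / 8) by lra. destruct (nome_Iinf _ He) as [M' HM'].
    exists (Rmax 0 (Rmax M M')). intros tau Ht.
    assert (L1 := Rmax_l 0 (Rmax M M')). assert (L2 := Rmax_r 0 (Rmax M M')).
    assert (L3 := Rmax_l M M'). assert (L4 := Rmax_r M M').
    assert (H : 0 < Im tau) by lra.
    assert (Hq := HM' tau ltac:(lra)). replace (nome tau - 0)%C with (nome tau) in Hq by ring.
    assert (B : forall n, Cmod (tE tau) <= 1 * (/ 2) ^ n).
    { intro n.
      assert (En : forall n t, 0 < Im t -> Cmod (tE t) = 4 ^ n * Cmod (tE (dbl n t))).
      { clear. induction n as [|n IH]; intros t H; [simpl; ring|].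
        simpl dbl. assert (H2 : 0 < Im (2 * t)%C) by (rewrite Im_double; lra).
        transitivity (4 * (4 ^ n * Cmod (tE (dbl n (2 * t)%C)))); [|simpl; ring].
        rewrite <- IH, tE_double by auto. rewrite Cmod_div by (intro K; injection K; lra).
        rewrite Cmod_R, Rabs_pos_eq by lra. field. }
      rewrite (En n tau H).
      assert (Ib : M < Im (dbl n tau)).
      { rewrite Im_dbl. assert (1 <= 2 ^ n) by (apply pow_R1_Rle; lra).
        assert (1 * Im tau <= 2 ^ n * Im tau) by (apply Rmult_le_compat_r; lra). lra. }
      assert (K := HM _ Ib). replace (tE (dbl n tau) / nome (dbl n tau) - 0)%C
        with (tE (dbl n tau) / nome (dbl n tau))%C in K by ring.
      rewrite Cmod_div in K by apply nome_neq_0.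
      assert (P := proj1 (Cmod_gt_0 _) (nome_neq_0 (dbl n tau))).
      apply (Rmult_lt_compat_r (Cmod (nome (dbl n tau)))) in K; auto.
      unfold Rdiv in K. rewrite Rmult_assoc, Rinv_l, Rmult_1_r, Rmult_1_l in K by lra.
      rewrite nome_dbl, Cmod_pow in K.
      assert (P' := Cmod_ge_0 (nome tau)).
      assert (J := pow_decr (Cmod (nome tau)) n (2 ^ n) ltac:(lra) ltac:(assert (Z := pow2_ge_S n); lia)).
      assert (J' := pow_incr (Cmod (nome tau)) (1 / 8) n ltac:(lra)).
      assert (P4 : 0 < 4 ^ n) by (apply pow_lt; lra).
      apply Rle_trans with (4 ^ n * (1 / 8) ^ n).
      - apply Rmult_le_compat_l; lra.
      - rewrite <- Rpow_mult_distr, Rmult_1_l. replace (4 * (1 / 8)) with (/ 2) by field. lra. }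
    apply Cmod_eq_0. apply Rle_antisym; [|apply Cmod_ge_0]. apply Rnot_lt_le. intro N.
    destruct (geom_lim 1 (/ 2) ltac:(lra) _ N) as [k Hk]. specialize (Hk k (Nat.le_refl _)). specialize (B k).
    assert (A := Rle_abs (1 * (/ 2) ^ k)). lra.
Qed.

Lemma tA2_eq tau : 0 < Im tau ->
  tA2 tau = (2 * (tA1 tau * tA1 tau) / tA tau + tA tau * (tB tau * tB tau) * tC tau / 4)%C.
Proof.
  intro H. destruct (tAB_neq_0 _ H) as [N1 N2]. assert (E := tE_0 tau H).
  replace (tA2 tau) with (2 * (tA1 tau * tA1 tau) / tA tau + tA tau * (tB tau * tB tau) * tC tau / 4 - tA tau * tE tau)%C
    by (unfold tE; field; auto).
  rewrite E. ring.
Qed.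

Lemma tA_plus_1 tau : tA (tau + 1)%C = tB tau.
Proof. unfold tA, tB. now rewrite nome_plus_1. Qed.

Lemma tB_plus_1 tau : tB (tau + 1)%C = tA tau.
Proof. unfold tA, tB. rewrite nome_plus_1. f_equal. ring. Qed.

(** * Hypergeometric series *)

Definition hc (a b c : R) (n : nat) : R :=
  pochhammer a n * pochhammer b n / (pochhammer c n * pochhammer 1 n).

Lemma hypergeometric_CPS a b c z : hypergeometric a b c z = CPS (hc a b c) z.
Proof. reflexivity. Qed.

Lemma pochhammer_pos a n : 0 < a -> 0 < pochhammer a n.
Proof.
  intro Ha. induction n as [|n IH]; simpl; [lra|].
  apply Rmult_lt_0_compat; auto. assert (P := pos_INR n). lra.
Qed.

Section HG.
Context (a b c : R) (Ha : 0 < a) (Hb : 0 < b) (Hac : a <= c) (Hb1 : b <= 1).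

Lemma hc_0 : hc a b c 0 = 1.
Proof. unfold hc. simpl. field. Qed.

Lemma hc_S n : hc a b c (S n) = hc a b c n * ((a + INR n) * (b + INR n) / ((c + INR n) * (1 + INR n))).
Proof.
  unfold hc. simpl pochhammer. assert (P := pos_INR n).
  assert (P1 := pochhammer_pos c n ltac:(lra)). assert (P2 := pochhammer_pos 1 n ltac:(lra)).
  field. repeat split; lra.
Qed.

Lemma hc_rec n : (INR n + 1) * (c + INR n) * hc a b c (S n) = (a + INR n) * (b + INR n) * hc a b c n.
Proof. rewrite hc_S. assert (P := pos_INR n). field. lra. Qed.

Lemma hc_pos n : 0 < hc a b c n.
Proof.
  unfold hc. apply Rdiv_lt_0_compat; apply Rmult_lt_0_compat; apply pochhammer_pos; lra.
Qed.

(** The ratio (a + n)(b + n) / ((c + n)(1 + n)) is at most 1 because a <= c and b <= 1. The bound by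
    1 and the absence of zeros in the disc both rest on this. *)
Lemma hc_decr n : hc a b c (S n) <= hc a b c n.
Proof.
  rewrite hc_S. rewrite <- (Rmult_1_r (hc a b c n)) at 2.
  apply Rmult_le_compat_l; [apply Rlt_le, hc_pos|].
  assert (P := pos_INR n).
  apply (Rmult_le_reg_r ((c + INR n) * (1 + INR n))); [apply Rmult_lt_0_compat; lra|].
  unfold Rdiv. rewrite Rmult_assoc, Rinv_l, Rmult_1_r, Rmult_1_l by (apply Rgt_not_eq, Rmult_lt_0_compat; lra).
  apply Rmult_le_compat; lra.
Qed.

Lemma hc_le_1 n : hc a b c n <= 1.
Proof. induction n as [|n IH]; [rewrite hc_0; lra|]. assert (H := hc_decr n). lra. Qed.

Lemma hc_poly : poly_bd (hc a b c).
Proof.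
  apply (poly_bd_const _ 1). intro n. rewrite Rabs_pos_eq by apply Rlt_le, hc_pos. apply hc_le_1.
Qed.

Definition shiftc (u : nat -> R) (n : nat) : R := match n with O => 0 | S m => u m end.

Lemma poly_bd_shiftc u : poly_bd u -> poly_bd (shiftc u).
Proof.
  intros [K [k H]]. exists (Rabs K), k. intros [|n]; simpl shiftc; assert (Q := Rabs_pos K).
  - rewrite Rabs_R0. apply Rmult_le_pos; auto. apply pow_le. simpl. lra.
  - eapply Rle_trans; [apply H|]. rewrite S_INR. assert (P := pos_INR n).
    apply Rmult_le_compat; try apply Rle_abs.
    + specialize (H O). simpl in H. rewrite Rplus_0_l, pow1 in H. assert (A := Rabs_pos (u O)). lra.
    + apply pow_le. lra.
    + apply pow_incr. lra.
Qed.

Lemma poly_bd_plus u v : poly_bd u -> poly_bd v -> poly_bd (fun n => u n + v n).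
Proof.
  intros [K [k H]] [L [l H']]. exists (Rabs K + Rabs L), (k + l)%nat. intro n.
  assert (P := pos_INR n). assert (Q := Rabs_pos K). assert (Q' := Rabs_pos L).
  assert (A1 : 1 <= (INR n + 1) ^ k) by (apply pow_R1_Rle; lra).
  assert (A2 : 1 <= (INR n + 1) ^ l) by (apply pow_R1_Rle; lra).
  eapply Rle_trans; [apply Rabs_triang|]. rewrite pow_add, Rmult_plus_distr_r.
  apply Rplus_le_compat; (eapply Rle_trans; [apply H || apply H'|]).
  - apply Rle_trans with (Rabs K * (INR n + 1) ^ k); [apply Rmult_le_compat_r; [lra | apply Rle_abs]|].
    apply Rmult_le_compat_l; auto. nra.
  - apply Rle_trans with (Rabs L * (INR n + 1) ^ l); [apply Rmult_le_compat_r; [lra | apply Rle_abs]|].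
    apply Rmult_le_compat_l; auto. nra.
Qed.

Lemma poly_bd_scal x u : poly_bd u -> poly_bd (fun n => x * u n).
Proof.
  intros [K [k H]]. exists (Rabs x * K), k. intro n. rewrite Rabs_mult, Rmult_assoc.
  apply Rmult_le_compat_l; [apply Rabs_pos | apply H].
Qed.

(** Multiplication by z is a shift of the coefficients, so the equation is the two-term recursion
    [hc_rec] read coefficient by coefficient. *)
Lemma hypergeometric_ODE z : Cmod z < 1 ->
  (z * (1 - z) * CPS (dcoef (dcoef (hc a b c))) z + (RtoC c - RtoC (a + b + 1) * z) * CPS (dcoef (hc a b c)) z
   = RtoC (a * b) * CPS (hc a b c) z)%C.
Proof.
  intro Hz. set (h := hc a b c). assert (P0 : poly_bd h) by apply hc_poly.
  assert (P1 := poly_bd_dcoef _ P0). assert (P2 := poly_bd_dcoef _ P1).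
  assert (S1 := poly_bd_shiftc _ P1). assert (S2 := poly_bd_shiftc _ P2). assert (S3 := poly_bd_shiftc _ S2).
  assert (E1 : CPS (fun n => shiftc (dcoef (dcoef h)) n + c * dcoef h n) z
    = (z * CPS (dcoef (dcoef h)) z + RtoC c * CPS (dcoef h) z)%C).
  { rewrite CPS_plus, CPS_scal; auto; [|apply poly_bd_scal; auto]. f_equal. apply CPS_shift; auto. }
  assert (E2 : CPS (fun n => shiftc (shiftc (dcoef (dcoef h))) n + ((a + b + 1) * shiftc (dcoef h) n + a * b * h n)) z
    = (z * (z * CPS (dcoef (dcoef h)) z) + (RtoC (a + b + 1) * (z * CPS (dcoef h) z) + RtoC (a * b) * CPS h z))%C).
  { assert (Q1 := poly_bd_scal (a + b + 1) _ S1). assert (Q2 := poly_bd_scal (a * b) _ P0).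
    assert (Q3 := poly_bd_plus _ _ Q1 Q2).
    rewrite CPS_plus, CPS_plus, !CPS_scal; auto. f_equal; [|f_equal; f_equal].
    - rewrite <- (CPS_shift (dcoef (dcoef h))) by auto. apply CPS_shift; auto.
    - apply CPS_shift; auto. }
  assert (E : CPS (fun n => shiftc (dcoef (dcoef h)) n + c * dcoef h n) z =
    CPS (fun n => shiftc (shiftc (dcoef (dcoef h))) n + ((a + b + 1) * shiftc (dcoef h) n + a * b * h n)) z).
  { apply CPS_ext. intro n. assert (R := hc_rec n). fold h in R.
    (* The single and double shifts put zeros in degrees 0 and 1, which are therefore separate
       cases. *)
    destruct n as [|[|n]]; unfold shiftc, dcoef in *.
    - simpl INR in *. lra.
    - assert (R0 := hc_rec 0). fold h in R0. simpl INR in *. lra.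
    - rewrite !S_INR in *. nra. }
  rewrite E1, E2 in E.
  transitivity ((z * CPS (dcoef (dcoef h)) z + RtoC c * CPS (dcoef h) z)
     - z * (z * CPS (dcoef (dcoef h)) z) - RtoC (a + b + 1) * (z * CPS (dcoef h) z))%C; [ring|].
  rewrite E. ring.
Qed.

(* Enestrom-Kakeya: (1-z)F(z) = 1 - z * (power series with positive coefficients of sum <= 1). *)
Lemma hypergeometric_neq_0 z : Cmod z < 1 -> CPS (hc a b c) z <> 0.
Proof.
  intros Hz E. set (h := hc a b c) in *. assert (P0 : poly_bd h) by apply hc_poly.
  set (d := fun n => h n + - (1) * h (S n)).
  assert (dpos : forall n, 0 <= d n) by (intro n; unfold d; assert (H := hc_decr n); fold h in H; lra).
  assert (PS : poly_bd (fun n => h (S n))).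
  { apply (poly_bd_const _ 1). intro n. rewrite Rabs_pos_eq by apply Rlt_le, hc_pos. apply hc_le_1. }
  assert (E1 : CPS d z = (CPS h z + RtoC (- (1)) * CPS (fun n => h (S n)) z)%C).
  { unfold d. rewrite CPS_plus, CPS_scal; auto. apply poly_bd_scal; auto. }
  assert (E2 := CPS_unshift h P0 z Hz). rewrite E in E1, E2.
  assert (h0 : h O = 1) by apply hc_0. rewrite h0 in E2.
  assert (E3 : (z * CPS d z)%C = RtoC 1).
  { rewrite E1. transitivity (1 - (1 + z * CPS (fun n => h (S n)) z))%C; [|rewrite <- E2; ring].
    rewrite RtoC_opp. ring. }
  assert (B : Cmod (CPS d z) <= 1).
  { apply (Clf_le eventually (Csum (fun n => RtoC (d n) * z ^ n)%C)).
    - exists O. intros n _.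
      assert (K : Cmod (Csum (fun n => RtoC (d n) * z ^ n)%C n) <= 1 - h n).
      { induction n as [|n IH]; [simpl; rewrite Cmod_0; lra|].
        simpl. eapply Rle_trans; [apply Cmod_triangle|].
        rewrite Cmod_mult, Cmod_R, Rabs_pos_eq, Cmod_pow by auto.
        assert (Q : Cmod z ^ n <= 1).
        { rewrite <- (pow1 n). apply pow_incr. split; [apply Cmod_ge_0 | lra]. }
        assert (d n * Cmod z ^ n <= d n * 1) by (apply Rmult_le_compat_l; auto).
        unfold d in *. lra. }
      assert (Q := hc_pos n). fold h in Q. lra.
    - apply CPS_correct; auto. unfold d. apply poly_bd_plus; auto. apply poly_bd_scal; auto. }
  apply (f_equal Cmod) in E3. rewrite Cmod_mult, Cmod_1 in E3.
  assert (A := Cmod_ge_0 z). assert (A' := Cmod_ge_0 (CPS d z)). nra.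
Qed.
End HG.

Lemma CPS_const_1 z : Cmod z < 1 -> ((1 - z) * CPS (fun _ => 1) z = 1)%C.
Proof.
  intro Hz. assert (P : poly_bd (fun _ => 1)) by (apply (poly_bd_const _ 1); intro; rewrite Rabs_R1; lra).
  assert (E := CPS_unshift (fun _ => 1) P z Hz). simpl in E.
  transitivity (CPS (fun _ => 1) z - z * CPS (fun _ => 1) z)%C; [ring|]. rewrite E at 1. ring.
Qed.

Lemma Abel_bound (b : nat -> R) K N e x : 0 <= x < 1 -> 0 <= K -> 0 <= e -> (forall n, Rabs (b n) <= K) ->
  (forall n, (N <= n)%nat -> Rabs (b n) <= e) -> Cmod (CPS b (RtoC x)) <= K * INR N + e / (1 - x).
Proof.
  intros Hx HK He Hb Hbe. apply (Clf_le eventually (Csum (fun n => RtoC (b n) * RtoC x ^ n)%C)).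
  - exists O. intros n _.
    assert (H : Cmod (Csum (fun n => RtoC (b n) * RtoC x ^ n)%C n) <= K * INR (Nat.min n N) + e * ((1 - x ^ n) / (1 - x))).
    { induction n as [|n IH].
      - simpl. rewrite Cmod_0. replace (e * ((1 - 1) / (1 - x))) with 0 by (field; lra). lra.
      - simpl Csum. eapply Rle_trans; [apply Cmod_triangle|].
        rewrite Cmod_mult, Cmod_pow, !Cmod_R, (Rabs_pos_eq x) by lra.
        assert (Pn : 0 <= x ^ n <= 1).
        { split; [apply pow_le; lra|]. rewrite <- (pow1 n). apply pow_incr. lra. }
        replace ((1 - x ^ S n) / (1 - x)) with ((1 - x ^ n) / (1 - x) + x ^ n) by (simpl; field; lra).
        destruct (Nat.le_gt_cases N n) as [L|L].
        + rewrite Nat.min_r in IH |- * by lia. specialize (Hbe n L).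
          assert (Rabs (b n) * x ^ n <= e * x ^ n) by (apply Rmult_le_compat_r; lra). lra.
        + rewrite Nat.min_l in IH |- * by lia. rewrite S_INR. specialize (Hb n).
          assert (A := Rabs_pos (b n)).
          assert (Rabs (b n) * x ^ n <= K * 1) by (apply Rmult_le_compat; lra).
          assert (0 <= e * x ^ n) by (apply Rmult_le_pos; lra). lra. }
    eapply Rle_trans; [exact H|]. apply Rplus_le_compat.
    + apply Rmult_le_compat_l; auto. apply le_INR. lia.
    + unfold Rdiv. apply Rmult_le_compat_l; auto. rewrite <- (Rmult_1_l (/ (1 - x))) at 2.
      apply Rmult_le_compat_r; [apply Rlt_le, Rinv_0_lt_compat; lra|].
      assert (0 <= x ^ n) by (apply pow_le; lra). lra.
  - apply CPS_correct; [apply (poly_bd_const _ K); auto|]. rewrite Cmod_R, Rabs_pos_eq; lra.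
Qed.

Lemma lim_seq_bounded (b : nat -> R) l : is_lim_seq b (Finite l) -> exists M, forall n, Rabs (b n) <= M.
Proof.
  intro H. apply is_lim_seq_spec in H. destruct (H (mkposreal 1 Rlt_0_1)) as [N HN]. simpl in HN.
  assert (Q : exists M, forall n, (n < N)%nat -> Rabs (b n) <= M).
  { clear HN. induction N as [|N [M HM]]; [exists 0; intros; lia|].
    exists (Rmax M (Rabs (b N))). intros n Hn. destruct (Nat.eq_dec n N) as [->|Hne]; [apply Rmax_r|].
    eapply Rle_trans; [apply HM; lia | apply Rmax_l]. }
  destruct Q as [M HM]. exists (Rmax M (Rabs l + 1)). intro n.
  destruct (Nat.lt_ge_cases n N) as [L|L].
  - eapply Rle_trans; [apply HM, L | apply Rmax_l].
  - eapply Rle_trans; [|apply Rmax_r]. specialize (HN n L).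
    replace (b n) with ((b n - l) + l) by ring. eapply Rle_trans; [apply Rabs_triang|]. lra.
Qed.

(** Subtracting l (1 - x) times the geometric series reduces to limit 0, where [Abel_bound] splits
    the series at N. Applied to derived coefficients (n + 1) h_(n+1), it says that (1 - x) times the
    derivative tends to lim n h_n: the logarithmic growth of the series at 1. *)
Lemma Abel_limit {T} (F : (T -> Prop) -> Prop) {FF : Filter F} (x : T -> R) (b : nat -> R) l :
  is_lim_seq b (Finite l) -> F (fun t => 0 <= x t < 1) -> Clf F (fun t => RtoC (x t)) 1 ->
  Clf F (fun t => (1 - RtoC (x t)) * CPS b (RtoC (x t)))%C (RtoC l).
Proof.
  intros Hb Hx Hl e He.
  assert (Hbd : exists K, 0 < K /\ forall n, Rabs (b n + - (1) * l) <= K).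
  { destruct (lim_seq_bounded b l Hb) as [M HM].
    exists (Rabs M + Rabs l + 1). assert (P1 := Rabs_pos M). assert (P2 := Rabs_pos l). split; [lra|].
    intro n. eapply Rle_trans; [apply Rabs_triang|]. rewrite Rabs_mult, Rabs_Ropp, Rabs_R1, Rmult_1_l.
    specialize (HM n). assert (Q := Rle_abs M). lra. }
  destruct Hbd as [K [HK Hbd]].
  apply is_lim_seq_spec in Hb. assert (He2 : 0 < e / 2) by lra.
  destruct (Hb (mkposreal _ He2)) as [N HN]. simpl in HN.
  assert (Hd : 0 < e / (4 * (K * INR N + 1))).
  { assert (0 <= K * INR N) by (apply Rmult_le_pos; [lra | apply pos_INR]). apply Rdiv_lt_0_compat; lra. }
  generalize (filter_and _ _ Hx (Hl _ Hd)). apply filter_imp. intros t [H1 H2].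
  rewrite Cmod_sym, <- RtoC_minus, Cmod_R, Rabs_pos_eq in H2 by lra.
  assert (Hm : Cmod (RtoC (x t)) < 1) by (rewrite Cmod_R, Rabs_pos_eq; lra).
  assert (Pb : poly_bd b).
  { apply (poly_bd_const _ (K + Rabs l)). intro n. specialize (Hbd n).
    replace (b n) with ((b n + - (1) * l) + l) by ring. eapply Rle_trans; [apply Rabs_triang|]. lra. }
  assert (E : ((1 - RtoC (x t)) * CPS b (RtoC (x t)) - RtoC l)%C
    = ((1 - RtoC (x t)) * CPS (fun n => b n + - (1) * l)%R (RtoC (x t)))%C).
  { rewrite CPS_plus; auto.
    - rewrite (CPS_ext (fun _ => - (1) * l) (fun _ => (- (1) * l) * 1)) by (intro; ring).
      rewrite CPS_scal; auto.
      + assert (G := CPS_const_1 _ Hm).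
        transitivity ((1 - RtoC (x t)) * CPS b (RtoC (x t)) - RtoC l * ((1 - RtoC (x t)) * CPS (fun _ => 1) (RtoC (x t))))%C.
        * rewrite G. ring.
        * rewrite RtoC_mult, RtoC_opp. ring.
      + apply (poly_bd_const _ 1); intro; rewrite Rabs_R1; lra.
    - apply (poly_bd_const _ (Rabs (- (1) * l))). intro. lra. }
  rewrite E, Cmod_mult, <- RtoC_minus, Cmod_R, Rabs_pos_eq by lra.
  assert (B := Abel_bound (fun n => b n + - (1) * l) K N (e / 2) (x t) H1 ltac:(lra) ltac:(lra) Hbd).
  assert (B' : Cmod (CPS (fun n => b n + - (1) * l) (RtoC (x t))) <= K * INR N + e / 2 / (1 - x t)).
  { apply B. intros n Hn. apply Rlt_le. specialize (HN n Hn). replace (b n - l) with (b n + - (1) * l) in HN by ring. exact HN. }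
  apply Rle_lt_trans with ((1 - x t) * (K * INR N + e / 2 / (1 - x t))).
  - apply Rmult_le_compat_l; lra.
  - replace ((1 - x t) * (K * INR N + e / 2 / (1 - x t))) with ((1 - x t) * (K * INR N) + e / 2) by (field; lra).
    assert (P : 0 <= K * INR N) by (apply Rmult_le_pos; [lra | apply pos_INR]).
    assert (Q : (1 - x t) * (K * INR N + 1) < e / 4).
    { apply (Rmult_lt_compat_r (K * INR N + 1)) in H2; [|lra].
      replace (e / (4 * (K * INR N + 1)) * (K * INR N + 1)) with (e / 4) in H2 by (field; lra). exact H2. }
    nra.
Qed.

(** * Wallis' product and the beta function *)

(** The central binomial coefficient divided by 4^n. *)
Definition wcoef (n : nat) : R := pochhammer (1 / 2) n / pochhammer 1 n.

Lemma wcoef_pos n : 0 < wcoef n.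
Proof. apply Rdiv_lt_0_compat; apply pochhammer_pos; lra. Qed.

Lemma wcoef_S n : wcoef (S n) * (INR n + 1) = wcoef n * (INR n + 1 / 2).
Proof.
  unfold wcoef. simpl pochhammer. assert (P := pos_INR n).
  assert (P2 := pochhammer_pos 1 n ltac:(lra)). field. lra.
Qed.

Definition cosint (n : nat) : R := RInt (fun t => cos t ^ n) 0 (PI / 2).

Lemma cos_pow_continuous n t : continuous (fun t => cos t ^ n) t.
Proof.
  apply (ex_derive_continuous (V := R_NormedModule)). auto_derive. exact I.
Qed.

Lemma cos_pow_ex n : ex_RInt (fun t => cos t ^ n) 0 (PI / 2).
Proof. apply (ex_RInt_continuous (V := R_CompleteNormedModule)). intros; apply cos_pow_continuous. Qed.

(** The integrand is the derivative of cos^(n+1) sin, which vanishes at both ends. *)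
Lemma cosint_rec n : (INR n + 2) * cosint (S (S n)) = (INR n + 1) * cosint n.
Proof.
  assert (H : is_RInt (fun t => (INR n + 2) * cos t ^ S (S n) - (INR n + 1) * cos t ^ n) 0 (PI / 2)
    (minus (cos (PI / 2) ^ S n * sin (PI / 2)) (cos 0 ^ S n * sin 0))).
  { apply (is_RInt_derive (V := R_CompleteNormedModule) (fun t => cos t ^ S n * sin t)).
    - intros t _. auto_derive; [exact I|].
      assert (E := sin2_cos2 t). unfold Rsqr in E.
      replace (match n with O => 1 | S _ => INR n + 1 end) with (INR n + 1) by (destruct n; simpl; ring).
      simpl. assert (E' : sin t * sin t = 1 - cos t * cos t) by lra.
      match goal with |- ?l = _ => replace l with (cos t * (cos t * cos t ^ n) - (INR n + 1) * cos t ^ n * (sin t * sin t)) by ring end.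
      rewrite E'. ring.
    - intros t _. apply (ex_derive_continuous (V := R_NormedModule)). auto_derive. exact I. }
  apply (is_RInt_unique (V := R_CompleteNormedModule)) in H. rewrite cos_PI2, sin_0, Rmult_0_r in H.
  rewrite (RInt_minus (V := R_CompleteNormedModule) (fun t => (INR n + 2) * cos t ^ S (S n)) (fun t => (INR n + 1) * cos t ^ n)) in H
    by (apply (ex_RInt_scal (V := R_NormedModule)); apply cos_pow_ex).
  rewrite !(RInt_scal (V := R_CompleteNormedModule)) in H by apply cos_pow_ex.
  unfold minus, plus, opp, scal, mult in H; simpl in H. unfold cosint. simpl. unfold mult in H; simpl in H. lra.
Qed.

Lemma cosint_0 : cosint 0 = PI / 2.
Proof.
  unfold cosint. simpl. rewrite RInt_const. unfold scal; simpl; unfold mult; simpl. ring.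
Qed.

Lemma cosint_1 : cosint 1 = 1.
Proof.
  assert (H : is_RInt (fun t => cos t ^ 1) 0 (PI / 2) (minus (sin (PI / 2)) (sin 0))).
  { apply (is_RInt_derive (V := R_CompleteNormedModule) sin (fun t => cos t ^ 1)).
    - intros t _. auto_derive; [exact I | simpl; ring].
    - intros t _. apply cos_pow_continuous. }
  apply (is_RInt_unique (V := R_CompleteNormedModule)) in H. unfold cosint. rewrite H, sin_PI2, sin_0.
  unfold minus, plus, opp; simpl. ring.
Qed.

Lemma cosint_decr n : cosint (S n) <= cosint n.
Proof.
  assert (P := PI_RGT_0). unfold cosint. apply RInt_le; try apply cos_pow_ex; [lra|].
  intros t Ht. assert (0 < cos t) by (apply cos_gt_0; lra). assert (C := COS_bound t).
  simpl. rewrite <- (Rmult_1_l (cos t ^ n)) at 2. apply Rmult_le_compat_r; [apply pow_le|]; lra.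
Qed.

Lemma cosint_even n : cosint (2 * n) = PI / 2 * wcoef n.
Proof.
  induction n as [|n IH].
  - simpl. rewrite cosint_0. unfold wcoef. simpl. field.
  - replace (2 * S n)%nat with (S (S (2 * n))) by lia. assert (R := cosint_rec (2 * n)). rewrite IH in R.
    assert (W := wcoef_S n). rewrite mult_INR in R. replace (INR 2) with 2 in R by (simpl; ring). assert (P := pos_INR n).
    apply (Rmult_eq_reg_l (2 * INR n + 2)); [|lra]. rewrite R.
    replace ((2 * INR n + 2) * (PI / 2 * wcoef (S n))) with (PI * (wcoef (S n) * (INR n + 1))) by field.
    rewrite W. field.
Qed.

Lemma cosint_odd n : cosint (S (2 * n)) * ((2 * INR n + 1) * wcoef n) = 1.
Proof.
  induction n as [|n IH].
  - simpl (S (2 * 0)). rewrite cosint_1. unfold wcoef. simpl. field.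
  - replace (S (2 * S n)) with (S (S (S (2 * n)))) by lia. assert (R := cosint_rec (S (2 * n))).
    assert (W := wcoef_S n). rewrite S_INR, mult_INR in R. replace (INR 2) with 2 in R by (simpl; ring). rewrite S_INR. assert (P := pos_INR n).
    set (X := cosint (S (S (S (2 * n))))) in *. set (Y := cosint (S (2 * n))) in *.
    replace (2 * (INR n + 1) + 1) with (2 * INR n + 3) by ring.
    replace (X * ((2 * INR n + 3) * wcoef (S n))) with (((2 * INR n + 1 + 2) * X) * wcoef (S n)) by ring.
    rewrite R. replace ((2 * INR n + 1 + 1) * Y * wcoef (S n)) with (2 * Y * (wcoef (S n) * (INR n + 1))) by ring.
    rewrite W. lra.
Qed.

(** [cosint] decreases and has closed forms at even and odd indices; comparing the index 2 n + 2
    with 2 n + 3 and with 2 n + 1 gives the two bounds. *)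
Lemma Wallis_bounds n : 2 / PI <= (2 * INR (S n) + 1) * (wcoef (S n) * wcoef (S n)) /\
  2 * INR (S n) * (wcoef (S n) * wcoef (S n)) <= 2 / PI.
Proof.
  assert (P := PI_RGT_0). assert (A := cosint_odd (S n)). assert (B := cosint_odd n).
  assert (E := cosint_even (S n)). assert (D1 := cosint_decr (2 * S n)).
  assert (D2 := cosint_decr (S (2 * n))). replace (S (S (2 * n))) with (2 * S n)%nat in D2 by lia.
  rewrite E in D1, D2. assert (W := wcoef_S n). assert (Wp := wcoef_pos (S n)). assert (Wp' := wcoef_pos n).
  rewrite S_INR in *. assert (Pn := pos_INR n). set (w := wcoef (S n)) in *.
  set (X := cosint (S (2 * S n))) in *. set (Y := cosint (S (2 * n))) in *.
  split.
  - apply (Rmult_le_reg_l (PI / 2)); [lra|]. replace (PI / 2 * (2 / PI)) with 1 by (field; lra).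
    apply Rle_trans with (X * ((2 * (INR n + 1) + 1) * w)); [lra|]. replace (PI / 2 * ((2 * (INR n + 1) + 1) * (w * w))) with ((PI / 2 * w) * ((2 * (INR n + 1) + 1) * w)) by ring.
    apply Rmult_le_compat_r; [|exact D1]. apply Rmult_le_pos; lra.
  - apply (Rmult_le_reg_l (PI / 2)); [lra|]. replace (PI / 2 * (2 / PI)) with 1 by (field; lra).
    apply Rle_trans with (Y * ((2 * INR n + 1) * wcoef n)); [|lra]. replace (PI / 2 * (2 * (INR n + 1) * (w * w))) with ((PI / 2 * w) * (2 * (w * (INR n + 1)))) by ring.
    rewrite W. replace ((2 * INR n + 1) * wcoef n) with (2 * (wcoef n * (INR n + 1 / 2))) by field.
    apply Rmult_le_compat_r; [|exact D2]. apply Rmult_le_pos; [lra|]. apply Rmult_le_pos; lra.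
Qed.

Lemma hc_half n : hc (1 / 2) (1 / 2) 1 n = wcoef n * wcoef n.
Proof. unfold hc, wcoef. assert (P2 := pochhammer_pos 1 n ltac:(lra)). field. lra. Qed.

Lemma lim_div_SS : is_lim_seq (fun n => (INR n + 1) / (INR n + 2)) 1.
Proof.
  apply is_lim_seq_spec. intro eps. destruct (archimed_cor1 eps (cond_pos eps)) as [N [HN HN0]].
  exists N. intros n Hn. assert (P := pos_INR n).
  replace ((INR n + 1) / (INR n + 2) - 1) with (- / (INR n + 2)) by (field; lra).
  rewrite Rabs_Ropp, Rabs_pos_eq by (apply Rlt_le, Rinv_0_lt_compat; lra).
  eapply Rle_lt_trans; [|exact HN]. apply Rinv_le_contravar; [apply lt_0_INR; auto|].
  apply le_INR in Hn. lra.
Qed.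

(** Wallis' product as an asymptotic for the coefficients of the complete elliptic integral; it
    becomes the slope in [K1_axis]. *)
Lemma Wallis_limit : is_lim_seq (dcoef (hc (1 / 2) (1 / 2) 1)) (1 / PI).
Proof.
  assert (P := PI_RGT_0).
  apply (is_lim_seq_le_le (fun n => 1 / PI * ((INR n + 1) / (INR n + 2))) _ (fun _ => 1 / PI)).
  - intro n. unfold dcoef. rewrite hc_half. destruct (Wallis_bounds n) as [A B]. rewrite S_INR in *.
    assert (Pn := pos_INR n). set (y := wcoef (S n) * wcoef (S n)) in *.
    assert (E : 2 / PI = 2 * (1 / PI)) by (field; lra). rewrite E in A, B. split; [|lra].
    assert (Hy : 0 < y) by (apply Rmult_lt_0_compat; apply wcoef_pos).
    apply (Rmult_le_reg_r (INR n + 2)); [lra|].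
    replace (1 / PI * ((INR n + 1) / (INR n + 2)) * (INR n + 2)) with ((1 / PI) * (INR n + 1)) by (field; lra).
    apply Rle_trans with (((2 * (INR n + 1) + 1) * y / 2) * (INR n + 1)); [apply Rmult_le_compat_r; lra|]. nra.
  - 
    assert (L := is_lim_seq_scal_l _ (1 / PI) 1 lim_div_SS). simpl in L. rewrite Rmult_1_r in L. exact L.
  - apply is_lim_seq_const.
Qed.

(** * Truncated beta integrals *)

Definition bint (s t : R) : R := Rpower t (s - 1) * Rpower (1 - t) (1 / 2 - 1).
Definition bprim (s t : R) : R := Rpower t s * Rpower (1 - t) (1 / 2).
(** The integral for B(s, 1/2) cut off to [a, b]. The recursions hold exactly for it, up to boundary
    terms [bprim], and the limit a -> 0+, b -> 1- along [Fb] is taken afterwards. *)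
Definition bK (s : R) (ab : R * R) : R := RInt (bint s) (fst ab) (snd ab).
Definition Fb : (R * R -> Prop) -> Prop := filter_prod (at_right 0) (at_left 1).

Lemma Rpower_pred t s : 0 < t -> Rpower t s = t * Rpower t (s - 1).
Proof.
  intro Ht. rewrite <- (Rpower_1 t Ht) at 2. rewrite <- Rpower_plus. f_equal. ring.
Qed.

Lemma bint_continuous s t : 0 < t < 1 -> continuous (bint s) t.
Proof.
  intro Ht. apply (ex_derive_continuous (V := R_NormedModule)). unfold bint, Rpower. auto_derive. lra.
Qed.

Lemma bint_ex s a b : 0 < a < 1 -> 0 < b < 1 -> ex_RInt (bint s) a b.
Proof.
  intros Ha Hb. apply (ex_RInt_continuous (V := R_CompleteNormedModule)). intros t Ht. apply bint_continuous.
  split.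
  - eapply Rlt_le_trans; [|apply Ht]. apply Rmin_pos; lra.
  - eapply Rle_lt_trans; [apply Ht|]. apply Rmax_lub_lt; lra.
Qed.

Lemma bprim_der s t : 0 < t < 1 -> is_derive (bprim s) t (s * bint s t - (s + 1 / 2) * bint (s + 1) t).
Proof.
  intro Ht. unfold bprim.
  assert (D : is_derive (fun t => Rpower t s * Rpower (1 - t) (1 / 2)) t
    (Rpower t s * (s / t) * Rpower (1 - t) (1 / 2) - Rpower t s * (Rpower (1 - t) (1 / 2) * (1 / 2 / (1 - t))))).
  { unfold Rpower. auto_derive; [lra|]. replace (1 + - t) with (1 - t) by ring. field. lra. }
  replace (s * bint s t - (s + 1 / 2) * bint (s + 1) t) with
    (Rpower t s * (s / t) * Rpower (1 - t) (1 / 2) - Rpower t s * (Rpower (1 - t) (1 / 2) * (1 / 2 / (1 - t)))); [exact D|].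
  unfold bint. replace (s + 1 - 1) with s by ring.
  rewrite (Rpower_pred t s) by lra. rewrite (Rpower_pred (1 - t) (1 / 2)) by lra. field. lra.
Qed.

(** Integrating the derivative of t^s (1 - t)^(1/2) gives B(s + 1, 1/2) = s / (s + 1/2) B(s, 1/2)
    together with its boundary terms. *)
Lemma bK_rec s a b : 0 < a < 1 -> 0 < b < 1 ->
  s * bK s (a, b) - (s + 1 / 2) * bK (s + 1) (a, b) = bprim s b - bprim s a.
Proof.
  intros Ha Hb.
  assert (In : forall t, Rmin a b <= t <= Rmax a b -> 0 < t < 1).
  { intros t Ht. split.
    - eapply Rlt_le_trans; [|apply Ht]. apply Rmin_pos; lra.
    - eapply Rle_lt_trans; [apply Ht|]. apply Rmax_lub_lt; lra. }
  assert (H : is_RInt (fun t => s * bint s t - (s + 1 / 2) * bint (s + 1) t) a b (minus (bprim s b) (bprim s a))).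
  { apply (is_RInt_derive (V := R_CompleteNormedModule) (bprim s)).
    - intros t Ht. apply bprim_der, In, Ht.
    - intros t Ht. apply (ex_derive_continuous (V := R_NormedModule)). specialize (In t Ht).
      unfold bint, Rpower. auto_derive. lra. }
  apply (is_RInt_unique (V := R_CompleteNormedModule)) in H.
  rewrite (RInt_minus (V := R_CompleteNormedModule) (fun t => s * bint s t) (fun t => (s + 1 / 2) * bint (s + 1) t)) in H
    by (apply (ex_RInt_scal (V := R_NormedModule)); apply bint_ex; auto).
  rewrite !(RInt_scal (V := R_CompleteNormedModule)) in H by (apply bint_ex; auto).
  exact H.
Qed.

Global Instance Fb_filter : ProperFilter Fb.
Proof. apply filter_prod_proper. Qed.

Lemma Fb_near d : 0 < d -> Fb (fun ab => 0 < fst ab < d /\ 1 - d < snd ab < 1).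
Proof.
  intro Hd. apply (Filter_prod _ _ _ (fun a => 0 < a < d) (fun b => 1 - d < b < 1)).
  - exists (mkposreal d Hd). intros y Hy Hy0. change (Rabs (y - 0) < d) in Hy.
    rewrite Rminus_0_r, Rabs_pos_eq in Hy by lra. lra.
  - exists (mkposreal d Hd). intros y Hy Hy0. change (Rabs (y - 1) < d) in Hy.
    rewrite Rabs_left in Hy by lra. lra.
  - intros a b Ha Hb. simpl. auto.
Qed.

Definition L2 (f : R * R -> R) (l : R) : Prop := forall e, 0 < e -> Fb (fun ab => Rabs (f ab - l) < e).

Lemma L2_ext f g l : Fb (fun ab => f ab = g ab) -> L2 f l -> L2 g l.
Proof.
  intros H Hf e He. generalize (filter_and _ _ H (Hf e He)). apply filter_imp. intros ab [<- K]. exact K.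
Qed.

Lemma L2_val f l m : l = m -> L2 f l -> L2 f m.
Proof. intros <-. auto. Qed.

Lemma L2_plus f g l m : L2 f l -> L2 g m -> L2 (fun ab => f ab + g ab) (l + m).
Proof.
  intros Hf Hg e He. assert (He2 : 0 < e / 2) by lra.
  generalize (filter_and _ _ (Hf _ He2) (Hg _ He2)). apply filter_imp. intros ab [A B].
  replace (f ab + g ab - (l + m)) with ((f ab - l) + (g ab - m)) by ring.
  eapply Rle_lt_trans; [apply Rabs_triang|]. lra.
Qed.

Lemma L2_scal c f l : L2 f l -> L2 (fun ab => c * f ab) (c * l).
Proof.
  intros Hf e He. assert (P := Rabs_pos c).
  assert (He2 : 0 < e / (Rabs c + 1)) by (apply Rdiv_lt_0_compat; lra).
  generalize (Hf _ He2). apply filter_imp. intros ab A.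
  rewrite <- Rmult_minus_distr_l, Rabs_mult.
  apply (Rmult_lt_compat_r (Rabs c + 1)) in A; [|lra].
  replace (e / (Rabs c + 1) * (Rabs c + 1)) with e in A by (field; lra).
  assert (Q := Rabs_pos (f ab - l)). nra.
Qed.

Lemma Rpower_small s e : 0 < s -> 0 < e -> forall t, 0 < t < Rpower e (/ s) -> Rpower t s < e.
Proof.
  intros Hs He t Ht. apply Rlt_le_trans with (Rpower (Rpower e (/ s)) s).
  - apply Rlt_Rpower_l; lra.
  - rewrite Rpower_mult, Rinv_l, Rpower_1 by lra. lra.
Qed.

Lemma Rpower_le_1 t s : 0 <= s -> 0 < t < 1 -> 0 < Rpower t s <= 1.
Proof.
  intros Hs Ht. split; [apply exp_pos|]. rewrite <- (Rpower_O t) by lra.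
  destruct (Req_dec s 0) as [->|N]; [lra|]. unfold Rpower.
  apply Rlt_le, exp_increasing. assert (ln t < 0) by (rewrite <- ln_1; apply ln_increasing; lra).
  assert (s * ln t < s * 0) by (apply Rmult_lt_compat_l; lra). lra.
Qed.

Lemma bprim_lim s : 0 < s -> L2 (fun ab => bprim s (snd ab) - bprim s (fst ab)) 0.
Proof.
  intros Hs e He. set (d := Rmin (1 / 2) (Rmin (Rpower (e / 2) (/ s)) (Rpower (e / 2) (/ (1 / 2))))).
  assert (Hd : 0 < d) by (unfold d; repeat apply Rmin_pos; try apply exp_pos; lra).
  assert (d1 : d <= 1 / 2) by apply Rmin_l.
  assert (d2 : d <= Rpower (e / 2) (/ s)) by (unfold d; eapply Rle_trans; [apply Rmin_r | apply Rmin_l]).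
  assert (d3 : d <= Rpower (e / 2) (/ (1 / 2))) by (unfold d; eapply Rle_trans; [apply Rmin_r | apply Rmin_r]).
  generalize (Fb_near d Hd). apply filter_imp. intros [a b] [A B]. simpl in *.
  assert (Ha := Rpower_small s (e / 2) Hs ltac:(lra) a ltac:(lra)).
  assert (Hb := Rpower_small (1 / 2) (e / 2) ltac:(lra) ltac:(lra) (1 - b) ltac:(lra)).
  assert (A1 := Rpower_le_1 a s ltac:(lra) ltac:(lra)). assert (A2 := Rpower_le_1 (1 - a) (1 / 2) ltac:(lra) ltac:(lra)).
  assert (B1 := Rpower_le_1 b s ltac:(lra) ltac:(lra)). assert (B2 := Rpower_le_1 (1 - b) (1 / 2) ltac:(lra) ltac:(lra)).
  unfold bprim.
  assert (0 < Rpower a s * Rpower (1 - a) (1 / 2) < e / 2) by nra.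
  assert (0 < Rpower b s * Rpower (1 - b) (1 / 2) < e / 2) by nra.
  apply Rabs_lt_between. lra.
Qed.

Lemma sqrt_near_1 e : 0 < e -> forall a, 0 < a < Rmin e 1 -> Rabs (Rpower (1 - a) (1 / 2) - 1) < e.
Proof.
  intros He a Ha. assert (M1 := Rmin_l e 1). assert (M2 := Rmin_r e 1).
  assert (B := Rpower_le_1 (1 - a) (1 / 2) ltac:(lra) ltac:(lra)).
  assert (E : Rpower (1 - a) (1 / 2) * Rpower (1 - a) (1 / 2) = 1 - a).
  { rewrite <- Rpower_plus. replace (1 / 2 + 1 / 2) with 1 by field. apply Rpower_1. lra. }
  apply Rabs_lt_between. nra.
Qed.

Lemma bK_1 : L2 (bK 1) 2.
Proof.
  apply (L2_ext (fun ab => 2 * Rpower (1 - fst ab) (1 / 2) + - 2 * Rpower (1 - snd ab) (1 / 2))).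
  - generalize (Fb_near (1 / 2) ltac:(lra)). apply filter_imp. intros [a b] [A B]. simpl in *.
    (* At s = 0 the recursion loses its first term and evaluates the integral of (1 - t)^(-1/2). *)
    assert (R := bK_rec 0 a b ltac:(lra) ltac:(lra)). unfold bprim in R. rewrite !Rpower_O in R by lra.
    replace (0 + 1) with 1 in R by ring. lra.
  - apply (L2_val _ (2 * 1 + -2 * 0)); [ring|]. apply L2_plus; apply L2_scal; intros e He.
    + assert (Hm : 0 < Rmin e 1) by (apply Rmin_pos; lra). generalize (Fb_near _ Hm).
      apply filter_imp. intros [a b] [A B]. simpl in *. apply sqrt_near_1; auto.
    + assert (Hd : 0 < Rmin (1 / 2) (Rpower e (/ (1 / 2)))) by (apply Rmin_pos; [lra | apply exp_pos]).
      generalize (Fb_near _ Hd). apply filter_imp. intros [a b] [A B]. simpl in *.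
      assert (M1 := Rmin_l (1 / 2) (Rpower e (/ (1 / 2)))). assert (M2 := Rmin_r (1 / 2) (Rpower e (/ (1 / 2)))).
      assert (H := Rpower_small (1 / 2) e ltac:(lra) He (1 - b) ltac:(lra)).
      assert (H' := Rpower_le_1 (1 - b) (1 / 2) ltac:(lra) ltac:(lra)).
      apply Rabs_lt_between. lra.
Qed.

Lemma bK_step s l : 0 < s -> L2 (bK s) l -> L2 (bK (s + 1)) (s / (s + 1 / 2) * l).
Proof.
  intros Hs H. apply (L2_ext (fun ab => s / (s + 1 / 2) * bK s ab + - / (s + 1 / 2) * (bprim s (snd ab) - bprim s (fst ab)))).
  - assert (Hh : 0 < 1 / 2) by lra.
    generalize (Fb_near (1 / 2) Hh). apply filter_imp. intros [a b] [A B]. simpl in *.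
    rewrite <- (bK_rec s a b) by lra. field. lra.
  - replace (s / (s + 1 / 2) * l) with (s / (s + 1 / 2) * l + - / (s + 1 / 2) * 0) by ring.
    apply L2_plus; apply L2_scal; auto. apply bprim_lim, Hs.
Qed.

Lemma bK_int n : L2 (bK (INR n + 1)) (/ ((INR n + 1 / 2) * wcoef n)).
Proof.
  induction n as [|n IH].
  - simpl. rewrite Rplus_0_l. replace (/ ((0 + 1 / 2) * wcoef 0)) with 2 by (unfold wcoef; simpl; field). apply bK_1.
  - assert (P := pos_INR n). apply bK_step in IH; [|lra]. rewrite S_INR.
    assert (W := wcoef_S n). assert (Wp := wcoef_pos n). assert (Wp' := wcoef_pos (S n)).
    replace (/ ((INR n + 1 + 1 / 2) * wcoef (S n))) with ((INR n + 1) / (INR n + 1 + 1 / 2) * / ((INR n + 1 / 2) * wcoef n)); [exact IH|].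
    rewrite <- (Rmult_comm (wcoef n)), <- W. field. repeat split; lra.
Qed.

(** The product of the factors s / (s + 1/2) for s = 1/6, 7/6, ..., that is, B(n + 1/6, 1/2) /
    B(1/6, 1/2). *)
Definition vcoef (n : nat) : R := pochhammer (1 / 6) n / pochhammer (2 / 3) n.

Lemma vcoef_pos n : 0 < vcoef n.
Proof. apply Rdiv_lt_0_compat; apply pochhammer_pos; lra. Qed.

Lemma hc_vw n : hc (1 / 6) (1 / 2) (2 / 3) n = vcoef n * wcoef n.
Proof.
  unfold hc, vcoef, wcoef. assert (P2 := pochhammer_pos 1 n ltac:(lra)). assert (P3 := pochhammer_pos (2 / 3) n ltac:(lra)).
  field. lra.
Qed.

(** Formulated as a difference tending to 0, since the convergence of the integral for B(1/6, 1/2)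
    itself is established only in [bK_sixth_lim]. *)
Lemma bK_sixth n : L2 (fun ab => bK (1 / 6) ab + - / vcoef n * bK (INR n + 1 / 6) ab) 0.
Proof.
  induction n as [|n IH].
  - apply (L2_ext (fun _ => 0)).
    + apply filter_forall. intro ab. simpl. rewrite Rplus_0_l. unfold vcoef. simpl. field.
    + intros e He. apply filter_forall. intros _. rewrite Rminus_diag, Rabs_R0. exact He.
  - assert (P := pos_INR n). assert (V := vcoef_pos n).
    apply (L2_ext (fun ab => (bK (1 / 6) ab + - / vcoef n * bK (INR n + 1 / 6) ab)
      + / vcoef n * / (INR n + 1 / 6) * (bprim (INR n + 1 / 6) (snd ab) - bprim (INR n + 1 / 6) (fst ab)))).
    + assert (Hh : 0 < 1 / 2) by lra.
      generalize (Fb_near (1 / 2) Hh). apply filter_imp. intros [a b] [A B]. simpl fst in *. simpl snd in *.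
      rewrite <- (bK_rec (INR n + 1 / 6) a b) by lra. rewrite S_INR.
      replace (INR n + 1 / 6 + 1) with (INR n + 1 + 1 / 6) by ring.
      assert (E : vcoef (S n) = vcoef n * ((1 / 6 + INR n) / (2 / 3 + INR n))).
      { unfold vcoef. simpl. assert (P3 := pochhammer_pos (2 / 3) n ltac:(lra)). field. lra. }
      rewrite E. field. repeat split; lra.
    + apply (L2_val _ (0 + / vcoef n * / (INR n + 1 / 6) * 0)); [ring|].
      apply L2_plus; [exact IH|]. apply L2_scal, bprim_lim. lra.
Qed.

Lemma bint_mono s s' t : s <= s' -> 0 < t < 1 -> bint s' t <= bint s t.
Proof.
  intros Hs Ht. unfold bint. apply Rmult_le_compat_r; [apply Rlt_le, exp_pos|].
  replace (s' - 1) with ((s - 1) + (s' - s)) by ring. rewrite Rpower_plus.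
  rewrite <- (Rmult_1_r (Rpower t (s - 1))) at 2. apply Rmult_le_compat_l; [apply Rlt_le, exp_pos|].
  apply Rpower_le_1; lra.
Qed.

Lemma bK_mono s s' a b : s <= s' -> 0 < a -> a <= b -> b < 1 -> bK s' (a, b) <= bK s (a, b).
Proof.
  intros Hs Ha Hab Hb. apply RInt_le; auto; simpl; try (apply bint_ex; lra).
  intros t Ht. apply bint_mono; lra.
Qed.

Definition h23 (n : nat) : R := hc (1 / 6) (1 / 2) (2 / 3) n.

Lemma h23_pos n : 0 < h23 n.
Proof. apply hc_pos; lra. Qed.

Lemma h23_rec n : (2 / 3 + INR n) * (INR n + 1) * h23 (S n) = (1 / 6 + INR n) * (1 / 2 + INR n) * h23 n.
Proof. rewrite <- (hc_rec (1 / 6) (1 / 2) (2 / 3)) by lra. unfold h23. ring. Qed.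

(** The sequence (n + 1/2) h_n decreases while n h_n increases, so the limit exists and is at least
    h_1 > 0. *)
Lemma h23_lim : exists k, 0 < k /\ is_lim_seq (fun n => (INR n + 1 / 2) * h23 n) k.
Proof.
  assert (Dn : forall n, (INR (S n) + 1 / 2) * h23 (S n) <= (INR n + 1 / 2) * h23 n).
  { intro n. assert (R := h23_rec n). assert (P := pos_INR n). assert (H := h23_pos n). assert (H' := h23_pos (S n)).
    rewrite S_INR. set (x := INR n) in *.
    apply (Rmult_le_reg_l ((2 / 3 + x) * (x + 1))); [apply Rmult_lt_0_compat; lra|].
    replace ((2 / 3 + x) * (x + 1) * ((x + 1 + 1 / 2) * h23 (S n))) with ((x + 1 + 1 / 2) * ((2 / 3 + x) * (x + 1) * h23 (S n))) by ring.
    rewrite R. replace ((x + 1 + 1 / 2) * ((1 / 6 + x) * (1 / 2 + x) * h23 n)) with (((x + 1 / 2) * h23 n) * ((x + 3 / 2) * (1 / 6 + x))) by field.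
    replace ((2 / 3 + x) * (x + 1) * ((x + 1 / 2) * h23 n)) with (((x + 1 / 2) * h23 n) * ((2 / 3 + x) * (x + 1))) by ring.
    apply Rmult_le_compat_l; [apply Rmult_le_pos; lra|]. nra. }
  assert (Up : forall n, h23 1 <= INR (S n) * h23 (S n)).
  { induction n as [|n IH]; [simpl; lra|]. eapply Rle_trans; [exact IH|].
    assert (R := h23_rec (S n)). assert (P := pos_INR n). assert (H := h23_pos (S n)). assert (H' := h23_pos (S (S n))).
    rewrite (S_INR (S n)). assert (Q : 0 < INR (S n)) by (rewrite S_INR; lra). set (x := INR (S n)) in *.
    apply (Rmult_le_reg_l (2 / 3 + x)); [lra|].
    replace ((2 / 3 + x) * ((x + 1) * h23 (S (S n)))) with ((2 / 3 + x) * (x + 1) * h23 (S (S n))) by ring.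
    rewrite R. rewrite <- Rmult_assoc. apply Rmult_le_compat_r; [lra|]. nra. }
  destruct (ex_finite_lim_seq_decr (fun n => (INR n + 1 / 2) * h23 n) 0) as [k Hk].
  - intro n. apply Dn.
  - intro n. apply Rmult_le_pos; [assert (P := pos_INR n); lra | apply Rlt_le, h23_pos].
  - exists k. split; [|exact Hk]. apply Rlt_le_trans with (h23 1); [apply h23_pos|].
    change (Rbar_le (h23 1) k). apply (is_lim_seq_le_loc (fun _ => h23 1) (fun n => (INR n + 1 / 2) * h23 n)).
    + exists 1%nat. intros [|n] Hn; [lia|]. specialize (Up n). assert (P := h23_pos (S n)). lra.
    + apply is_lim_seq_const.
    + exact Hk.
Qed.

(** For n >= 1, B(n + 1/6, 1/2) lies between B(n + 1, 1/2) and B(n, 1/2), which have closed forms.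
    Divided by [vcoef n] the three become B(1/6, 1/2), 1 / ((n + 1/2) h_n) and 1 / (n h_n), and the
    outer two tend to 1/k. *)
Lemma bK_sixth_lim k : 0 < k -> is_lim_seq (fun n => (INR n + 1 / 2) * h23 n) k -> L2 (bK (1 / 6)) (/ k).
Proof.
  intros Hk Hl e He.
  assert (L1 : is_lim_seq (fun n => / ((INR (S n) + 1 / 2) * h23 (S n))) (/ k)).
  { apply (is_lim_seq_inv _ k); [apply is_lim_seq_incr_1 in Hl; exact Hl|]. intro E. injection E. lra. }
  assert (L2' : is_lim_seq (fun n => / (INR (S n) * h23 (S n))) (/ k)).
  { apply (is_lim_seq_inv _ k); [|intro E; injection E; lra].
    apply (is_lim_seq_ext (fun n => ((INR (S n) + 1 / 2) * h23 (S n)) * (1 - / 2 * / (INR (S n) + 1 / 2)))).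
    - intro n. assert (P := pos_INR n). rewrite S_INR. field. lra.
    - replace (Finite k) with (Rbar_mult k (Finite (1 - / 2 * 0))) by (simpl; f_equal; ring).
      apply is_lim_seq_mult'; [apply is_lim_seq_incr_1 in Hl; exact Hl|].
      apply is_lim_seq_minus'; [apply is_lim_seq_const|].
      apply (is_lim_seq_scal_l _ (/ 2) 0). apply is_lim_seq_spec. intro eps.
      destruct (archimed_cor1 eps (cond_pos eps)) as [N [HN HN0]]. exists N. intros n Hn.
      assert (P := pos_INR n). rewrite S_INR, Rminus_0_r, Rabs_pos_eq by (apply Rlt_le, Rinv_0_lt_compat; lra).
      eapply Rle_lt_trans; [|exact HN]. apply Rinv_le_contravar; [apply lt_0_INR; auto|]. apply le_INR in Hn. lra. }
  assert (He3 : 0 < e / 3) by lra.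
  apply is_lim_seq_spec in L1. apply is_lim_seq_spec in L2'.
  destruct (L1 (mkposreal _ He3)) as [N1 HN1]. destruct (L2' (mkposreal _ He3)) as [N2 HN2]. simpl pos in HN1, HN2.
  set (n := (N1 + N2)%nat). specialize (HN1 n ltac:(unfold n; lia)). specialize (HN2 n ltac:(unfold n; lia)).
  assert (V := vcoef_pos (S n)). assert (W := wcoef_pos (S n)). assert (W0 := wcoef_pos n).
  assert (B1 := bK_sixth (S n)).
  assert (Bl := L2_scal (/ vcoef (S n)) _ _ (bK_int (S n))). assert (Bu := L2_scal (/ vcoef (S n)) _ _ (bK_int n)).
  assert (Pn := pos_INR n).
  assert (El : / vcoef (S n) * / ((INR (S n) + 1 / 2) * wcoef (S n)) = / ((INR (S n) + 1 / 2) * h23 (S n))).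
  { unfold h23. rewrite hc_vw, S_INR. field. repeat split; lra. }
  assert (Eu : / vcoef (S n) * / ((INR n + 1 / 2) * wcoef n) = / (INR (S n) * h23 (S n))).
  { unfold h23. rewrite hc_vw, (Rmult_comm (INR n + 1 / 2)), <- wcoef_S, S_INR. field. repeat split; lra. }
  rewrite El in Bl. rewrite Eu in Bu.
  assert (Hh : 0 < 1 / 2) by lra.
  generalize (filter_and _ _ (Fb_near (1 / 2) Hh) (filter_and _ _ (B1 _ He3) (filter_and _ _ (Bl _ He3) (Bu _ He3)))).
  apply filter_imp. intros [a b] [AB [C1 [C2 C3]]]. simpl fst in *. simpl snd in *.
  assert (M1 := bK_mono (INR (S n) + 1 / 6) (INR (S n) + 1) a b ltac:(lra) ltac:(lra) ltac:(lra) ltac:(lra)).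
  assert (Hs : INR n + 1 <= INR (S n) + 1 / 6) by (rewrite S_INR; lra).
  assert (M2 := bK_mono (INR n + 1) (INR (S n) + 1 / 6) a b Hs ltac:(lra) ltac:(lra) ltac:(lra)).
  assert (Vi : 0 < / vcoef (S n)) by (apply Rinv_0_lt_compat, V).
  apply (Rmult_le_compat_l (/ vcoef (S n))) in M1; [|lra]. apply (Rmult_le_compat_l (/ vcoef (S n))) in M2; [|lra].
  rewrite Rminus_0_r in C1.
  apply Rabs_lt_between in C1. apply Rabs_lt_between in C2. apply Rabs_lt_between in C3.
  apply Rabs_lt_between in HN1. apply Rabs_lt_between in HN2. apply Rabs_lt_between. lra.
Qed.

(** As c = a + b, the coefficients decay like 1/n, with the factor Gamma(2/3) / (Gamma(1/6)
    Gamma(1/2)) = 1 / B(1/6, 1/2). This ties the Beta value in [phi1_principal] to the growth of the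
    second series at 1. *)
Lemma Beta_limit : exists k, 0 < k /\ Beta (1 / 6) (1 / 2) = / k /\
  is_lim_seq (dcoef (hc (1 / 6) (1 / 2) (2 / 3))) k.
Proof.
  destruct h23_lim as [k [Hk Hl]]. exists k. split; [auto|]. split.
  - assert (H := bK_sixth_lim k Hk Hl). unfold Beta.
    apply (is_RInt_gen_unique (V := R_CompleteNormedModule) (Fa := at_right 0) (Fb := at_left 1)).
    intros P [d HP]. unfold filtermapi.
    assert (Hh : 0 < 1 / 2) by lra.
    generalize (filter_and _ _ (Fb_near (1 / 2) Hh) (H d (cond_pos d))). apply filter_imp.
    intros [a b] [AB K]. simpl fst in *. simpl snd in *. exists (bK (1 / 6) (a, b)). split.
    + apply (RInt_correct (V := R_CompleteNormedModule) (bint (1 / 6))). simpl. apply bint_ex; lra.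
    + apply HP. exact K.
  - unfold dcoef. apply (is_lim_seq_ext (fun n => ((INR (S n) + 1 / 2) * h23 (S n)) * ((INR n + 1) / (INR n + 1 + 1 / 2)))).
    + intro n. assert (P := pos_INR n). unfold h23. rewrite S_INR. field. lra.
    + replace (Finite k) with (Rbar_mult k (Finite 1)) by (simpl; f_equal; ring).
      apply is_lim_seq_mult'; [apply is_lim_seq_incr_1 in Hl; exact Hl|].
      apply is_lim_seq_spec. intro eps. destruct (archimed_cor1 eps (cond_pos eps)) as [N [HN HN0]].
      exists N. intros n Hn. assert (P := pos_INR n).
      replace ((INR n + 1) / (INR n + 1 + 1 / 2) - 1) with (- (/ 2 * / (INR n + 1 + 1 / 2))) by (field; lra).
      assert (Pi : 0 < / (INR n + 1 + 1 / 2)) by (apply Rinv_0_lt_compat; lra).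
      rewrite Rabs_Ropp, Rabs_pos_eq by lra.
      eapply Rle_lt_trans; [|exact HN]. apply Rle_trans with (/ (INR n + 1 + 1 / 2)); [lra|].
      apply Rinv_le_contravar; [apply lt_0_INR; auto|]. apply le_INR in Hn. lra.
Qed.

(** * Hypergeometric functions of modular functions *)

(* If the weight g and the argument m satisfy the two compatibility conditions, then
   F(m) g has vanishing second derivative: F(m) g is an affine function of tau. *)
Lemma hypergeometric_affine (a b c : R) (m m1 m2 g g1 g2 : C -> C) (tau : C) :
  0 < a -> 0 < b -> a <= c -> b <= 1 ->
  Cmod (m tau) < 1 -> m tau <> 0 -> m tau <> 1 ->
  Cder m tau (ipi * m1 tau)%C -> Cder m1 tau (ipi * m2 tau)%C ->
  Cder g tau (ipi * g1 tau)%C -> Cder g1 tau (ipi * g2 tau)%C ->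
  (m tau * (1 - m tau) * (m2 tau * g tau + 2 * m1 tau * g1 tau)
    = m1 tau * m1 tau * g tau * (RtoC c - RtoC (a + b + 1) * m tau))%C ->
  (m tau * (1 - m tau) * g2 tau = - RtoC (a * b) * (m1 tau * m1 tau) * g tau)%C ->
  Cder (fun t => CPS (hc a b c) (m t) * g t)%C tau
    (ipi * (CPS (dcoef (hc a b c)) (m tau) * m1 tau * g tau + CPS (hc a b c) (m tau) * g1 tau))%C /\
  Cder (fun t => CPS (dcoef (hc a b c)) (m t) * m1 t * g t + CPS (hc a b c) (m t) * g1 t)%C tau 0.
Proof.
  intros Ha Hb Hac Hb1 Hm N0 N1 Dm Dm1 Dg Dg1 H1 H2.
  set (h := hc a b c). assert (P0 : poly_bd h) by (apply hc_poly; auto).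
  assert (D0 : Cder (fun t => CPS h (m t)) tau (CPS (dcoef h) (m tau) * (ipi * m1 tau))%C).
  { apply (Cder_comp (CPS h) m); auto. apply CPS_der; auto. }
  assert (D1 : Cder (fun t => CPS (dcoef h) (m t)) tau (CPS (dcoef (dcoef h)) (m tau) * (ipi * m1 tau))%C).
  { apply (Cder_comp (CPS (dcoef h)) m); auto. apply CPS_der; auto. apply poly_bd_dcoef, P0. }
  split.
  - eapply Cder_eq; [apply Cder_mult; [exact D0 | exact Dg]|]. cbv beta. ring.
  - eapply Cder_eq.
    + apply Cder_plus; apply Cder_mult; [apply Cder_mult; [exact D1 | exact Dm1] | exact Dg | exact D0 | exact Dg1].
    + cbv beta. assert (E := hypergeometric_ODE a b c Ha Hb Hac Hb1 (m tau) Hm). fold h in E.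
      assert (N1' : (1 - m tau)%C <> 0) by (intro K; apply N1; symmetry; apply Cminus_eq_0, K).
      assert (N2 : (m tau * (1 - m tau))%C <> 0) by (apply Cmult_neq_0; auto).
      set (F := CPS h (m tau)) in *. set (F1 := CPS (dcoef h) (m tau)) in *. set (F2 := CPS (dcoef (dcoef h)) (m tau)) in *.
      set (M := m tau) in *. set (M1 := m1 tau) in *. set (M2 := m2 tau) in *. set (G := g tau) in *.
      set (G1 := g1 tau) in *. set (G2 := g2 tau) in *.
      transitivity (ipi * ((M1 * M1 * G * (M * (1 - M) * F2) + F1 * (M * (1 - M) * (M2 * G + 2 * M1 * G1))
         + F * (M * (1 - M) * G2)) / (M * (1 - M))))%C; [field; auto|].
      rewrite H1, H2. replace (M * (1 - M) * F2)%C with (RtoC (a * b) * F - (RtoC c - RtoC (a + b + 1) * M) * F1)%C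
        by (rewrite <- E; ring).
      field. auto.
Qed.

Lemma ray_const f x0 t0 : (forall t, t0 < t -> Cder f (x0, t) 0) ->
  forall t1 t2, t0 < t1 -> t0 < t2 -> f (x0, t1) = f (x0, t2).
Proof.
  intros H t1 t2 H1 H2. symmetry. apply Cder_0_segment. intros t Ht.
  replace ((x0, t1) + RtoC t * ((x0, t2) - (x0, t1)))%C with ((x0, t1 + t * (t2 - t1))%R : C)
    by (apply injective_projections; simpl; ring).
  apply H. destruct (Rle_lt_dec t1 t2) as [L|L].
  - assert (0 <= t * (t2 - t1)) by (apply Rmult_le_pos; lra). lra.
  - assert (t * (t1 - t2) <= 1 * (t1 - t2)) by (apply Rmult_le_compat_r; lra). lra.
Qed.

Definition Rinf : (R -> Prop) -> Prop := Rbar_locally p_infty.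

Lemma Iinf_ray x0 P : Iinf P -> Rinf (fun t => P (x0, t)).
Proof. intros [M H]. exists M. intros t Ht. apply H. exact Ht. Qed.

Lemma Clf_ray x0 f l : Clf Iinf f l -> Clf Rinf (fun t => f (x0, t)) l.
Proof. intros H e He. apply (Iinf_ray x0 (fun tau => Cmod (f tau - l)%C < e)). apply H, He. Qed.

Lemma Rinf_gt M : Rinf (fun t => M < t).
Proof. exists M. auto. Qed.

Lemma ray_const_lim f x0 t0 l : (forall t, t0 < t -> Cder f (x0, t) 0) ->
  Clf Rinf (fun t => f (x0, t)) l -> forall t, t0 < t -> f (x0, t) = l.
Proof.
  intros H Hl t Ht. apply (Clf_unique Rinf (fun t => f (x0, t))); [|exact Hl].
  apply (Clf_ext (fun _ => f (x0, t))); [|apply Clf_const].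
  generalize (Rinf_gt t0). apply filter_imp. intros s Hs. apply (ray_const f x0 t0); auto.
Qed.

Lemma ray_affine f f1 x0 t0 l : (forall t, t0 < t -> Cder f (x0, t) (ipi * f1 (x0, t))%C) ->
  (forall t, t0 < t -> f1 (x0, t) = l) ->
  exists beta, forall t, t0 < t -> f (x0, t) = (ipi * l * (x0, t) + beta)%C.
Proof.
  intros H1 H2. exists (f (x0, t0 + 1)%R - ipi * l * ((x0, t0 + 1)%R))%C. intros t Ht.
  assert (E := ray_const (fun z => f z - ipi * l * z)%C x0 t0).
  rewrite <- (E ltac:(intros s Hs; eapply Cder_eq; [apply Cder_minus; [apply H1; auto | apply Cder_scal, Cder_id]|];
    cbv beta; rewrite H2 by auto; ring) t (t0 + 1)) by lra. ring.
Qed.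

Lemma lim_dcoef_0 h k : is_lim_seq (dcoef h) (Finite k) -> is_lim_seq h 0.
Proof.
  intro H. apply (is_lim_seq_incr_1 h).
  apply (is_lim_seq_ext (fun n => dcoef h n * / (INR n + 1))).
  - intro n. unfold dcoef. assert (P := pos_INR n). field. lra.
  - replace (Finite 0) with (Rbar_mult k (Finite 0)) by (simpl; f_equal; ring).
    apply is_lim_seq_mult'; [exact H|]. apply is_lim_seq_spec. intro eps.
    destruct (archimed_cor1 eps (cond_pos eps)) as [N [HN HN0]]. exists N. intros n Hn.
    assert (P := pos_INR n). rewrite Rminus_0_r, Rabs_pos_eq by (apply Rlt_le, Rinv_0_lt_compat; lra).
    eapply Rle_lt_trans; [|exact HN]. apply Rinv_le_contravar; [apply lt_0_INR; auto|]. apply le_INR in Hn. lra.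
Qed.

(** * The transformation tau -> -1/tau *)

(** The modular lambda function theta10^4 / theta00^4. [tL1] and [tL2] are its derivatives with
    respect to pi i tau; the first is lambda (1 - lambda) theta00^4. *)
Definition tL (tau : C) : C := (tC tau / (tA tau * tA tau))%C.
Definition tL1 (tau : C) : C := (tC tau * (tB tau * tB tau) / (tA tau * tA tau))%C.
Definition tL2 (tau : C) : C := (tL1 tau * (2 * tA1 tau / tA tau + tB tau * tB tau - tC tau))%C.

Lemma tL_der tau : 0 < Im tau ->
  Cder tL tau (ipi * tL1 tau)%C /\ Cder tL1 tau (ipi * tL2 tau)%C.
Proof.
  intro H. destruct (tA_der _ H) as [DA _]. destruct (tB_der _ H) as [DB _].
  destruct (tAB_neq_0 _ H) as [N1 N2]. assert (DC := tC_der _ H).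
  assert (N3 : (tA tau * tA tau)%C <> 0) by (apply Cmult_neq_0; auto).
  assert (DAA := Cder_mult _ _ _ _ _ DA DA). assert (DBB := Cder_mult _ _ _ _ _ DB DB).
  split.
  - eapply Cder_eq; [apply Cder_div; [exact N3 | exact DC | exact DAA]|].
    cbv beta. unfold tL1. rewrite tB1_eq by auto. unfold tC. field. auto.
  - eapply Cder_eq; [apply Cder_div; [exact N3 | apply Cder_mult; [exact DC | exact DBB] | exact DAA]|].
    cbv beta. unfold tL2, tL1. rewrite tB1_eq by auto. unfold tC. field. auto.
Qed.

Definition gA (tau : C) : C := (/ tA tau)%C.
Definition gA1 (tau : C) : C := (- tA1 tau / (tA tau * tA tau))%C.
Definition gA2 (tau : C) : C := (- (tB tau * tB tau) * tC tau / (4 * tA tau))%C.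

Lemma gA_der tau : 0 < Im tau ->
  Cder gA tau (ipi * gA1 tau)%C /\ Cder gA1 tau (ipi * gA2 tau)%C.
Proof.
  intro H. destruct (tA_der _ H) as [DA DA1]. destruct (tAB_neq_0 _ H) as [N1 N2].
  assert (N3 : (tA tau * tA tau)%C <> 0) by (apply Cmult_neq_0; auto).
  split.
  - eapply Cder_eq; [apply Cder_inv; [exact N1 | exact DA]|]. unfold gA1. field. auto.
  - eapply Cder_eq; [apply Cder_div; [exact N3 | apply Cder_opp, DA1 | apply Cder_mult; exact DA]|].
    cbv beta. unfold gA2. rewrite tA2_eq by auto. field. auto.
Qed.

Lemma tL_compl tau : 0 < Im tau -> (1 - tL tau)%C = (tB tau * tB tau / (tA tau * tA tau))%C.
Proof. intro H. destruct (tAB_neq_0 _ H) as [N1 N2]. unfold tL, tC. field. auto. Qed.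

Lemma tL_neq tau : 0 < Im tau -> tL tau <> 0 /\ (1 - tL tau)%C <> 0.
Proof.
  intro H. destruct (tAB_neq_0 _ H) as [N1 N2]. assert (N3 := tC_neq_0 _ H). split.
  - unfold tL. intro E. apply N3. replace (tC tau) with (tC tau / (tA tau * tA tau) * (tA tau * tA tau))%C by (field; auto).
    rewrite E. ring.
  - rewrite tL_compl by auto. intro E. apply (Cmult_neq_0 _ _ N2 N2).
    replace (tB tau * tB tau)%C with (tB tau * tB tau / (tA tau * tA tau) * (tA tau * tA tau))%C by (field; auto).
    rewrite E. ring.
Qed.

Definition hP := hc (1 / 2) (1 / 2) 1.

Lemma RtoC_1_4 : RtoC (1 / 2 * (1 / 2)) = (1 / 4)%C.
Proof. replace (1 / 2 * (1 / 2)) with (/ 4) by field. rewrite RtoC_inv by lra. field. Qed.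

Lemma RtoC_half2 : RtoC (1 / 2 + 1 / 2 + 1) = 2.
Proof. f_equal. field. Qed.

Lemma K0_affine tau : 0 < Im tau -> Cmod (tL tau) < 1 ->
  Cder (fun t => CPS hP (tL t) * gA t)%C tau
    (ipi * (CPS (dcoef hP) (tL tau) * tL1 tau * gA tau + CPS hP (tL tau) * gA1 tau))%C /\
  Cder (fun t => CPS (dcoef hP) (tL t) * tL1 t * gA t + CPS hP (tL t) * gA1 t)%C tau 0.
Proof.
  intros H Hm. destruct (tL_der _ H) as [D1 D2]. destruct (gA_der _ H) as [D3 D4].
  destruct (tL_neq _ H) as [N1 N2]. destruct (tAB_neq_0 _ H) as [NA NB].
  apply (hypergeometric_affine (1 / 2) (1 / 2) 1 tL tL1 tL2 gA gA1 gA2); auto; try lra.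
  - intro E. apply N2. rewrite E. ring.
  - rewrite RtoC_half2. unfold tL2, gA, gA1, tL1, tL, tC. field. auto.
  - rewrite RtoC_1_4. unfold gA2, gA, tL1, tL, tC. field. auto.
Qed.

Lemma K1_affine tau : 0 < Im tau -> Cmod (1 - tL tau)%C < 1 ->
  Cder (fun t => CPS hP (1 - tL t)%C * gA t)%C tau
    (ipi * (CPS (dcoef hP) (1 - tL tau)%C * - tL1 tau * gA tau + CPS hP (1 - tL tau)%C * gA1 tau))%C /\
  Cder (fun t => CPS (dcoef hP) (1 - tL t)%C * - tL1 t * gA t + CPS hP (1 - tL t)%C * gA1 t)%C tau 0.
Proof.
  intros H Hm. destruct (tL_der _ H) as [D1 D2]. destruct (gA_der _ H) as [D3 D4].
  destruct (tL_neq _ H) as [N1 N2]. destruct (tAB_neq_0 _ H) as [NA NB].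
  apply (hypergeometric_affine (1 / 2) (1 / 2) 1 (fun t => 1 - tL t)%C (fun t => - tL1 t)%C (fun t => - tL2 t)%C gA gA1 gA2); auto; try lra.
  - intro E. apply N1. replace (tL tau) with (1 - (1 - tL tau))%C by ring. rewrite E. ring.
  - eapply Cder_eq; [apply Cder_minus; [apply Cder_const | exact D1]|]. ring.
  - eapply Cder_eq; [apply Cder_opp; exact D2|]. ring.
  - rewrite RtoC_half2. unfold tL2, gA, gA1, tL1, tL, tC. field. auto.
  - rewrite RtoC_1_4. unfold gA2, gA, tL1, tL, tC. field. auto.
Qed.

Lemma tC_quot : Clf Iinf (fun t => tC t / nome t)%C 16.
Proof.
  apply (Clf_ext (fun t => (tA t - tB t) / nome t * (tA t + tB t))%C).
  - exists 0. intros t Ht. unfold tC. field. apply nome_neq_0.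
  - apply (Clf_eq _ (8 * (1 + 1))%C); [rewrite <- RtoC_plus, <- RtoC_mult; f_equal; ring|].
    apply Clf_mult; [apply tAB_quot | apply Clf_plus; [apply tA_Iinf | apply tB_Iinf]].
Qed.

Lemma tC_Iinf : Clf Iinf tC 0.
Proof.
  apply (Clf_eq _ (1 * 1 - 1 * 1)%C); [ring|]. apply Clf_minus; apply Clf_mult; apply tA_Iinf || apply tB_Iinf.
Qed.

Lemma C1_neq_0 : RtoC 1 <> 0. Proof. intro K. injection K. lra. Qed.

Lemma tL_Iinf : Clf Iinf tL 0.
Proof.
  apply (Clf_eq _ (0 / (1 * 1))%C); [field|].
  apply Clf_div; [rewrite Cmult_1_l; apply C1_neq_0 | apply tC_Iinf | apply Clf_mult; apply tA_Iinf].
Qed.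

Lemma gA_Iinf : Clf Iinf gA 1.
Proof.
  apply (Clf_eq _ (/ 1)%C); [field|]. apply Clf_inv; [apply C1_neq_0 | apply tA_Iinf].
Qed.

Lemma tA1_Iinf : Clf Iinf tA1 0.
Proof.
  apply (Clf_ext (fun t => tA1 t / nome t * nome t)%C).
  - apply filter_forall. intro t. field. apply nome_neq_0.
  - apply (Clf_eq _ (4 * 0)%C); [ring|]. apply Clf_mult; [apply tA1_quot | apply nome_Iinf].
Qed.

Lemma gA1_Iinf : Clf Iinf gA1 0.
Proof.
  apply (Clf_eq _ (- 0 / (1 * 1))%C); [field|].
  apply Clf_div; [rewrite Cmult_1_l; apply C1_neq_0 | apply Clf_opp, tA1_Iinf | apply Clf_mult; apply tA_Iinf].
Qed.

Lemma tL1_Iinf : Clf Iinf tL1 0.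
Proof.
  apply (Clf_eq _ (0 * (1 * 1) / (1 * 1))%C); [field|].
  apply Clf_div; [rewrite Cmult_1_l; apply C1_neq_0 | | apply Clf_mult; apply tA_Iinf].
  apply Clf_mult; [apply tC_Iinf | apply Clf_mult; apply tB_Iinf].
Qed.

(** * Values on the imaginary axis *)

Lemma nome_axis t : nome (0, t) = RtoC (exp (- PI * t)).
Proof.
  unfold nome, ipi, Cexp. apply injective_projections; simpl.
  - replace ((PI * 0 - 0 * 1) * t + (PI * 1 + 0 * 0) * 0) with 0 by ring.
    replace ((PI * 0 - 0 * 1) * 0 - (PI * 1 + 0 * 0) * t) with (- PI * t) by ring. rewrite cos_0. ring.
  - replace ((PI * 0 - 0 * 1) * t + (PI * 1 + 0 * 0) * 0) with 0 by ring. rewrite sin_0. ring.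
Qed.

Lemma FA_real x : Rabs x < 1 -> exists y, FA (RtoC x) = RtoC (y * y).
Proof.
  intro Hx. unfold FA. rewrite (CPS_real tc tc_poly x Hx).
  exists (Series (fun n => tc n * x ^ n)). now rewrite RtoC_mult.
Qed.

Definition ra (t : R) : R := Re (tA (0, t)).
Definition rb (t : R) : R := Re (tB (0, t)).

(** For real nome p the theta series is real, so its square is positive as soon as it is nonzero. *)
Lemma real_square_axis t (f : C -> C) (p : R) : 0 < t -> Rabs p < 1 -> f (0, t) = FA (RtoC p) -> f (0, t) <> 0 ->
  f (0, t) = RtoC (Re (f (0, t))) /\ 0 < Re (f (0, t)).
Proof.
  intros Ht Hp Hf Hn. destruct (FA_real p Hp) as [y Hy]. rewrite Hf, Hy in *. simpl. split; [reflexivity|].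
  assert (y <> 0) by (intro E; apply Hn; rewrite E; now rewrite Rmult_0_l).
  destruct (Rtotal_order y 0) as [L|[L|L]]; [nra | lra | nra].
Qed.

Lemma exp_axis t : 0 < t -> Rabs (exp (- PI * t)) < 1.
Proof.
  intro H. rewrite Rabs_pos_eq by apply Rlt_le, exp_pos. rewrite <- exp_0. apply exp_increasing.
  assert (P := PI_RGT_0). assert (0 < PI * t) by (apply Rmult_lt_0_compat; auto). lra.
Qed.

Lemma ra_spec t : 0 < t -> tA (0, t) = RtoC (ra t) /\ 0 < ra t.
Proof.
  intro H. apply (real_square_axis t tA (exp (- PI * t))); auto.
  - apply exp_axis, H.
  - unfold tA. now rewrite nome_axis.
  - apply (tAB_neq_0 (0, t)). exact H.
Qed.

Lemma rb_spec t : 0 < t -> tB (0, t) = RtoC (rb t) /\ 0 < rb t.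
Proof.
  intro H. apply (real_square_axis t tB (- exp (- PI * t))); auto.
  - rewrite Rabs_Ropp. apply exp_axis, H.
  - unfold tB. rewrite nome_axis, RtoC_opp. reflexivity.
  - apply (tAB_neq_0 (0, t)). exact H.
Qed.

Lemma axis_double t : (0, 2 * t) = (2 * (0, t))%C.
Proof. apply injective_projections; simpl; ring. Qed.

Lemma rab_double t : 0 < t -> ra (2 * t) = (ra t + rb t) / 2 /\ rb (2 * t) * rb (2 * t) = ra t * rb t.
Proof.
  intro H. destruct (ra_spec t H) as [A1 _]. destruct (rb_spec t H) as [B1 _].
  destruct (ra_spec (2 * t) ltac:(lra)) as [A2 _]. destruct (rb_spec (2 * t) ltac:(lra)) as [B2 _].
  rewrite axis_double in A2, B2. split.
  - assert (E := tA_double (0, t) H). rewrite A1, B1, A2 in E. rewrite <- RtoC_plus, <- RtoC_div2 in E.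
    now injection E.
  - assert (E := tB_double_sq (0, t) H). rewrite A1, B1, B2, <- !RtoC_mult in E. now injection E.
Qed.

Lemma rb_lt_ra t : 0 < t -> rb t < ra t.
Proof.
  intro H. assert (E := rab_double (t / 2) ltac:(lra)). replace (2 * (t / 2)) with t in E by field.
  destruct E as [E1 E2]. destruct (ra_spec t H) as [A1 A2]. destruct (rb_spec t H) as [B1 B2].
  assert (N : ra t <> rb t).
  { intro K. apply (tA_minus_tB_neq_0 (0, t) H). rewrite A1, B1, K. ring. }
  set (u := ra (t / 2)) in *. set (v := rb (t / 2)) in *.
  assert (0 <= (u - v) * (u - v)) by apply (Rle_0_sqr (u - v)).
  assert (ra t * ra t = rb t * rb t + (u - v) * (u - v) / 4) by (rewrite E1, E2; field). nra.
Qed.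

(** The complementary modulus k' = theta01^2 / theta00^2; on the axis lambda = 1 - rx^2. *)
Definition rx (t : R) : R := rb t / ra t.

Lemma rx_bounds t : 0 < t -> 0 < rx t < 1.
Proof.
  intro H. destruct (ra_spec t H) as [_ A]. destruct (rb_spec t H) as [_ B]. assert (L := rb_lt_ra t H).
  unfold rx. split; [apply Rdiv_lt_0_compat; auto|]. apply (Rmult_lt_reg_r (ra t)); auto.
  unfold Rdiv. rewrite Rmult_assoc, Rinv_l by lra. lra.
Qed.

Lemma tL_axis t : 0 < t -> tL (0, t) = RtoC (1 - rx t * rx t) /\ (1 - tL (0, t))%C = RtoC (rx t * rx t).
Proof.
  intro H. destruct (ra_spec t H) as [A1 A2]. destruct (rb_spec t H) as [B1 B2].
  assert (E : (1 - tL (0, t))%C = RtoC (rx t * rx t)).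
  { rewrite tL_compl, A1, B1 by exact H. unfold rx. unfold Rdiv. rewrite !RtoC_mult, RtoC_inv by lra.
    field. intro K. injection K. lra. }
  split; [|exact E]. replace (tL (0, t)) with (1 - (1 - tL (0, t)))%C by ring. rewrite E, RtoC_minus. reflexivity.
Qed.

(** Landen's transformation: the quotient of the geometric mean by the arithmetic mean, squared. *)
Lemma rx_double t : 0 < t -> rx (2 * t) * rx (2 * t) * ((1 + rx t) * (1 + rx t)) = 4 * rx t.
Proof.
  intro H. destruct (rab_double t H) as [E1 E2]. destruct (ra_spec t H) as [_ A]. destruct (rb_spec t H) as [_ B].
  unfold rx. transitivity ((rb (2 * t) * rb (2 * t)) * ((1 + rb t / ra t) * (1 + rb t / ra t)) / (ra (2 * t) * ra (2 * t))).
  - field. rewrite E1. split; lra.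
  - rewrite E1, E2. field. split; lra.
Qed.

Lemma Cder_vertical f x0 t l : Cder f (x0, t) l -> is_derive (fun s => Re (f (x0, s))) t (Re (l * Ci)%C).
Proof.
  intro H. assert (E : forall s, (RtoC x0 + RtoC s * Ci)%C = (x0, s)) by (intro s; apply injective_projections; simpl; ring).
  assert (H' : Cder f (RtoC x0 + RtoC t * Ci)%C l) by (rewrite E; exact H).
  assert (D := proj1 (Cder_line f (RtoC x0) Ci t l H')).
  revert D. apply is_derive_ext. intro s. now rewrite E.
Qed.

Lemma is_derive_continuity_pt (f : R -> R) t l : is_derive f t l -> continuity_pt f t.
Proof.
  intro H. apply continuity_pt_filterlim. apply (ex_derive_continuous (V := R_NormedModule)). exists l. exact H.
Qed.

Lemma rx_continuous t : 0 < t -> continuity_pt rx t.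
Proof.
  intro H. destruct (ra_spec t H) as [_ A]. unfold rx. apply continuity_pt_div; [| |lra].
  - exact (is_derive_continuity_pt _ _ _ (Cder_vertical _ _ _ _ (proj1 (tB_der (0, t) H)))).
  - exact (is_derive_continuity_pt _ _ _ (Cder_vertical _ _ _ _ (proj1 (tA_der (0, t) H)))).
Qed.

(** Halving t at least squares the modulus: u^2 (1 + v)^2 = 4 v with v < 1 gives v <= u^2. The
    values at t = 2^(-n) therefore tend to 0 at least geometrically. *)
Lemma rx_small y : 0 < y -> exists t, 0 < t /\ rx t < y.
Proof.
  intro Hy. assert (B := rx_bounds 1 Rlt_0_1).
  destruct (geom_lim 1 (rx 1) ltac:(lra) y Hy) as [N HN]. exists ((/ 2) ^ N).
  assert (P2 : forall n, 0 < (/ 2) ^ n) by (intro n; apply pow_lt; lra).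
  split; [apply P2|].
  assert (K : forall n, rx ((/ 2) ^ n) <= rx 1 ^ S n).
  { induction n as [|n IH]; [simpl; lra|].
    assert (D := rx_double ((/ 2) ^ S n) (P2 (S n))). replace (2 * (/ 2) ^ S n) with ((/ 2) ^ n) in D by (simpl; field).
    assert (B1 := rx_bounds _ (P2 (S n))). assert (B2 := rx_bounds _ (P2 n)).
    set (v := rx ((/ 2) ^ S n)) in *. set (u := rx ((/ 2) ^ n)) in *.
    assert (L1 : v <= u * u) by nra.
    assert (L2 : u <= rx 1).
    { eapply Rle_trans; [exact IH|]. rewrite <- (pow_1 (rx 1)) at 2. apply pow_decr; [lra | lia]. }
    change (rx 1 ^ S (S n)) with (rx 1 * rx 1 ^ S n).
    eapply Rle_trans; [exact L1|]. apply Rmult_le_compat; lra. }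
  eapply Rle_lt_trans; [apply K|]. specialize (HN (S N) ltac:(lia)).
  rewrite Rmult_1_l in HN. assert (A := Rle_abs (rx 1 ^ S N)). lra.
Qed.

Lemma rx_large y : y < 1 -> exists t, 0 < t /\ y < rx t.
Proof.
  intro Hy.
  assert (L : Clf Rinf (fun t => RtoC (rx t)) 1).
  { apply (Clf_ext (fun t => tB (0, t) / tA (0, t))%C).
    - generalize (Rinf_gt 0). apply filter_imp. intros t Ht.
      destruct (ra_spec t Ht) as [A1 A2]. destruct (rb_spec t Ht) as [B1 B2]. rewrite A1, B1.
      unfold rx, Rdiv. rewrite RtoC_mult, RtoC_inv by lra. reflexivity.
    - apply (Clf_eq _ (1 / 1)%C); [field|].
      apply Clf_div; [apply C1_neq_0 | apply (Clf_ray 0 tB), tB_Iinf | apply (Clf_ray 0 tA), tA_Iinf]. }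
  assert (Hd : 0 < 1 - y) by lra.
  destruct (filter_ex _ (filter_and _ _ (Rinf_gt 0) (L _ Hd))) as [t [Ht K]].
  exists t. split; [exact Ht|]. rewrite <- RtoC_minus, Cmod_R in K. apply Rabs_lt_between in K. lra.
Qed.

(** By the intermediate value theorem [rx] takes every value between 0 and 1. That the dual
    parameter is 1/t comes out only in [S_axis]. *)
Lemma rx_dual t : 0 < t -> exists t', 0 < t' /\ rx t' * rx t' = 1 - rx t * rx t.
Proof.
  intro H. assert (B := rx_bounds t H). set (y := sqrt (1 - rx t * rx t)).
  assert (Hy : 0 < 1 - rx t * rx t < 1) by nra.
  assert (Y2 : y * y = 1 - rx t * rx t) by (apply sqrt_sqrt; lra).
  assert (Y0 : 0 < y) by (apply sqrt_lt_R0; lra). assert (Y1 : y < 1) by nra.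
  destruct (rx_small y Y0) as [t1 [T1 L1]]. destruct (rx_large y Y1) as [t2 [T2 L2]].
  assert (exists z, 0 < z /\ rx z = y); [|destruct H0 as [z [Z1 Z2]]; exists z; split; [auto | rewrite Z2; exact Y2]].
  destruct (Rtotal_order t1 t2) as [L|[L|L]].
  - destruct (IVT_interv (fun s => rx s - y) t1 t2) as [z [Hz Ez]]; try lra.
    + intros s Hs. apply continuity_pt_minus; [apply rx_continuous; lra | apply continuity_pt_const; intros ? ?; reflexivity].
    + exists z. split; lra.
  - subst. lra.
  - destruct (IVT_interv (fun s => y - rx s) t2 t1) as [z [Hz Ez]]; try lra.
    + intros s Hs. apply continuity_pt_minus; [apply continuity_pt_const; intros ? ?; reflexivity | apply rx_continuous; lra].
    + exists z. split; lra.
Qed.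

(** Jacobi's formula F(1/2, 1/2, 1; lambda) = theta00^2: the quotient is affine in tau, its slope
    tends to 0 at the cusp and its value tends to 1. *)
Lemma K0_axis t : 0 < t -> CPS hP (tL (0, t)) = tA (0, t).
Proof.
  intro Ht.
  assert (P0 : poly_bd hP) by (apply hc_poly; lra).
  assert (small : forall s, 0 < s -> Cmod (tL (0, s)) < 1).
  { intros s Hs. rewrite (proj1 (tL_axis s Hs)), Cmod_R. assert (B := rx_bounds s Hs). apply Rabs_lt_between. nra. }
  assert (L0 : Clf Iinf (fun t => CPS hP (tL t)) 1).
  { apply (Clf_eq _ (RtoC (hP 0))); [unfold hP; now rewrite hc_0|]. apply CPS_Iinf; [exact P0 | apply tL_Iinf]. }
  assert (E1 : forall s, 0 < s -> (CPS (dcoef hP) (tL (0, s)) * tL1 (0, s) * gA (0, s) + CPS hP (tL (0, s)) * gA1 (0, s))%C = 0).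
  { apply (ray_const_lim (fun t => CPS (dcoef hP) (tL t) * tL1 t * gA t + CPS hP (tL t) * gA1 t)%C 0 0 0).
    - intros s Hs. apply K0_affine; auto.
    - apply (Clf_ray 0 (fun t => CPS (dcoef hP) (tL t) * tL1 t * gA t + CPS hP (tL t) * gA1 t)%C).
      apply (Clf_eq _ (RtoC (dcoef hP 0) * 0 * 1 + 1 * 0)%C); [ring|].
      apply Clf_plus; [apply Clf_mult; [apply Clf_mult|]|apply Clf_mult].
      + apply CPS_Iinf; [apply poly_bd_dcoef, P0 | apply tL_Iinf].
      + apply tL1_Iinf.
      + apply gA_Iinf.
      + exact L0.
      + apply gA1_Iinf. }
  assert (E : (CPS hP (tL (0, t)) * gA (0, t))%C = 1).
  { apply (ray_const_lim (fun t => CPS hP (tL t) * gA t)%C 0 0 1); [| |exact Ht].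
    - intros s Hs. eapply Cder_eq; [apply (K0_affine (0, s)); auto|]. rewrite E1 by auto. ring.
    - apply (Clf_ray 0 (fun t => CPS hP (tL t) * gA t)%C). apply (Clf_eq _ (1 * 1)%C); [ring|].
      apply Clf_mult; [exact L0 | apply gA_Iinf]. }
  unfold gA in E. destruct (tAB_neq_0 (0, t) Ht) as [NA _].
  replace (CPS hP (tL (0, t))) with (CPS hP (tL (0, t)) * / tA (0, t) * tA (0, t))%C by (field; auto).
  rewrite E. ring.
Qed.

(** By Wallis and Abel the slope in pi i tau is -1/pi, and (pi i) (-1/pi) (i t) = t. The additive
    constant cannot be read off at the cusp and is left unknown here. *)
Lemma K1_axis : exists beta : C, forall t, 0 < t -> CPS hP (1 - tL (0, t))%C = ((RtoC t + beta) * tA (0, t))%C.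
Proof.
  assert (P := PI_RGT_0).
  assert (small : forall s, 0 < s -> Cmod (1 - tL (0, s))%C < 1).
  { intros s Hs. rewrite (proj2 (tL_axis s Hs)), Cmod_R. assert (B := rx_bounds s Hs). apply Rabs_lt_between. nra. }
  assert (xr : Rinf (fun t => 0 <= rx t * rx t < 1)).
  { generalize (Rinf_gt 0). apply filter_imp. intros t Ht. assert (B := rx_bounds t Ht). nra. }
  assert (xl : Clf Rinf (fun t => RtoC (rx t * rx t)) 1).
  { apply (Clf_ext (fun t => 1 - tL (0, t))%C).
    - generalize (Rinf_gt 0). apply filter_imp. intros t Ht. apply (tL_axis t Ht).
    - apply (Clf_eq _ (1 - 0)%C); [ring|]. apply Clf_minus; [apply Clf_const | apply (Clf_ray 0 tL), tL_Iinf]. }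
  assert (A1 := Abel_limit Rinf (fun t => rx t * rx t) _ _ Wallis_limit xr xl).
  assert (A0 := Abel_limit Rinf (fun t => rx t * rx t) _ _ (lim_dcoef_0 _ _ Wallis_limit) xr xl).
  fold hP in A1, A0.
  assert (E1 : forall s, 0 < s -> (CPS (dcoef hP) (1 - tL (0, s))%C * - tL1 (0, s) * gA (0, s) + CPS hP (1 - tL (0, s))%C * gA1 (0, s))%C = RtoC (- (1 / PI))).
  { apply (ray_const_lim (fun t => CPS (dcoef hP) (1 - tL t)%C * - tL1 t * gA t + CPS hP (1 - tL t)%C * gA1 t)%C 0 0).
    - intros s Hs. apply K1_affine; auto.
    - apply (Clf_ext (fun t => - ((1 - RtoC (rx t * rx t)) * CPS (dcoef hP) (RtoC (rx t * rx t)) * (tB (0, t) * tB (0, t)) * gA (0, t))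
         - (1 - RtoC (rx t * rx t)) * CPS hP (RtoC (rx t * rx t)) * ((tA1 (0, t) / nome (0, t)) / (tC (0, t) / nome (0, t))))%C).
      + generalize (Rinf_gt 0). apply filter_imp. intros t Ht. destruct (tL_axis t Ht) as [T1 T2]. rewrite <- T2.
        replace (1 - (1 - tL (0, t)))%C with (tL (0, t)) by ring.
        destruct (tAB_neq_0 (0, t) Ht) as [NA NB]. assert (NC := tC_neq_0 (0, t) Ht).
        unfold gA1, tL1, tL. field. split; [auto|]. split; [apply nome_neq_0 | auto].
      + apply (Clf_eq _ (- (RtoC (1 / PI) * (1 * 1) * 1) - RtoC 0 * (4 / 16))%C).
        { rewrite RtoC_opp. ring. }
        apply Clf_minus; [apply Clf_opp; apply Clf_mult; [apply Clf_mult|]|apply Clf_mult].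
        * exact A1.
        * apply Clf_mult; apply (Clf_ray 0 tB), tB_Iinf.
        * apply (Clf_ray 0 gA), gA_Iinf.
        * exact A0.
        * apply Clf_div; [intro K; injection K; lra | |].
          -- apply (Clf_ray 0 (fun t => tA1 t / nome t)%C), tA1_quot.
          -- apply (Clf_ray 0 (fun t => tC t / nome t)%C), tC_quot. }
  destruct (ray_affine (fun t => CPS hP (1 - tL t)%C * gA t)%C
    (fun t => CPS (dcoef hP) (1 - tL t)%C * - tL1 t * gA t + CPS hP (1 - tL t)%C * gA1 t)%C 0 0 (RtoC (- (1 / PI)))) as [beta Hb].
  - intros t Ht. apply (K1_affine (0, t)); auto.
  - exact E1.
  - exists beta. intros t Ht. specialize (Hb t Ht). simpl in Hb.
    destruct (tAB_neq_0 (0, t) Ht) as [NA _].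
    replace (CPS hP (1 - tL (0, t))%C) with (CPS hP (1 - tL (0, t))%C * gA (0, t) * tA (0, t))%C by (unfold gA; field; auto).
    rewrite Hb. f_equal. f_equal.
    unfold ipi. apply injective_projections; simpl; field; lra.
Qed.

Lemma Cmult_integral (x y : C) : (x * y)%C = 0 -> x = 0 \/ y = 0.
Proof.
  intro H. destruct (classic (x = 0)) as [E|N]; [now left|]. right.
  replace y with (x * y / x)%C by (field; exact N). rewrite H. field. exact N.
Qed.

(** Parameters s, s' with complementary moduli satisfy (s + beta)(s' + beta) = 1, and Landen's
    transformation carries the pair to (2 s, s'/2). Subtracting the two relations leaves beta (s'/2
    - s) = 0. If s' = 2 s for s = 1, the doubled pair is used instead; so beta = 0 and s' = 1/s. *)
Lemma S_axis t : 0 < t -> ra (/ t) = t * ra t /\ rx (/ t) * rx (/ t) = 1 - rx t * rx t.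
Proof.
  destruct K1_axis as [beta Hb].
  assert (pair : forall s s', 0 < s -> 0 < s' -> rx s' * rx s' = 1 - rx s * rx s ->
    RtoC (ra s') = ((RtoC s + beta) * RtoC (ra s))%C).
  { intros s s' Hs Hs' E. destruct (ra_spec s Hs) as [A _]. destruct (ra_spec s' Hs') as [A' _].
    rewrite <- A, <- A', <- (Hb s Hs), <- (K0_axis s' Hs'). f_equal.
    rewrite (proj1 (tL_axis s' Hs')), (proj2 (tL_axis s Hs)). f_equal. lra. }
  assert (prod : forall s s', 0 < s -> 0 < s' -> rx s' * rx s' = 1 - rx s * rx s ->
    ((RtoC s + beta) * (RtoC s' + beta))%C = 1).
  { intros s s' Hs Hs' E. assert (P1 := pair s s' Hs Hs' E). assert (P2 := pair s' s Hs' Hs ltac:(lra)).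
    rewrite P1 in P2. destruct (ra_spec s Hs) as [_ A].
    assert (N : RtoC (ra s) <> 0) by (intro K; injection K; lra).
    replace ((RtoC s + beta) * (RtoC s' + beta))%C with ((RtoC s' + beta) * ((RtoC s + beta) * RtoC (ra s)) / RtoC (ra s))%C by (field; auto).
    rewrite <- P2. field. auto. }
  assert (dblp : forall s s', 0 < s -> 0 < s' -> rx s' * rx s' = 1 - rx s * rx s ->
    rx (s' / 2) * rx (s' / 2) = 1 - rx (2 * s) * rx (2 * s)).
  { intros s s' Hs Hs' E. assert (D1 := rx_double s Hs). assert (D2 := rx_double (s' / 2) ltac:(lra)).
    replace (2 * (s' / 2)) with s' in D2 by field. rewrite E in D2.
    assert (B1 := rx_bounds s Hs). assert (B2 := rx_bounds (s' / 2) ltac:(lra)).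
    set (x := rx s) in *. set (y := rx (s' / 2)) in *. set (X := rx (2 * s) * rx (2 * s)) in *.
    (* The other root of the quadratic given by Landen's relation is (1 + x) / (1 - x), which
       exceeds 1. *)
    assert (Y : y * (1 + x) = 1 - x).
    { assert (F : (y * (1 + x) - (1 - x)) * (y * (1 - x) - (1 + x)) = 0) by nra.
      apply Rmult_integral in F. destruct F as [F|F]; [lra|]. nra. }
    assert (E2 : y * y * ((1 + x) * (1 + x)) = (1 - x) * (1 - x)).
    { replace (y * y * ((1 + x) * (1 + x))) with ((y * (1 + x)) * (y * (1 + x))) by ring. rewrite Y. ring. }
    apply (Rmult_eq_reg_r ((1 + x) * (1 + x))); nra. }
  assert (sub : forall s s', 0 < s -> 0 < s' -> rx s' * rx s' = 1 - rx s * rx s -> (beta * RtoC (s' / 2 - s))%C = 0).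
  { intros s s' Hs Hs' E. assert (P1 := prod s s' Hs Hs' E).
    assert (P2 := prod (2 * s) (s' / 2) ltac:(lra) ltac:(lra) (dblp s s' Hs Hs' E)).
    transitivity ((RtoC s + beta) * (RtoC s' + beta) - (RtoC (2 * s) + beta) * (RtoC (s' / 2) + beta))%C; [|rewrite P1, P2; ring].
    rewrite RtoC_minus, RtoC_mult, RtoC_div2. field. }
  assert (b0 : beta = 0).
  { destruct (rx_dual 1 Rlt_0_1) as [s' [Hs' E]].
    destruct (Req_dec (s' / 2 - 1) 0) as [Z|Z].
    - assert (F := sub (2 * 1) (s' / 2) ltac:(lra) ltac:(lra) (dblp 1 s' Rlt_0_1 Hs' E)).
      apply Cmult_integral in F. destruct F as [F|F]; [exact F|]. injection F. lra.
    - assert (F := sub 1 s' Rlt_0_1 Hs' E). apply Cmult_integral in F. destruct F as [F|F]; [exact F|].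
      injection F. lra. }
  intro Ht. destruct (rx_dual t Ht) as [t' [Ht' E]].
  assert (Q := prod t t' Ht Ht' E). rewrite b0, !Cplus_0_r, <- RtoC_mult in Q. injection Q as Q.
  assert (Et : t' = / t) by (apply (Rmult_eq_reg_l t); [rewrite Rinv_r; lra | lra]).
  rewrite <- Et. split; [|exact E].
  assert (Q2 := pair t t' Ht Ht' E). rewrite b0, Cplus_0_r, <- RtoC_mult in Q2. now injection Q2.
Qed.

Lemma upper_convex : convexC (fun z => 0 < Im z).
Proof.
  intros z w t Hz Hw Ht. replace (Im (z + RtoC t * (w - z))%C) with ((1 - t) * Im z + t * Im w)
    by (destruct z, w; unfold Im; simpl; ring).
  destruct (Rle_lt_dec t (1 / 2)).
  - assert (0 < (1 - t) * Im z) by (apply Rmult_lt_0_compat; lra).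
    assert (0 <= t * Im w) by (apply Rmult_le_pos; lra). lra.
  - assert (0 <= (1 - t) * Im z) by (apply Rmult_le_pos; lra).
    assert (0 < t * Im w) by (apply Rmult_lt_0_compat; lra). lra.
Qed.

Lemma upper_neq_0 tau : 0 < Im tau -> tau <> 0.
Proof. intros H E. subst. simpl in H. lra. Qed.

Lemma Im_opp_inv tau : 0 < Im tau -> 0 < Im (- / tau)%C.
Proof.
  intro H. destruct tau as [x y]. unfold Cinv, Copp, Im in *. simpl in *.
  replace (- (- y / (x * (x * 1) + y * (y * 1)))) with (y / (x * (x * 1) + y * (y * 1))) by (field; nra).
  apply Rdiv_lt_0_compat; [exact H|]. apply sum_sq_pos. right. lra.
Qed.

Lemma holo_opp_inv tau : 0 < Im tau -> holo_at (fun t => - / t)%C tau.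
Proof.
  intro H. eexists. apply Cder_opp, Cder_inv; [apply upper_neq_0, H | apply Cder_id].
Qed.

Lemma upper_identity f : (forall z, 0 < Im z -> holo_at f z) -> (forall t, 0 < t -> f (0, t) = 0) ->
  forall tau, 0 < Im tau -> f tau = 0.
Proof.
  intros Hf Hz tau Ht. apply (identity_theorem (fun z => 0 < Im z) f (0, 1)); auto.
  - apply upper_convex.
  - intros z H. apply upper_open, H.
  - simpl. lra.
  - intros e He. exists (0, 1 + e / 2). split.
    + replace ((0, (1 + e / 2)%R) - (0, 1))%C with (Ci * RtoC (e / 2))%C by (apply injective_projections; simpl; field).
      rewrite Cmod_mult, Cmod_Ci, Cmod_R, Rabs_pos_eq; lra.
    + apply Hz. lra.
Qed.

Lemma axis_opp_inv t : 0 < t -> (- / (0, t))%C = (0, / t).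
Proof. intro H. unfold Cinv, Copp. apply injective_projections; simpl; field; lra. Qed.

(** On the axis this is theta00^2(i/t) = t theta00^2(i t), squared, the sign coming from (i t)^2 = -
    t^2; the identity theorem extends it to the half-plane. *)
Lemma tA_S tau : 0 < Im tau -> (tA (- / tau) * tA (- / tau))%C = (- (tau * tau) * (tA tau * tA tau))%C.
Proof.
  intro H. apply Cminus_eq_0. revert tau H.
  apply (upper_identity (fun tau => tA (- / tau) * tA (- / tau) - - (tau * tau) * (tA tau * tA tau))%C).
  - intros z H. destruct (holo_opp_inv z H) as [l Hl].
    destruct (tA_der _ (Im_opp_inv z H)) as [D _]. destruct (tA_der _ H) as [D' _].
    assert (Dc := Cder_comp tA (fun t => - / t)%C z _ _ D Hl).
    eexists. apply Cder_minus; apply Cder_mult; [exact Dc | exact Dc | | apply Cder_mult; exact D'].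
    apply Cder_opp, Cder_mult; apply Cder_id.
  - intros t Ht. rewrite axis_opp_inv by auto. destruct (S_axis t Ht) as [S1 S2].
    assert (Hi : 0 < / t) by (apply Rinv_0_lt_compat; auto).
    destruct (ra_spec t Ht) as [A _]. destruct (ra_spec _ Hi) as [A' _]. rewrite A, A', S1.
    apply injective_projections; simpl; ring.
Qed.

Lemma tB_S tau : 0 < Im tau -> (tB (- / tau) * tB (- / tau))%C = (- (tau * tau) * tC tau)%C.
Proof.
  intro H. apply Cminus_eq_0. revert tau H.
  apply (upper_identity (fun tau => tB (- / tau) * tB (- / tau) - - (tau * tau) * tC tau)%C).
  - intros z H. destruct (holo_opp_inv z H) as [l Hl].
    destruct (tB_der _ (Im_opp_inv z H)) as [D _].
    assert (Dc := Cder_comp tB (fun t => - / t)%C z _ _ D Hl).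
    eexists. apply Cder_minus; apply Cder_mult; [exact Dc | exact Dc | | apply tC_der, H].
    apply Cder_opp, Cder_mult; apply Cder_id.
  - intros t Ht. rewrite axis_opp_inv by auto. destruct (S_axis t Ht) as [S1 S2].
    assert (Hi : 0 < / t) by (apply Rinv_0_lt_compat; auto).
    destruct (ra_spec t Ht) as [A A0]. destruct (ra_spec _ Hi) as [A' A0'].
    destruct (rb_spec t Ht) as [B _]. destruct (rb_spec _ Hi) as [B' _].
    unfold tC. rewrite A, B, B'.
    assert (Eb : rb (/ t) * rb (/ t) = t * t * (ra t * ra t - rb t * rb t)).
    { unfold rx in S2. transitivity ((rb (/ t) / ra (/ t) * (rb (/ t) / ra (/ t))) * (ra (/ t) * ra (/ t))); [field; lra|].
      rewrite S2, S1. field. lra. }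
    rewrite <- !RtoC_mult, <- RtoC_minus, Eb. apply injective_projections; simpl; ring.
Qed.

Lemma tC_S tau : 0 < Im tau -> tC (- / tau)%C = (- (tau * tau) * (tB tau * tB tau))%C.
Proof. intro H. unfold tC at 1. rewrite tA_S, tB_S by auto. unfold tC. ring. Qed.

(** * The function nu *)

Lemma sqrt3_sq : sqrt 3 * sqrt 3 = 3. Proof. apply sqrt_sqrt. lra. Qed.
Lemma sqrt3_pos : 0 < sqrt 3. Proof. apply sqrt_lt_R0. lra. Qed.

Lemma omega_pair : omega = (- (1 / 2), sqrt 3 / 2).
Proof. unfold omega, Cdiv, Cinv. apply injective_projections; simpl; field. Qed.

Lemma omega_sq : (omega * omega = - (1) - omega)%C.
Proof.
  assert (S := sqrt3_sq). rewrite omega_pair. apply injective_projections; simpl; nra.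
Qed.

Lemma omega_pow2 : (omega ^ 2 = - (1) - omega)%C.
Proof. rewrite <- omega_sq. simpl. ring. Qed.

Lemma omega_sqrt3 : (RtoC (sqrt 3) * Ci = 2 * omega + 1)%C.
Proof. rewrite omega_pair. apply injective_projections; simpl; field. Qed.

Lemma Im_omega : 0 < Im omega.
Proof. assert (S := sqrt3_pos). rewrite omega_pair. simpl. lra. Qed.

Lemma omega_neq_0 : omega <> 0.
Proof. apply upper_neq_0, Im_omega. Qed.

Lemma omega_cube : (omega * omega * omega)%C = 1.
Proof.
  rewrite omega_sq. transitivity (- omega - omega * omega)%C; [ring|]. rewrite omega_sq. ring.
Qed.

Lemma inv_omega : (/ omega)%C = (omega * omega)%C.
Proof.
  transitivity (omega * omega * omega * / omega)%C; [rewrite omega_cube; ring | field; exact omega_neq_0].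
Qed.

Lemma omega_plus_1_sq : ((omega + 1) * (omega + 1) = omega)%C.
Proof.
  transitivity (omega * omega + 2 * omega + 1)%C; [ring|]. rewrite omega_sq. ring.
Qed.

Lemma omega_plus_1_neq_0 : (omega + 1)%C <> 0.
Proof.
  intro E. apply omega_neq_0. rewrite <- omega_plus_1_sq, E. ring.
Qed.

Lemma omega_fixed : (- / (omega + 1))%C = omega.
Proof.
  assert (N := omega_plus_1_neq_0).
  transitivity ((omega * omega + omega) / (omega + 1))%C; [|field; exact N].
  rewrite omega_sq. field. exact N.
Qed.

Lemma Im_plus_1 tau : Im (tau + 1)%C = Im tau.
Proof. destruct tau. unfold Im. simpl. ring. Qed.

Lemma sqrt3i_neq_0 : (2 * omega + 1)%C <> 0.
Proof.
  rewrite <- omega_sqrt3. apply Cmult_neq_0.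
  - intro K. injection K. assert (S := sqrt3_pos). lra.
  - intro K. injection K. lra.
Qed.

(* tz is nu, written so that 1 - tz = tu ^ 3. *)
Definition tH (tau : C) : C := (tA tau * tA tau + omega * tC tau)%C.
Definition tG (tau : C) : C := (tA tau * tA tau + omega ^ 2 * tC tau)%C.
Definition tz (tau : C) : C :=
  (3 * (2 * omega + 1) * (tA tau * tA tau * (tB tau * tB tau) * tC tau) / (tH tau * tH tau * tH tau))%C.
Definition tu (tau : C) : C := (tG tau / tH tau)%C.

Lemma nu_tz tau : 0 < Im tau -> nu tau = tz tau.
Proof.
  intro H. unfold nu. rewrite theta00_tA, theta01_tB, theta10_tAB by auto.
  fold (tC tau). fold (tH tau). unfold tz, Cdiv.
  replace (tH tau ^ 3)%C with (tH tau * tH tau * tH tau)%C by ring.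
  replace (3 * RtoC (sqrt 3) * Ci)%C with (3 * (RtoC (sqrt 3) * Ci))%C by ring.
  rewrite omega_sqrt3. ring.
Qed.

Lemma tz_tu tau : tH tau <> 0 -> tz tau = (1 - tu tau * tu tau * tu tau)%C.
Proof.
  intro N. unfold tz, tu.
  assert (E : (tH tau * tH tau * tH tau - tG tau * tG tau * tG tau
     = 3 * (2 * omega + 1) * (tA tau * tA tau * (tB tau * tB tau) * tC tau))%C).
  { unfold tH, tG. rewrite omega_pow2. unfold tC. assert (W := omega_sq).
    generalize dependent omega. intros w W. ring [W]. }
  rewrite <- E. field. exact N.
Qed.

Definition tH1 (tau : C) : C :=
  (2 * tA1 tau / tA tau * tH tau + omega * (tB tau * tB tau * tC tau))%C.
Definition tH2 (tau : C) : C :=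
  ((2 * (tA1 tau * tA1 tau) / (tA tau * tA tau) + tB tau * tB tau * tC tau / 2) * tH tau
   + 2 * tA1 tau / tA tau * tH1 tau
   + omega * (tB tau * tB tau * tC tau * (4 * tA1 tau / tA tau + tB tau * tB tau - tC tau)))%C.

Lemma tC_der' tau : 0 < Im tau ->
  Cder tC tau (ipi * (2 * tA1 tau * tC tau / tA tau + tB tau * tB tau * tC tau))%C.
Proof.
  intro H. destruct (tAB_neq_0 _ H) as [N1 N2]. eapply Cder_eq; [apply tC_der, H|].
  rewrite tB1_eq by auto. unfold tC. field. exact N1.
Qed.

Lemma tH_der tau : 0 < Im tau -> Cder tH tau (ipi * tH1 tau)%C /\ Cder tH1 tau (ipi * tH2 tau)%C.
Proof.
  intro H. destruct (tA_der _ H) as [DA DA1]. destruct (tB_der _ H) as [DB _].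
  destruct (tAB_neq_0 _ H) as [N1 N2]. assert (DC := tC_der' _ H).
  assert (DH : Cder tH tau (ipi * tH1 tau)%C).
  { eapply Cder_eq; [apply Cder_plus; [apply Cder_mult; exact DA | apply Cder_scal, DC]|].
    unfold tH1, tH. field. exact N1. }
  split; [exact DH|].
  eapply Cder_eq.
  - apply Cder_plus; [apply Cder_mult; [apply Cder_div; [exact N1 | apply Cder_scal; exact DA1 | exact DA] | exact DH]|].
    apply Cder_scal. apply Cder_mult; [apply Cder_mult; exact DB | exact DC].
  - cbv beta. unfold tH2. rewrite tA2_eq, tB1_eq by auto. field. exact N1.
Qed.

Lemma tG_der tau : 0 < Im tau ->
  Cder tG tau (ipi * (2 * tA1 tau / tA tau * tG tau + omega ^ 2 * (tB tau * tB tau * tC tau)))%C.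
Proof.
  intro H. destruct (tA_der _ H) as [DA DA1]. destruct (tAB_neq_0 _ H) as [N1 N2]. assert (DC := tC_der' _ H).
  eapply Cder_eq; [apply Cder_plus; [apply Cder_mult; exact DA | apply Cder_scal, DC]|].
  unfold tG. field. exact N1.
Qed.

Definition tu1 (tau : C) : C := (- tz tau * tH tau / 3)%C.

(** In G' H - G H' the terms with the logarithmic derivative of theta00 cancel, and omega^2 H -
    omega G = - (2 omega + 1) theta00^4 turns the rest into the numerator of nu. *)
Lemma tu_der tau : 0 < Im tau -> tH tau <> 0 -> Cder tu tau (ipi * tu1 tau)%C.
Proof.
  intros H N. destruct (tAB_neq_0 _ H) as [N1 N2]. destruct (tH_der _ H) as [DH _].
  eapply Cder_eq; [apply Cder_div; [exact N | apply tG_der, H | exact DH]|].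
  unfold tu1, tz, tH1.
  transitivity (ipi * ((omega ^ 2 * tH tau - omega * tG tau) * (tB tau * tB tau * tC tau)) / (tH tau * tH tau))%C;
    [field; auto|].
  replace (omega ^ 2 * tH tau - omega * tG tau)%C with (- (2 * omega + 1) * (tA tau * tA tau))%C.
  - field. exact N.
  - unfold tH, tG. rewrite omega_pow2. assert (W := omega_sq). generalize dependent omega. intros w W. ring [W].
Qed.

Definition tz1 (tau : C) : C := (tz tau * (tu tau * tu tau) * tH tau)%C.
Definition tz2 (tau : C) : C :=
  (tz1 tau * (tu tau * tu tau) * tH tau + 2 * tz tau * tu tau * tu1 tau * tH tau
   + tz tau * (tu tau * tu tau) * tH1 tau)%C.

Lemma tH_near tau : 0 < Im tau -> tH tau <> 0 -> Cnear tau (fun t => 0 < Im t /\ tH t <> 0).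
Proof.
  intros H N. apply filter_and; [apply upper_open, H|].
  apply (Clf_neq tH _ _ N). exact (Cder_cont _ _ _ (proj1 (tH_der _ H))).
Qed.

Lemma tz_der tau : 0 < Im tau -> tH tau <> 0 ->
  Cder tz tau (ipi * tz1 tau)%C /\ Cder tz1 tau (ipi * tz2 tau)%C.
Proof.
  intros H N. assert (Du := tu_der _ H N).
  assert (Dz : Cder tz tau (ipi * tz1 tau)%C).
  { apply (Cder_ext (fun t => 1 - tu t * tu t * tu t)%C).
    - generalize (tH_near _ H N). apply filter_imp. intros t [_ Nt]. symmetry. apply tz_tu, Nt.
    - eapply Cder_eq; [apply Cder_minus; [apply Cder_const | apply Cder_mult; [apply Cder_mult; exact Du | exact Du]]|].
      cbv beta. unfold tz1, tu1. field. }
  split; [exact Dz|]. eapply Cder_eq.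
  - apply Cder_mult; [apply Cder_mult; [exact Dz | apply Cder_mult; exact Du] | apply tH_der, H].
  - cbv beta. unfold tz2. ring.
Qed.

Lemma Cinv_neq_0 (x : C) : x <> 0 -> (/ x)%C <> 0.
Proof.
  intros H E. apply C1_neq_0. rewrite <- (Cinv_r x H), E. ring.
Qed.

Ltac cmult_nz := match goal with
  | |- (_ * _)%C <> _ => apply Cmult_neq_0; cmult_nz
  | |- _ => auto end.

Lemma tz_neq_0 tau : 0 < Im tau -> tH tau <> 0 -> tz tau <> 0.
Proof.
  intros H N. destruct (tAB_neq_0 _ H) as [N1 N2]. assert (N3 := tC_neq_0 _ H). assert (N4 := sqrt3i_neq_0).
  unfold tz, Cdiv. apply Cmult_neq_0.
  - apply Cmult_neq_0; [apply Cmult_neq_0; [intro K; injection K; lra | auto]|].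
    cmult_nz.
  - apply Cinv_neq_0. cmult_nz.
Qed.

(** * A square root on the right half-plane *)

(** The principal branch by half-angle formulas, for Re z > 0. The condition Re H > 0 in [region] is
    there to make H^(-1/2) holomorphic with this branch. *)
Definition Csqrt (z : C) : C :=
  let p := sqrt ((Cmod z + Re z) / 2) in (p, Im z / (2 * p)).

Lemma Csqrt_spec z : 0 < Re z -> (Csqrt z * Csqrt z)%C = z /\ 0 < Re (Csqrt z).
Proof.
  intro H. assert (K := re_le_Cmod z). rewrite Rabs_pos_eq in K by lra.
  assert (P : 0 < (Cmod z + Re z) / 2) by lra.
  assert (S := sqrt_sqrt _ (Rlt_le _ _ P)). assert (S0 := sqrt_lt_R0 _ P).
  assert (E := Cmod2_alt z). unfold Csqrt. set (p := sqrt ((Cmod z + Re z) / 2)) in *.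
  split; [|exact S0].
  apply injective_projections; simpl.
  - apply (Rmult_eq_reg_r (4 * (p * p))); [|nra].
    replace ((p * p - Im z / (2 * p) * (Im z / (2 * p))) * (4 * (p * p))) with (4 * (p * p) * (p * p) - Im z * Im z) by (field; lra).
    rewrite S. change (fst z) with (Re z). nra.
  - change (snd z) with (Im z). field. lra.
Qed.

Lemma Csqrt_unique s t : (s * s)%C = (t * t)%C -> 0 < Re s -> 0 < Re t -> s = t.
Proof.
  intros E Hs Ht. assert (F : ((s - t) * (s + t))%C = 0).
  { replace ((s - t) * (s + t))%C with (s * s - t * t)%C by ring. rewrite E. ring. }
  apply Cmult_integral in F. destruct F as [F|F]; [apply Cminus_eq_0, F|].
  apply (f_equal Re) in F. change (Re (s + t)%C) with (Re s + Re t) in F. simpl in F. lra.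
Qed.

Lemma Re_near z : 0 < Re z -> Cnear z (fun w => 0 < Re w).
Proof.
  intro H. exists (Re z). split; [auto|]. intros w Hw.
  assert (K := re_le_Cmod (w - z)%C). change (Re (w - z)%C) with (Re w - Re z) in K.
  apply Rabs_le_between in K. lra.
Qed.

Lemma Csqrt_der z : 0 < Re z -> Cder Csqrt z (/ (2 * Csqrt z))%C.
Proof.
  intro H. destruct (Csqrt_spec z H) as [S1 S2]. set (s0 := Csqrt z) in *.
  assert (sum : forall w, 0 < Re w -> Re s0 <= Cmod (Csqrt w + s0)%C /\ (Csqrt w + s0)%C <> 0 /\ (Csqrt w - s0 = (w - z) / (Csqrt w + s0))%C).
  { intros w Hw. destruct (Csqrt_spec w Hw) as [W1 W2].
    assert (K := re_le_Cmod (Csqrt w + s0)%C). change (Re (Csqrt w + s0)%C) with (Re (Csqrt w) + Re s0) in K.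
    rewrite Rabs_pos_eq in K by lra.
    assert (N : (Csqrt w + s0)%C <> 0) by (apply Cmod_gt_0; lra).
    split; [lra|]. split; [exact N|]. transitivity ((Csqrt w * Csqrt w - s0 * s0) / (Csqrt w + s0))%C; [field; exact N | now rewrite W1, S1]. }
  assert (C : Clf (Cnear z) Csqrt s0).
  { intros e He. assert (He' : 0 < e * Re s0) by (apply Rmult_lt_0_compat; auto).
    generalize (filter_and _ _ (Re_near z H) (Cnear_ball z _ He')). apply filter_imp. intros w [W1 W2].
    destruct (sum w W1) as [A1 [A2 A3]]. rewrite A3, Cmod_div by auto.
    apply (Rmult_lt_reg_r (Cmod (Csqrt w + s0)%C)); [lra|].
    unfold Rdiv. rewrite Rmult_assoc, Rinv_l, Rmult_1_r by lra.
    eapply Rlt_le_trans; [exact W2|]. apply Rmult_le_compat_l; lra. }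
  destruct (sum z H) as [_ [N _]]. fold s0 in N.
  exists (fun w => / (Csqrt w + s0))%C. split; [|split].
  - generalize (Re_near z H). apply filter_imp. intros w Hw. destruct (sum w Hw) as [_ [A2 A3]].
    fold s0. transitivity (s0 + (Csqrt w - s0))%C; [ring|]. rewrite A3. field. exact A2.
  - fold s0. f_equal. ring.
  - apply (Clf_eq _ (/ (s0 + s0))%C); [f_equal; ring|].
    apply Clf_inv; [exact N|]. apply Clf_plus; [exact C | apply Clf_const].
Qed.

Definition gS (tau : C) : C := (/ Csqrt (tH tau))%C.
Definition gS1 (tau : C) : C := (- (tH1 tau / (2 * tH tau)) * gS tau)%C.
Definition gS2 (tau : C) : C :=
  ((- (tH2 tau / (2 * tH tau)) + 3 * (tH1 tau * tH1 tau) / (4 * (tH tau * tH tau))) * gS tau)%C.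

Lemma Re_pos_neq_0 z : 0 < Re z -> z <> 0.
Proof. intros H E. rewrite E in H. simpl in H. lra. Qed.

Lemma gS_der tau : 0 < Im tau -> 0 < Re (tH tau) ->
  Cder gS tau (ipi * gS1 tau)%C /\ Cder gS1 tau (ipi * gS2 tau)%C.
Proof.
  intros H HR. assert (NH := Re_pos_neq_0 _ HR). destruct (Csqrt_spec _ HR) as [S1 S2].
  assert (NS := Re_pos_neq_0 _ S2). destruct (tH_der _ H) as [DH DH1].
  assert (Ds : Cder (fun t => Csqrt (tH t)) tau (/ (2 * Csqrt (tH tau)) * (ipi * tH1 tau))%C).
  { apply (Cder_comp Csqrt tH); [apply Csqrt_der, HR | exact DH]. }
  assert (Dg : Cder gS tau (ipi * gS1 tau)%C).
  { eapply Cder_eq; [apply Cder_inv; [exact NS | exact Ds]|]. unfold gS1, gS. cbv beta.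
    set (s := Csqrt (tH tau)) in *. rewrite <- S1. field. exact NS. }
  split; [exact Dg|]. unfold gS1. eapply Cder_eq.
  - apply Cder_mult; [apply Cder_opp, Cder_div; [| exact DH1 | apply Cder_scal, DH] | exact Dg].
    apply Cmult_neq_0; [apply C2_neq_0 | exact NH].
  - cbv beta. unfold gS2, gS1. field. exact NH.
Qed.

(** The left side is (H^(-1/2))'' divided by H^(-1/2). Since nu' = nu u^2 H and 1 - nu = u^3, the
    right side is - ab nu'^2 / (nu (1 - nu)) with ab = 1/12 for the parameters (1/6, 1/2). *)
Lemma nu_weight tau : 0 < Im tau -> tH tau <> 0 ->
  (- (tH2 tau / (2 * tH tau)) + 3 * (tH1 tau * tH1 tau) / (4 * (tH tau * tH tau))
    = - (1 / 12) * (tz tau * tu tau * (tH tau * tH tau)))%C.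
Proof.
  intros H N. destruct (tAB_neq_0 _ H) as [N1 N2].
  unfold tz, tu, tH2, tH1.
  set (b := (tB tau * tB tau)%C). set (A := tA tau) in *. set (p := tA1 tau).
  assert (EC : (tC tau = A * A - b)%C) by reflexivity.
  set (c := tC tau) in *. set (h := tH tau) in *.
  assert (Eh : (h = A * A + omega * c)%C) by reflexivity.
  assert (EG : (tG tau = A * A + omega ^ 2 * c)%C) by reflexivity.
  set (G := tG tau) in *.
  transitivity (- (b * c / 4) * (h * h + 2 * omega * (b - c) * h - 3 * (omega * omega) * (b * c)) / (h * h))%C;
    [field; auto|].
  assert (K : (h * h + 2 * omega * (b - c) * h - 3 * (omega * omega) * (b * c) = (2 * omega + 1) * (A * A) * G)%C).
  { rewrite EG, omega_pow2. rewrite Eh, EC. assert (W := omega_sq). revert W. generalize omega. intros w W. ring [W]. }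
  rewrite K. field. exact N.
Qed.

Lemma RtoC_abc : RtoC (1 / 6 + 1 / 2 + 1) = (5 / 3)%C /\ RtoC (1 / 6 * (1 / 2)) = (1 / 12)%C /\ RtoC (2 / 3) = (2 / 3)%C.
Proof.
  repeat split.
  - replace (1 / 6 + 1 / 2 + 1) with (5 / 3) by field. unfold Rdiv. rewrite RtoC_mult, RtoC_inv by lra. reflexivity.
  - replace (1 / 6 * (1 / 2)) with (1 / 12) by field. unfold Rdiv. rewrite RtoC_mult, RtoC_inv by lra. reflexivity.
  - unfold Rdiv. rewrite RtoC_mult, RtoC_inv by lra. reflexivity.
Qed.

Definition hF := hc (1 / 6) (1 / 2) 1.
Definition hG := hc (1 / 6) (1 / 2) (2 / 3).

Definition kF (tau : C) : C := (CPS hF (tz tau) * gS tau)%C.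
Definition kF1 (tau : C) : C := (CPS (dcoef hF) (tz tau) * tz1 tau * gS tau + CPS hF (tz tau) * gS1 tau)%C.
Definition kG (tau : C) : C := (CPS hG (1 - tz tau) * gS tau)%C.
Definition kG1 (tau : C) : C :=
  (CPS (dcoef hG) (1 - tz tau) * - tz1 tau * gS tau + CPS hG (1 - tz tau) * gS1 tau)%C.

Definition region (tau : C) : Prop :=
  0 < Im tau /\ 0 < Re (tH tau) /\ Cmod (tz tau) < 1 /\ Cmod (1 - tz tau)%C < 1.

Lemma region_neq tau : region tau -> tz tau <> 0 /\ tz tau <> 1.
Proof.
  intros [H [HR [H1 H2]]]. split.
  - intro E. rewrite E in H2. replace (1 - 0)%C with (RtoC 1) in H2 by ring. rewrite Cmod_1 in H2. lra.
  - intro E. rewrite E, Cmod_1 in H1. lra.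
Qed.

(** The logarithmic derivative of nu' g^2 = nu (1 - nu)^(2/3) for g = H^(-1/2), with denominators
    cleared; 5/3 = 1 + 2/3. *)
Lemma nu_compat_1 tau : 0 < Im tau -> tH tau <> 0 ->
  (tz tau * (1 - tz tau) * (tz2 tau * gS tau + 2 * tz1 tau * gS1 tau)
    = tz1 tau * tz1 tau * gS tau * (1 - 5 / 3 * tz tau))%C.
Proof.
  intros H N. unfold tz2, gS1, tz1, tu1. assert (E := tz_tu _ N).
  set (Z := tz tau) in *. set (U := tu tau) in *. rewrite E. field. exact N.
Qed.

Lemma nu_compat_2 tau : 0 < Im tau -> tH tau <> 0 ->
  (tz tau * (1 - tz tau) * gS2 tau = - (1 / 12) * (tz1 tau * tz1 tau) * gS tau)%C.
Proof.
  intros H N. unfold gS2, tz1. rewrite nu_weight by auto. assert (E := tz_tu _ N).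
  set (Z := tz tau) in *. set (U := tu tau) in *. rewrite E. field.
Qed.

Lemma kF_affine tau : region tau -> Cder kF tau (ipi * kF1 tau)%C /\ Cder kF1 tau 0.
Proof.
  intro Hr. destruct (region_neq _ Hr) as [N0 N1]. destruct Hr as [H [HR [Z1 Z2]]].
  assert (NH := Re_pos_neq_0 _ HR). destruct (tz_der _ H NH) as [D1 D2]. destruct (gS_der _ H HR) as [D3 D4].
  destruct RtoC_abc as [E1 [E2 E3]].
  apply (hypergeometric_affine (1 / 6) (1 / 2) 1 tz tz1 tz2 gS gS1 gS2); auto; try lra.
  - rewrite E1. apply nu_compat_1; auto.
  - rewrite E2. apply nu_compat_2; auto.
Qed.

Lemma kG_affine tau : region tau -> Cder kG tau (ipi * kG1 tau)%C /\ Cder kG1 tau 0.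
Proof.
  intro Hr. destruct (region_neq _ Hr) as [N0 N1]. destruct Hr as [H [HR [Z1 Z2]]].
  assert (NH := Re_pos_neq_0 _ HR). destruct (tz_der _ H NH) as [D1 D2]. destruct (gS_der _ H HR) as [D3 D4].
  destruct RtoC_abc as [E1 [E2 E3]].
  apply (hypergeometric_affine (1 / 6) (1 / 2) (2 / 3) (fun t => 1 - tz t)%C (fun t => - tz1 t)%C (fun t => - tz2 t)%C gS gS1 gS2); auto; try lra.
  - intro E. apply N1. replace (tz tau) with (1 - (1 - tz tau))%C by ring. rewrite E. ring.
  - intro E. apply N0. replace (tz tau) with (1 - (1 - tz tau))%C by ring. rewrite E. ring.
  - eapply Cder_eq; [apply Cder_minus; [apply Cder_const | exact D1]|]. ring.
  - eapply Cder_eq; [apply Cder_opp; exact D2|]. ring.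
  - rewrite E1, E3. assert (K := nu_compat_1 _ H NH).
    transitivity (- (tz tau * (1 - tz tau) * (tz2 tau * gS tau + 2 * tz1 tau * gS1 tau)))%C; [ring|].
    rewrite K. field.
  - rewrite E2. assert (K := nu_compat_2 _ H NH).
    transitivity (tz tau * (1 - tz tau) * gS2 tau)%C; [ring|]. rewrite K. ring.
Qed.

Lemma region_open tau : region tau -> Cnear tau region.
Proof.
  intros [H [HR [Z1 Z2]]]. assert (NH := Re_pos_neq_0 _ HR).
  assert (CH := Cder_cont _ _ _ (proj1 (tH_der _ H))). assert (Cz := Cder_cont _ _ _ (proj1 (tz_der _ H NH))).
  unfold region. apply filter_and; [apply upper_open, H|].
  apply filter_and; [exact (Clf_near _ tH _ (fun w => 0 < Re w) CH (Re_near _ HR))|].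
  assert (D : forall c z, Cmod (z - c)%C < 1 -> Cnear z (fun w => Cmod (w - c)%C < 1)) by (intros c z; apply disc_open).
  apply filter_and.
  - apply (Clf_near _ tz _ (fun w => Cmod w < 1) Cz).
    assert (Q := D 0 (tz tau)). replace (tz tau - 0)%C with (tz tau) in Q by ring. generalize (Q Z1).
    apply filter_imp. intros w Hw. replace (w - 0)%C with w in Hw by ring. exact Hw.
  - apply (Clf_near _ tz _ (fun w => Cmod (1 - w)%C < 1) Cz). rewrite Cmod_sym in Z2. generalize (D 1 (tz tau) Z2).
    apply filter_imp. intros w Hw. rewrite Cmod_sym. exact Hw.
Qed.

(** * The ray Re tau = -1/2 *)

Local Notation hray t := (@pair R R (- (1 / 2))%R t%R) (only parsing).

(** On this ray q is purely imaginary, so -q is its conjugate, and the theta series has real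
    coefficients. *)
Lemma tAB_half t : 0 < t -> tB (hray t) = Cconj (tA (hray t)).
Proof.
  intro H. assert (Hq : Cmod (nome (hray t)) < 1) by (apply nome_lt_1; exact H).
  assert (E : (- nome (hray t))%C = Cconj (nome (hray t))).
  { rewrite <- nome_plus_1. unfold nome, ipi, Cexp, Cconj. apply injective_projections; simpl.
    - replace ((PI * 0 - 0 * 1) * (- (1 / 2) + 1) - (PI * 1 + 0 * 0) * (t + 0)) with (- PI * t) by ring.
      replace ((PI * 0 - 0 * 1) * - (1 / 2) - (PI * 1 + 0 * 0) * t) with (- PI * t) by ring.
      replace ((PI * 0 - 0 * 1) * (t + 0) + (PI * 1 + 0 * 0) * (- (1 / 2) + 1)) with (PI / 2) by field.
      replace ((PI * 0 - 0 * 1) * t + (PI * 1 + 0 * 0) * - (1 / 2)) with (- (PI / 2)) by field.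
      now rewrite cos_neg.
    - replace ((PI * 0 - 0 * 1) * (- (1 / 2) + 1) - (PI * 1 + 0 * 0) * (t + 0)) with (- PI * t) by ring.
      replace ((PI * 0 - 0 * 1) * - (1 / 2) - (PI * 1 + 0 * 0) * t) with (- PI * t) by ring.
      replace ((PI * 0 - 0 * 1) * (t + 0) + (PI * 1 + 0 * 0) * (- (1 / 2) + 1)) with (PI / 2) by field.
      replace ((PI * 0 - 0 * 1) * t + (PI * 1 + 0 * 0) * - (1 / 2)) with (- (PI / 2)) by field.
      rewrite sin_neg. ring. }
  unfold tB, tA, FA. rewrite E, !CPS_conj by (apply tc_poly || exact Hq). now rewrite Cmult_conj.
Qed.

Definition hal (t : R) : R := Re (tA (hray t) * tA (hray t))%C.
Definition hbe (t : R) : R := Im (tA (hray t) * tA (hray t))%C.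

Lemma half_values t : 0 < t ->
  (tA (hray t) * tA (hray t))%C = (hal t, hbe t) /\
  (tB (hray t) * tB (hray t))%C = (hal t, - hbe t) /\
  tC (hray t) = (0, 2 * hbe t) /\
  tH (hray t) = RtoC (hal t - sqrt 3 * hbe t) /\
  tG (hray t) = RtoC (hal t + sqrt 3 * hbe t).
Proof.
  intro H. assert (E1 : (tA (hray t) * tA (hray t))%C = (hal t, hbe t)).
  { unfold hal, hbe. now destruct (tA (hray t) * tA (hray t))%C. }
  assert (E2 : (tB (hray t) * tB (hray t))%C = (hal t, - hbe t)).
  { rewrite tAB_half, <- Cmult_conj, E1 by auto. reflexivity. }
  assert (E3 : tC (hray t) = (0, 2 * hbe t)).
  { unfold tC. rewrite E1, E2. apply injective_projections; simpl; ring. }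
  split; [exact E1|]. split; [exact E2|]. split; [exact E3|]. split.
  - unfold tH. rewrite E1, E3, omega_pair. apply injective_projections; simpl; field.
  - unfold tG. rewrite E1, E3, omega_pow2, omega_pair. apply injective_projections; simpl; field.
Qed.

Lemma nome_half t : nome (hray t) = (- Ci * RtoC (exp (- PI * t)))%C.
Proof.
  unfold nome, ipi, Cexp. apply injective_projections; simpl.
  - replace ((PI * 0 - 0 * 1) * t + (PI * 1 + 0 * 0) * - (1 / 2)) with (- (PI / 2)) by field.
    rewrite cos_neg, cos_PI2. ring.
  - replace ((PI * 0 - 0 * 1) * t + (PI * 1 + 0 * 0) * - (1 / 2)) with (- (PI / 2)) by field.
    replace ((PI * 0 - 0 * 1) * - (1 / 2) - (PI * 1 + 0 * 0) * t) with (- PI * t) by ring.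
    rewrite sin_neg, sin_PI2. ring.
Qed.

(** theta10^4 never vanishes, so its imaginary part on the ray keeps one sign by continuity; near
    the cusp theta10^4 is close to 16 q = -16 i exp(-pi t). *)
Lemma hbe_neg t : 0 < t -> hbe t < 0.
Proof.
  intro H.
  assert (Hn : forall s, 0 < s -> hbe s <> 0).
  { intros s Hs E. destruct (half_values s Hs) as [_ [_ [E3 _]]]. apply (tC_neq_0 (hray s) Hs).
    rewrite E3, E. apply injective_projections; simpl; ring. }
  assert (Hc : forall s, 0 < s -> continuity_pt (fun u => - hbe u) s).
  { intros s Hs. apply continuity_pt_opp.
    destruct (tA_der (hray s) Hs) as [D _].
    assert (D2 := Cder_scal (- Ci)%C _ _ _ (Cder_mult _ _ _ _ _ D D)).
    assert (C := is_derive_continuity_pt _ _ _ (Cder_vertical _ _ _ _ D2)).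
    apply (continuity_pt_ext (fun u => Re (- Ci * (tA (hray u) * tA (hray u)))%C)); [|exact C].
    intro u. unfold hbe. destruct (tA (hray u) * tA (hray u))%C. simpl. ring. }
  assert (ev : Rinf (fun s => hbe s < 0)).
  { assert (L := Clf_ray (- (1 / 2)) _ _ tC_quot 1 Rlt_0_1).
    generalize (filter_and _ _ (Rinf_gt 0) L). apply filter_imp. intros s [Hs K]. cbv beta in K.
    destruct (half_values s Hs) as [_ [_ [E3 _]]]. rewrite E3, nome_half in K.
    assert (P := exp_pos (- PI * s)).
    assert (Ek : ((0, (2 * hbe s)%R) / (- Ci * RtoC (exp (- PI * s))) - 16)%C = RtoC (- (2 * hbe s / exp (- PI * s)) - 16)).
    { rewrite RtoC_minus, RtoC_opp. unfold Rdiv. rewrite !RtoC_mult, RtoC_inv by lra.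
      replace ((0, (2 * hbe s)%R) : C) with (Ci * (2 * RtoC (hbe s)))%C by (apply injective_projections; simpl; ring).
      assert (Ni : Ci <> 0) by (intro Z; injection Z; lra).
      field. split; [intro Z; injection Z; lra | exact Ni]. }
    rewrite Ek, Cmod_R in K. apply Rabs_lt_between in K.
    apply Rnot_le_lt. intro L0. assert (0 <= 2 * hbe s / exp (- PI * s)) by (apply Rdiv_le_0_compat; lra).
    unfold Rdiv in *. lra. }
  apply Rnot_le_lt. intro L.
  destruct (filter_ex _ (filter_and _ _ (Rinf_gt t) ev)) as [s [Hs Ks]].
  assert (Hn0 := Hn t H).
  destruct (IVT_interv (fun u => - hbe u) t s) as [z [Hz Ez]]; try lra.
  - intros a Ha. apply Hc. lra.
  - apply (Hn z); lra.
Qed.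

(** Minus the cotangent of the argument of theta00^4. On the ray u = (hcot - sqrt 3) / (hcot + sqrt
    3), so the range of nu is governed by the monotonicity of this one real function. *)
Definition hcot (t : R) : R := - hal t / hbe t.

Lemma hcot_der t : 0 < t -> is_derive hcot t (- PI * (hal t * hal t + hbe t * hbe t) / hbe t).
Proof.
  (* On the ray [hcot] is -i (2 / lambda - 1), so its derivative is obtained from that of lambda. *)
  intro H. set (f := fun tau => (- Ci * (2 / tL tau - 1))%C).
  destruct (tL_der (hray t) H) as [DL _]. destruct (tL_neq (hray t) H) as [NL _].
  destruct (tAB_neq_0 (hray t) H) as [NA NB]. assert (NC := tC_neq_0 (hray t) H).
  assert (D : Cder f (hray t) (ipi * (2 * Ci * (tA (hray t) * tA (hray t)) * (tB (hray t) * tB (hray t)) / tC (hray t)))%C).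
  { eapply Cder_eq.
    - apply Cder_scal, Cder_minus; [apply Cder_div; [exact NL | apply Cder_const | exact DL] | apply Cder_const].
    - unfold tL1, tL. field. auto. }
  assert (D' := Cder_vertical _ _ _ _ D).
  assert (B := hbe_neg t H).
  assert (E : Re (ipi * (2 * Ci * (tA (hray t) * tA (hray t)) * (tB (hray t) * tB (hray t)) / tC (hray t)) * Ci)%C
     = - PI * (hal t * hal t + hbe t * hbe t) / hbe t).
  { destruct (half_values t H) as [E1 [E2 [E3 _]]]. rewrite E1, E2, E3. unfold ipi. simpl. field. lra. }
  rewrite E in D'. apply (is_derive_ext_loc (fun s => Re (f (hray s)))); [|exact D'].
  exists (mkposreal t H). intros s Hs. change (Rabs (s - t) < t) in Hs. apply Rabs_lt_between in Hs.
  assert (Hs0 : 0 < s) by lra. assert (Bs := hbe_neg s Hs0).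
  assert (EF : f (hray s) = (- Ci * ((2 * (tA (hray s) * tA (hray s)) - tC (hray s)) / tC (hray s)))%C).
  { destruct (tAB_neq_0 (hray s) Hs0) as [N1 N2]. assert (N3 := tC_neq_0 (hray s) Hs0). unfold f, tL. field. auto. }
  rewrite EF. destruct (half_values s Hs0) as [E1 [E2 [E3 _]]]. rewrite E1, E3. unfold hcot. simpl. field. lra.
Qed.

Lemma sqrt3_half : 0 < sqrt 3 / 2. Proof. assert (S := sqrt3_pos). lra. Qed.

(** The map tau -> -1/(tau + 1) fixes omega; the transformation formulas there give theta10^4 = -
    omega theta00^4. *)
Lemma tG_omega : tG omega = 0.
Proof.
  assert (I1 : 0 < Im (omega + 1)%C) by (rewrite Im_plus_1; apply Im_omega).
  assert (Ea := tA_S _ I1). assert (Ec := tC_S _ I1). rewrite omega_fixed, omega_plus_1_sq in Ea, Ec.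
  rewrite tA_plus_1 in Ea. rewrite tB_plus_1 in Ec.
  assert (Eb : (tB omega * tB omega)%C = (tA omega * tA omega - tC omega)%C) by (unfold tC; ring).
  unfold tG. rewrite omega_pow2, Ec.
  transitivity (tA omega * tA omega + (omega + omega * omega) * (tA omega * tA omega))%C; [ring|].
  rewrite omega_sq. ring.
Qed.

Lemma hcot_omega : hcot (sqrt 3 / 2) = sqrt 3.
Proof.
  assert (H := sqrt3_half). destruct (half_values _ H) as [_ [_ [_ [_ E]]]].
  rewrite <- omega_pair, tG_omega in E. injection E as E. assert (B := hbe_neg _ H). unfold hcot.
  replace (- hal (sqrt 3 / 2)) with (sqrt 3 * hbe (sqrt 3 / 2)) by lra. field. lra.
Qed.

Lemma hcot_gt t : sqrt 3 / 2 < t -> sqrt 3 < hcot t.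
Proof.
  intro Ht. assert (H := sqrt3_half). rewrite <- hcot_omega.
  apply (incr_function hcot (Finite 0) p_infty (fun t => - PI * (hal t * hal t + hbe t * hbe t) / hbe t)); simpl; auto.
  - intros x Hx _. apply hcot_der. exact Hx.
  - intros x Hx _. assert (B := hbe_neg x Hx). assert (P := PI_RGT_0).
    replace (- PI * (hal x * hal x + hbe x * hbe x) / hbe x) with (PI * (hal x * hal x + hbe x * hbe x) / (- hbe x)) by (field; lra).
    apply Rdiv_lt_0_compat; [apply Rmult_lt_0_compat; [lra | nra] | lra].
Qed.

Definition ru (t : R) : R := (hcot t - sqrt 3) / (hcot t + sqrt 3).
Definition rz (t : R) : R := 1 - ru t * ru t * ru t.

Lemma half_tu t : sqrt 3 / 2 <= t -> 0 < Re (tH (hray t)) /\ tu (hray t) = RtoC (ru t) /\ 0 <= ru t < 1 /\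
  (sqrt 3 / 2 < t -> 0 < ru t).
Proof.
  intro Ht. assert (H0 := sqrt3_half). assert (S := sqrt3_pos). assert (H : 0 < t) by lra.
  assert (B := hbe_neg t H). destruct (half_values t H) as [_ [_ [_ [EH EG]]]].
  assert (Hc : sqrt 3 <= hcot t).
  { destruct (Req_dec t (sqrt 3 / 2)) as [->|N]; [rewrite hcot_omega; lra|]. apply Rlt_le, hcot_gt. lra. }
  assert (Ea : hal t = - hbe t * hcot t) by (unfold hcot; field; lra).
  assert (Eh : hal t - sqrt 3 * hbe t = - hbe t * (hcot t + sqrt 3)) by (rewrite Ea; ring).
  assert (Eg : hal t + sqrt 3 * hbe t = - hbe t * (hcot t - sqrt 3)) by (rewrite Ea; ring).
  rewrite Eh in EH. rewrite Eg in EG.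
  assert (Hp : 0 < - hbe t * (hcot t + sqrt 3)) by (apply Rmult_lt_0_compat; lra).
  split; [rewrite EH; exact Hp|]. split.
  - unfold tu. rewrite EH, EG. unfold ru, Rdiv. rewrite !RtoC_mult, RtoC_inv by lra.
    field. split; intro K; injection K; lra.
  - assert (P1 : 0 < / (hcot t + sqrt 3)) by (apply Rinv_0_lt_compat; lra). unfold ru, Rdiv. split.
    + split; [apply Rmult_le_pos; lra|]. apply (Rmult_lt_reg_r (hcot t + sqrt 3)); [lra|].
      rewrite Rmult_assoc, Rinv_l by lra. lra.
    + intro L. apply hcot_gt in L. apply Rmult_lt_0_compat; lra.
Qed.

Lemma half_tz t : sqrt 3 / 2 <= t -> tz (hray t) = RtoC (rz t) /\ 0 < rz t <= 1 /\ (sqrt 3 / 2 < t -> rz t < 1).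
Proof.
  intro Ht. destruct (half_tu t Ht) as [HR [EU [B1 B2]]]. split.
  - rewrite tz_tu by (apply Re_pos_neq_0, HR). rewrite EU. unfold rz. now rewrite RtoC_minus, !RtoC_mult.
  - unfold rz. set (u := ru t) in *. assert (Q : 0 <= u * u < 1) by nra. split.
    + split; [nra|]. assert (0 <= u * u * u) by (apply Rmult_le_pos; lra). lra.
    + intro L. specialize (B2 L). assert (0 < u * u) by nra. assert (0 < u * u * u) by (apply Rmult_lt_0_compat; lra). lra.
Qed.

Lemma half_region t : sqrt 3 / 2 < t -> region (hray t).
Proof.
  intro Ht. destruct (half_tu t ltac:(lra)) as [HR _]. destruct (half_tz t ltac:(lra)) as [EZ [B1 B2]].
  specialize (B2 Ht). assert (S := sqrt3_half). unfold region. rewrite EZ, <- RtoC_minus, !Cmod_R, !Rabs_pos_eq by lra.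
  repeat split; auto; simpl; lra.
Qed.

(** * Limits at the cusp, and the two affine functions on the ray *)

Lemma tC_nome : Clf Iinf (fun t => (2 * tA1 t * tC t / tA t + tB t * tB t * tC t) / nome t)%C 16.
Proof.
  apply (Clf_ext (fun t => 2 * tA1 t * (tC t / nome t) / tA t + tB t * tB t * (tC t / nome t))%C).
  - exists 0. intros t Ht. destruct (tAB_neq_0 _ Ht) as [N1 N2]. field. split; [exact N1 | apply nome_neq_0].
  - apply (Clf_eq _ (2 * 0 * 16 / 1 + 1 * 1 * 16)%C); [field|].
    apply Clf_plus; [apply Clf_div; [apply C1_neq_0| |apply tA_Iinf]|].
    + apply Clf_mult; [apply Clf_mult; [apply Clf_const | apply tA1_Iinf] | apply tC_quot].
    + apply Clf_mult; [apply Clf_mult; apply tB_Iinf | apply tC_quot].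
Qed.

Lemma tH_Iinf : Clf Iinf tH 1.
Proof.
  apply (Clf_eq _ (1 * 1 + omega * 0)%C); [ring|].
  apply Clf_plus; [apply Clf_mult; apply tA_Iinf | apply Clf_mult; [apply Clf_const | apply tC_Iinf]].
Qed.

Lemma tG_Iinf : Clf Iinf tG 1.
Proof.
  apply (Clf_eq _ (1 * 1 + omega ^ 2 * 0)%C); [ring|].
  apply Clf_plus; [apply Clf_mult; apply tA_Iinf | apply Clf_mult; [apply Clf_const | apply tC_Iinf]].
Qed.

Lemma tu_Iinf : Clf Iinf tu 1.
Proof.
  apply (Clf_eq _ (1 / 1)%C); [field|]. apply Clf_div; [apply C1_neq_0 | apply tG_Iinf | apply tH_Iinf].
Qed.

Lemma tz_quot : Clf Iinf (fun t => tz t / nome t)%C (48 * (2 * omega + 1))%C.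
Proof.
  apply (Clf_ext (fun t => 3 * (2 * omega + 1) * (tA t * tA t * (tB t * tB t) * (tC t / nome t)) / (tH t * tH t * tH t))%C).
  - generalize (filter_and _ _ (Iinf_above 0) (Clf_neq _ _ _ C1_neq_0 tH_Iinf)). apply filter_imp. intros t [Ht Nt].
    unfold tz. field. split; [exact Nt | apply nome_neq_0].
  - apply (Clf_eq _ (3 * (2 * omega + 1) * (1 * 1 * (1 * 1) * 16) / (1 * 1 * 1))%C); [field|].
    assert (N : (RtoC 1 * 1 * 1)%C <> 0) by (rewrite !Cmult_1_l; apply C1_neq_0).
    assert (Q1 := tA_Iinf). assert (Q2 := tB_Iinf). assert (Q3 := tC_quot). assert (Q4 := tH_Iinf).
    apply Clf_div; [exact N | | apply Clf_mult; [apply Clf_mult|]; exact Q4].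
    apply Clf_mult; [apply Clf_const|]. apply Clf_mult; [|exact Q3]. apply Clf_mult; apply Clf_mult; assumption.
Qed.

Lemma quot_Iinf f l : Clf Iinf (fun t => f t / nome t)%C l -> Clf Iinf f 0.
Proof.
  intro H. apply (Clf_ext (fun t => f t / nome t * nome t)%C).
  - apply filter_forall. intro t. field. apply nome_neq_0.
  - apply (Clf_eq _ (l * 0)%C); [ring|]. apply Clf_mult; [exact H | apply nome_Iinf].
Qed.

Lemma tz_Iinf : Clf Iinf tz 0.
Proof. exact (quot_Iinf _ _ tz_quot). Qed.

Lemma tH1_quot : Clf Iinf (fun t => tH1 t / nome t)%C (8 + 16 * omega)%C.
Proof.
  apply (Clf_ext (fun t => 2 * tA t * (tA1 t / nome t)
     + omega * ((2 * tA1 t * tC t / tA t + tB t * tB t * tC t) / nome t))%C).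
  - exists 0. intros t Ht. destruct (tAB_neq_0 _ Ht) as [N1 N2]. unfold tH1, tH. field. split; [exact N1 | apply nome_neq_0].
  - apply (Clf_eq _ (2 * 1 * 4 + omega * 16)%C).
    { replace (2 * 1 * 4)%C with (RtoC 8) by (rewrite <- !RtoC_mult; f_equal; ring). ring. }
    apply Clf_plus; apply Clf_mult; try apply Clf_const.
    + apply Clf_mult; [apply Clf_const | apply tA_Iinf].
    + apply tA1_quot.
    + apply tC_nome.
Qed.

Lemma Csqrt_1 : Csqrt 1 = 1.
Proof.
  assert (P : 0 < Re 1) by (simpl; lra). destruct (Csqrt_spec 1 P) as [S1 S2].
  apply Csqrt_unique; auto. rewrite S1. ring.
Qed.

Lemma gS_Iinf : Clf Iinf gS 1.
Proof.
  apply (Clf_eq _ (/ Csqrt 1)%C); [rewrite Csqrt_1; field|].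
  apply Clf_inv; [rewrite Csqrt_1; apply C1_neq_0|].
  apply (Ccont_comp Iinf Csqrt tH 1 tH_Iinf). apply (Cder_cont _ _ _ (Csqrt_der 1 ltac:(simpl; lra))).
Qed.

Lemma gS1_Iinf : Clf Iinf gS1 0.
Proof.
  apply (Clf_eq _ (- (0 / (2 * 1)) * 1)%C); [field|].
  apply Clf_mult; [apply Clf_opp, Clf_div|apply gS_Iinf].
  - rewrite Cmult_1_r. apply C2_neq_0.
  - exact (quot_Iinf _ _ tH1_quot).
  - apply Clf_mult; [apply Clf_const | apply tH_Iinf].
Qed.

Lemma tz1_Iinf : Clf Iinf tz1 0.
Proof.
  apply (Clf_eq _ (0 * (1 * 1) * 1)%C); [ring|].
  apply Clf_mult; [apply Clf_mult; [apply tz_Iinf | apply Clf_mult; apply tu_Iinf] | apply tH_Iinf].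
Qed.

Lemma hF_poly : poly_bd hF. Proof. apply hc_poly; lra. Qed.
Lemma hG_poly : poly_bd hG. Proof. apply hc_poly; lra. Qed.

Lemma kF_half t : sqrt 3 / 2 < t -> kF1 (- (1 / 2), t) = 0 /\ kF (- (1 / 2), t) = 1.
Proof.
  assert (LF : Clf Iinf (fun t => CPS hF (tz t)) 1).
  { apply (Clf_eq _ (RtoC (hF 0))); [unfold hF; now rewrite hc_0|]. apply CPS_Iinf; [apply hF_poly | apply tz_Iinf]. }
  assert (E1 : forall s, sqrt 3 / 2 < s -> kF1 (- (1 / 2), s) = 0).
  { apply (ray_const_lim kF1).
    - intros s Hs. apply kF_affine, half_region, Hs.
    - apply (Clf_ray (- (1 / 2)) kF1). apply (Clf_eq _ (RtoC (dcoef hF 0) * 0 * 1 + 1 * 0)%C); [ring|].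
      apply Clf_plus; apply Clf_mult.
      + apply Clf_mult; [|apply tz1_Iinf]. apply CPS_Iinf; [apply poly_bd_dcoef, hF_poly | apply tz_Iinf].
      + apply gS_Iinf.
      + exact LF.
      + apply gS1_Iinf. }
  intro Ht. split; [apply E1, Ht|]. revert t Ht. apply (ray_const_lim kF).
  - intros s Hs. eapply Cder_eq; [apply kF_affine, half_region, Hs|]. rewrite E1 by auto. ring.
  - apply (Clf_ray (- (1 / 2)) kF). apply (Clf_eq _ (1 * 1)%C); [ring|]. apply Clf_mult; [exact LF | apply gS_Iinf].
Qed.

Lemma rz_lim : Clf Rinf (fun t => RtoC (1 - rz t)) 1.
Proof.
  apply (Clf_ext (fun t => 1 - tz (- (1 / 2), t)%R)%C).
  - generalize (Rinf_gt (sqrt 3 / 2)). apply filter_imp. intros t Ht.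
    rewrite (proj1 (half_tz t (Rlt_le _ _ Ht))), RtoC_minus. reflexivity.
  - apply (Clf_eq _ (1 - 0)%C); [ring|]. apply Clf_minus; [apply Clf_const | apply (Clf_ray (- (1 / 2)) tz), tz_Iinf].
Qed.

(** With x = 1 - nu tending to 1, Abel's theorem gives (1 - x) G'(x) -> k and (1 - x) G(x) -> 0. The
    second limit tames the logarithmic growth of G in the term with H', because H'/nu has a finite
    limit at the cusp. *)
Lemma kG1_half k : is_lim_seq (dcoef hG) (Finite k) ->
  forall t, sqrt 3 / 2 < t -> kG1 (- (1 / 2), t) = RtoC (- k).
Proof.
  intro Hk.
  assert (xr : Rinf (fun t => 0 <= 1 - rz t < 1)).
  { generalize (Rinf_gt (sqrt 3 / 2)). apply filter_imp. intros t Ht.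
    destruct (half_tz t ltac:(lra)) as [_ [B _]]. lra. }
  assert (A1 := Abel_limit Rinf _ _ _ Hk xr rz_lim).
  assert (A0 := Abel_limit Rinf _ _ _ (lim_dcoef_0 _ _ Hk) xr rz_lim).
  apply (ray_const_lim kG1).
  - intros s Hs. apply kG_affine, half_region, Hs.
  - apply (Clf_ext (fun t => - ((1 - RtoC (1 - rz t)) * CPS (dcoef hG) (RtoC (1 - rz t)) *
        (tu (- (1 / 2), t)%R * tu (- (1 / 2), t)%R * tH (- (1 / 2), t)%R) * gS (- (1 / 2), t)%R)
      - (1 - RtoC (1 - rz t)) * CPS hG (RtoC (1 - rz t)) *
        ((tH1 (- (1 / 2), t)%R / nome (- (1 / 2), t)%R) / (tz (- (1 / 2), t)%R / nome (- (1 / 2), t)%R)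
          / (2 * tH (- (1 / 2), t)%R) * gS (- (1 / 2), t)%R))%C).
    + generalize (Rinf_gt (sqrt 3 / 2)). apply filter_imp. intros t Ht.
      destruct (half_tz t ltac:(lra)) as [EZ [B1 _]]. destruct (half_tu t ltac:(lra)) as [HR _].
      assert (NH := Re_pos_neq_0 _ HR). assert (S := sqrt3_half).
      assert (Nz := tz_neq_0 (- (1 / 2), t) ltac:(simpl; lra) NH). assert (Nn := nome_neq_0 (- (1 / 2), t)).
      assert (E : RtoC (1 - rz t) = (1 - tz (- (1 / 2), t)%R)%C) by (rewrite EZ, RtoC_minus; reflexivity).
      rewrite E. unfold kG1, gS1, tz1. field. auto.
    + apply (Clf_eq _ (- (RtoC k * (1 * 1 * 1) * 1) - RtoC 0 * ((8 + 16 * omega) / (48 * (2 * omega + 1)) / (2 * 1) * 1))%C).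
      { rewrite RtoC_opp. ring. }
      assert (R : forall f l, Clf Iinf f l -> Clf Rinf (fun t => f (- (1 / 2), t)) l) by (intros f l; apply (Clf_ray (- (1 / 2)))).
      apply Clf_minus; [apply Clf_opp; apply Clf_mult; [apply Clf_mult|]|apply Clf_mult].
      * exact A1.
      * apply Clf_mult; [apply Clf_mult; apply (R tu), tu_Iinf | apply (R tH), tH_Iinf].
      * apply (R gS), gS_Iinf.
      * exact A0.
      * apply Clf_mult; [apply Clf_div; [|apply Clf_div|]|].
        -- rewrite Cmult_1_r. apply C2_neq_0.
        -- apply Cmult_neq_0; [intro K; injection K; lra | apply sqrt3i_neq_0].
        -- exact (R _ _ tH1_quot).
        -- exact (R _ _ tz_quot).
        -- apply Clf_mult; [apply Clf_const | apply (R tH), tH_Iinf].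
        -- apply (R gS), gS_Iinf.
Qed.

(** * Values at omega *)

Lemma ray_edge f x0 t0 l : Ccont f (x0, t0) -> (forall t, t0 < t -> f (x0, t) = l) -> f (x0, t0) = l.
Proof.
  intros Hc H. apply Cminus_eq_0, Cmod_eq_0. apply Rle_antisym; [|apply Cmod_ge_0]. apply Rnot_lt_le. intro N.
  destruct (Hc _ N) as [d [Hd K]]. specialize (K (x0, t0 + d / 2)). cbv beta in K.
  rewrite H in K by lra.
  assert (E : Cmod ((x0, (t0 + d / 2)%R) - (x0, t0))%C = d / 2).
  { replace ((x0, (t0 + d / 2)%R) - (x0, t0))%C with (Ci * RtoC (d / 2))%C by (apply injective_projections; simpl; field).
    rewrite Cmod_mult, Cmod_Ci, Cmod_R, Rabs_pos_eq; lra. }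
  rewrite E in K. specialize (K ltac:(lra)). rewrite Cmod_sym in K. lra.
Qed.

(* tau -> -1/(tau+1) has order 3 and fixes omega; differentiating this identity at omega gives H'(omega). *)
Lemma tH_order3 tau : 0 < Im tau ->
  tH (- / (tau + 1))%C = (omega ^ 2 * ((tau + 1) * (tau + 1)) * tH tau)%C.
Proof.
  intro H. assert (H1 : 0 < Im (tau + 1)%C) by (rewrite Im_plus_1; exact H).
  unfold tH. rewrite tA_S, tC_S, tA_plus_1, tB_plus_1 by auto. rewrite omega_pow2.
  unfold tC. assert (W := omega_sq). revert W. generalize omega. intros w W. ring [W].
Qed.

Lemma tH_omega_neq_0 : tH omega <> 0.
Proof.
  rewrite omega_pair. destruct (half_tu (sqrt 3 / 2) (Rle_refl _)) as [H _]. apply Re_pos_neq_0, H.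
Qed.

Lemma tH1_omega : (ipi * tH1 omega * (omega * omega - 1) = - (2) * omega * tH omega)%C.
Proof.
  assert (I := Im_omega). assert (N := omega_plus_1_neq_0). assert (N0 := omega_neq_0).
  destruct (tH_der _ I) as [DH _].
  assert (Dm : Cder (fun t => - / (t + 1))%C omega (/ omega)%C).
  { eapply Cder_eq; [apply Cder_opp, Cder_inv; [exact N | apply Cder_plus; [apply Cder_id | apply Cder_const]]|].
    cbv beta. rewrite omega_plus_1_sq. field. exact N0. }
  assert (D1 : Cder (fun t => tH (- / (t + 1))%C) omega (ipi * tH1 omega * / omega)%C).
  { apply (Cder_comp tH (fun t => - / (t + 1))%C); [rewrite omega_fixed; exact DH | exact Dm]. }
  assert (D2 : Cder (fun t => tH (- / (t + 1))%C) omega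
     (omega ^ 2 * (2 * (omega + 1)) * tH omega + omega ^ 2 * omega * (ipi * tH1 omega))%C).
  { apply (Cder_ext (fun t => omega ^ 2 * ((t + 1) * (t + 1)) * tH t)%C).
    - generalize (upper_open _ I). apply filter_imp. intros t Ht. symmetry. apply tH_order3, Ht.
    - assert (Dt : Cder (fun t => t + 1)%C omega 1).
      { eapply Cder_eq; [apply Cder_plus; [apply Cder_id | apply Cder_const]|]. ring. }
      eapply Cder_eq; [apply Cder_mult; [apply Cder_scal, Cder_mult; exact Dt | exact DH]|].
      cbv beta. rewrite omega_plus_1_sq. ring. }
  assert (E := Cder_unique _ _ _ _ D1 D2).
  rewrite inv_omega, omega_pow2 in E.
  transitivity (ipi * tH1 omega * (omega * omega) - ipi * tH1 omega)%C; [ring|]. rewrite E.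
  generalize (tH omega) (ipi * tH1 omega)%C. assert (W := omega_sq). revert W. generalize omega.
  intros w W h X. ring [W].
Qed.

Lemma tz_omega : tu omega = 0 /\ tz1 omega = 0 /\ (1 - tz omega)%C = 0.
Proof.
  assert (N := tH_omega_neq_0). assert (E : tu omega = 0) by (unfold tu; rewrite tG_omega; field; exact N).
  split; [exact E|]. split; [unfold tz1; rewrite E; ring | rewrite tz_tu, E by exact N; ring].
Qed.

(** Since nu omega = 1, omega is on the edge of [region] and not in it; values found on the open ray
    are carried to omega by continuity. *)
Lemma kG_cont_omega : Ccont kG omega /\ Ccont kG1 omega.
Proof.
  assert (I := Im_omega). assert (N := tH_omega_neq_0). destruct tz_omega as [_ [_ E]].
  assert (HR : 0 < Re (tH omega)).
  { rewrite omega_pair. apply (half_tu (sqrt 3 / 2) (Rle_refl _)). }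
  destruct (gS_der _ I HR) as [G1 G2]. destruct (tz_der _ I N) as [Z1 Z2].
  apply Cder_cont in G1. apply Cder_cont in G2. apply Cder_cont in Z1. apply Cder_cont in Z2.
  assert (L : Cmod (1 - tz omega)%C < 1) by (rewrite E, Cmod_0; lra).
  assert (Z : Clf (Cnear omega) (fun t => 1 - tz t)%C (1 - tz omega)%C) by (apply Clf_minus; [apply Clf_const | exact Z1]).
  assert (K : forall a, poly_bd a -> Clf (Cnear omega) (fun t => CPS a (1 - tz t)) (CPS a (1 - tz omega))).
  { intros a Ha. apply (Ccont_comp (Cnear omega) (CPS a) (fun t => 1 - tz t)%C _ Z). apply CPS_cont; auto. }
  assert (K1 := K _ hG_poly). assert (K2 := K _ (poly_bd_dcoef _ hG_poly)).
  split.
  - apply Clf_mult; [exact K1 | exact G1].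
  - apply Clf_plus; apply Clf_mult; [apply Clf_mult; [exact K2 | apply Clf_opp; exact Z2] | exact G1 | exact K1 | exact G2].
Qed.

(** At omega the series is evaluated at 0, so the value and the slope are those of H^(-1/2), and
    H'(omega) gives their ratio. It places the zero of the affine function at omega^2, the conjugate
    of omega. *)
Lemma kG_half k : is_lim_seq (dcoef hG) (Finite k) ->
  forall t, sqrt 3 / 2 < t -> kG (- (1 / 2), t) = (- (ipi * RtoC k) * ((- (1 / 2), t)%R - omega ^ 2))%C.
Proof.
  intro Hk. destruct kG_cont_omega as [C0 C1]. destruct tz_omega as [E0 [E1 E2]].
  assert (N := tH_omega_neq_0). assert (Nw := omega_neq_0). assert (Ni := ipi_neq_0).
  assert (V1 : kG1 omega = RtoC (- k)).
  { rewrite omega_pair in C1 |- *. apply ray_edge; [exact C1 | apply kG1_half, Hk]. }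
  assert (H0 : CPS hG 0 = 1) by (rewrite CPS_at_0; unfold hG; now rewrite hc_0).
  assert (V2 : kG omega = gS omega) by (unfold kG; rewrite E2, H0; ring).
  assert (V3 : kG1 omega = gS1 omega) by (unfold kG1; rewrite E2, H0, E1; ring).
  destruct (ray_affine kG kG1 (- (1 / 2)) (sqrt 3 / 2) (RtoC (- k))) as [beta Hb].
  { intros t Ht. apply kG_affine, half_region, Ht. }
  { apply kG1_half, Hk. }
  assert (V4 : (kG omega - ipi * RtoC (- k) * omega)%C = beta).
  { assert (C2 : Ccont (fun t => kG t - ipi * RtoC (- k) * t)%C omega).
    { apply Clf_minus; [exact C0 | apply Clf_mult; [apply Clf_const | apply Ccont_id]]. }
    rewrite omega_pair in C2 |- *. apply (ray_edge _ _ _ beta C2). intros t Ht. rewrite Hb by exact Ht. ring. }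
  assert (V5 : gS omega = (- (ipi * RtoC k) * (omega - omega ^ 2))%C).
  { assert (T := tH1_omega). rewrite V1 in V3. unfold gS1 in V3. rewrite omega_pow2.
    set (g := gS omega) in *. set (h := tH omega) in *.
    assert (F : (ipi * (omega * omega - 1) * RtoC (- k) = omega * g)%C).
    { rewrite V3. transitivity (- (ipi * tH1 omega * (omega * omega - 1)) / (2 * h) * g)%C; [field; exact N|].
      rewrite T. field. exact N. }
    transitivity (omega * g * / omega)%C; [field; exact Nw|]. rewrite <- F, RtoC_opp.
    rewrite inv_omega. generalize (RtoC k) ipi. assert (W := omega_sq). revert W. generalize omega.
    intros w W h0 X. ring [W]. }
  intros t Ht. rewrite Hb by exact Ht. rewrite <- V4, V2, V5, RtoC_opp. ring.
Qed.

(** The point -1/2 + i is on the ray because sqrt 3 / 2 < 1, and a disc about it lies in [region];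
    vanishing derivatives carry the identities from the ray to the disc. The constants cancel as i
    (B/pi) (- i pi k) = 1 with B = 1/k. *)
Lemma phi_nu : exists d, 0 < d /\ forall tau, Cmod (tau - (- (1 / 2), 1)%R)%C < d ->
  0 < Im tau /\ tH tau <> 0 /\ lens (tz tau) /\ phi1_principal (tz tau) = tau.
Proof.
  destruct Beta_limit as [k [Hk [EB Lk]]]. fold hG in Lk.
  assert (S3 : sqrt 3 / 2 < 1).
  { assert (sqrt 3 < 2); [|lra]. rewrite <- (sqrt_square 2) by lra. apply sqrt_lt_1; lra. }
  destruct (region_open _ (half_region 1 S3)) as [d [Hd Hr]]. exists d. split; [exact Hd|].
  set (c0 := (- (1 / 2), 1) : C) in *.
  assert (In0 : forall tau, Cmod (tau - c0)%C < d -> forall t, 0 <= t <= 1 -> region (c0 + RtoC t * (tau - c0))%C).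
  { intros tau Ht t Htt. apply Hr. apply (disc_convex c0 d c0 tau t); auto. rewrite Cmod_self. exact Hd. }
  assert (c1 : forall tau, Cmod (tau - c0)%C < d -> kF1 tau = 0 /\ kG1 tau = RtoC (- k)).
  { intros tau Ht. split.
    - rewrite (Cder_0_segment kF1 c0 tau) by (intros t Htt; apply kF_affine, (In0 tau Ht t Htt)). apply kF_half, S3.
    - rewrite (Cder_0_segment kG1 c0 tau) by (intros t Htt; apply kG_affine, (In0 tau Ht t Htt)). apply kG1_half; auto. }
  assert (seg : forall tau, Cmod (tau - c0)%C < d -> forall t, 0 <= t <= 1 -> Cmod (c0 + RtoC t * (tau - c0) - c0)%C < d).
  { intros tau Ht t Htt. apply (disc_convex c0 d c0 tau t); auto. rewrite Cmod_self. exact Hd. }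
  intros tau Ht. destruct (Hr tau Ht) as [H [HR [Z1 Z2]]].
  assert (F : kF tau = 1).
  { rewrite (Cder_0_segment kF c0 tau); [apply kF_half, S3|]. intros t Htt.
    eapply Cder_eq; [apply kF_affine, (In0 tau Ht t Htt)|]. rewrite (proj1 (c1 _ (seg tau Ht t Htt))). ring. }
  assert (G : kG tau = (- (ipi * RtoC k) * (tau - omega ^ 2))%C).
  { assert (E : (kG tau + ipi * RtoC k * tau)%C = (kG c0 + ipi * RtoC k * c0)%C).
    { apply (Cder_0_segment (fun t => kG t + ipi * RtoC k * t)%C). intros t Htt. eapply Cder_eq.
      - apply Cder_plus; [apply kG_affine, (In0 tau Ht t Htt) | apply Cder_scal, Cder_id].
      - rewrite (proj2 (c1 _ (seg tau Ht t Htt))), RtoC_opp. ring. }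
    assert (E0 := kG_half k Lk 1 S3). fold c0 in E0. rewrite E0 in E.
    transitivity (kG tau + ipi * RtoC k * tau - ipi * RtoC k * tau)%C; [ring|]. rewrite E. ring. }
  split; [exact H|]. split; [apply Re_pos_neq_0, HR|]. split; [split; assumption|].
  assert (Ng : gS tau <> 0).
  { intro K. apply C1_neq_0. rewrite <- F. unfold kF. rewrite K. ring. }
  assert (NF : CPS hF (tz tau) <> 0).
  { intro K. apply C1_neq_0. rewrite <- F. unfold kF. rewrite K. ring. }
  unfold phi1_principal. rewrite !hypergeometric_CPS. fold hF hG. rewrite EB.
  assert (Q : (CPS hG (1 - tz tau) / CPS hF (tz tau))%C = (- (ipi * RtoC k) * (tau - omega ^ 2))%C).
  { rewrite <- G. transitivity (kG tau / kF tau)%C; [unfold kG, kF; field; auto | rewrite F; field]. }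
  rewrite Q. assert (P := PI_RGT_0). assert (Ek : RtoC (/ k / PI) = (/ (RtoC k * RtoC PI))%C).
  { unfold Rdiv. rewrite RtoC_mult, !RtoC_inv by lra. field.
    split; intro K; injection K; lra. }
  rewrite Ek. unfold ipi. transitivity (omega ^ 2 + - (Ci * Ci) * (tau - omega ^ 2))%C.
  - field. split; intro K; injection K; lra.
  - replace (Ci * Ci)%C with (- (1))%C by (apply injective_projections; simpl; ring). ring.
Qed.

(** * Paths avoiding the ramification points *)

(** Connectedness of [0, 1], applied to joining points by paths and to the elements of a
    continuation. *)
Lemma locally_constant (Q : R -> Prop) :
  (forall t, 0 <= t <= 1 -> exists d, 0 < d /\ forall s, 0 <= s <= 1 -> Rabs (s - t) < d -> (Q s <-> Q t)) ->
  Q 0 -> Q 1.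
Proof.
  intros H Q0. set (E := fun t => 0 <= t <= 1 /\ forall s, 0 <= s <= t -> Q s).
  assert (E0 : E 0). { split; [lra|]. intros s Hs. replace s with 0 by lra. exact Q0. }
  destruct (completeness E) as [m [Hub Hlub]].
  - exists 1. intros t [Ht _]. lra.
  - exists 0. exact E0.
  - assert (Hm0 : 0 <= m) by (apply Hub, E0).
    assert (Hm1 : m <= 1) by (apply Hlub; intros t [Ht _]; lra).
    destruct (H m ltac:(lra)) as [d [Hd K]].
    assert (Hex : forall e, 0 < e -> exists t, E t /\ m - e < t).
    { intros e He. apply NNPP. intro N. assert (m <= m - e); [|lra]. apply Hlub. intros t Et.
      apply Rnot_lt_le. intro L. apply N. exists t. auto. }
    assert (Qm : Q m).
    { destruct (Hex d Hd) as [t [[Ht Et] L]]. assert (t <= m) by (apply Hub; split; auto).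
      apply (K t); [lra | apply Rabs_def1; lra | apply Et; lra]. }
    assert (All : forall s, 0 <= s <= m -> Q s).
    { intros s Hs. destruct (Req_dec s m) as [->|N]; [exact Qm|].
      destruct (Hex (m - s) ltac:(lra)) as [t [[Ht Et] L]]. apply Et. lra. }
    destruct (Req_dec m 1) as [E1|N1]; [rewrite <- E1; exact Qm|]. exfalso.
    set (t := Rmin 1 (m + d / 2)). assert (m < t) by (apply Rmin_glb_lt; lra).
    assert (T1 := Rmin_l 1 (m + d / 2)). assert (T2 := Rmin_r 1 (m + d / 2)). fold t in T1, T2.
    assert (Et : E t).
    { split; [lra|]. intros s Hs. destruct (Rle_lt_dec s m) as [L|L]; [apply All; lra|].
      apply (K s); [lra | apply Rabs_def1; lra | exact Qm]. }
    apply Hub in Et. lra.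
Qed.

Definition Rcontinuous (T : R -> C) : Prop :=
  forall t e, 0 < e -> exists d, 0 < d /\ forall s, Rabs (s - t) < d -> Cmod (T s - T t)%C < e.

Lemma Rcontinuous_plus T1 T2 : Rcontinuous T1 -> Rcontinuous T2 -> Rcontinuous (fun t => T1 t + T2 t)%C.
Proof.
  intros H1 H2 t e He. destruct (H1 t (e / 2) ltac:(lra)) as [d1 [D1 K1]].
  destruct (H2 t (e / 2) ltac:(lra)) as [d2 [D2 K2]]. exists (Rmin d1 d2). split; [apply Rmin_pos; auto|].
  intros s Hs. assert (L1 := Rmin_l d1 d2). assert (L2 := Rmin_r d1 d2).
  specialize (K1 s ltac:(lra)). specialize (K2 s ltac:(lra)).
  replace (T1 s + T2 s - (T1 t + T2 t))%C with ((T1 s - T1 t) + (T2 s - T2 t))%C by ring.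
  assert (T := Cmod_triangle (T1 s - T1 t) (T2 s - T2 t)). lra.
Qed.

Lemma Rcontinuous_affine T b : Rcontinuous T -> Rcontinuous (fun t => T (2 * t + b)).
Proof.
  intros H t e He. destruct (H (2 * t + b) e He) as [d [D K]]. exists (d / 2). split; [lra|].
  intros s Hs. apply K. replace (2 * s + b - (2 * t + b)) with (2 * (s - t)) by ring.
  rewrite Rabs_mult, Rabs_pos_eq by lra. lra.
Qed.

(* Paths are extended to R by constants, so that they can be concatenated by a formula without cases. *)
Definition joined (D : C -> Prop) (a b : C) : Prop :=
  exists T, Rcontinuous T /\ (forall t, t <= 0 -> T t = a) /\ (forall t, 1 <= t -> T t = b) /\ forall t, D (T t).

Lemma joined_trans D a b c : joined D a b -> joined D b c -> joined D a c.
Proof.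
  intros [T1 [C1 [A1 [B1 D1]]]] [T2 [C2 [A2 [B2 D2]]]].
  exists (fun t : R => T1 (2 * t + 0)%R + (T2 (2 * t + - (1))%R + - b))%C. repeat split.
  - apply Rcontinuous_plus; [apply Rcontinuous_affine, C1|]. apply Rcontinuous_plus; [apply Rcontinuous_affine, C2|].
    intros t e He. exists 1. split; [lra|]. intros. rewrite Cmod_self. exact He.
  - intros t Ht. rewrite A1, A2 by lra. ring.
  - intros t Ht. rewrite B1, B2 by lra. ring.
  - intro t. destruct (Rle_lt_dec t (1 / 2)).
    + rewrite A2 by lra. replace (T1 (2 * t + 0)%R + (b + - b))%C with (T1 (2 * t + 0)) by ring. apply D1.
    + rewrite B1 by lra. replace (b + (T2 (2 * t + - (1))%R + - b))%C with (T2 (2 * t + - (1))) by ring. apply D2.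
Qed.

Lemma joined_segment (D : C -> Prop) a b :
  (forall t, 0 <= t <= 1 -> D (a + RtoC t * (b - a))%C) -> joined D a b.
Proof.
  intro H. set (cl := fun t => Rmax 0 (Rmin 1 t)).
  assert (cl0 : forall t, t <= 0 -> cl t = 0).
  { intros t Ht. unfold cl. rewrite Rmin_right by lra. apply Rmax_left. lra. }
  assert (cl1 : forall t, 1 <= t -> cl t = 1).
  { intros t Ht. unfold cl. rewrite Rmin_left by lra. apply Rmax_right. lra. }
  exists (fun t => a + RtoC (cl t) * (b - a))%C. repeat split.
  - intros t e He. exists (e / (Cmod (b - a)%C + 1)). assert (P := Cmod_ge_0 (b - a)%C).
    assert (Q : 0 < e / (Cmod (b - a)%C + 1)) by (apply Rdiv_lt_0_compat; lra). split; [exact Q|].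
    intros s Hs.
    replace (a + RtoC (cl s) * (b - a) - (a + RtoC (cl t) * (b - a)))%C with (RtoC (cl s - cl t) * (b - a))%C
      by (rewrite RtoC_minus; ring).
    rewrite Cmod_mult, Cmod_R.
    assert (L : Rabs (cl s - cl t) <= Rabs (s - t)).
    { unfold cl, Rmax, Rmin, Rabs. repeat destruct Rle_dec; repeat destruct Rcase_abs; lra. }
    apply Rle_lt_trans with (Rabs (s - t) * (Cmod (b - a)%C + 1)).
    + apply Rmult_le_compat; try apply Rabs_pos; lra.
    + replace e with (e / (Cmod (b - a)%C + 1) * (Cmod (b - a)%C + 1)) by (field; lra).
      apply Rmult_lt_compat_r; lra.
  - intros t Ht. rewrite cl0 by auto. ring.
  - intros t Ht. rewrite cl1 by auto. ring.
  - intro t. apply H. unfold cl. assert (A := Rmin_l 1 t). split; [apply Rmax_l | apply Rmax_lub; lra].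
Qed.

(** If the segment from a to b meets p, then b - p is a negative multiple of a - p, and the detour
    through p + i (a - p) avoids p. *)
Lemma joined_punctured_disc (D : C -> Prop) p rho :
  (forall w, 0 < Cmod (w - p)%C < rho -> D w) ->
  forall a b, 0 < Cmod (a - p)%C < rho -> 0 < Cmod (b - p)%C < rho -> joined D a b.
Proof.
  intros HD.
  assert (seg : forall a b, Cmod (a - p)%C < rho -> Cmod (b - p)%C < rho ->
     (forall t, 0 <= t <= 1 -> (a + RtoC t * (b - a))%C <> p) -> joined D a b).
  { intros a b Ha Hb N. apply joined_segment. intros t Ht. apply HD. split.
    - apply Cmod_gt_0. intro E. apply (N t Ht). apply Cminus_eq_0, E.
    - apply (disc_convex p rho a b t); auto. }
  intros a b [Pa Ha] [Pb Hb].
  destruct (classic (exists t, 0 <= t <= 1 /\ (a + RtoC t * (b - a))%C = p)) as [[t [Ht E]]|N].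
  2:{ apply seg; auto. intros t Ht E. apply N. exists t. auto. }
  set (u := (a - p)%C) in *. assert (Nu : u <> 0) by (apply Cmod_gt_0, Pa).
  assert (Nb : (b - p)%C <> 0) by (apply Cmod_gt_0, Pb).
  assert (E' : (RtoC (1 - t) * u + RtoC t * (b - p))%C = 0).
  { rewrite RtoC_minus. unfold u. transitivity (a + RtoC t * (b - a) - p)%C; [ring|]. rewrite E. ring. }
  assert (t0 : t <> 0).
  { intro Z. apply Nu. rewrite Z in E'. transitivity (RtoC (1 - 0) * u + RtoC 0 * (b - p))%C; [rewrite RtoC_minus; ring | exact E']. }
  assert (Ntc : RtoC t <> 0) by (intro Z; injection Z; auto).
  set (v := (p + Ci * u)%C).
  assert (Hv : Cmod (v - p)%C < rho).
  { unfold v. replace (p + Ci * u - p)%C with (Ci * u)%C by ring. rewrite Cmod_mult, Cmod_Ci. lra. }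
  assert (Eb : b = (p + RtoC (- ((1 - t) / t)) * u)%C).
  { unfold Rdiv. rewrite RtoC_opp, RtoC_mult, RtoC_inv by auto.
    transitivity (p + (RtoC (1 - t) * u + RtoC t * (b - p) - RtoC (1 - t) * u) * / RtoC t)%C; [field; auto|].
    rewrite E'. ring. }
  assert (key : forall x y, (x <> 0 \/ y <> 0) -> (p + (RtoC x + Ci * RtoC y) * u)%C <> p).
  { intros x y Hxy K. assert (K' : ((RtoC x + Ci * RtoC y) * u)%C = 0).
    { transitivity (p + (RtoC x + Ci * RtoC y) * u - p)%C; [ring|]. rewrite K. ring. }
    apply Cmult_integral in K'. destruct K' as [K'|K']; [|auto].
    assert (Kr := f_equal Re K'). assert (Ki := f_equal Im K'). simpl in Kr, Ki. lra. }
  apply joined_trans with v; apply seg; auto.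
  - intros s Hs. replace (a + RtoC s * (v - a))%C with (p + (RtoC (1 - s) + Ci * RtoC s) * u)%C
      by (unfold v, u; rewrite RtoC_minus; ring). apply key. lra.
  - intros s Hs. rewrite Eb.
    replace (v + RtoC s * (p + RtoC (- ((1 - t) / t)) * u - v))%C with (p + (RtoC (s * - ((1 - t) / t)) + Ci * RtoC (1 - s)) * u)%C
      by (unfold v; rewrite RtoC_minus, RtoC_mult; ring).
    apply key. destruct (Req_dec s 1) as [->|N]; [left|right; lra].
    intro K. apply Nb. rewrite Eb. replace (- ((1 - t) / t)) with 0 by lra. ring.
Qed.

(** H <> 0 excludes the poles of nu and G <> 0 the points with nu = 1; the value 0 is never attained
    where H <> 0. *)
Definition regular (tau : C) : Prop := 0 < Im tau /\ tH tau <> 0 /\ tG tau <> 0.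

Lemma Cder_isolated f p l v : Cder f p l -> l <> 0 ->
  Cnear p (fun w => w <> p -> f w <> v).
Proof.
  intros [phi [H1 [H2 H3]]] Hl. destruct (classic (f p = v)) as [E|N].
  - generalize (filter_and _ _ H1 (Clf_neq _ _ _ Hl H3)). apply filter_imp. intros w [W1 W2] Hw K.
    rewrite W1, E in K. assert (Z : (phi w * (w - p))%C = 0).
    { transitivity (v + phi w * (w - p) - v)%C; [ring|]. rewrite K. ring. }
    apply Cmult_integral in Z. destruct Z as [Z|Z]; [auto|]. apply Hw, Cminus_eq_0, Z.
  - assert (D : Cder f p l) by (exists phi; auto).
    generalize (Clf_neq _ _ _ N (Cder_cont _ _ _ D)). apply filter_imp. auto.
Qed.

(** Zeros of H and of G are the points where lambda equals - omega^2 and - omega, and lambda has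
    nonvanishing derivative, so they are isolated. *)
Lemma regular_isolated p : 0 < Im p -> exists rho, 0 < rho /\ forall w, 0 < Cmod (w - p)%C < rho -> regular w.
Proof.
  intro H. destruct (tL_der _ H) as [D _]. destruct (tAB_neq_0 _ H) as [N1 N2]. assert (N3 := tC_neq_0 _ H).
  assert (Nl : (ipi * tL1 p)%C <> 0).
  { unfold tL1, Cdiv. assert (N4 := ipi_neq_0).
    apply Cmult_neq_0; [exact N4|]. apply Cmult_neq_0; [cmult_nz | apply Cinv_neq_0; cmult_nz]. }
  destruct (filter_and _ _ (upper_open _ H)
    (filter_and _ _ (Cder_isolated tL p _ (- omega ^ 2)%C D Nl) (Cder_isolated tL p _ (- omega)%C D Nl)))
    as [rho [Hr K]].
  exists rho. split; [exact Hr|]. intros w [W0 W1]. destruct (K w W1) as [K1 [K2 K3]].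
  assert (Hw : w <> p). { intros ->. rewrite Cmod_self in W0. lra. }
  specialize (K2 Hw). specialize (K3 Hw). destruct (tAB_neq_0 _ K1) as [M1 M2].
  split; [exact K1|]. split; intro Z.
  - apply K2. unfold tL, tH in *.
    transitivity (((tA w * tA w + omega * tC w) * (omega * omega) - tC w * (omega * omega * omega - 1)
       - tA w * tA w * (omega * omega)) / (tA w * tA w))%C; [field; exact M1|].
    rewrite Z, omega_cube. field. exact M1.
  - apply K3. unfold tL, tG in *.
    transitivity (((tA w * tA w + omega ^ 2 * tC w) * omega - tC w * (omega * omega * omega - 1)
       - tA w * tA w * omega) / (tA w * tA w))%C; [field; exact M1|].
    rewrite Z, omega_cube. field. exact M1.
Qed.

(** The segment from a to b may meet exceptional points, so [Q t] speaks of all regular points near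
    g t instead of g t itself. By [Spread], one joined point in a punctured disc makes all regular
    points of the disc joined; hence [Q] is locally constant. *)
Lemma regular_joined a b : regular a -> regular b -> joined regular a b.
Proof.
  intros Ha Hb. set (g := fun t => (a + RtoC t * (b - a))%C).
  assert (Hg : forall t, 0 <= t <= 1 -> 0 < Im (g t)).
  { intros t Ht. apply upper_convex; [apply Ha | apply Hb | exact Ht]. }
  assert (gd : forall s t, Cmod (g s - g t)%C = Rabs (s - t) * Cmod (b - a)%C).
  { intros s t. unfold g. rewrite <- Cmod_R, <- Cmod_mult. f_equal. rewrite RtoC_minus. ring. }
  set (Q := fun t => exists rho, 0 < rho /\ forall w, Cmod (w - g t)%C < rho -> regular w -> joined regular a w).
  assert (refl : forall w, regular w -> joined regular w w).
  { intros w Hw. apply joined_segment. intros t Ht. replace (w + RtoC t * (w - w))%C with w by ring. exact Hw. }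
  assert (Spread : forall t, 0 <= t <= 1 -> exists rho, 0 < rho /\ forall v, 0 < Cmod (v - g t)%C < rho ->
     joined regular a v -> forall w, Cmod (w - g t)%C < rho -> regular w -> joined regular a w).
  { intros t Ht. destruct (regular_isolated _ (Hg t Ht)) as [rho [Hr K]]. exists rho. split; [exact Hr|].
    intros v Hv Jv w Hw Rw. destruct (classic (w = g t)) as [E|N].
    - apply joined_trans with v; [exact Jv|]. apply joined_segment. intros s Hs.
      destruct (Req_dec s 1) as [->|Ns].
      + replace (v + 1 * (w - v))%C with w by ring. exact Rw.
      + apply K. rewrite E. replace (v + RtoC s * (g t - v) - g t)%C with (RtoC (1 - s) * (v - g t))%C by (rewrite RtoC_minus; ring).
        rewrite Cmod_mult, Cmod_R, Rabs_pos_eq by lra. split; [apply Rmult_lt_0_compat; lra|].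
        apply Rle_lt_trans with (1 * Cmod (v - g t)%C); [apply Rmult_le_compat_r; lra | lra].
    - apply joined_trans with v; [exact Jv|]. apply (joined_punctured_disc regular (g t) rho K); auto.
      split; [|exact Hw]. apply Cmod_gt_0. intro Z. apply N, Cminus_eq_0, Z. }
  assert (near2 : forall p q r, 0 < r -> exists v, 0 < Cmod (v - p)%C /\ 0 < Cmod (v - q)%C /\ Cmod (v - p)%C < r /\ Cmod (v - q)%C < r + Cmod (p - q)%C).
  { intros p q r Hr. assert (Hd : forall x, 0 < x -> Cmod ((p + RtoC x) - p)%C = x).
    { intros x Hx. replace (p + RtoC x - p)%C with (RtoC x) by ring. rewrite Cmod_R, Rabs_pos_eq; lra. }
    assert (tri : forall v, Cmod (v - p)%C < r -> Cmod (v - q)%C < r + Cmod (p - q)%C).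
    { intros v Hv. assert (T := Cmod_tri_sub v p q). lra. }
    assert (H1 := Hd (r / 2) ltac:(lra)). assert (H2 := Hd (r / 3) ltac:(lra)).
    destruct (classic ((p + RtoC (r / 2))%C = q)) as [E|N].
    - exists (p + RtoC (r / 3))%C. split; [lra|]. split; [|split; [lra | apply tri; lra]].
      rewrite <- E. replace (p + RtoC (r / 3) - (p + RtoC (r / 2)))%C with (RtoC (r / 3 - r / 2)) by (rewrite RtoC_minus; ring).
      rewrite Cmod_R. apply Rabs_pos_lt. lra.
    - exists (p + RtoC (r / 2))%C. split; [lra|]. split; [|split; [lra | apply tri; lra]].
      apply Cmod_gt_0. intro Z. apply N, Cminus_eq_0, Z. }
  assert (Sym : forall t, 0 <= t <= 1 -> exists d, 0 < d /\ forall s, 0 <= s <= 1 -> Rabs (s - t) < d -> (Q s <-> Q t)).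
  { intros t Ht. destruct (Spread t Ht) as [rho [Hr K]]. destruct (regular_isolated _ (Hg t Ht)) as [r2 [Hr2 K2]].
    set (r3 := Rmin rho r2). assert (P3 : 0 < r3) by (apply Rmin_pos; auto).
    assert (L1 := Rmin_l rho r2). assert (L2 := Rmin_r rho r2). fold r3 in L1, L2.
    assert (Pb := Cmod_ge_0 (b - a)%C).
    exists (r3 / 2 / (Cmod (b - a)%C + 1)). assert (Pd : 0 < r3 / 2 / (Cmod (b - a)%C + 1)) by (apply Rdiv_lt_0_compat; lra).
    split; [exact Pd|]. intros s Hs Hst.
    assert (Dst : Cmod (g s - g t)%C < r3 / 2).
    { rewrite gd. apply Rle_lt_trans with (Rabs (s - t) * (Cmod (b - a)%C + 1)).
      - apply Rmult_le_compat_l; [apply Rabs_pos | lra].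
      - replace (r3 / 2) with (r3 / 2 / (Cmod (b - a)%C + 1) * (Cmod (b - a)%C + 1)) by (field; lra).
        apply Rmult_lt_compat_r; lra. }
    split.
    - intros [r [Pr J]]. destruct (near2 (g s) (g t) (Rmin r (r3 / 2))) as [v [V1 [V2 [V3 V4]]]]; [apply Rmin_pos; lra|].
      assert (M1 := Rmin_l r (r3 / 2)). assert (M2 := Rmin_r r (r3 / 2)).
      exists rho. split; [exact Hr|]. apply (K v); [lra|]. apply J; [lra|]. apply K2. lra.
    - intros [r [Pr J]]. destruct (near2 (g t) (g t) (Rmin r r3)) as [v [V1 [V2 [V3 V4]]]]; [apply Rmin_pos; lra|].
      assert (M1 := Rmin_l r r3). assert (M2 := Rmin_r r r3).
      exists (r3 / 2). split; [lra|]. intros w Hw Rw. assert (T := Cmod_tri_sub w (g s) (g t)).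
      apply (K v); [lra| |lra|exact Rw]. apply J; [lra|]. apply K2. lra. }
  assert (Q0 : Q 0).
  { destruct (Spread 0 ltac:(lra)) as [rho [Hr K]].
    destruct (regular_isolated a (proj1 Ha)) as [r2 [Hr2 K2]].
    assert (g0 : g 0 = a) by (unfold g; ring). rewrite g0 in K.
    set (r3 := Rmin rho r2). assert (P3 : 0 < r3) by (apply Rmin_pos; auto).
    assert (L1 := Rmin_l rho r2). assert (L2 := Rmin_r rho r2). fold r3 in L1, L2.
    destruct (near2 a a r3 P3) as [v [V1 [_ [V3 _]]]].
    exists rho. split; [exact Hr|]. rewrite g0. apply (K v); [lra|].
    apply joined_segment. intros s Hs. destruct (Req_dec s 0) as [->|Ns].
    - replace (a + 0 * (v - a))%C with a by ring. exact Ha.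
    - apply K2. replace (a + RtoC s * (v - a) - a)%C with (RtoC s * (v - a))%C by ring.
      rewrite Cmod_mult, Cmod_R, Rabs_pos_eq by lra. split; [apply Rmult_lt_0_compat; lra|].
      apply Rle_lt_trans with (1 * Cmod (v - a)%C); [apply Rmult_le_compat_r; lra | lra]. }
  destruct (locally_constant Q Sym Q0) as [rho [Hr K]].
  apply K; [|exact Hb]. replace (g 1) with b by (unfold g; ring). rewrite Cmod_self. exact Hr.
Qed.

(** * Lifting paths through nu *)

Lemma regular_tz p : 0 < Im p -> (regular p <-> Zdomain (tz p)).
Proof.
  intro H. split.
  - intros [_ [N1 N2]]. split; [apply tz_neq_0; auto|]. rewrite tz_tu by auto. intro E.
    assert (Z : (tu p * tu p * tu p)%C = 0).
    { transitivity (1 - (1 - tu p * tu p * tu p))%C; [ring|]. rewrite E. ring. }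
    assert (Nu : tu p <> 0).
    { unfold tu. intro K. apply N2. transitivity (tG p / tH p * tH p)%C; [field; auto | rewrite K; ring]. }
    apply Cmult_integral in Z. destruct Z as [Z|Z]; [apply Cmult_integral in Z; tauto | auto].
  - intros [N0 N1]. assert (NH : tH p <> 0).
    { intro E. apply N0. unfold tz. rewrite E. apply injective_projections; simpl; unfold Rdiv; ring. }
    split; [exact H|]. split; [exact NH|]. intro E. apply N1. rewrite tz_tu by auto. unfold tu. rewrite E.
    field. exact NH.
Qed.

Lemma tz_local p : regular p -> exists eta eps s, 0 < eta /\ 0 < eps /\
    (forall x y, Cmod (x - p)%C < eta -> Cmod (y - p)%C < eta -> tz x = tz y -> x = y) /\
    (forall w, Cmod (w - tz p)%C < eps -> Cmod (s w - p)%C < eta /\ tz (s w) = w /\ holo_at s w).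
Proof.
  intros [H [N1 N2]]. apply (inverse_function tz (fun t => ipi * tz1 t)%C).
  - generalize (tH_near _ H N1). apply filter_imp. intros t [T1 T2]. apply tz_der; auto.
  - apply Clf_mult; [apply Clf_const|]. exact (Cder_cont _ _ _ (proj2 (tz_der _ H N1))).
  - assert (Nz := tz_neq_0 _ H N1). assert (Ni := ipi_neq_0).
    assert (Nu : tu p <> 0).
    { unfold tu. intro K. apply N2. transitivity (tG p / tH p * tH p)%C; [field; auto | rewrite K; ring]. }
    unfold tz1. cmult_nz.
Qed.

Lemma tz_cont p : regular p -> Ccont tz p.
Proof. intros [H [N1 N2]]. exact (Cder_cont _ _ _ (proj1 (tz_der _ H N1))). Qed.

Lemma tz_inverse_unique p f g w : regular p -> Ccont f w -> Ccont g w -> f w = p -> g w = p ->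
  Cnear w (fun v => tz (f v) = v) -> Cnear w (fun v => tz (g v) = v) -> Cnear w (fun v => f v = g v).
Proof.
  intros Hp Cf Cg Ef Eg If Ig. destruct (tz_local p Hp) as [eta [eps [s [He [_ [inj _]]]]]].
  unfold Ccont in Cf, Cg. rewrite Ef in Cf. rewrite Eg in Cg.
  generalize (filter_and _ _ (filter_and _ _ (Cf eta He) (Cg eta He)) (filter_and _ _ If Ig)).
  apply filter_imp. intros v [[V1 V2] [V3 V4]]. apply inj; auto. congruence.
Qed.

Lemma continuous_on_Rcontinuous T : Rcontinuous T -> forall D, continuous_on D T.
Proof.
  intros H D t _. intros P HP. apply (proj2 (Cnear_locally _ _)) in HP. destruct HP as [e [He K]].
  destruct (H t e He) as [d [Hd L]]. exists (mkposreal d Hd). intros s Hs _. apply K, L. exact Hs.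
Qed.

Definition tau0 : C := (- (1 / 2), 1).

Lemma lens_Zdomain z : lens z -> Zdomain z.
Proof.
  intros [L1 L2]. split.
  - intro Z. rewrite Z in L2. replace (1 - 0)%C with (RtoC 1) in L2 by ring. rewrite Cmod_1 in L2. lra.
  - intro Z. rewrite Z, Cmod_1 in L1. lra.
Qed.

Lemma tau0_lens : 0 < Im tau0 /\ lens (tz tau0).
Proof.
  destruct phi_nu as [d [Hd K]]. destruct (K tau0) as [H [_ [L _]]]; [unfold tau0; rewrite Cmod_self; exact Hd | auto].
Qed.

Lemma tau0_regular : regular tau0.
Proof. destruct tau0_lens as [H L]. apply regular_tz; [exact H | apply lens_Zdomain, L]. Qed.

Lemma phi_section s : Ccont s (tz tau0) -> s (tz tau0) = tau0 -> Cnear (tz tau0) (fun w => tz (s w) = w) ->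
  Cnear (tz tau0) (fun w => s w = phi1_principal w).
Proof.
  intros Cs Es Hs. destruct phi_nu as [d [Hd K]]. unfold Ccont in Cs. rewrite Es in Cs.
  generalize (filter_and _ _ (Cs d Hd) Hs). apply filter_imp. intros w [W1 W2].
  destruct (K _ W1) as [_ [_ [_ E]]]. rewrite W2 in E. symmetry. exact E.
Qed.

(** The path is chosen in the tau-plane and projected by nu, so its lift is given in advance; the
    function elements are the local inverses of nu at the points [T t]. *)
Lemma regular_value tau : regular tau -> phi1 (tz tau) tau.
Proof.
  intro Ht. destruct (regular_joined _ _ tau0_regular Ht) as [T [CT [T0 [T1 RT]]]].
  destruct (choice (fun t (x : R * R * (C -> C)) => let '(eta, eps, s) := x in 0 < eta /\ 0 < eps /\
    (forall x y, Cmod (x - T t)%C < eta -> Cmod (y - T t)%C < eta -> tz x = tz y -> x = y) /\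
    (forall w, Cmod (w - tz (T t))%C < eps -> Cmod (s w - T t)%C < eta /\ tz (s w) = w /\ holo_at s w))) as [F HF].
  { intro t. destruct (tz_local _ (RT t)) as [eta [eps [s K]]]. exists (eta, eps, s). exact K. }
  set (f := fun t => snd (F t)). set (r := fun t => snd (fst (F t))). set (eta := fun t => fst (fst (F t))).
  assert (H : forall t, 0 < eta t /\ 0 < r t /\
    (forall x y, Cmod (x - T t)%C < eta t -> Cmod (y - T t)%C < eta t -> tz x = tz y -> x = y) /\
    (forall w, Cmod (w - tz (T t))%C < r t -> Cmod (f t w - T t)%C < eta t /\ tz (f t w) = w /\ holo_at (f t) w)).
  { intro t. unfold f, r, eta. specialize (HF t). destruct (F t) as [[e1 e2] s]. exact HF. }
  clearbody f r eta. clear F HF.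
  assert (fc : forall t, Ccont (f t) (tz (T t)) /\ f t (tz (T t)) = T t /\ Cnear (tz (T t)) (fun w => tz (f t w) = w)).
  { intro t. destruct (H t) as [H1 [H2 [H3 H4]]]. destruct (H4 (tz (T t))) as [A [B Ch]]; [rewrite Cmod_self; exact H2|].
    split; [destruct Ch as [l Ch]; apply (Cder_cont _ _ _ Ch)|]. split.
    - apply H3; [exact A | rewrite Cmod_self; exact H1 | exact B].
    - exists (r t). split; [exact H2|]. intros w Hw. apply H4, Hw. }
  assert (CG : Rcontinuous (fun t => tz (T t))).
  { intros t e He. destruct (tz_cont _ (RT t) e He) as [d [Hd K]]. destruct (CT t d Hd) as [d2 [Hd2 K2]].
    exists d2. split; [exact Hd2|]. intros s Hs. apply K, K2, Hs. }
  exists (tz tau0), (fun t => tz (T t)), f, r. split; [|split; [|split; [|split]]].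
  - apply tau0_lens.
  - split; [apply continuous_on_Rcontinuous, CG|]. split; [|rewrite T0, T1 by lra; auto].
    intros t _. apply regular_tz; apply RT.
  - intros t _. destruct (H t) as [H1 [H2 [H3 H4]]]. split; [exact H2|]. split.
    + intros w Hw. destruct (H4 w Hw) as [_ [_ [l Hl]]]. exact (Cder_ex_derive _ _ _ Hl).
    + destruct (CG t (r t) H2) as [d1 [Hd1 K1]]. destruct (CT t (eta t) H1) as [d2 [Hd2 K2]].
      exists (Rmin d1 d2). split; [apply Rmin_pos; auto|]. intros s _ Hs.
      assert (L1 := Rmin_l d1 d2). assert (L2 := Rmin_r d1 d2).
      specialize (K1 s ltac:(lra)). specialize (K2 s ltac:(lra)). cbv beta in K1. split; [exact K1|].
      (* Near nu (T s) both f s w and f t w lie in the disc about [T t] on which nu is injective,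
         and they have the same image. *)
      destruct (fc s) as [F1 [F2 F3]]. unfold Ccont in F1. rewrite F2 in F1.
      destruct (filter_and _ _ F3 (filter_and _ _ (Clf_near _ _ _ _ F1 (disc_open _ _ _ K2)) (disc_open _ _ _ K1)))
        as [e [He K]].
      exists e. split; [exact He|]. intros w Hw. destruct (K w Hw) as [W1 [W2 W3]].
      destruct (H4 w W3) as [V1 [V2 _]]. apply H3; [exact W2 | exact V1 | congruence].
  - destruct (fc 0) as [F1 [F2 F3]]. rewrite T0 in F1, F2, F3 by lra. apply phi_section; auto.
  - destruct (fc 1) as [_ [F2 _]]. rewrite T1 in F2 by lra. exact F2.
Qed.

(** * Uniform sections of nu *)

Definition flip (z : C) : C := (z / (z - 1))%C.

Lemma Zdomain_sub_1 z : Zdomain z -> (z - 1)%C <> 0.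
Proof. intros [_ N] E. apply N, Cminus_eq_0, E. Qed.

Lemma flip_Zdomain z : Zdomain z -> Zdomain (flip z) /\ flip (flip z) = z.
Proof.
  intro H. assert (N := Zdomain_sub_1 _ H). destruct H as [H0 H1].
  assert (E1 : (flip z - 1)%C = (/ (z - 1))%C) by (unfold flip; field; exact N).
  split; [split|].
  - unfold flip, Cdiv. apply Cmult_neq_0; [exact H0 | apply Cinv_neq_0, N].
  - intro E. apply (Cinv_neq_0 _ N). rewrite <- E1, E. ring.
  - unfold flip at 1. rewrite E1. unfold flip. field. exact N.
Qed.

Lemma flip_holo z : Zdomain z -> holo_at flip z.
Proof.
  intro H. eexists. apply Cder_div; [apply Zdomain_sub_1, H | apply Cder_id |
    apply Cder_minus; [apply Cder_id | apply Cder_const]].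
Qed.

(* Under tau -> tau + 1 and tau -> -1/tau, nu is not invariant: U = 1 - nu goes to 1/U, i.e. nu to nu / (nu - 1). *)
Definition flips (g : C -> C) : Prop := forall tau, regular tau ->
  regular (g tau) /\ holo_at g tau /\ tz (g tau) = flip (tz tau).

Lemma flip_tz tau : regular tau ->
  flip (tz tau) = (- (3 * (2 * omega + 1) * (tA tau * tA tau * (tB tau * tB tau) * tC tau)) / (tG tau * tG tau * tG tau))%C.
Proof.
  intros [H [N1 N2]].
  assert (E : (tH tau * tH tau * tH tau - tG tau * tG tau * tG tau
     = 3 * (2 * omega + 1) * (tA tau * tA tau * (tB tau * tB tau) * tC tau))%C).
  { unfold tH, tG. rewrite omega_pow2. unfold tC. assert (W := omega_sq). revert W. generalize omega. intros w W. ring [W]. }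
  assert (Ez : tz tau = ((tH tau * tH tau * tH tau - tG tau * tG tau * tG tau) / (tH tau * tH tau * tH tau))%C).
  { rewrite E. reflexivity. }
  rewrite <- E.
  assert (E1 : (tz tau - 1)%C = (- (tG tau * tG tau * tG tau) / (tH tau * tH tau * tH tau))%C) by (rewrite Ez; field; exact N1).
  unfold flip. rewrite E1, Ez. field. split; assumption.
Qed.

Lemma flips_shift c : (forall tau, tA (tau + c) = tB tau /\ tB (tau + c) = tA tau)%C -> Im c = 0 ->
  flips (fun tau => tau + c)%C.
Proof.
  intros HAB Hc tau Hr. assert (HC : tC (tau + c)%C = (- tC tau)%C).
  { unfold tC. rewrite (proj1 (HAB tau)), (proj2 (HAB tau)). ring. }
  destruct (HAB tau) as [EA EB].
  assert (EH : tH (tau + c)%C = tG tau).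
  { unfold tH, tG. rewrite EA, HC, omega_pow2. unfold tC. ring. }
  assert (EG : tG (tau + c)%C = tH tau).
  { unfold tH, tG. rewrite EA, HC, omega_pow2. unfold tC. ring. }
  assert (I : Im (tau + c)%C = Im tau) by (change (Im tau + Im c = Im tau); lra).
  destruct Hr as [H [N1 N2]]. split; [|split].
  - unfold regular. rewrite EH, EG, I. auto.
  - eexists. apply Cder_plus; [apply Cder_id | apply Cder_const].
  - rewrite flip_tz by (split; auto). unfold tz. rewrite EH, EA, EB, HC. field. exact N2.
Qed.

Lemma flips_plus_1 : flips (fun tau => tau + 1)%C.
Proof. apply flips_shift; [|reflexivity]. intro tau. rewrite tA_plus_1, tB_plus_1. auto. Qed.

Lemma flips_minus_1 : flips (fun tau => tau + - (1))%C.
Proof.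
  apply flips_shift; [|simpl; ring]. intro tau.
  rewrite <- (tA_plus_1 (tau + - (1))%C), <- (tB_plus_1 (tau + - (1))%C).
  replace (tau + - (1) + 1)%C with tau by ring. auto.
Qed.

Lemma flips_S : flips (fun tau => - / tau)%C.
Proof.
  intros tau [H [N1 N2]]. assert (EA := tA_S _ H). assert (EB := tB_S _ H). assert (EC := tC_S _ H).
  assert (N0 := upper_neq_0 _ H). assert (Nw := omega_neq_0).
  assert (EH : tH (- / tau)%C = (tau * tau * (omega * omega) * tG tau)%C).
  { unfold tH, tG. rewrite EA, EC, omega_pow2. unfold tC. assert (W := omega_sq). revert W. generalize omega. intros w W. ring [W]. }
  assert (EG : tG (- / tau)%C = (tau * tau * omega * tH tau)%C).
  { unfold tH, tG. rewrite EA, EC, omega_pow2. unfold tC. assert (W := omega_sq). revert W. generalize omega. intros w W. ring [W]. }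
  split; [|split].
  - unfold regular. rewrite EH, EG. split; [apply Im_opp_inv, H|]. split; cmult_nz.
  - apply holo_opp_inv, H.
  - rewrite flip_tz by (split; auto). unfold tz. rewrite EH, EA, EB, EC.
    transitivity (- (3 * (2 * omega + 1) * (tA tau * tA tau * (tB tau * tB tau) * tC tau)) /
      ((omega * omega * omega) * (omega * omega * omega) * (tG tau * tG tau * tG tau)))%C.
    + field. auto.
    + rewrite omega_cube. field. exact N2.
Qed.

(** The covering property of nu over V, seen from the single sheet through tau. The premise
    [V (tz tau)] allows it to be asserted for every tau of the half-plane, which the induction over
    the modular group requires. *)
Definition section_on (V : C -> Prop) (tau : C) : Prop := V (tz tau) ->
  exists s, (forall w, V w -> holo_at s w /\ 0 < Im (s w) /\ tz (s w) = w) /\ s (tz tau) = tau.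

(** A section s over the flipped set through g tau is conjugated to h o s o flip over V, which
    passes through h (g tau) = tau. *)
Lemma section_on_flips (V : C -> Prop) g h tau : (forall w, V w -> Zdomain w) -> flips g -> flips h -> h (g tau) = tau ->
  0 < Im tau -> section_on (fun w => Zdomain w /\ V (flip w)) (g tau) -> section_on V tau.
Proof.
  intros HV Fg Fh E H S Ht. assert (R := proj2 (regular_tz _ H) (HV _ Ht)). destruct (Fg _ R) as [R1 [_ E1]].
  destruct (flip_Zdomain _ (HV _ Ht)) as [Z1 Z2].
  destruct S as [s [S1 S2]]; [rewrite E1, Z2; auto|]. rewrite E1 in S2.
  exists (fun w => h (s (flip w))). split; [|rewrite S2; exact E].
  intros w Hw. destruct (flip_Zdomain _ (HV _ Hw)) as [Y1 Y2].
  destruct (S1 (flip w)) as [A1 [A2 A3]]; [rewrite Y2; auto|].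
  assert (Rs : regular (s (flip w))) by (apply regular_tz; [exact A2 | rewrite A3; exact Y1]).
  destruct (Fh _ Rs) as [B1 [[l2 B2] B3]]. destruct A1 as [l1 A1]. destruct (flip_holo _ (HV _ Hw)) as [l0 A0].
  split; [|split].
  - exists (l2 * (l1 * l0))%C. apply (Cder_comp h (fun w => s (flip w)) w l2 (l1 * l0)); [exact B2|].
    apply (Cder_comp s flip w); [exact A1 | exact A0].
  - apply B1.
  - rewrite B3, A3. exact Y2.
Qed.

(** * Reduction to a fundamental domain *)

(** A half-strip containing the usual fundamental domain; cut off at a bounded height it is a
    compact rectangle, as [section_rect] needs. *)
Definition rect (tau : C) : Prop := - (1 / 2) <= Re tau <= 1 / 2 /\ 1 / 2 <= Im tau.

(** Translations bring Re tau into [-1/2, 1/2]. If then Im tau < 1/2, |tau|^2 <= 1/2 and tau ->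
    -1/tau at least doubles the imaginary part; the induction is on n with Im tau >= 2^(-n) / 2. *)
Lemma modular_induction (P : C -> Prop) :
  (forall tau, 0 < Im tau -> P (tau + 1)%C -> P tau) -> (forall tau, 0 < Im tau -> P (tau + - (1))%C -> P tau) ->
  (forall tau, 0 < Im tau -> P (- / tau)%C -> P tau) -> (forall tau, rect tau -> P tau) ->
  forall tau, 0 < Im tau -> P tau.
Proof.
  intros Pp Pm Ps Pr.
  assert (shift : forall y, 0 < y -> (forall x, - (1 / 2) <= x <= 1 / 2 -> P (x, y)) -> forall x, P (x, y)).
  { intros y Hy H.
    assert (G : forall n x, Rabs x <= INR n + 1 / 2 -> P (x, y)).
    { induction n as [|n IH]; intros x Hx.
      - simpl in Hx. apply H. apply Rabs_le_between in Hx. lra.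
      - rewrite S_INR in Hx. apply Rabs_le_between in Hx. assert (N := pos_INR n).
        destruct (Rle_lt_dec (1 / 2) x) as [L|L]; [|destruct (Rle_lt_dec x (- (1 / 2))) as [L'|L']].
        + apply Pm; [exact Hy|]. replace ((x, y) + - (1))%C with ((x - 1, y)%R : C) by (apply injective_projections; simpl; ring).
          apply IH. apply Rabs_le. lra.
        + apply Pp; [exact Hy|]. replace ((x, y) + 1)%C with ((x + 1, y)%R : C) by (apply injective_projections; simpl; ring).
          apply IH. apply Rabs_le. lra.
        + apply H. lra. }
    intro x. destruct (nfloor_ex (Rabs x) (Rabs_pos x)) as [n Hn]. apply (G (S n)). rewrite S_INR. lra. }
  assert (G : forall n x y, / 2 ^ n / 2 <= y -> P (x, y)).
  { induction n as [|n IH]; intros x y Hy.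
    - simpl in Hy. apply shift; [lra|]. intros x' Hx. apply Pr. unfold rect. simpl. lra.
    - assert (P2 : 0 < / 2 ^ n) by (apply Rinv_0_lt_compat, pow_lt; lra).
      assert (E2 : / 2 ^ S n = / 2 ^ n / 2) by (simpl; field; apply pow_nonzero; lra). rewrite E2 in Hy.
      apply shift; [lra|]. intros x' Hx. destruct (Rle_lt_dec (1 / 2) y) as [L|L].
      + apply Pr. unfold rect. simpl. lra.
      + apply Ps; [simpl; lra|].
        assert (Q : 0 < x' * x' + y * y <= 1 / 2) by nra.
        replace (- / (x', y))%C with ((- x' / (x' * x' + y * y), y / (x' * x' + y * y))%R : C)
          by (unfold Cinv; apply injective_projections; simpl; field; lra).
        apply IH. apply (Rmult_le_reg_r (x' * x' + y * y)); [lra|]. 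
        replace (y / (x' * x' + y * y) * (x' * x' + y * y)) with y by (field; lra). nra. }
  intros [x y] Hy. simpl in Hy. destruct (nfloor_ex (/ y)) as [n Hn]; [apply Rlt_le, Rinv_0_lt_compat, Hy|].
  apply (G (S n)). assert (P2 : INR n + 1 <= 2 ^ n) by (clear; induction n as [|n IH]; [simpl; lra | rewrite S_INR; simpl; assert (N := pos_INR n); lra]). assert (P1 := pos_INR n).
  assert (L : / y <= 2 ^ S n) by (simpl; lra).
  assert (/ 2 ^ S n <= y); [|assert (0 < / 2 ^ S n) by (apply Rinv_0_lt_compat, pow_lt; lra); lra].
  rewrite <- (Rinv_inv y). apply Rinv_le_contravar; [apply Rinv_0_lt_compat, Hy | exact L].
Qed.

Lemma section_on_sub (V V' : C -> Prop) tau : (forall w, V' w -> V w) -> section_on V tau -> section_on V' tau.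
Proof. intros H S Ht. destruct (S (H _ Ht)) as [s [S1 S2]]. exists s. auto. Qed.

(** Either nu p = z, and one local inverse at p serves all nearby tau by injectivity; or N - z D
    does not vanish at p, nu stays away from z near p, and the claim is vacuous. Numerator and
    denominator are kept apart so that poles fall under the second case. *)
Lemma section_local z p : Zdomain z -> 0 < Im p -> exists rho, 0 < rho /\
  forall tau, Cmod (tau - p)%C < rho -> section_on (fun w => Cmod (w - z)%C < rho) tau.
Proof.
  intros [Hz Hz1] H.
  set (N := fun t => (3 * (2 * omega + 1) * (tA t * tA t * (tB t * tB t) * tC t))%C).
  set (D := fun t => (tH t * tH t * tH t)%C).
  assert (Ez : forall t, tz t = (N t / D t)%C) by reflexivity.
  destruct (tA_der _ H) as [DA _]. destruct (tB_der _ H) as [DB _]. assert (DC := tC_der _ H).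
  destruct (tH_der _ H) as [DH _].
  apply Cder_cont in DA. apply Cder_cont in DB. apply Cder_cont in DC. apply Cder_cont in DH.
  assert (CN : Ccont N p).
  { apply Clf_mult; [apply Clf_const|]. apply Clf_mult; [|exact DC].
    apply Clf_mult; apply Clf_mult; assumption. }
  assert (CD : Ccont D p) by (apply Clf_mult; [apply Clf_mult|]; assumption).
  destruct (classic ((N p - z * D p)%C = 0)) as [E|NE].
  - assert (NH : tH p <> 0).
    { intro K. assert (N0 : N p = 0).
      { transitivity (N p - z * D p + z * D p)%C; [ring|]. rewrite E. unfold D. rewrite K. ring. }
      destruct (tAB_neq_0 _ H) as [N1 N2]. assert (N3 := tC_neq_0 _ H). assert (N4 := sqrt3i_neq_0).
      revert N0. unfold N. apply Cmult_neq_0.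
      - apply Cmult_neq_0; [intro K3; injection K3; lra | exact N4].
      - cmult_nz. }
    assert (ND : D p <> 0) by (unfold D; cmult_nz).
    assert (Ep : tz p = z).
    { rewrite Ez. transitivity ((N p - z * D p) / D p + z)%C; [field; exact ND|]. rewrite E. field. exact ND. }
    assert (Rp : regular p) by (apply regular_tz; [exact H | rewrite Ep; split; assumption]).
    destruct (tz_local p Rp) as [eta [eps [s [He [Hp [inj Hs]]]]]]. rewrite Ep in Hs.
    assert (Es : s z = p).
    { destruct (Hs z) as [A [B _]]; [rewrite Cmod_self; exact Hp|]. apply inj; [exact A | rewrite Cmod_self; exact He | congruence]. }
    assert (Cs : Clf (Cnear z) s p).
    { destruct (Hs z) as [_ [_ [l Hl]]]; [rewrite Cmod_self; exact Hp|]. rewrite <- Es. exact (Cder_cont _ _ _ Hl). }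
    destruct (Clf_near _ _ _ _ Cs (upper_open _ H)) as [e [Pe Ke]].
    exists (Rmin eta (Rmin eps e)). assert (L1 := Rmin_l eta (Rmin eps e)). assert (L2 := Rmin_r eta (Rmin eps e)).
    assert (L3 := Rmin_l eps e). assert (L4 := Rmin_r eps e).
    split; [repeat apply Rmin_pos; auto|]. intros tau Ht Hw. exists s. split.
    + intros w Hw'. destruct (Hs w ltac:(lra)) as [A [B Ch]]. split; [exact Ch|]. split; [apply Ke; lra | exact B].
    + destruct (Hs (tz tau) ltac:(lra)) as [A [B _]]. apply inj; [exact A | lra | exact B].
  - assert (P := proj1 (Cmod_gt_0 _) NE). set (c := Cmod (N p - z * D p)%C) in *.
    assert (CF : Clf (Cnear p) (fun t => N t - z * D t)%C (N p - z * D p)%C).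
    { apply Clf_minus; [exact CN | apply Clf_mult; [apply Clf_const | exact CD]]. }
    assert (Pc : 0 < c / 2) by lra. assert (PD := Cmod_ge_0 (D p)). assert (Pz := proj1 (Cmod_gt_0 _) Hz).
    destruct (filter_and _ _ (CF _ Pc) (Clf_bounded _ _ CD)) as [d [Hd K]].
    set (m := c / 2 / (Cmod (D p) + 1)). assert (Pm : 0 < m) by (apply Rdiv_lt_0_compat; lra).
    exists (Rmin d (Rmin (Cmod z) m)). assert (L1 := Rmin_l d (Rmin (Cmod z) m)). assert (L2 := Rmin_r d (Rmin (Cmod z) m)).
    assert (L3 := Rmin_l (Cmod z) m). assert (L4 := Rmin_r (Cmod z) m).
    split; [repeat apply Rmin_pos; auto|]. intros tau Ht Hw. exfalso.
    destruct (K tau ltac:(lra)) as [K1 K2]. cbv beta in K1.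
    assert (K3 : c / 2 < Cmod (N tau - z * D tau)%C).
    { assert (T := Cmod_rev_tri (N p - z * D p)%C (N tau - z * D tau)%C). rewrite Cmod_sym in K1. fold c in T. lra. }
    destruct (classic (D tau = 0)) as [D0|D1].
    (* At a pole the value is 0 by the convention on division, at distance |z| from z. *)
    + rewrite Ez, D0 in Hw. replace (N tau / 0 - z)%C with (- z)%C in Hw.
      * rewrite Cmod_opp in Hw. lra.
      * apply injective_projections; simpl; unfold Rdiv; ring.
    + assert (E : (N tau - z * D tau)%C = ((tz tau - z) * D tau)%C) by (rewrite Ez; field; exact D1).
      rewrite E, Cmod_mult in K3.
      assert (Cmod (tz tau - z)%C * Cmod (D tau) <= m * (Cmod (D p) + 1)).
      { apply Rmult_le_compat; try apply Cmod_ge_0; lra. }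
      replace (m * (Cmod (D p) + 1)) with (c / 2) in * by (unfold m; field; lra). lra.
Qed.

(** Above some height M the value of nu is within |z|/2 of 0 and so away from z; the part of [rect]
    below M is compact, and finitely many local radii have a positive lower bound. *)
Lemma section_rect z : Zdomain z -> exists e, 0 < e /\
  forall tau, rect tau -> section_on (fun w => Cmod (w - z)%C < e) tau.
Proof.
  intro Hz. assert (Pz : 0 < Cmod z) by (apply Cmod_gt_0, Hz).
  destruct (tz_Iinf (Cmod z / 2) ltac:(lra)) as [M HM].
  destruct (choice (fun (p : C) (rho : posreal) => 0 < Im p -> forall tau, Cmod (tau - p)%C < rho ->
     section_on (fun w => Cmod (w - z)%C < rho) tau)) as [rho Hrho].
  { intro p. destruct (Rlt_le_dec 0 (Im p)) as [L|L].
    - destruct (section_local z p Hz L) as [r [Hr K]]. exists (mkposreal r Hr). intros _. exact K.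
    - exists (mkposreal 1 Rlt_0_1). intro. lra. }
  assert (Ph : forall u v, 0 < rho (u, v) / 2) by (intros u v; assert (P := cond_pos (rho (u, v))); lra).
  destruct (compactness_value_2d (- (1 / 2)) (1 / 2) (1 / 2) M (fun u v => mkposreal _ (Ph u v))) as [d Hd].
  exists (Rmin d (Cmod z / 2)). assert (L1 := Rmin_l d (Cmod z / 2)). assert (L2 := Rmin_r d (Cmod z / 2)).
  split; [apply Rmin_pos; [apply cond_pos | lra]|].
  intros [x y] [Hx Hy]. simpl in Hx, Hy. destruct (Rlt_le_dec M y) as [L|L].
  - intro K. exfalso. specialize (HM (x, y) L). cbv beta in HM, K.
    assert (T := Cmod_tri_sub 0 (tz (x, y)) z). replace (0 - z)%C with (- z)%C in T by ring.
    rewrite Cmod_opp, (Cmod_sym 0) in T. lra.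
  - apply NNPP. intro NS. apply (Hd x y); [lra | lra|]. intros [u [v [Hu [Hv [A [B Dl]]]]]]. simpl in A, B, Dl.
    apply NS. assert (P := cond_pos (rho (u, v))).
    apply (section_on_sub (fun w => Cmod (w - z)%C < rho (u, v))); [intros w Hw; lra|].
    apply (Hrho (u, v)); [simpl; lra|]. eapply Rle_lt_trans; [apply Cmod_le_ReIm|]. simpl. unfold Rminus in A, B. lra.
Qed.

(** The generators of the modular group exchange the assertions for the disc [V0] about z and for
    its flipped image [V1], so the two are proved together. The radius e is small enough for flip to
    map [V0] into the disc obtained for [flip z]. *)
Lemma uniform_section z : Zdomain z -> exists e, 0 < e /\
  (forall w, Cmod (w - z)%C < e -> Zdomain w) /\
  forall tau, 0 < Im tau -> section_on (fun w => Cmod (w - z)%C < e) tau.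
Proof.
  intro Hz. destruct (flip_Zdomain _ Hz) as [Fz FFz].
  destruct (section_rect z Hz) as [e0 [P0 S0]]. destruct (section_rect (flip z) Fz) as [e1 [P1 S1]].
  destruct (flip_holo _ Hz) as [l Hl]. apply Cder_cont in Hl.
  assert (Z0 : Cnear z Zdomain).
  { apply filter_and; [apply (Clf_neq (fun w => w) z); [apply Hz | apply Ccont_id] |
      apply (Clf_neq (fun w => w) z); [apply Hz | apply Ccont_id]]. }
  destruct (filter_and _ _ Z0 (filter_and _ _ (Cnear_ball z e0 P0) (Hl e1 P1))) as [e [Pe K]].
  exists e. split; [exact Pe|]. split; [intros w Hw; apply (K w Hw)|].
  set (V0 := fun w => Cmod (w - z)%C < e). set (V1 := fun w => Zdomain w /\ V0 (flip w)).
  assert (Z1 : forall w, V0 w -> Zdomain w) by (intros w Hw; apply (K w Hw)).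
  assert (step : forall g h, flips g -> flips h -> (forall tau, 0 < Im tau -> h (g tau) = tau) -> forall tau, 0 < Im tau ->
     section_on V0 (g tau) /\ section_on V1 (g tau) -> section_on V0 tau /\ section_on V1 tau).
  { intros g h Fg Fh E tau H [A B]. split.
    - apply (section_on_flips V0 g h); auto.
    - apply (section_on_flips V1 g h); auto; [intros w [Hw _]; exact Hw|].
      revert A. apply section_on_sub. intros w [W1 [_ W2]]. now rewrite (proj2 (flip_Zdomain _ W1)) in W2. }
  intros tau H. apply (modular_induction (fun tau => section_on V0 tau /\ section_on V1 tau)); [| | | |exact H].
  - apply (step (fun t => t + 1)%C (fun t => t + - (1))%C); [apply flips_plus_1 | apply flips_minus_1 | intros; ring].
  - apply (step (fun t => t + - (1))%C (fun t => t + 1)%C); [apply flips_minus_1 | apply flips_plus_1 | intros; ring].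
  - apply (step (fun t => - / t)%C (fun t => - / t)%C); [apply flips_S | apply flips_S|].
    intros t Ht. assert (N := upper_neq_0 _ Ht). field. exact N.
  - intros t Ht. split.
    + apply (section_on_sub _ _ _ (fun w Hw => proj1 (proj2 (K w Hw))) (S0 t Ht)).
    + apply (section_on_sub (fun w => Cmod (w - flip z)%C < e1)); [|apply S1, Ht].
      intros w [W1 W2]. destruct (K _ W2) as [_ [_ W3]]. now rewrite (proj2 (flip_Zdomain _ W1)) in W3.
Qed.

(** * Continuation of local inverses of nu *)

Definition inverts_nu (f : C -> C) (w : C) : Prop := Cnear w (fun v => 0 < Im (f v) /\ tz (f v) = v).

(** The section of nu through f w0 exists on the whole common disc. It agrees with f near w0 because
    nu is locally injective, and on the disc of radius r by the identity theorem. *)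
Lemma inverts_nu_propagates z e f r w0 w : 0 < e ->
  (forall v, Cmod (v - z)%C < e -> Zdomain v) ->
  (forall tau, 0 < Im tau -> section_on (fun w => Cmod (w - z)%C < e) tau) -> r <= e ->
  (forall v, Cmod (v - z)%C < r -> holo_at f v) ->
  Cmod (w0 - z)%C < r -> Cmod (w - z)%C < r -> inverts_nu f w0 -> inverts_nu f w.
Proof.
  intros He HZ HS Hr Hf H0 Hw G. destruct (Cnear_self _ _ G) as [G1 G2].
  destruct (HS (f w0) G1) as [s [S1 S2]]; [rewrite G2; lra|]. rewrite G2 in S2.
  assert (near : Cnear w0 (fun v => f v = s v)).
  { assert (R : regular (f w0)) by (apply regular_tz; [exact G1 | rewrite G2; apply HZ; lra]).
    apply (tz_inverse_unique (f w0)); auto.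
    - apply holo_cont, Hf, H0.
    - apply holo_cont, S1. lra.
    - apply (filter_imp (F := Cnear w0) (fun v => 0 < Im (f v) /\ tz (f v) = v)); [intros v [_ E]; exact E | exact G].
    - generalize (disc_open z r w0 H0). apply filter_imp. intros v Hv. apply S1. lra. }
  assert (all : forall v, Cmod (v - z)%C < r -> (f v - s v)%C = 0).
  { apply (identity_theorem (fun v => Cmod (v - z)%C < r) (fun v => f v - s v)%C w0).
    - apply disc_convex.
    - apply disc_open.
    - intros v Hv. destruct (Hf v Hv) as [l1 D1]. destruct (S1 v ltac:(lra)) as [[l2 D2] _].
      exists (l1 - l2)%C. apply Cder_minus; assumption.
    - exact H0.
    - intros d Hd. destruct (Cnear_punctured _ _ (filter_and _ _ near (Cnear_ball w0 d Hd))) as [v [V1 [V2 V3]]].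
      exists v. split; [split; [|exact V3] | rewrite V2; ring].
      apply Cmod_gt_0. intro K. apply V1, Cminus_eq_0, K. }
  unfold inverts_nu. generalize (disc_open z r w Hw). apply filter_imp. intros v Hv.
  assert (E := Cminus_eq_0 _ _ (all v Hv)). rewrite E. apply S1. lra.
Qed.

Lemma continuous_on_eps (D : R -> Prop) g t e : continuous_on D g -> D t -> 0 < e ->
  exists d, 0 < d /\ forall s, D s -> Rabs (s - t) < d -> Cmod (g s - g t)%C < e.
Proof.
  intros H Ht He. assert (K := H t Ht). assert (B := proj1 (Cnear_locally _ _) (Cnear_ball (g t) e He)).
  destruct (K _ B) as [d Hd]. exists d. split; [apply cond_pos|]. intros s Hs L. apply Hd; [exact L | exact Hs].
Qed.

Lemma germ_inverts f g z : germ_eq z f g -> inverts_nu f z <-> inverts_nu g z.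
Proof.
  intros [r [Hr H]]. assert (N : Cnear z (fun w => f w = g w)) by (exists r; auto).
  unfold inverts_nu. split; intro G; generalize (filter_and _ _ N G); apply filter_imp; intros v [E K]; [rewrite <- E | rewrite E]; exact K.
Qed.

(** Inverting nu near gamma t is a locally constant property of t: on a disc of radius min(r t, e)
    it passes from any point to any other, and neighbouring elements have equal germs. *)
Lemma continuation_inverts gamma f r z0 z1 : path_in Zdomain gamma z0 z1 -> continuation_along gamma f r ->
  inverts_nu (f 0) z0 -> inverts_nu (f 1) z1.
Proof.
  intros [Cg [Zg [E0 E1]]] Hc. rewrite <- E0, <- E1. apply (locally_constant (fun t => inverts_nu (f t) (gamma t))).
  intros t Ht. destruct (uniform_section _ (Zg t Ht)) as [e [He [HZ HS]]].
  destruct (Hc t Ht) as [Hr [Hf [d [Hd K]]]]. set (m := Rmin (r t) e). assert (Hm : 0 < m) by (apply Rmin_pos; auto).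
  assert (L1 := Rmin_l (r t) e). assert (L2 := Rmin_r (r t) e). fold m in L1, L2.
  destruct (continuous_on_eps _ _ _ _ Cg Ht Hm) as [d2 [Hd2 K2]].
  exists (Rmin d d2). split; [apply Rmin_pos; auto|]. intros s Hs L.
  assert (M1 := Rmin_l d d2). assert (M2 := Rmin_r d d2).
  destruct (K s Hs ltac:(lra)) as [_ Ge]. specialize (K2 s Hs ltac:(lra)).
  assert (Hol : forall v, Cmod (v - gamma t)%C < m -> holo_at (f t) v).
  { intros v Hv. apply ex_derive_Cder, Hf. lra. }
  assert (Self : Cmod (gamma t - gamma t)%C < m) by (rewrite Cmod_self; exact Hm).
  rewrite (germ_inverts _ _ _ Ge).
  split; apply (inverts_nu_propagates (gamma t) e (f t) m); auto.
Qed.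

Lemma lens_convex : convexC lens.
Proof.
  intros z w t [A1 A2] [B1 B2] Ht. split.
  - assert (K := disc_convex 0 1 z w t). cbv beta in K. replace (z - 0)%C with z in K by ring. replace (w - 0)%C with w in K by ring.
    replace (z + RtoC t * (w - z) - 0)%C with (z + RtoC t * (w - z))%C in K by ring. auto.
  - rewrite Cmod_sym in A2. rewrite Cmod_sym in B2.
    rewrite Cmod_sym. apply (disc_convex 1 1 z w t); auto.
Qed.

(** The denominator has no zero in the unit disc by [hypergeometric_neq_0]. *)
Lemma phi1_principal_holo z : lens z -> holo_at phi1_principal z.
Proof.
  intros [L1 L2]. assert (N : CPS hF z <> 0) by (apply hypergeometric_neq_0; lra || exact L1).
  assert (D1 := CPS_der hF hF_poly z L1). assert (D2 := CPS_der hG hG_poly _ L2).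
  eexists. unfold phi1_principal. apply Cder_plus; [apply Cder_const|]. apply Cder_scal.
  apply Cder_div; [exact N | | exact D1].
  apply (Cder_comp (CPS hG) (fun w => 1 - w)%C); [exact D2 | apply Cder_minus; [apply Cder_const | apply Cder_id]].
Qed.

Lemma phi1_principal_inverts_base : inverts_nu phi1_principal (tz tau0).
Proof.
  destruct (tz_local _ tau0_regular) as [eta [eps [s [He [Hp [inj Hs]]]]]].
  destruct (Hs (tz tau0)) as [A [B Ch]]; [rewrite Cmod_self; exact Hp|].
  assert (Es : s (tz tau0) = tau0) by (apply inj; [exact A | rewrite Cmod_self; exact He | exact B]).
  assert (Cs := holo_cont _ _ Ch).
  assert (near : Cnear (tz tau0) (fun w => tz (s w) = w)) by (exists eps; split; [exact Hp | intros w Hw; apply Hs, Hw]).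
  assert (Ep := phi_section s Cs Es near). unfold Ccont in Cs. rewrite Es in Cs. unfold inverts_nu.
  generalize (filter_and _ _ Ep (filter_and _ _ near (Clf_near _ _ _ _ Cs (upper_open _ (proj1 tau0_regular))))).
  apply filter_imp. intros w [<- [W1 W2]]. auto.
Qed.

(** The lens is convex, so [phi1_principal] continues itself along the segment from nu [tau0], where
    it is known to invert nu, to the arbitrary starting point z0. *)
Lemma phi1_principal_inverts z0 : lens z0 -> inverts_nu phi1_principal z0.
Proof.
  intro Hz0. assert (Hb := proj2 tau0_lens).
  set (b := tz tau0) in *. set (g := fun t => (b + RtoC t * (z0 - b))%C).
  assert (Lg : forall t, unit_interval t -> lens (g t)) by (intros t Ht; apply lens_convex; auto).
  assert (Cg : continuous_on unit_interval g).
  { apply continuous_on_Rcontinuous. intros u e He. assert (P := Cmod_ge_0 (z0 - b)%C). exists (e / (Cmod (z0 - b)%C + 1)).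
    assert (Q : 0 < e / (Cmod (z0 - b)%C + 1)) by (apply Rdiv_lt_0_compat; lra). split; [exact Q|]. intros s Hs.
    unfold g. replace (b + RtoC s * (z0 - b) - (b + RtoC u * (z0 - b)))%C with (RtoC (s - u) * (z0 - b))%C
      by (rewrite RtoC_minus; ring).
    rewrite Cmod_mult, Cmod_R. apply Rle_lt_trans with (Rabs (s - u) * (Cmod (z0 - b)%C + 1)).
    - apply Rmult_le_compat_l; [apply Rabs_pos | lra].
    - replace e with (e / (Cmod (z0 - b)%C + 1) * (Cmod (z0 - b)%C + 1)) by (field; lra).
      apply Rmult_lt_compat_r; lra. }
  (* The radius of the largest open disc about g t inside the lens. *)
  set (r := fun t => Rmin (1 - Cmod (g t)) (1 - Cmod (1 - g t)%C)).
  apply (continuation_inverts g (fun _ => phi1_principal) r b z0).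
  - split; [exact Cg|]. split; [intros t Ht; apply lens_Zdomain, Lg, Ht|]. split; unfold g; ring.
  - intros t Ht. destruct (Lg t Ht) as [L1 L2].
    assert (M1 := Rmin_l (1 - Cmod (g t)) (1 - Cmod (1 - g t)%C)). assert (M2 := Rmin_r (1 - Cmod (g t)) (1 - Cmod (1 - g t)%C)).
    fold (r t) in M1, M2. assert (Pr : 0 < r t) by (apply Rmin_pos; lra). split; [exact Pr|]. split.
    + intros w Hw. destruct (phi1_principal_holo w) as [l Hl]; [|exact (Cder_ex_derive _ _ _ Hl)].
      assert (T1 := Cmod_rev_tri w (g t)). assert (T2 := Cmod_triangle (1 - g t) (- (w - g t))%C). rewrite Cmod_opp in T2.
      replace (1 - g t + - (w - g t))%C with (1 - w)%C in T2 by ring. split; lra.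
    + destruct (continuous_on_eps _ _ _ _ Cg Ht Pr) as [d [Hd K]]. exists d. split; [exact Hd|].
      intros s Hs L. split; [apply K; auto|]. exists 1. split; [lra | reflexivity].
  - apply phi1_principal_inverts_base.
Qed.

Theorem theorem5p5 (z tau : C) (hz : Zdomain z) (htau : H1 tau) :
  phi1 z tau <-> nu tau = z.
Proof.
  destruct htau as [H _]. rewrite nu_tz by exact H. split.
  - intros [z0 [gamma [f [r [Hz0 [Hp [Hc [Hg E]]]]]]]].
    assert (G := proj2 (germ_inverts _ _ _ Hg) (phi1_principal_inverts z0 Hz0)).
    assert (G1 := continuation_inverts _ _ _ _ _ Hp Hc G).
    rewrite <- E. apply (Cnear_self _ _ G1).
  - intro E. rewrite <- E. apply regular_value, regular_tz; [exact H|]. rewrite E. exact hz.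
Qed.
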